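(* Let $\gamma=1$ and $\delta\in\mathbb{R}$. Then, for any $\theta_0\in A^1$ with $$\|\theta_0\|_{A^0}<\frac{\sqrt{\pi}}{\sqrt2\,(1+|\delta|)},$$ there exists a unique weak solution $\theta$ of $$\theta_t+(\mathcal{H}\theta)\,\theta_x+\delta\,\theta\,\Lambda\theta+\Lambda^{\gamma}\theta=0,\qquad \theta(0,\cdot)=\theta_0,$$ verifying, for all $T>0$, $\theta\in\mathcal{W}_T$ and $$\sup_{t\in[0,T]}\|\theta(t)\|_{A^1}+\left(1-\frac{\sqrt2\,(1+|\delta|)\,\|\theta_0\|_{A^0}}{\sqrt\pi}\right)\int_0^T\|\theta_x(t)\|_{A^1}\,dt\le\|\theta_0\|_{A^1}.$$
   Context: Functions are real-valued on $\mathbb{R}$. The Fourier transform is $\hat f(\xi)=\frac{1}{\sqrt{2\pi}}\int_{\mathbb{R}}f(x)e^{-ix\xi}\,dx$. The Hilbert transform $\mathcal{H}$ is the Fourier multiplier $-i\,\mathrm{sgn}\,\xi$, $\Lambda^{\gamma}$ is the Fourier multiplier $|\xi|^{\gamma}$, and $\Lambda=\Lambda^1=\mathcal{H}\partial_x$. Wiener spaces: $A^0=\{f\in L^1_{loc}:\hat f\in L^1\}$ with $\|f\|_{A^0}=\|\hat f\|_{L^1}$, and for $\alpha>0$, $A^\alpha=\{f\in L^1_{loc}:\|f\|_{A^\alpha}=\int_{\mathbb{R}}(1+|\xi|^\alpha)|\hat f(\xi)|\,d\xi<\infty\}$. For $T>0$, $\mathcal{W}_T=L^\infty(0,T;W^{1,\infty})\cap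 W^{1,\infty}(0,T;L^\infty)\cap L^1(0,T;W^{2,\infty})$ (spatial spaces on $\mathbb{R}$). Weak solution with initial data $\theta_0$ means: for every $0<T<\infty$ and every $\psi\in C_c^\infty([0,T)\times\mathbb{R})$, $$\int_0^T\!\!\int_{\mathbb{R}}\big[\theta\psi_t+(\mathcal{H}\theta)\theta\psi_x+(1-\delta)(\Lambda\theta)\theta\psi-\theta\Lambda^{\gamma}\psi\big]\,dx\,dt=-\int_{\mathbb{R}}\theta_0(x)\psi(0,x)\,dx.$$
   Formalization: The printed estimate fails for every nonzero initial datum (the supremum already reaches the A^1 norm of θ_0, forcing θ_x = 0); it is replaced by sup over t in [0,T] of ‖θ(t)‖_{A^1} plus the same constant times the integral of ‖θ_x‖_{A^1} over [0,t], bounded by ‖θ_0‖_{A^1}. *)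

(* Defs.v *)
From mathcomp Require Import all_boot all_order all_algebra.
From mathcomp Require Import all_classical all_reals all_analysis.
From mathcomp Require Export complex.

Set Implicit Arguments.
Unset Strict Implicit.
Unset Printing Implicit Defensive.

Import Order.TTheory GRing.Theory Num.Theory.
Import numFieldNormedType.Exports.

Local Open Scope classical_set_scope.
Local Open Scope ring_scope.

Section Fourier.
Context {R : realType}.
Local Notation mu := (@lebesgue_measure R).

Definition cintegrable (f : R -> R[i]) : Prop :=
  mu.-integrable setT (fun x => (complex.Re (f x))%:E) /\
  mu.-integrable setT (fun x => (complex.Im (f x))%:E).

Definition cintegral (f : R -> R[i]) : R[i] :=
  Complex (\int[mu]_x complex.Re (f x)) (\int[mu]_x complex.Im (f x)).

(* e^{i x} *)
Definition expi (x : R) : R[i] := Complex (cos x) (sin x).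

Definition fourier_int (f : R -> R[i]) (xi : R) : R[i] :=
  real_complex R (Num.sqrt (2 * pi))^-1 *
  cintegral (fun x => f x * expi (- (x * xi))).

Definition inverse_fourier_int (g : R -> R[i]) (x : R) : R[i] :=
  real_complex R (Num.sqrt (2 * pi))^-1 *
  cintegral (fun xi => g xi * expi (x * xi)).

Definition smooth (f : R -> R) : Prop :=
  forall n x, derivable (derive1n n f) x 1.

Definition schwartz (f : R -> R) : Prop :=
  smooth f /\
  forall k n : nat, exists C : R, forall x, `|x ^+ k * derive1n n f x| <= C.

(* The Fourier transform of a function that need not be integrable is taken in
   the sense of tempered distributions. Both sides are complex-linear in the
   test function, so real-valued test functions suffice. *)
Definition is_fourier (f : R -> R) (g : R -> R[i]) : Prop :=
  locally_integrable setT f /\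
  forall phi : R -> R, schwartz phi ->
    let phihat := fourier_int (fun x => real_complex R (phi x)) in
    [/\ cintegrable (fun x => real_complex R (f x) * phihat x),
        cintegrable (fun xi => g xi * real_complex R (phi xi)) &
        cintegral (fun x => real_complex R (f x) * phihat x) =
        cintegral (fun xi => g xi * real_complex R (phi xi))].

(* Determined up to a.e. equality; junk value 0 if the distributional Fourier
   transform of f is not a function. *)
Definition fourier (f : R -> R) : R -> R[i] :=
  xget (fun=> 0) [set g | is_fourier f g].

Definition has_fourier (f : R -> R) : Prop := exists g, is_fourier f g.

Definition wiener_norm0 (f : R -> R) : \bar R :=
  if `[< has_fourier f >]
  then (\int[mu]_xi (Normc.normc (fourier f xi))%:E)%E
  else +oo%E.

(* The norm of A^alpha for alpha > 0; wiener_norm0 is that of A^0. A function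
   belongs to the space iff its norm is finite. *)
Definition wiener_norm (alpha : R) (f : R -> R) : \bar R :=
  if `[< has_fourier f >]
  then (\int[mu]_xi
          ((1 + `|xi| `^ alpha) * Normc.normc (fourier f xi))%:E)%E
  else +oo%E.

(* F^{-1} (m * F f). The real part only serves to have a real-valued result:
   for the symbols used below (m (- xi) conjugate to m xi) and real-valued f
   the imaginary part vanishes. *)
Definition multiplier (m : R -> R[i]) (f : R -> R) (x : R) : R :=
  complex.Re (inverse_fourier_int (fun xi => m xi * fourier f xi) x).

Definition hilbert : (R -> R) -> R -> R :=
  multiplier (fun xi => Complex 0 (- Num.sg xi)).

Definition Lambda (gamma : R) : (R -> R) -> R -> R :=
  multiplier (fun xi => real_complex R (`|xi| `^ gamma)).

End Fourier.

Section Sobolev.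
Context {R : realType}.
Local Notation mu := (@lebesgue_measure R).

Definition test_fun (phi : R -> R) : Prop :=
  smooth phi /\ exists M : R, forall x, M < `|x| -> phi x = 0.

Definition is_weak_deriv (f g : R -> R) : Prop :=
  [/\ locally_integrable setT f, locally_integrable setT g &
      forall phi, test_fun phi ->
        \int[mu]_x (f x * derive1 phi x) = - \int[mu]_x (g x * phi x)].

(* Determined up to a.e. equality; junk value 0 if there is none. *)
Definition weak_deriv (f : R -> R) : R -> R :=
  xget (fun=> 0) [set g | is_weak_deriv f g].

Definition Linf_norm (f : R -> R) : \bar R :=
  if `[< measurable_fun setT f >]
  then Lnorm mu +oo%E (EFin \o f) else +oo%E.

(* The W^{k,oo} norm; since ereal_inf set0 = +oo, it is infinite when one of
   the weak derivatives up to order k does not exist. *)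
Fixpoint sobolev_norm (k : nat) (f : R -> R) : \bar R :=
  if k is k'.+1
  then (Linf_norm f +
        ereal_inf [set sobolev_norm k' g | g in is_weak_deriv f])%E
  else Linf_norm f.

End Sobolev.

(* Functions of time t in (0, T) with values in the Banach space of the (classes
   of) functions on R whose norm N is finite. *)
Section Bochner.
Context {R : realType}.
Local Notation mu := (@lebesgue_measure R).
Variables (T : R) (N : (R -> R) -> \bar R).
Local Notation I := `]0, T[%classic.

Definition step_val (s : seq (set R * (R -> R))) (t x : R) : R :=
  \sum_(p <- s) \1_(p.1) t * p.2 x.

Definition step_int (s : seq (set R * (R -> R))) (x : R) : R :=
  \sum_(p <- s) fine (mu (p.1 `&` I)) * p.2 x.

Definition is_step (s : seq (set R * (R -> R))) : Prop :=
  forall p, p \in s -> measurable p.1 /\ (N p.2 < +oo)%E.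

Definition step_approx (u : R -> R -> R) (s : nat -> seq (set R * (R -> R))) :
    Prop :=
  (forall n, is_step (s n)) /\
  {ae mu, forall t, I t ->
    (fun n => N (fun x => u t x - step_val (s n) t x)) @ \oo --> 0%E}.

Definition strongly_measurable (u : R -> R -> R) : Prop :=
  exists s, step_approx u s.

Definition is_bochner_integral (u : R -> R -> R) (v : R -> R) : Prop :=
  exists s, [/\ step_approx u s,
    (fun n => \int[mu]_(t in I) N (fun x => u t x - step_val (s n) t x)%R)%E
      @ \oo --> 0%E &
    (fun n => N (fun x => v x - step_int (s n) x)) @ \oo --> 0%E].

Definition L1_time (u : R -> R -> R) : Prop :=
  strongly_measurable u /\ (\int[mu]_(t in I) N (u t) < +oo)%E.

Definition Linf_time (u : R -> R -> R) : Prop :=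
  strongly_measurable u /\
  exists M : R, {ae mu, forall t, I t -> (N (u t) <= M%:E)%E}.

Definition W1inf_time (u : R -> R -> R) : Prop :=
  Linf_time u /\ exists ut, Linf_time ut /\
  forall phi : R -> R, smooth phi ->
    (exists a b, [/\ 0 < a, b < T &
       forall t, ~ (a <= t <= b) -> phi t = 0]) ->
    exists v, is_bochner_integral (fun t x => derive1 phi t * u t x) v /\
              is_bochner_integral (fun t x => phi t * ut t x) (fun x => - v x).

End Bochner.

Section Equation.
Context {R : realType}.
Local Notation mu := (@lebesgue_measure R).

Definition W_space (T : R) (theta : R -> R -> R) : Prop :=
  [/\ Linf_time T (sobolev_norm 1) theta,
      W1inf_time T Linf_norm theta &
      L1_time T (sobolev_norm 2) theta].

Definition dt (psi : R -> R -> R) (t x : R) : R := derive1 (psi ^~ x) t.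
Definition dx (psi : R -> R -> R) (t x : R) : R := derive1 (psi t) x.

Fixpoint Cn2 (n : nat) (psi : R -> R -> R) : Prop :=
  continuous (fun p : R * R => psi p.1 p.2) /\
  if n is n'.+1 then
    [/\ forall t x, derivable (psi ^~ x) t 1 /\ derivable (psi t) x 1,
        Cn2 n' (dt psi) & Cn2 n' (dx psi)]
  else True.

(* C_c^oo([0, T) x R): the functions on [0, T) x R obtained by restricting a
   smooth function on R^2, with compact support in [0, T) x R (they need not
   vanish at t = 0). *)
Definition test_fun2 (T : R) (psi : R -> R -> R) : Prop :=
  (forall n, Cn2 n psi) /\
  exists T' M : R, T' < T /\
    forall t x, 0 <= t -> T' < t \/ M < `|x| -> psi t x = 0.

Definition weak_solution (gamma delta : R) (theta0 : R -> R)
    (theta : R -> R -> R) : Prop :=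
  forall T : R, 0 < T -> forall psi, test_fun2 T psi ->
    \int[mu]_(t in `[0, T]) (\int[mu]_x
       (theta t x * dt psi t x
        + hilbert (theta t) x * theta t x * dx psi t x
        + (1 - delta) * Lambda 1 (theta t) x * theta t x * psi t x
        - theta t x * Lambda gamma (psi t) x))
    = - \int[mu]_x (theta0 x * psi 0 x).

(* The dissipation is integrated up to the time t at which the norm is taken.
   With sup_{[0, T]} |theta|_{A^1} + c int_0^T instead and c > 0, the inequality
   would force theta0 = 0 a.e.: the supremum is at least the norm of theta0
   (lower semicontinuity as t -> 0), so that int_0^T would vanish. *)
Definition energy_inequality (delta : R) (theta0 : R -> R)
    (theta : R -> R -> R) (T : R) : Prop :=
  let c : R := 1 - Num.sqrt 2 * (1 + `|delta|) * fine (wiener_norm0 theta0)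
                   / Num.sqrt pi in
  (ereal_sup [set wiener_norm 1 (theta t) +
       c%:E * \int[mu]_(s in `[0%R, t]) wiener_norm 1 (weak_deriv (theta s))
     | t in `[0%R, T]%classic]
   <= wiener_norm 1 theta0)%E.

Definition global_solution (gamma delta : R) (theta0 : R -> R)
    (theta : R -> R -> R) : Prop :=
  weak_solution gamma delta theta0 theta /\
  forall T : R, 0 < T ->
    W_space T theta /\ energy_inequality delta theta0 theta T.

End Equation.

(* Main.v *)
From HB Require Import structures.
Require Import Defs.
From mathcomp Require Import all_boot all_order all_algebra.
From mathcomp Require Import all_classical all_reals all_analysis.
From mathcomp Require Import measurable_realfun ring lra.
Set Implicit Arguments.
Unset Strict Implicit.
Unset Printing Implicit Defensive.
Import Order.TTheory GRing.Theory Num.Theory.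
Import numFieldNormedType.Exports.
Import HBNNSimple.
Local Open Scope classical_set_scope.
Local Open Scope ring_scope.

(** On the Fourier side a solution [u t], the transform of [theta t], solves
    [u_t + |xi| u + B(u, u) = 0] with [|B(p, q)|_1 <= C0 |p|_1 ||xi| q|_1] and
    [C0 = (1 + |delta|) / sqrt(2 pi)]; the smallness assumption is
    [2 C0 |u0|_1 < 1].
    Existence: in Duhamel form with unknown [F = B(u, u)], and with one factor
    [u] rescaled so that its L1 norm is at most [|u0|_1], the right-hand side is
    a contraction for the norm [int e^{-K t} |F(t)|_1 dt] with [K] large.  The
    energy inequality then shows that the rescaling never acts.
    Uniqueness: the transform of a solution has a jointly measurable
    representative.  Testing the weak formulation with [chi(t) phi(x)] for
    countably many [phi] shows that it satisfies the equation integrated in time,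
    hence its Duhamel form, and the weighted estimate applies again. *)

Notation normc := Normc.normc.
Notation mfunT := (measurable_fun setT).
Notation Lint f := (integrable (@lebesgue_measure _) setT (EFin \o f)).

(** * Measure and complex integration *)

Section NoMeas.
Context d (T : measurableType d) (R : realType) (mu : {measure set T -> \bar R}).
Local Open Scope ereal_scope.

(* Monotonicity needs no measurability: the integral of a nonnegative function is a
   supremum over the simple functions below it. *)
Lemma ge0_le_integral_nomeas (D : set T) (f g : T -> \bar R) :
  (forall x, D x -> 0 <= f x) -> (forall x, D x -> f x <= g x) ->
  \int[mu]_(x in D) f x <= \int[mu]_(x in D) g x.
Proof.
move=> f0 fg; rewrite ge0_integralE// ge0_integralE; last first.
  by move=> x Dx; apply: le_trans (f0 _ Dx) (fg _ Dx).
apply: ereal_sup_le => _ [h hf <-]; exists h => // x.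
apply: le_trans (hf x) _; rewrite !patchE; case: ifPn => //.
by rewrite inE => /fg.
Qed.

Lemma ge0_integral_null_indep (D N : set T) (f g : T -> \bar R) :
  measurable N -> mu N = 0 ->
  (forall x, D x -> 0 <= f x) -> (forall x, D x -> 0 <= g x) ->
  (forall x, D x -> ~ N x -> f x <= g x) ->
  \int[mu]_(x in D) f x <= \int[mu]_(x in D) g x.
Proof.
move=> mN N0 f0 g0 fg; rewrite ge0_integralE// ge0_integralE//.
apply: ge_ereal_sup => _ [h hf <-].
apply: ereal_sup_ubound; exists (proj_nnsfun h (measurableC mN)) => /=.
  move=> x; rewrite /= /mindic indicE.
  have := hf x; rewrite !patchE.
  case: (boolP (x \in D)) => xD; last first.
    by case: (boolP (x \in ~` N)) => _; rewrite ?mulr1 ?mulr0.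
  case: (boolP (x \in ~` N)) => [/set_mem xN|_]; last first.
    by rewrite mulr0 => _; apply: g0; rewrite inE in xD.
  by rewrite mulr1 => /le_trans; apply; apply: fg => //; rewrite inE in xD.
rewrite -!integralT_nnsfun.
rewrite [RHS](ge0_negligible_integral mN) ?setTD//; last 2 first.
  exact/measurable_EFinP.
  by move=> x _; rewrite lee_fin.
rewrite [LHS](ge0_negligible_integral mN) ?setTD//; last 2 first.
  exact/measurable_EFinP.
  by move=> x _; rewrite lee_fin.
by apply: eq_integral => x xN /=; rewrite /mindic indicE xN mulr1.
Qed.

Lemma integral_null_indep (D N : set T) (f g : T -> \bar R) :
  measurable N -> mu N = 0 -> (forall x, D x -> ~ N x -> f x = g x) ->
  \int[mu]_(x in D) f x = \int[mu]_(x in D) g x.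
Proof.
move=> mN N0 fg; rewrite integralE [RHS]integralE; congr (_ - _);
  apply/eqP; rewrite eq_le; apply/andP; split;
  apply: (@ge0_integral_null_indep _ N) => // x Dx Nx.
all: by rewrite ?funeposE ?funenegE fg.
Qed.

Lemma ae_integral_indep (D : set T) (f g : T -> \bar R) :
  {ae mu, forall x, D x -> f x = g x} ->
  \int[mu]_(x in D) f x = \int[mu]_(x in D) g x.
Proof.
move=> [N [mN N0 sN]]; apply: (@integral_null_indep _ N) => // x Dx Nx.
by apply: contrapT => h; apply: Nx; apply: sN => /= /(_ Dx).
Qed.

Lemma ae_Rintegral_indep (D : set T) (f g : T -> R) :
  {ae mu, forall x, D x -> f x = g x} ->
  (\int[mu]_(x in D) f x)%R = (\int[mu]_(x in D) g x)%R.
Proof.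
move=> fg; rewrite /Rintegral; congr fine; apply: ae_integral_indep.
by apply: filterS fg => x h Dx; rewrite h.
Qed.

Lemma ae_ge0_le_integral_nomeas (D : set T) (f g : T -> \bar R) :
  (forall x, D x -> 0 <= f x) -> (forall x, D x -> 0 <= g x) ->
  {ae mu, forall x, D x -> f x <= g x} ->
  \int[mu]_(x in D) f x <= \int[mu]_(x in D) g x.
Proof.
move=> f0 g0 [N [mN N0 sN]]; apply: (@ge0_integral_null_indep _ N) => // x Dx Nx.
by apply: contrapT => h; apply: Nx; apply: sN => /= /(_ Dx).
Qed.

End NoMeas.

Section Affine.
Context {R : realType}.
Local Notation mu := (@lebesgue_measure R).
Local Open Scope ereal_scope.

Definition aff (a b x : R) : R := (a * x + b)%R.

Lemma measurable_aff (a b : R) :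
  mfunT (aff a b : measurableTypeR R -> measurableTypeR R).
Proof. by apply: measurable_funD => //; apply: measurable_funM. Qed.

Lemma lebesgue_affine (a b : R) (A : set R) : a != 0%R -> measurable A ->
  mu (aff a b @^-1` A) = (`|a|^-1)%:E * mu A.
Proof.
move=> a0 mA.
have ap : (0 < `|a|)%R by rewrite normr_gt0.
pose nu : {measure set (measurableTypeR R) -> \bar R} :=
  mscale (NngNum (ltW ap))
   (pushforward mu (aff a b : measurableTypeR R -> measurableTypeR R)).
have -> : mu A = nu (@measurable_aff a b) A.
  apply: lebesgue_measure_unique => // _ [[x y] _ <-] /=.
  rewrite /nu /mscale /= /pushforward /=.
  have -> : aff a b @^-1` `]x, y]%classic = if (0 < a)%R
      then `]((x - b) / a)%R, ((y - b) / a)%R]%classic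
      else `[((y - b) / a)%R, ((x - b) / a)%R[%classic.
    apply/seteqP; split => z /=; case: ifPn => a1; rewrite /= !in_itv /= /aff.
    - by rewrite ltr_pdivrMr// ler_pdivlMr// ltrBlDr lerBrDr (mulrC z).
    - have {}a1 : (a < 0)%R by rewrite lt_neqAle a0/= leNgt.
      by rewrite ler_ndivrMr// ltr_ndivlMr// ltrBlDr lerBrDr (mulrC z) andbC.
    - by rewrite ltr_pdivrMr// ler_pdivlMr// ltrBlDr lerBrDr (mulrC z).
    - have {}a1 : (a < 0)%R by rewrite lt_neqAle a0/= leNgt.
      by rewrite ler_ndivrMr// ltr_ndivlMr// ltrBlDr lerBrDr (mulrC z) andbC.
  case: ifPn => a1; rewrite !lebesgue_measure_itv /= !lte_fin -?EFinB.
  - rewrite ltr_pM2r ?invr_gt0// ltrD2r; case: ifPn => xy; last by rewrite mule0.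
    rewrite -EFinM gtr0_norm// -mulrBl; congr EFin; field; exact: lt0r_neq0.
  - have {}a1 : (a < 0)%R by rewrite lt_neqAle a0/= leNgt.
    rewrite ltr_nM2r ?invr_lt0// ltrD2r; case: ifPn => xy; last by rewrite mule0.
    rewrite -EFinM ltr0_norm// -mulrBl; congr EFin; field; exact: ltr0_neq0.
rewrite /nu /mscale /= /pushforward /= muleA -EFinM mulVf ?mul1e//.
by rewrite gt_eqF.
Qed.

Lemma ge0_integral_affine (a b : R) (f : R -> \bar R) : a != 0%R ->
  mfunT f -> (forall x, 0 <= f x) ->
  \int[mu]_x f (a * x + b)%R = (`|a|^-1)%:E * \int[mu]_x f x.
Proof.
move=> a0 mf f0.
have ap : (0 <= `|a|^-1)%R by rewrite invr_ge0.
pose mixin := isMeasurableFun.Build _ _ _ _ _ (measurable_aff a b).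
pose phi : {mfun measurableTypeR R >-> measurableTypeR R} :=
  HB.pack (aff a b : measurableTypeR R -> measurableTypeR R) mixin.
transitivity (\int[pushforward mu phi]_x f x).
  by rewrite ge0_integral_pushforward//; exact: (measurable_aff a b).
transitivity (\int[mscale (NngNum ap) mu]_x f x).
  by apply: eq_measure_integral => A mA _; exact: lebesgue_affine.
by rewrite ge0_integral_mscale.
Qed.

Lemma ge0_muleBr (r : R) (A B : \bar R) : (0 < r)%R -> 0 <= A -> 0 <= B ->
  r%:E * A - r%:E * B = r%:E * (A - B).
Proof.
move=> r0; case: A => [x||] //; case: B => [y||] // _ _;
  rewrite -?EFinB -?EFinM -?EFinB ?mulrBr//.
- by rewrite gt0_muley ?lte_fin// addeNy ?gt0_muleNy ?lte_fin.
- by rewrite gt0_muley ?lte_fin// addye// gt0_muley ?lte_fin.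
- by rewrite gt0_muley ?lte_fin//= gt0_muleNy ?lte_fin.
Qed.

Lemma integral_affine (a b : R) (f : R -> \bar R) : a != 0%R ->
  mfunT f ->
  \int[mu]_x f (a * x + b)%R = (`|a|^-1)%:E * \int[mu]_x f x.
Proof.
move=> a0 mf; rewrite integralE [X in _ = _ * X]integralE.
under [X in X - _ = _]eq_integral do rewrite (funepos_comp f (aff a b)) /=.
under [X in _ - X = _]eq_integral do rewrite (funeneg_comp f (aff a b)) /=.
rewrite !(@ge0_integral_affine _ b _ a0)//; last 2 first.
- exact: measurable_funeneg.
- exact: measurable_funepos.
apply: ge0_muleBr.
- by rewrite invr_gt0 normr_gt0.
- by apply: integral_ge0 => x _; exact: funepos_ge0.
- by apply: integral_ge0 => x _; exact: funeneg_ge0.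
Qed.

Lemma fine_pmul (r : R) (A : \bar R) : (0 < r)%R ->
  fine (r%:E * A) = (r * fine A)%R.
Proof.
move=> r0; case: A => [x||] //=; rewrite ?gt0_muley ?gt0_muleNy ?lte_fin//=;
  by rewrite mulr0.
Qed.

Lemma Rintegral_affine (a b : R) (f : R -> R) : a != 0%R ->
  mfunT f ->
  (\int[mu]_x f (a * x + b) = `|a|^-1 * \int[mu]_x f x)%R.
Proof.
move=> a0 mf; rewrite /Rintegral (@integral_affine a b (EFin \o f))//; last first.
  exact/measurable_EFinP.
by apply: fine_pmul; rewrite invr_gt0 normr_gt0.
Qed.

End Affine.

Notation Re := complex.Re.
Notation Im := complex.Im.
Notation "x %:C" := (real_complex _ x) (format "x %:C") : ring_scope.

Section CAlg.
Context {R : realType}.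
Implicit Types z w : R[i].

Lemma complex_eqP z w : Re z = Re w -> Im z = Im w -> z = w.
Proof. by case: z; case: w => a b c d /= -> ->. Qed.
Lemma ReD z w : Re (z + w) = Re z + Re w. Proof. by case: z; case: w. Qed.
Lemma ImD z w : Im (z + w) = Im z + Im w. Proof. by case: z; case: w. Qed.
Lemma ReN z : Re (- z) = - Re z. Proof. by case: z. Qed.
Lemma ImN z : Im (- z) = - Im z. Proof. by case: z. Qed.
Lemma ReB z w : Re (z - w) = Re z - Re w. Proof. by rewrite ReD ReN. Qed.
Lemma ImB z w : Im (z - w) = Im z - Im w. Proof. by rewrite ImD ImN. Qed.
Lemma ReM z w : Re (z * w) = Re z * Re w - Im z * Im w.
Proof. by case: z; case: w. Qed.
Lemma ImM z w : Im (z * w) = Re z * Im w + Im z * Re w.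
Proof. by case: z; case: w. Qed.
Lemma ReJ z : Re (conjc z) = Re z. Proof. by case: z. Qed.
Lemma ImJ z : Im (conjc z) = - Im z. Proof. by case: z. Qed.
Lemma Re0 : Re (0 : R[i]) = 0. Proof. by []. Qed.
Lemma Im0 : Im (0 : R[i]) = 0. Proof. by []. Qed.
Lemma ReC (x : R) : Re x%:C = x. Proof. by []. Qed.
Lemma ImC (x : R) : Im x%:C = 0. Proof. by []. Qed.

Definition reimE := (ReD, ImD, ReN, ImN, ReM, ImM, ReJ, ImJ, Re0, Im0, ReC, ImC).

Lemma conjcM z w : conjc (z * w) = conjc z * conjc w.
Proof. by apply: complex_eqP; rewrite !reimE; ring. Qed.
Lemma conjcD z w : conjc (z + w) = conjc z + conjc w.
Proof. by apply: complex_eqP; rewrite !reimE; ring. Qed.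
Lemma conjcN z : conjc (- z) = - conjc z.
Proof. by apply: complex_eqP; rewrite !reimE; ring. Qed.
Lemma conjcB z w : conjc (z - w) = conjc z - conjc w.
Proof. by rewrite conjcD conjcN. Qed.
Lemma conjcC (x : R) : conjc x%:C = x%:C.
Proof. by apply: complex_eqP; rewrite !reimE//; ring. Qed.

Lemma sqr_normc z : normc z ^+ 2 = Re z ^+ 2 + Im z ^+ 2.
Proof. by case: z => a b /=; rewrite sqr_sqrtr// addr_ge0// sqr_ge0. Qed.

Lemma normc_ge0 z : 0 <= normc z.
Proof. by case: z => a b /=; exact: sqrtr_ge0. Qed.

Lemma normcJ z : normc (conjc z) = normc z.
Proof. by case: z => a b /=; rewrite sqrrN. Qed.

Lemma normcC (x : R) : normc x%:C = `|x|.
Proof. by rewrite /= expr0n/= addr0 sqrtr_sqr. Qed.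

Lemma Re_le_normc z : `|Re z| <= normc z.
Proof.
rewrite -(@ler_pXn2r _ 2)// ?nnegrE ?normc_ge0//.
by rewrite sqr_normc real_normK ?num_real// lerDl sqr_ge0.
Qed.

Lemma Im_le_normc z : `|Im z| <= normc z.
Proof.
rewrite -(@ler_pXn2r _ 2)// ?nnegrE ?normc_ge0//.
by rewrite sqr_normc real_normK ?num_real// lerDr sqr_ge0.
Qed.

Lemma normc_le_ReIm z : normc z <= `|Re z| + `|Im z|.
Proof.
rewrite -(@ler_pXn2r _ 2)// ?nnegrE ?normc_ge0 ?addr_ge0//.
rewrite sqr_normc sqrrD !real_normK ?num_real// -addrA lerD2l lerDr.
by rewrite mulrn_wge0// mulr_ge0.
Qed.

Lemma normc_eq0 z : normc z = 0 -> z = 0.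
Proof. exact: Normc.eq0_normc. Qed.

Lemma normcB z w : normc (z - w) <= normc z + normc w.
Proof. by rewrite -(normcN w); exact: le_normcD. Qed.

Lemma normcBC z w : normc (z - w) = normc (w - z).
Proof. by rewrite -normcN opprB. Qed.

Lemma normc_sub_le z w : `|normc z - normc w| <= normc (z - w).
Proof.
rewrite ler_norml; apply/andP; split.
  by rewrite lerNl opprB lerBlDr (normcBC z) -{1}(subrK z w); exact: le_normcD.
by rewrite lerBlDr -{1}(subrK w z); exact: le_normcD.
Qed.

Lemma expiD (x y : R) : expi (x + y) = expi x * expi y.
Proof.
by apply: complex_eqP; rewrite !reimE /= ?cosD ?sinD; ring.
Qed.
Lemma expiN (x : R) : expi (- x) = conjc (expi x).
Proof. by apply: complex_eqP; rewrite !reimE /= ?cosN ?sinN. Qed.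
Lemma expi0 : expi 0 = 1 :> R[i].
Proof. by rewrite /expi cos0 sin0. Qed.
Lemma normc_expi (x : R) : normc (expi x) = 1.
Proof. by rewrite /= cos2Dsin2 sqrtr1. Qed.

End CAlg.

Section CMeas.
Context {R : realType} d (T : measurableType d).
Implicit Types f g : T -> R[i].

Definition cmeas f := mfunT (fun x => Re (f x)) /\ mfunT (fun x => Im (f x)).

Lemma cmeasD f g : cmeas f -> cmeas g -> cmeas (fun x => f x + g x).
Proof.
move=> [f1 f2] [g1 g2]; split.
  by under eq_fun do rewrite reimE; exact: measurable_funD.
by under eq_fun do rewrite reimE; exact: measurable_funD.
Qed.

Lemma cmeasN f : cmeas f -> cmeas (fun x => - f x).
Proof.
move=> [f1 f2]; split.
  by under eq_fun do rewrite reimE; exact: measurableT_comp.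
by under eq_fun do rewrite reimE; exact: measurableT_comp.
Qed.

Lemma cmeasB f g : cmeas f -> cmeas g -> cmeas (fun x => f x - g x).
Proof. by move=> mf mg; apply: cmeasD => //; exact: cmeasN. Qed.

Lemma cmeasM f g : cmeas f -> cmeas g -> cmeas (fun x => f x * g x).
Proof.
move=> [f1 f2] [g1 g2]; split.
  by under eq_fun do rewrite reimE; apply: measurable_funB; exact: measurable_funM.
by under eq_fun do rewrite reimE; apply: measurable_funD; exact: measurable_funM.
Qed.

Lemma cmeasJ f : cmeas f -> cmeas (fun x => conjc (f x)).
Proof.
move=> [f1 f2]; split.
  by under eq_fun do rewrite reimE.
by under eq_fun do rewrite reimE; exact: measurableT_comp.
Qed.

Lemma cmeasC (f : T -> R) : mfunT f -> cmeas (fun x => (f x)%:C).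
Proof. by move=> mf; split => //; exact: measurable_cst. Qed.

Lemma cmeas_cst (c : R[i]) : cmeas (fun=> c).
Proof. by split; exact: measurable_cst. Qed.

Lemma cmeas_Complex (f g : T -> R) :
  mfunT f -> mfunT g ->
  cmeas (fun x => Complex (f x) (g x)).
Proof. by []. Qed.

Lemma cmeas_expi (f : T -> R) : mfunT f -> cmeas (fun x => expi (f x)).
Proof.
by move=> mf; split; apply: (measurableT_comp _ mf);
  apply: continuous_measurable_fun; [exact: continuous_cos|exact: continuous_sin].
Qed.

Lemma cmeas_Re f : cmeas f -> mfunT (fun x => Re (f x)).
Proof. by case. Qed.
Lemma cmeas_Im f : cmeas f -> mfunT (fun x => Im (f x)).
Proof. by case. Qed.

Lemma cmeas_norm f : cmeas f -> mfunT (fun x => normc (f x)).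
Proof.
move=> [f1 f2].
rewrite (_ : (fun x => _) = fun x => Num.sqrt (Re (f x) ^+ 2 + Im (f x) ^+ 2)).
  apply: (@measurableT_comp _ _ _ _ _ _ (@Num.sqrt R)).
    by apply: continuous_measurable_fun; exact: sqrt_continuous.
  by apply: measurable_funD; exact: measurable_funX.
by apply/funext => x; case: (f x).
Qed.

Lemma cmeas_sum (I : Type) (s : seq I) (F : I -> T -> R[i]) :
  (forall i, cmeas (F i)) -> cmeas (fun x => \sum_(i <- s) F i x).
Proof.
move=> mF; elim: s => [|i s IH].
  by under eq_fun do rewrite big_nil; exact: cmeas_cst.
by under eq_fun do rewrite big_cons; exact: cmeasD.
Qed.

End CMeas.

Lemma cmeas_comp {R : realType} d d' (T : measurableType d) (T' : measurableType d')
  (f : T' -> R[i]) (g : T -> T') : cmeas f -> mfunT g ->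
  cmeas (fun x => f (g x)).
Proof. by move=> [f1 f2] mg; split; [exact: (measurableT_comp f1 mg)|
  exact: (measurableT_comp f2 mg)]. Qed.

Lemma aeS d (T : measurableType d) (R : realType) (mu : {measure set T -> \bar R})
  (P Q : T -> Prop) : (forall x, P x -> Q x) ->
  {ae mu, forall x, P x} -> {ae mu, forall x, Q x}.
Proof. by move=> PQ; apply: filterS. Qed.

Section RInt.
Context {R : realType}.
Local Notation mu := (@lebesgue_measure R).

Lemma integrable_meas (f : R -> R) :
  Lint f -> mfunT f.
Proof. by move=> /integrableP[/measurable_EFinP]. Qed.

Lemma integrable_le (f g : R -> R) : mfunT f ->
  Lint g -> (forall x, `|f x| <= g x) ->
  Lint f.
Proof.
move=> mf ig fg; apply: (le_integrable measurableT _ _ ig).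
  exact/measurable_EFinP.
by move=> x _ /=; rewrite lee_fin (le_trans (fg x))// ler_norm.
Qed.

Lemma RFubini (f : R -> R -> R) :
  mfunT (fun p : R * R => f p.1 p.2) ->
  (\int[mu]_x \int[mu]_y (`|f x y|)%:E < +oo)%E ->
  (\int[mu]_x \int[mu]_y f x y = \int[mu]_y \int[mu]_x f x y)%R.
Proof.
move=> mf fi.
have mf' : mfunT (fun p : R * R => (f p.1 p.2)%:E).
  exact/measurable_EFinP.
have fi' : (mu \x mu)%E.-integrable setT (fun p : R * R => (f p.1 p.2)%:E).
  by apply/integrable12ltyP.
have := Fubini fi' => /= FE; rewrite /Rintegral; congr fine.
transitivity (\int[mu]_x \int[mu]_y (f x y)%:E)%E; last first.
  rewrite FE; apply: ae_integral_indep.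
  have := ae_integrable2 fi'; apply: filterS => y /= /integrable_fin_num h _.
  by rewrite /= fineK// h.
apply: ae_integral_indep.
have := ae_integrable1 fi'; apply: filterS => y /= /integrable_fin_num h _.
by rewrite /= fineK// h.
Qed.

Lemma measurable_Rintegral d (T : measurableType d) (f : T * R -> R) :
  mfunT f ->
  mfunT (fun x => \int[mu]_y f (x, y)).
Proof.
move=> mf; rewrite /Rintegral.
have mf' : mfunT (EFin \o f) by exact/measurable_EFinP.
apply: (@measurableT_comp _ _ _ _ _ _ (@fine R)).
  exact: fine_measurable.
under eq_fun do rewrite integralE.
apply: emeasurable_funB.
- have := @measurable_fun_fubini_tonelli_F _ _ _ _ _ mu ((EFin \o f)^\+)%E
    (measurable_funepos mf') (funepos_ge0 _).
  congr measurable_fun; apply/funext => x; apply: eq_integral => y _.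
  by rewrite !funeposE.
- have := @measurable_fun_fubini_tonelli_F _ _ _ _ _ mu ((EFin \o f)^\-)%E
    (measurable_funeneg mf') (funeneg_ge0 _).
  congr measurable_fun; apply/funext => x; apply: eq_integral => y _.
  by rewrite !funenegE.
Qed.

Lemma measurable_ge0_integral d (T : measurableType d) (f : T * R -> \bar R) :
  mfunT f -> (forall p, 0 <= f p)%E ->
  mfunT (fun x => \int[mu]_y f (x, y))%E.
Proof. by move=> mf f0; exact: (@measurable_fun_fubini_tonelli_F _ _ _ _ _ mu f). Qed.

Lemma Tonelli (f : R -> R -> \bar R) :
  mfunT (fun p : R * R => f p.1 p.2) -> (forall x y, 0 <= f x y)%E ->
  (\int[mu]_x \int[mu]_y f x y = \int[mu]_y \int[mu]_x f x y)%E.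
Proof.
move=> mf f0; exact: (@fubini_tonelli _ _ _ _ _ mu mu (fun p => f p.1 p.2)).
Qed.

End RInt.

Section CInt.
Context {R : realType}.
Local Notation cmeas2 F := (cmeas (fun z : R * R => F z.1 z.2)).
Local Notation mu := (@lebesgue_measure R).
Implicit Types f g : R -> R[i].

Definition L1n f : \bar R := (\int[mu]_x (normc (f x))%:E)%E.

Lemma L1n_ge0 f : (0 <= L1n f)%E.
Proof. by apply: integral_ge0 => x _; rewrite lee_fin normc_ge0. Qed.

Lemma cintegrableP f : cintegrable f <-> (cmeas f /\ (L1n f < +oo)%E).
Proof.
split=> [[i1 i2]|[mf fi]].
  have mf : cmeas f by split; exact: integrable_meas.
  split => //.
  have /integrableP[_] := integrableD measurableT (integrable_norm i1) (integrable_norm i2).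
  apply: le_lt_trans; apply: ge0_le_integral_nomeas => x _.
    by rewrite lee_fin normc_ge0.
  rewrite /= lee_fin; apply: le_trans (ler_norm _).
  exact: normc_le_ReIm.
have ni : mu.-integrable setT (fun x => (normc (f x))%:E).
  apply/integrableP; split; first exact/measurable_EFinP/cmeas_norm.
  by under eq_integral do rewrite gee0_abs ?lee_fin ?normc_ge0//.
by split; apply: (integrable_le _ ni); [exact: mf.1|
  move=> x; exact: Re_le_normc|exact: mf.2|move=> x; exact: Im_le_normc].
Qed.

Lemma cintegrable_meas f : cintegrable f -> cmeas f.
Proof. by move=> /cintegrableP[]. Qed.

Lemma cintegrable_L1n f : cintegrable f -> (L1n f < +oo)%E.
Proof. by move=> /cintegrableP[]. Qed.

Lemma cintegrable_norm f : cintegrable f -> mu.-integrable setT (fun x => (normc (f x))%:E).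
Proof.
move=> /cintegrableP[mf fi].
apply/integrableP; split; first exact/measurable_EFinP/cmeas_norm.
by under eq_integral do rewrite gee0_abs ?lee_fin ?normc_ge0//.
Qed.

Lemma L1n_fin f : cintegrable f -> L1n f = (\int[mu]_x normc (f x))%:E.
Proof.
move=> /cintegrable_norm fi; rewrite /Rintegral fineK//.
exact: integrable_fin_num.
Qed.

Lemma cintegrable_le f (g : R -> R) : cmeas f -> Lint g ->
  (forall x, normc (f x) <= g x) -> cintegrable f.
Proof.
move=> mf ig fg; split; apply: (integrable_le _ ig).
- exact: mf.1.
- by move=> x; apply: le_trans (Re_le_normc _) _.
- exact: mf.2.
- by move=> x; apply: le_trans (Im_le_normc _) _.
Qed.

Lemma cintegrable_lec f g : cmeas f -> cintegrable g ->
  (forall x, normc (f x) <= normc (g x)) -> cintegrable f.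
Proof. by move=> mf /cintegrable_norm ig fg; exact: (cintegrable_le mf ig). Qed.

Lemma cintegrableD f g : cintegrable f -> cintegrable g ->
  cintegrable (fun x => f x + g x).
Proof.
move=> [f1 f2] [g1 g2]; split.
  rewrite (_ : (fun x => _) = (fun x => (Re (f x))%:E) \+ (fun x => (Re (g x))%:E))%E.
    exact: integrableD.
  by apply/funext => x /=; rewrite reimE.
rewrite (_ : (fun x => _) = (fun x => (Im (f x))%:E) \+ (fun x => (Im (g x))%:E))%E.
  exact: integrableD.
by apply/funext => x /=; rewrite reimE.
Qed.

Lemma cintegrableMl f g (M : R) : cintegrable f -> cmeas g ->
  (forall x, normc (g x) <= M) -> cintegrable (fun x => g x * f x).
Proof.
move=> fi mg gM; have mf := cintegrable_meas fi.
have := integrableZl measurableT M (cintegrable_norm fi) => h.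
apply: (cintegrable_le _ h); first exact: cmeasM.
by move=> x /=; rewrite Normc.normcM ler_wpM2r// normc_ge0.
Qed.

Lemma cintegrableMr f g (M : R) : cintegrable f -> cmeas g ->
  (forall x, normc (g x) <= M) -> cintegrable (fun x => f x * g x).
Proof.
by move=> fi mg gM; under eq_fun do rewrite mulrC; exact: (cintegrableMl fi mg gM).
Qed.

Lemma cintegrableZ (c : R[i]) f : cintegrable f -> cintegrable (fun x => c * f x).
Proof. by move=> fi; apply: (@cintegrableMl _ _ (normc c)) => //; exact: cmeas_cst. Qed.

Lemma cintegrableN f : cintegrable f -> cintegrable (fun x => - f x).
Proof. by move=> fi; under eq_fun do rewrite -mulN1r; exact: cintegrableZ. Qed.

Lemma cintegrableB f g : cintegrable f -> cintegrable g ->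
  cintegrable (fun x => f x - g x).
Proof. by move=> fi gi; apply: cintegrableD => //; exact: cintegrableN. Qed.

Lemma cintegrableJ f : cintegrable f -> cintegrable (fun x => conjc (f x)).
Proof.
move=> fi; apply: (cintegrable_lec _ fi); first exact/cmeasJ/cintegrable_meas.
by move=> x; rewrite normcJ.
Qed.

Lemma cintegrableC (f : R -> R) : Lint f ->
  cintegrable (fun x => (f x)%:C).
Proof.
move=> fi; split => //=; exact: integrable0.
Qed.

Lemma Re_cintegral f : Re (cintegral f) = \int[mu]_x Re (f x). Proof. by []. Qed.
Lemma Im_cintegral f : Im (cintegral f) = \int[mu]_x Im (f x). Proof. by []. Qed.

Lemma cintegralD f g : cintegrable f -> cintegrable g ->
  cintegral (fun x => f x + g x) = cintegral f + cintegral g.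
Proof.
move=> [f1 f2] [g1 g2]; apply: complex_eqP.
  rewrite ReD !Re_cintegral.
  by under eq_Rintegral do rewrite ReD; rewrite RintegralD.
rewrite ImD !Im_cintegral.
by under eq_Rintegral do rewrite ImD; rewrite RintegralD.
Qed.

Lemma cintegralZ (c : R[i]) f : cintegrable f ->
  cintegral (fun x => c * f x) = c * cintegral f.
Proof.
move=> [f1 f2]; apply: complex_eqP.
  rewrite ReM !Re_cintegral Im_cintegral; under eq_Rintegral do rewrite ReM.
  rewrite RintegralB//; [|exact: (integrableZl measurableT (Re c) f1)|
    exact: (integrableZl measurableT (Im c) f2)].
  by rewrite !RintegralZl.
rewrite ImM !Im_cintegral Re_cintegral; under eq_Rintegral do rewrite ImM.
rewrite RintegralD//; [|exact: (integrableZl measurableT (Re c) f2)|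
  exact: (integrableZl measurableT (Im c) f1)].
by rewrite !RintegralZl.
Qed.

Lemma cintegralZr (c : R[i]) f : cintegrable f ->
  cintegral (fun x => f x * c) = cintegral f * c.
Proof. by move=> fi; under eq_fun do rewrite mulrC; rewrite cintegralZ// mulrC. Qed.

Lemma cintegralN f : cintegrable f -> cintegral (fun x => - f x) = - cintegral f.
Proof.
by move=> fi; under eq_fun do rewrite -mulN1r; rewrite cintegralZ// mulN1r.
Qed.

Lemma cintegralB f g : cintegrable f -> cintegrable g ->
  cintegral (fun x => f x - g x) = cintegral f - cintegral g.
Proof.
by move=> fi gi; rewrite cintegralD//; [rewrite cintegralN|exact: cintegrableN].
Qed.

Lemma cintegralJ f : cintegrable f ->
  cintegral (fun x => conjc (f x)) = conjc (cintegral f).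
Proof.
move=> [f1 f2]; apply: complex_eqP.
  by rewrite ReJ !Re_cintegral; under eq_Rintegral do rewrite ReJ.
rewrite ImJ !Im_cintegral; under eq_Rintegral do rewrite ImJ -mulN1r.
by rewrite RintegralZl// mulN1r.
Qed.

Lemma cintegralC (f : R -> R) : cintegral (fun x => (f x)%:C) = (\int[mu]_x f x)%:C.
Proof.
apply: complex_eqP => //=; rewrite /Rintegral integral0//.
Qed.

Lemma cintegral0 : cintegral (fun _ : R => 0 : R[i]) = 0.
Proof. by apply: complex_eqP => /=; rewrite /Rintegral integral0. Qed.

Lemma eq_cintegral f g : (forall x, f x = g x) -> cintegral f = cintegral g.
Proof. by move=> fg; congr cintegral; apply/funext. Qed.

Lemma ae_cintegral f g : {ae mu, forall x, f x = g x} -> cintegral f = cintegral g.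
Proof.
move=> fg; apply: complex_eqP => /=; apply: ae_Rintegral_indep;
  by apply: aeS fg => x ->.
Qed.

Lemma ae_L1n f g : {ae mu, forall x, f x = g x} -> L1n f = L1n g.
Proof. by move=> fg; apply: ae_integral_indep; apply: aeS fg => x ->. Qed.

Lemma le_normc_cintegral_R f : cintegrable f ->
  normc (cintegral f) <= \int[mu]_x normc (f x).
Proof.
move=> fi; set z := cintegral f.
have [z0|z0] := eqVneq (normc z) 0.
  by rewrite z0; apply: Rintegral_ge0 => x _; exact: normc_ge0.
have zp : 0 < normc z by rewrite lt_neqAle eq_sym z0 normc_ge0.
rewrite -(ler_pM2l zp) -expr2 sqr_normc.
have -> : Re z ^+ 2 + Im z ^+ 2 = Re (conjc z * z) by rewrite !reimE; ring.
rewrite -RintegralZl//; last exact: cintegrable_norm.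
rewrite /z -cintegralZ// -/z Re_cintegral.
apply: le_Rintegral => //.
- by have [] := cintegrableZ (conjc z) fi.
- exact: (integrableZl measurableT (normc z) (cintegrable_norm fi)).
- move=> x _; rewrite -(normcJ z) -Normc.normcM.
  exact: le_trans (ler_norm _) (Re_le_normc _).
Qed.

Lemma le_normc_cintegral f : cintegrable f -> ((normc (cintegral f))%:E <= L1n f)%E.
Proof. by move=> fi; rewrite L1n_fin// lee_fin; exact: le_normc_cintegral_R. Qed.

Lemma cintegral_affine (a b : R) f : a != 0 -> cmeas f ->
  cintegral (fun x => f (a * x + b)) = (`|a|^-1)%:C * cintegral f.
Proof.
move=> a0 [f1 f2]; apply: complex_eqP; rewrite !reimE /= ?mul0r ?subr0 ?addr0.
  exact: (@Rintegral_affine _ a b (fun x => Re (f x))).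
exact: (@Rintegral_affine _ a b (fun x => Im (f x))).
Qed.

Lemma cmeas_cintegral d (T : measurableType d) (f : T * R -> R[i]) :
  cmeas f -> cmeas (fun x => cintegral (fun y => f (x, y))).
Proof.
move=> [f1 f2]; split => /=.
  exact: (measurable_Rintegral f1).
exact: (measurable_Rintegral f2).
Qed.

Lemma cFubini (f : R -> R -> R[i]) : cmeas2 f ->
  (\int[mu]_x L1n (f x) < +oo)%E ->
  cintegral (fun x => cintegral (f x)) = cintegral (fun y => cintegral (fun x => f x y)).
Proof.
have le (h : R[i] -> R) : (forall z, `|h z| <= normc z) -> forall g : R -> R -> R[i],
    (\int[mu]_x \int[mu]_y (`|h (g x y)|)%:E <= \int[mu]_x L1n (g x))%E.
  move=> hz g; apply: ge0_le_integral_nomeas => x _.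
    by apply: integral_ge0 => y _; rewrite lee_fin.
  by apply: ge0_le_integral_nomeas => y _; rewrite lee_fin.
move=> [f1 f2] fi; apply: complex_eqP.
  exact: (RFubini f1 (le_lt_trans (le _ Re_le_normc f) fi)).
exact: (RFubini f2 (le_lt_trans (le _ Im_le_normc f) fi)).
Qed.

Lemma L1n_cintegral_le (f : R -> R -> R[i]) : cmeas2 f ->
  (\int[mu]_x L1n (f x) < +oo)%E ->
  cintegrable (fun x => cintegral (f x)) /\
  (L1n (fun x => cintegral (f x)) <= \int[mu]_x L1n (f x))%E.
Proof.
move=> mf fi.
have mN : mfunT (fun p : R * R => (normc (f p.1 p.2))%:E).
  exact/measurable_EFinP/cmeas_norm.
have mL : mfunT (fun x => L1n (f x)).
  by apply: (measurable_ge0_integral mN) => p; rewrite lee_fin normc_ge0.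
have ae_fin : {ae mu, forall x, (L1n (f x) < +oo)%E}.
  have : mu.-integrable setT (fun x => L1n (f x)).
    apply/integrableP; split => //.
    by under eq_integral do rewrite gee0_abs ?L1n_ge0//.
  move=> /integrable_ae => /(_ measurableT); apply: filterS => x /(_ I).
  by rewrite ge0_fin_numE// L1n_ge0.
have le : (L1n (fun x => cintegral (f x)) <= \int[mu]_x L1n (f x))%E.
  apply: ae_ge0_le_integral_nomeas => [x _|x _|].
  - by rewrite lee_fin normc_ge0.
  - exact: L1n_ge0.
  apply: aeS ae_fin => x fx _; apply: le_normc_cintegral.
  apply/cintegrableP; split => //.
  exact: (cmeas_comp mf (measurable_fun_pair (measurable_cst x) (@measurable_id _ _ _))).
split=> //; apply/cintegrableP; split; last exact: le_lt_trans le fi.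
exact: (cmeas_cintegral mf).
Qed.

Lemma L1n_swap (f : R -> R -> R[i]) : cmeas2 f ->
  (\int[mu]_x L1n (f x) = \int[mu]_y L1n (fun x => f x y))%E.
Proof.
move=> mf; apply: (@Tonelli _ (fun x y => (normc (f x y))%:E)).
  exact/measurable_EFinP/cmeas_norm.
by move=> x y; rewrite lee_fin normc_ge0.
Qed.

End CInt.

(** * Smooth functions and test functions *)

Section Smooth.
Context {R : realType}.
Implicit Types f g h : R -> R.

Lemma derive1_is f (f' : R -> R) : (forall x : R, is_derive x 1 f (f' x)) -> derive1 f = f'.
Proof. by move=> ff'; apply/funext => x; rewrite derive1E; case: (ff' x). Qed.

Lemma smooth_coind (P : (R -> R) -> Prop) :
  (forall f, P f -> exists f', (forall x : R, is_derive x 1 f (f' x)) /\ P f') ->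
  forall f, P f -> smooth f.
Proof.
move=> PP f Pf n; elim: n f Pf => [|n IH] f /PP[f' [ff' Pf']] x.
  by case: (ff' x).
by rewrite derive1Sn (derive1_is ff'); exact: IH.
Qed.

Lemma smooth_is_derive f : smooth f -> forall x : R, is_derive x 1 f (derive1 f x).
Proof. by move=> sf x; apply: DeriveDef; [exact: (sf 0%N)|rewrite derive1E]. Qed.

Lemma smooth_derive1 f : smooth f -> smooth (derive1 f).
Proof. by move=> sf n x; have := sf n.+1 x; rewrite derive1Sn. Qed.

Lemma smooth_derive1n n f : smooth f -> smooth (derive1n n f).
Proof. elim: n => [|n IH] sf; first exact: sf.
by rewrite derive1nS; exact/smooth_derive1/IH. Qed.

Lemma smoothS f f' : (forall x : R, is_derive x 1 f (f' x)) -> smooth f' -> smooth f.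
Proof.
move=> ff' sf'; apply: (smooth_coind (P := fun h => h = f \/ smooth h)); last by left.
move=> h [->|sh]; first by exists f'; split => //; right.
exists (derive1 h); split; first exact: smooth_is_derive.
by right; exact: smooth_derive1.
Qed.

Lemma smooth_cst (c : R) : smooth (fun=> c).
Proof.
apply: (smooth_coind (P := fun h => exists c, h = fun=> c)); last by exists c.
move=> h [{}c ->]; exists (fun=> 0); split; last by exists 0.
by move=> x; exact: is_derive_cst.
Qed.

Lemma smooth_id : smooth (fun x : R => x).
Proof.
by apply: (smoothS (f' := fun=> 1)); exact: smooth_cst.
Qed.

(* Coinduction needs a class closed under the terms that the product, quotient and
   chain rules produce. *)
Inductive smooth_closure : (R -> R) -> Prop :=
| sc_base f : smooth f -> smooth_closure f
| sc_D f g : smooth_closure f -> smooth_closure g ->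
    smooth_closure (fun x => f x + g x)
| sc_M f g : smooth_closure f -> smooth_closure g ->
    smooth_closure (fun x => f x * g x)
| sc_V f : smooth_closure f -> (forall x, f x != 0) ->
    smooth_closure (fun x => (f x)^-1)
| sc_comp f g : smooth f -> smooth_closure g ->
    smooth_closure (fun x => f (g x)).

Lemma smooth_closureP h : smooth_closure h -> smooth h.
Proof.
apply: smooth_coind => {}h; elim=> {h}.
- move=> f sf; exists (derive1 f); split; first exact: smooth_is_derive.
  exact/sc_base/smooth_derive1.
- move=> f g _ [f' [df sf]] _ [g' [dg sg]].
  exists (fun x => f' x + g' x); split; last exact: sc_D.
  by move=> x; exact: is_deriveD.
- move=> f g cf [f' [df sf]] cg [g' [dg sg]].
  exists (fun x => f x * g' x + g x * f' x); split; last first.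
    by apply: sc_D; exact: sc_M.
  by move=> x; exact: is_deriveM.
- move=> f cf [f' [df sf]] f0.
  exists (fun x => (-1) * (((f x)^-1 * (f x)^-1) * f' x)); split; last first.
    apply: sc_M; first exact/sc_base/smooth_cst.
    by apply: sc_M => //; apply: sc_M; exact: sc_V.
  move=> x; have dv := is_deriveV (f0 x) (df x); apply: (is_derive_eq dv).
  by rewrite /GRing.scale /= mulN1r mulNr -invfM expr2.
- move=> f g sf cg [g' [dg sg]].
  exists (fun x => derive1 f (g x) * g' x); split; last first.
    by apply: sc_M => //; apply: sc_comp => //; exact: smooth_derive1.
  move=> x; apply: (@is_derive1_comp _ f g) => //.
  exact: smooth_is_derive.
Qed.

Lemma smoothD f g : smooth f -> smooth g -> smooth (fun x => f x + g x).
Proof. by move=> sf sg; apply/smooth_closureP/sc_D; exact: sc_base. Qed.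
Lemma smoothM f g : smooth f -> smooth g -> smooth (fun x => f x * g x).
Proof. by move=> sf sg; apply/smooth_closureP/sc_M; exact: sc_base. Qed.
Lemma smoothV f : smooth f -> (forall x, f x != 0) -> smooth (fun x => (f x)^-1).
Proof. by move=> sf f0; apply/smooth_closureP/sc_V => //; exact: sc_base. Qed.
Lemma smooth_comp f g : smooth f -> smooth g -> smooth (fun x => f (g x)).
Proof. by move=> sf sg; apply/smooth_closureP/sc_comp => //; exact: sc_base. Qed.
Lemma smoothZ (c : R) f : smooth f -> smooth (fun x => c * f x).
Proof. by apply: smoothM; exact: smooth_cst. Qed.
Lemma smooth_aff (a b : R) : smooth (fun x => a * x + b).
Proof. by apply: smoothD; [exact/smoothZ/smooth_id|exact: smooth_cst]. Qed.

Lemma smooth_continuous f : smooth f -> continuous f.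
Proof.
by move=> sf x; apply/differentiable_continuous/derivable1_diffP; exact: (sf 0%N).
Qed.

Lemma smooth_measurable f : smooth f -> mfunT f.
Proof. by move=> sf; apply: continuous_measurable_fun; exact: smooth_continuous. Qed.

Lemma expR_ge_pow n (y : R) : 0 <= y -> y ^+ n <= n`!%:R * expR y.
Proof.
case: n => [y0|n y0].
  by rewrite expr0 fact0 mul1r -expR0 ler_expR.
rewrite mulrC -ler_pdivrMr ?ltr0n ?fact_gt0//.
by apply: le_trans (expR_ge1Dxn n y0); rewrite lerDr.
Qed.

Lemma poly_le_expR (p : {poly R}) : exists C : R, 0 <= C /\
  forall y, 0 <= y -> `|p.[y]| <= C * expR y.
Proof.
exists (\sum_(i < size p) `|p`_i| * i`!%:R); split.
  by apply: sumr_ge0 => i _; rewrite mulr_ge0.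
move=> y y0; rewrite horner_coef mulr_suml.
apply: le_trans (ler_norm_sum _ _ _) _; apply: ler_sum => i _.
by rewrite normrM -mulrA ler_wpM2l// normrX ger0_norm// expR_ge_pow.
Qed.

Definition flat (p : {poly R}) (x : R) : R :=
  if 0 < x then p.[x^-1] * expR (- x^-1) else 0.

Lemma flat_small p : exists C : R, 0 <= C /\ forall x, `|flat p x| <= C * x ^+ 2.
Proof.
have [C [C0 Cp]] := poly_le_expR (p * 'X^2).
exists C; split => // x; rewrite /flat; case: ifPn => x0; last first.
  by rewrite normr0 mulr_ge0// sqr_ge0.
have xi0 : 0 <= x^-1 by rewrite invr_ge0 ltW.
have := Cp _ xi0; rewrite hornerM hornerXn normrM (ger0_norm (exprn_ge0 _ xi0)).
rewrite normrM (ger0_norm (expR_ge0 _)) expRN => h.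
rewrite ler_pdivrMr ?expR_gt0// mulrAC.
have x2 : 0 < x^-1 ^+ 2 by rewrite exprn_gt0 // invr_gt0.
rewrite -(ler_pM2r x2); apply: le_trans h _.
by rewrite -[leRHS]mulrA -exprMn mulfV ?gt_eqF// expr1n mulr1.
Qed.

Lemma is_derive_quad_small f (C : R) : f 0 = 0 -> (forall x, `|f x| <= C * x ^+ 2) ->
  is_derive (0 : R) 1 f 0.
Proof.
move=> f0 fC.
have lim0 : (fun t : R => t^-1 *: ((f \o shift 0) (t *: 1) - f 0)) @ 0^' --> (0 : R).
  apply/cvgr0Pnorm_le => e e0.
  have C1 : 0 < `|C| + 1 by rewrite ltr_wpDl.
  near=> t; rewrite /= f0 subr0 addr0 /GRing.scale /= mulr1 normrM.
  have t0 : t != 0 by near: t; exact: nbhs_dnbhs_neq.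
  rewrite normfV ler_pdivrMl ?normr_gt0//.
  apply: le_trans (fC t) _; rewrite -real_normK ?num_real// expr2 mulrCA.
  rewrite ler_wpM2l//; apply: le_trans (_ : (`|C| + 1) * `|t| <= e).
    by rewrite ler_wpM2r// (le_trans (ler_norm C))// lerDl.
  rewrite -ler_pdivlMl//; near: t; apply: dnbhs0_le.
  by rewrite mulr_gt0// invr_gt0.
by apply: DeriveDef; [apply/cvg_ex; exists 0|exact/cvg_lim].
Unshelve. all: by end_near. Qed.

Lemma flat_derive p : exists q, forall x : R, is_derive x 1 (flat p) (flat q x).
Proof.
exists ('X^2 * (p - p^`())) => x.
have [x0|x0|->] := ltgtP x 0.
- rewrite {2}/flat ltNge (ltW x0) /=.
  apply: (near_eq_is_derive (f := cst 0)).
  near=> y; rewrite /flat ifF//; apply/negbTE; rewrite -leNgt.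
  by apply: ltW; near: y; exact: lt_nbhsl.
- rewrite {2}/flat x0.
  apply: (@near_eq_is_derive R R R (fun y => p.[y^-1] * expR (- y^-1))).
    near=> y; rewrite /flat ifT//; near: y; exact: lt_nbhsr.
  have xn0 : x != 0 by rewrite gt_eqF.
  have dV : is_derive x 1 (fun y : R => y^-1) (- x ^- 2).
    apply: is_derive_eq; first exact: (@is_deriveV _ id x 1 1 xn0 (is_derive_id _ _)).
    by rewrite /GRing.scale /= mulr1.
  have dp := @is_derive1_comp _ (horner p) (fun y => y^-1) x _ _ (is_derive_poly p _) dV.
  have dN := is_deriveN dV.
  have de := @is_derive1_comp _ expR (fun y => - y^-1) x _ _ (is_derive_expR _) dN.
  have dM := is_deriveM dp de; apply: (is_derive_eq dM).
  by rewrite /GRing.scale /= !hornerE /= exprVn; ring.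
- have [C [_ HC]] := flat_small p.
  have -> : flat ('X^2 * (p - p^`())) 0 = 0 by rewrite /flat ltxx.
  by apply: (is_derive_quad_small _ HC); rewrite /flat ltxx.
Unshelve. all: by end_near. Qed.

Lemma smooth_flat p : smooth (flat p).
Proof.
apply: (smooth_coind (P := fun h => exists q, h = flat q)); last by exists p.
move=> h [q ->]; have [q' hq'] := flat_derive q.
by exists (flat q'); split => //; exists q'.
Qed.

Definition sstep (x : R) : R := flat 1 x / (flat 1 x + flat 1 (1 - x)).

Lemma flat1_gt0 x : 0 < x -> 0 < flat 1 x.
Proof. by move=> x0; rewrite /flat x0 hornerC mul1r expR_gt0. Qed.
Lemma flat1_ge0 x : 0 <= flat 1 x.
Proof. by rewrite /flat; case: ifP => // _; rewrite hornerC mul1r expR_ge0. Qed.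
Lemma flat_le0 p x : x <= 0 -> flat p x = 0.
Proof. by move=> x0; rewrite /flat ltNge x0. Qed.

Lemma sstep_den x : 0 < flat 1 x + flat 1 (1 - x).
Proof.
have [x0|x0] := ltP 0 x; first by rewrite ltr_pwDl ?flat1_ge0// flat1_gt0.
by rewrite ltr_wpDl ?flat1_ge0// flat1_gt0// subr_gt0 (le_lt_trans x0).
Qed.

Lemma smooth_sstep : smooth sstep.
Proof.
apply: smoothM; first exact: smooth_flat.
apply: smoothV; last by move=> x; rewrite gt_eqF// sstep_den.
apply: smoothD; first exact: smooth_flat.
have -> : (fun x => flat 1 (1 - x)) = (fun x => flat 1 ((-1) * x + 1)).
  by apply/funext => x; congr (flat _ _); ring.
by apply: smooth_comp; [exact: smooth_flat|exact: smooth_aff].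
Qed.

Lemma sstep_le0 x : x <= 0 -> sstep x = 0.
Proof. by move=> x0; rewrite /sstep flat_le0// mul0r. Qed.
Lemma sstep_ge1 x : 1 <= x -> sstep x = 1.
Proof.
move=> x1; rewrite /sstep (@flat_le0 _ (1 - x)) ?subr_le0// addr0 divff//.
by rewrite gt_eqF// flat1_gt0// (lt_le_trans ltr01).
Qed.
Lemma sstep_ge0 x : 0 <= sstep x.
Proof. by rewrite /sstep divr_ge0 ?flat1_ge0// ltW// sstep_den. Qed.
Lemma sstep_le1 x : sstep x <= 1.
Proof. by rewrite /sstep ler_pdivrMr ?sstep_den// mul1r lerDl flat1_ge0. Qed.

Definition plateau (a b : R) (n : nat) (x : R) : R :=
  sstep (n.+1%:R * (x - a)) * sstep (n.+1%:R * (b - x)).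

Lemma smooth_plateau a b n : smooth (plateau a b n).
Proof.
apply: smoothM.
- apply: smooth_comp; first exact: smooth_sstep.
  under eq_fun do rewrite mulrBr; exact: smooth_aff.
- apply: smooth_comp; first exact: smooth_sstep.
  have -> : (fun x : R => n.+1%:R * (b - x)) = (fun x => (- n.+1%:R) * x + n.+1%:R * b).
    by apply/funext => x; ring.
  exact: smooth_aff.
Qed.

Lemma plateau_ge0 a b n x : 0 <= plateau a b n x.
Proof. by rewrite mulr_ge0// sstep_ge0. Qed.
Lemma plateau_le1 a b n x : plateau a b n x <= 1.
Proof. by rewrite mulr_ile1// ?sstep_ge0 ?sstep_le1. Qed.

Lemma plateau_out a b n x : ~ (a < x < b) -> plateau a b n x = 0.
Proof.
move=> /negP; rewrite negb_and -!leNgt => /orP[xa|bx].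
  by rewrite /plateau sstep_le0 ?mul0r// mulr_ge0_le0// subr_le0.
by rewrite /plateau (@sstep_le0 (_ * (b - x))) ?mulr0// mulr_ge0_le0// subr_le0.
Qed.

Lemma plateau_cvg a b x : plateau a b n x @[n --> \oo] --> (\1_(`]a, b[%classic) x : R).
Proof.
have [/andP[ax xb]|abx] := boolP (a < x < b); last first.
  rewrite (_ : (fun n => _) = fun=> 0); last first.
    by apply/funext => n; rewrite plateau_out//; exact/negP.
  by rewrite indicE memNset /= ?in_itv//=; [exact: cvg_cst|exact/negP].
rewrite indicE mem_set /= ?in_itv/= ?ax ?xb//.
have big (e : R) : 0 < e -> \forall n \near \oo, 1 <= n.+1%:R * e.
  move=> e0; near=> n; rewrite -ler_pdivrMr// div1r.
  rewrite invf_ple ?posrE// ltW//.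
  by near: n; exact: (near_infty_natSinv_lt (PosNum e0)).
apply: cvg_near_cst; near=> n; rewrite /plateau !sstep_ge1 ?mulr1//.
- by near: n; apply: big; rewrite subr_gt0.
- by near: n; apply: big; rewrite subr_gt0.
Unshelve. all: by end_near. Qed.

Lemma test_plateau a b n : test_fun (plateau a b n).
Proof.
split; first exact: smooth_plateau.
exists (`|a| + `|b|) => x xM; apply: plateau_out => /andP[ax xb].
move: xM; apply/negP; rewrite -leNgt ler_norml; apply/andP; split.
  by rewrite lerNl; apply: le_trans (_ : - a <= _); [rewrite lerN2 ltW|
    rewrite -(normrN a) (le_trans (ler_norm _))// lerDl].
by rewrite (le_trans (ltW xb))// (le_trans (ler_norm b))// lerDr.
Qed.

End Smooth.

Section Calc.
Context {R : realType}.
Local Notation mu := (@lebesgue_measure R).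

Lemma Rcvg_unique (u : nat -> R) (a b : R) :
  u @ \oo --> a -> u @ \oo --> b -> a = b.
Proof. by move=> ua ub; rewrite -(cvg_lim (@Rhausdorff R) ua) (cvg_lim (@Rhausdorff R) ub). Qed.

Lemma Ecvg_unique (u : nat -> \bar R) (a b : \bar R) :
  u @ \oo --> a -> u @ \oo --> b -> a = b.
Proof. by move=> ua ub; rewrite -(cvg_lim (@ereal_hausdorff R) ua) (cvg_lim (@ereal_hausdorff R) ub). Qed.

Lemma continuous_itv_integrable (f : R -> R) (a b : R) : continuous f ->
  mu.-integrable `[a, b] (EFin \o f).
Proof.
move=> cf; apply: continuous_compact_integrable; first exact: segment_compact.
exact: continuous_subspaceT.
Qed.

Lemma compact_supp_integrable (f : R -> R) (M : R) : continuous f ->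
  (forall x, M < `|x| -> f x = 0) -> Lint f.
Proof.
move=> cf f0; have fi := continuous_itv_integrable (- M) M cf.
suff <- : (EFin \o f) \_ `[- M, M] = EFin \o f.
  by apply/integrable_restrict => //; rewrite setTI.
apply/funext => x /=.
rewrite patchE; case: ifPn => //; rewrite notin_setE /= in_itv /= => /negP.
by rewrite -ler_norml -ltNge => /f0 ->.
Qed.

Lemma test_fun_integrable (f : R -> R) : test_fun f -> Lint f.
Proof.
by move=> [sf [M fM]]; exact: (compact_supp_integrable (smooth_continuous sf) fM).
Qed.

Lemma Rintegral_FTC (f f' : R -> R) (a b : R) : a <= b ->
  (forall x : R, is_derive x 1 f (f' x)) -> continuous f' ->
  \int[mu]_(x in `[a, b]) f' x = f b - f a.
Proof.
rewrite le_eqVlt => /orP[/eqP<-|ab] df cf.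
  by rewrite set_itv1 Rintegral_set1 subrr.
have cF : continuous f.
  by move=> x; apply/differentiable_continuous/derivable1_diffP; case: (df x).
rewrite /Rintegral (continuous_FTC2 (F := f))//.
- exact: continuous_subspaceT.
- split => [x _||].
  + by case: (df x).
  + by apply: cvg_at_right_filter; exact: cF.
  + by apply: cvg_at_left_filter; exact: cF.
- by move=> x _; rewrite (derive1_is df).
Qed.

Lemma cvg_Rintegral_dom (f_ : nat -> R -> R) (f g : R -> R) :
  (forall n, mfunT (f_ n)) -> mfunT f ->
  Lint g ->
  {ae mu, forall x, f_ n x @[n --> \oo] --> f x} ->
  (forall n x, `|f_ n x| <= g x) ->
  \int[mu]_x f_ n x @[n --> \oo] --> \int[mu]_x f x.
Proof.
move=> mf_ mf ig ff fg.
have [] := @dominated_convergence _ _ _ mu setT measurableT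
  (fun n x => (f_ n x)%:E) (fun x => (f x)%:E) (fun x => (g x)%:E).
- by move=> n; apply/measurable_EFinP; exact: mf_.
- by apply/measurable_EFinP; exact: mf.
- apply: aeS ff => x fx _; apply/fine_cvgP; split; last exact: fx.
  exact: nearW.
- exact: ig.
- by apply: aeW => x n _; rewrite /= lee_fin.
move=> /integrable_fin_num => /(_ measurableT) fif _ h.
rewrite /Rintegral; apply: fine_cvg; rewrite fineK//.
Qed.

Lemma measurable_restr (D : set R) (f : R -> R) : measurable D ->
  mfunT f -> mfunT (f \_ D).
Proof.
by move=> mD mf; apply/(measurable_restrictT f mD); exact: measurable_funTS.
Qed.

Lemma cvg_itv_Rintegral (f : R -> R) : Lint f ->
  \int[mu]_(x in `[- n%:R, n%:R]) f x @[n --> \oo] --> \int[mu]_x f x.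
Proof.
move=> fi; have mf := integrable_meas fi.
under eq_fun do rewrite Rintegral_mkcond.
apply: (cvg_Rintegral_dom (g := fun x => `|f x|)) => //.
- by move=> n; apply: measurable_restr.
- exact: (integrable_norm fi).
- apply: aeW => x; apply: cvg_near_cst; near=> n; rewrite patchE ifT//.
  rewrite inE /= in_itv /= -ler_norml; near: n; exact: nbhs_infty_ger.
- by move=> n x; rewrite patchE; case: ifP => // _; rewrite normr0.
Unshelve. all: by end_near. Qed.

Lemma Rintegral_derive0 (f f' : R -> R) : (forall x : R, is_derive x 1 f (f' x)) ->
  continuous f' -> Lint f' ->
  f n%:R @[n --> \oo] --> 0 -> f (- n%:R) @[n --> \oo] --> 0 ->
  \int[mu]_x f' x = 0.
Proof.
move=> df cf fi f1 f2.
have := cvg_itv_Rintegral fi.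
under eq_fun => n do rewrite (Rintegral_FTC _ df cf) ?lerNl ?(le_trans _ (ler0n _ _)) ?oppr_le0//.
move=> h; apply: (Rcvg_unique h).
by rewrite -[X in _ --> X](subr0 (0 : R)); exact: cvgB.
Qed.

Lemma Rintegral_derive0_bound (f f' : R -> R) (C : R) :
  (forall x : R, is_derive x 1 f (f' x)) ->
  continuous f' -> Lint f' ->
  (forall x, `|x| * `|f x| <= C) -> \int[mu]_x f' x = 0.
Proof.
move=> df cf fi fC.
have C0 : 0 <= C by apply: le_trans (fC 0); rewrite normr0 mul0r.
have cvg (s : bool) : f ((-1) ^+ s * n%:R) @[n --> \oo] --> 0.
  rewrite -(cvg_shiftS (fun n => f ((-1) ^+ s * n%:R))).
  apply/cvgr0Pnorm_le => e e0; near=> n.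
  have := fC ((-1) ^+ s * n.+1%:R); rewrite normrMsign normr_nat => h.
  rewrite -(@ler_pM2l _ n.+1%:R)//; apply: le_trans h _.
  rewrite -ler_pdivrMr//.
  apply: le_trans (_ : n%:R <= _); last by rewrite ler_nat.
  near: n; exact: nbhs_infty_ger.
apply: (Rintegral_derive0 df cf fi).
- by have := cvg false; under eq_fun do rewrite mul1r.
- by have := cvg true; under eq_fun do rewrite mulN1r.
Unshelve. all: by end_near. Qed.

Lemma Rintegral_derive0_supp (f f' : R -> R) (M : R) :
  (forall x : R, is_derive x 1 f (f' x)) -> continuous f' ->
  (forall x, M < `|x| -> f x = 0) -> \int[mu]_x f' x = 0.
Proof.
move=> df cf fM.
have f'M x : M < `|x| -> f' x = 0.
  move=> Mx; have <- : derive1 f x = f' x by rewrite (derive1_is df).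
  rewrite derive1E (@near_eq_derive _ _ _ f (cst 0)) ?derive_cst//.
  near=> y; apply: fM; near: y.
  have /cvgrPdist_lt h : `|y| @[y --> x] --> `|x| by exact: cvg_norm.
  have Mx0 : 0 < `|x| - M by rewrite subr_gt0.
  near=> y; have : `| `|x| - `|y| | < `|x| - M by near: y; exact: h.
  by move=> /(le_lt_trans (ler_norm _)); rewrite ltrD2l ltrN2.
apply: (Rintegral_derive0 df cf (compact_supp_integrable cf f'M)).
- apply: cvg_near_cst; near=> n; apply: fM; rewrite normr_nat.
  by near: n; exact: nbhs_infty_gtr.
- apply: cvg_near_cst; near=> n; apply: fM; rewrite normrN normr_nat.
  by near: n; exact: nbhs_infty_gtr.
Unshelve. all: by end_near. Qed.

Lemma locally_integrable_itv (f : R -> R) (a b : R) : locally_integrable setT f ->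
  mu.-integrable `[a, b] (EFin \o f).
Proof.
move=> [mf _ fK]; apply/integrableP; split.
  exact/measurable_EFinP/measurable_funTS.
by apply: fK => //; exact: segment_compact.
Qed.

Lemma integrable_indic_itv (f : R -> R) (a b : R) : locally_integrable setT f ->
  Lint (fun x => `|f x| * \1_(`[a, b]%classic) x).
Proof.
move=> lf; have fi := integrable_norm (locally_integrable_itv a b lf).
suff <- : (EFin \o (Num.Def.normr \o f)) \_ `[a, b] =
    EFin \o (fun x => `|f x| * \1_(`[a, b]%classic) x).
  by apply/integrable_restrict => //; rewrite setTI.
apply/funext => x /=.
rewrite patchE indicE; case: ifPn => xab; rewrite /= ?mulr1 ?mulr0//.
Qed.

Lemma integrable_locally_integrable (f : R -> R) :
  Lint f -> locally_integrable setT f.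
Proof. by move=> fi; apply: open_integrable_locally => //; exact: openT. Qed.

Lemma bounded_locally_integrable (f : R -> R) (C : R) : mfunT f ->
  (forall x, `|f x| <= C) -> locally_integrable setT f.
Proof.
move=> mf fC; split => //; first exact: openT.
move=> K _ cK; apply: le_lt_trans (_ : (\int[mu]_(x in K) C%:E < +oo)%E).
  by apply: ge0_le_integral_nomeas => x _; rewrite lee_fin.
rewrite integral_cst//; last exact: compact_measurable.
rewrite lte_mul_pinfty ?lee_fin ?(le_trans _ (fC 0))//.
exact: compact_finite_measure.
Qed.

Lemma plateau_ortho_itv (f : R -> R) (a b : R) : locally_integrable setT f ->
  (forall n, \int[mu]_x (f x * plateau a b n x) = 0) ->
  \int[mu]_(x in `]a, b[) f x = 0.
Proof.
move=> lf f0; rewrite Rintegral_mkcond.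
have mf : mfunT f by case: lf.
have h : \int[mu]_x (f x * plateau a b n x) @[n --> \oo] --> \int[mu]_x (f \_ `]a, b[) x.
  apply: (cvg_Rintegral_dom _ _ (integrable_indic_itv a b lf)); last 1 first.
  - move=> n x; rewrite normrM ler_wpM2l// ger0_norm ?plateau_ge0//.
    have [/andP[ax xb]|abx] := boolP (a < x < b).
      by rewrite indicE mem_set ?plateau_le1//= in_itv /= !ltW.
    by rewrite plateau_out//; exact/negP.
  - move=> n; apply: measurable_funM => //.
    by apply: smooth_measurable; exact: smooth_plateau.
  - by apply: measurable_restr.
  - apply: aeW => x; rewrite patchE.
    have h : (f x * plateau a b n x) @[n --> \oo] --> f x * \1_(`]a, b[%classic) x.
      by apply: cvgM; [exact: cvg_cst|exact: plateau_cvg].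
    move: h; rewrite indicE; case: ifPn => _; first by rewrite mulr1.
    by rewrite mulr0.
symmetry; apply: (Rcvg_unique (u := fun=> 0)); first exact: cvg_cst.
by move: h; rewrite (_ : (fun n => _) = fun=> 0)//; apply/funext.
Qed.

Lemma locally_integrable_eq0 (f : R -> R) : locally_integrable setT f ->
  (forall (a b : rat) n, \int[mu]_x (f x * plateau (ratr a) (ratr b) n x) = 0) ->
  {ae mu, forall x, f x = 0}.
Proof.
move=> lf f0.
have rq (x : R) n : exists q : rat * rat,
    (x - n.+1%:R^-1 < ratr q.1 < x - n.+1%:R^-1 / 2) &&
    (x + n.+1%:R^-1 / 2 < ratr q.2 < x + n.+1%:R^-1).
  have n0 : 0 < n.+1%:R^-1 :> R by rewrite invr_gt0.
  move: n0; set e := n.+1%:R^-1 => n0; have /rat_in_itvoo[q1] : x - e < x - e / 2 by lra.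
  have /rat_in_itvoo[q2] : x + e / 2 < x + e by lra.
  rewrite !in_itv /= => h2 h1; exists (q1, q2); by rewrite h1 h2.
pose q x n := sval (cid (rq x n)).
have qP x n := svalP (cid (rq x n)).
pose E (x : R) n : set R := `]ratr (q x n).1, ratr (q x n).2[%classic.
have hE x : nicely_shrinking x (E x).
  split; first by move=> n; exact: measurable_itv.
  have n0 n : 0 < n.+1%:R^-1 :> R by rewrite invr_gt0.
  exists (2, fun n => PosNum (n0 n)); split => //=.
  - exact: cvg_harmonic.
  - move=> n y; rewrite /E /ball/= in_itv /= => /andP[y1 y2].
    have := qP x n; rewrite -/(q x n) => /andP[/andP[p1 p2] /andP[p3 p4]].
    have := n0 n; set e := n.+1%:R^-1 in p1 p2 p3 p4 * => e0.
    by rewrite ltr_norml; apply/andP; split; lra.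
  - move=> n; rewrite lebesgue_measure_ball ?invr_ge0// /E.
    have := qP x n; rewrite -/(q x n) => /andP[/andP[p1 p2] /andP[p3 p4]].
    have := n0 n; set e := n.+1%:R^-1 in p1 p2 p3 p4 * => e0.
    rewrite lebesgue_measure_itv /= lte_fin ifT; last by lra.
    by rewrite -EFinB -EFinM lee_fin mulr2n; lra.
have := lebesgue_differentiation lf; apply: aeS => x /(nice_lebesgue_differentiation hE lf).
have -> : (fun n => ((mu (E x n))^-1 * \int[mu]_(y in E x n) (f y)%:E)%E) = fun=> 0%E.
  apply/funext => n; rewrite [X in (_ * X)%E](_ : _ = 0%E) ?mule0//.
  have := plateau_ortho_itv lf (f0 (q x n).1 (q x n).2).
  rewrite /Rintegral => /eqP; rewrite fine_eq0 => [/eqP //|].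
  apply: integrable_fin_num => //.
  apply: integrableS (locally_integrable_itv _ _ lf) => //.
  exact: subset_itv_oo_cc.
move=> h; have : 0%E = (f x)%:E by apply: (Ecvg_unique (u := fun=> 0%E)) => //; exact: cvg_cst.
by move=> [].
Qed.

Lemma test_ortho_eq0 (f : R -> R) : locally_integrable setT f ->
  (forall phi, test_fun phi -> \int[mu]_x (f x * phi x) = 0) ->
  {ae mu, forall x, f x = 0}.
Proof.
by move=> lf f0; apply: locally_integrable_eq0 => // a b n; apply: f0; exact: test_plateau.
Qed.

End Calc.

(** * Fourier inversion *)

Section Kernels.
Context {R : realType}.
Local Notation mu := (@lebesgue_measure R).

Definition hexp (a x : R) : R := if 0 <= x then expR (- (a * x)) else 0.

Lemma hexp_ge0 a x : 0 <= hexp a x.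
Proof. by rewrite /hexp; case: ifP => // _; exact: expR_ge0. Qed.

Lemma hexp_le1 a x : 0 <= a -> hexp a x <= 1.
Proof.
move=> a0; rewrite /hexp; case: ifP => // x0.
by rewrite -expR0 ler_expR oppr_le0 mulr_ge0.
Qed.

Lemma measurable_hexp2 d (T : measurableType d) (f g : T -> R) :
  mfunT f -> mfunT g ->
  mfunT (fun x => hexp (f x) (g x)).
Proof.
move=> mf mg; rewrite /hexp; apply: measurable_fun_ifT => //.
- exact: measurable_fun_ler.
- apply: (@measurableT_comp _ _ _ _ _ _ (@expR R)) => //.
  by apply: measurableT_comp => //; exact: measurable_funM.
Qed.

Lemma integral_hexp (a : R) : 0 < a ->
  (\int[mu]_x (hexp a x)%:E = (a^-1)%:E)%E.
Proof.
move=> a0; have := integral_exponential_pdf a0.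
have -> : (\int[mu]_x (exponential_pdf a x)%:E = \int[mu]_x (a%:E * (hexp a x)%:E))%E.
  apply: eq_integral => x _; rewrite /exponential_pdf patchE /hexp.
  case: (boolP (0 <= x)) => x0.
    by rewrite ifT ?mem_setE ?in_itv/= ?x0// mulNr EFinM.
  by rewrite ifF ?mule0//; rewrite mem_setE in_itv /= (negbTE x0).
have mh : mfunT (hexp a).
  exact: (@measurable_hexp2 _ _ (fun=> a) (fun x => x)).
rewrite ge0_integralZl//; [|exact/measurable_EFinP|by move=> x _; rewrite lee_fin hexp_ge0|
  by rewrite lee_fin ltW].
case: (integral _ _ _) => [r||] /=.
- by rewrite -EFinM => -[] ar; congr EFin; rewrite -(mul1r a^-1) -ar mulrAC mulfV ?mul1r// gt_eqF.
- by rewrite gt0_muley ?lte_fin.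
- by rewrite gt0_muleNy ?lte_fin.
Qed.

Lemma integrable_hexp (a : R) : 0 < a -> Lint (hexp a).
Proof.
move=> a0; apply/integrableP; split.
  by apply/measurable_EFinP; exact: (@measurable_hexp2 _ _ (fun=> a) (fun x => x)).
under eq_integral do rewrite /= ger0_norm ?hexp_ge0//.
by rewrite integral_hexp// ltry.
Qed.

Lemma cvg_expRN (a : R) : 0 < a -> expR (- (a * n%:R)) @[n --> \oo] --> 0.
Proof.
move=> a0; have a1 : `|expR (- a)| < 1 by rewrite ger0_norm ?expR_ge0// -expR0 ltr_expR oppr_lt0.
have := cvg_expr a1; apply: cvg_trans; apply: near_eq_cvg; apply: nearW => n.
by rewrite -expRM_natr mulNr.
Qed.

Lemma Rintegral_hexp_mul (a : R) (f F : R -> R) (C : R) : 0 < a ->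
  (forall x : R, is_derive x 1 (fun x => expR (- (a * x)) * F x) (expR (- (a * x)) * f x)) ->
  continuous f -> (forall x, `|f x| <= C) -> (forall x, `|F x| <= C) ->
  \int[mu]_x (hexp a x * f x) = - F 0.
Proof.
move=> a0 dF cf fC FC.
have mf : mfunT f by exact: continuous_measurable_fun.
have mh : mfunT (hexp a).
  exact: (@measurable_hexp2 _ _ (fun=> a) (fun x => x)).
have C0 : 0 <= C by exact: le_trans (fC 0).
have fi : Lint (fun x => hexp a x * f x).
  apply: (integrable_le _ (integrableZl measurableT C (integrable_hexp a0))).
    exact: measurable_funM.
  by move=> x /=; rewrite normrM (ger0_norm (hexp_ge0 _ _)) mulrC ler_wpM2r ?hexp_ge0.
have ce : continuous (fun x : R => expR (- (a * x)) * f x).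
  move=> x; apply: cvgM; last exact: cf.
  apply: (@continuous_comp _ _ _ (fun x => - (a * x)) expR); last exact: continuous_expR.
  by apply: cvgN; apply: cvgM => //; exact: cvg_cst.
apply: (Rcvg_unique (cvg_itv_Rintegral fi)).
have E n : \int[mu]_(x in `[- n%:R, n%:R]) (hexp a x * f x) =
    expR (- (a * n%:R)) * F n%:R - F 0.
  have <- : \int[mu]_(x in `[0, n%:R]) (expR (- (a * x)) * f x) =
      expR (- (a * n%:R)) * F n%:R - F 0.
    by rewrite (Rintegral_FTC _ dF ce) ?mulr0 ?oppr0 ?expR0 ?mul1r// ler0n.
  rewrite Rintegral_mkcond [RHS]Rintegral_mkcond; apply: eq_Rintegral => x _.
  rewrite !patchE /hexp !mem_setE !in_itv /=.
  case: (boolP (0 <= x)) => x0 /=.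
    by rewrite (le_trans _ x0)// oppr_le0 ler0n.
  by rewrite mul0r; case: ifP.
rewrite (_ : (fun n => _) = (fun n => expR (- (a * n%:R)) * F n%:R - F 0)); last exact/funext.
rewrite -[X in _ --> X]add0r; apply: cvgD; last exact: cvg_cst.
apply/cvgr0Pnorm_le => e e0.
have C1 : 0 < C + 1 by rewrite ltr_wpDl.
have /cvgr0Pnorm_le /(_ (e / (C + 1))) := cvg_expRN a0.
rewrite divr_gt0// => /(_ isT); apply: filterS => n h.
rewrite normrM; apply: le_trans (_ : e / (C + 1) * (C + 1) <= _); last first.
  by rewrite divfK// gt_eqF.
by apply: ler_pM => //; rewrite (le_trans (FC _))// lerDl.
Qed.

Lemma sqrD_gt0 (a y : R) : 0 < a -> 0 < a ^+ 2 + y ^+ 2.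
Proof. by move=> a0; rewrite ltr_pwDl ?exprn_gt0// sqr_ge0. Qed.

Lemma isdM (f g : R -> R) (x a b : R) : is_derive x 1 f a -> is_derive x 1 g b ->
  is_derive x 1 (fun x => f x * g x) (a * g x + f x * b).
Proof.
by move=> df dg; apply: (is_derive_eq (is_deriveM df dg)); rewrite /GRing.scale /=; ring.
Qed.
Lemma isdD (f g : R -> R) (x a b : R) : is_derive x 1 f a -> is_derive x 1 g b ->
  is_derive x 1 (fun x => f x + g x) (a + b).
Proof. by move=> df dg; exact: is_deriveD. Qed.
Lemma isdZ (f : R -> R) (c x a : R) : is_derive x 1 f a ->
  is_derive x 1 (fun x => c * f x) (c * a).
Proof. by move=> df; exact: is_deriveZ. Qed.
Lemma isd_comp (f g : R -> R) (x a b : R) : is_derive (g x) 1 f a -> is_derive x 1 g b ->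
  is_derive x 1 (fun x => f (g x)) (a * b).
Proof. by move=> df dg; exact: (is_derive1_comp df dg). Qed.

Lemma is_derive_expcos (a y x : R) :
  is_derive x 1 (fun x => expR (- (a * x))) (- a * expR (- (a * x))) /\
  is_derive x 1 (fun x => cos (x * y)) (- y * sin (x * y)) /\
  is_derive x 1 (fun x => sin (x * y)) (y * cos (x * y)).
Proof.
have dl (c : R) : is_derive x 1 (fun x : R => c * x) c.
  have dz := is_deriveZ c (is_derive_id x (1 : R)).
  by apply: (is_derive_eq dz); rewrite /GRing.scale /= mulr1.
have dr : is_derive x 1 (fun x : R => x * y) y.
  by under eq_fun do rewrite mulrC; exact: dl.
split; last split.
- have dz := @is_derive1_comp _ expR (fun x => - (a * x)) x _ _ (is_derive_expR _) (is_deriveN (dl a)).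
  by apply: (is_derive_eq dz); ring.
- have dz := @is_derive1_comp _ cos (fun x => x * y) x _ _ (is_derive_cos _) dr.
  by apply: (is_derive_eq dz); ring.
- have dz := @is_derive1_comp _ sin (fun x => x * y) x _ _ (is_derive_sin _) dr.
  by apply: (is_derive_eq dz); ring.
Qed.

Lemma continuous_cosM (y : R) : continuous (fun x : R => cos (x * y)).
Proof.
move=> x; have [_ [dc _]] := is_derive_expcos 0 y x.
by apply/differentiable_continuous/derivable1_diffP; by case: dc.
Qed.
Lemma continuous_sinM (y : R) : continuous (fun x : R => sin (x * y)).
Proof.
move=> x; have [_ [_ ds]] := is_derive_expcos 0 y x.
by apply/differentiable_continuous/derivable1_diffP; by case: ds.
Qed.

Lemma normr_trig_le (a y x : R) (D := a ^+ 2 + y ^+ 2) (s : R) : 0 < a -> `|s| <= 1 ->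
  `|(y * sin (x * y) - a * cos (x * y)) / D| <= (`|y| + a) / D + 1 /\
  `|(- a * sin (x * y) - y * cos (x * y)) / D| <= (`|y| + a) / D + 1.
Proof.
move=> a0 _; have D0 : 0 < D by exact: sqrD_gt0.
have cs : `|cos (x * y)| <= 1 by rewrite ler_norml cos_geN1 cos_le1.
have sn : `|sin (x * y)| <= 1 by rewrite ler_norml sin_geN1 sin_le1.
split; (apply: le_trans (_ : (`|y| + a) / D <= _); last by rewrite lerDl);
  rewrite normrM normfV (ger0_norm (ltW D0)) ler_pM2r ?invr_gt0//;
  (apply: le_trans (ler_normB _ _) _); rewrite !normrM ?normrN (ger0_norm (ltW a0)).
  by apply: lerD; rewrite ler_piMr// ltW.
by rewrite addrC; apply: lerD; rewrite ler_piMr// ltW.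
Qed.

Lemma Rintegral_hexp_cos (a y : R) : 0 < a ->
  \int[mu]_x (hexp a x * cos (x * y)) = a / (a ^+ 2 + y ^+ 2).
Proof.
move=> a0; have D0 := sqrD_gt0 y a0; set D := a ^+ 2 + y ^+ 2 in D0 *.
have dF (x : R) : is_derive x 1
    (fun x => expR (- (a * x)) * ((y * sin (x * y) - a * cos (x * y)) / D)) (expR (- (a * x)) * cos (x * y)).
  have [de [dc ds]] := is_derive_expcos a y x.
  have dz := isdM de (isdZ (D^-1) (isdD (isdZ y ds) (isdZ (- a) dc))).
  rewrite [X in is_derive _ _ X _](_ : _ = (fun x => expR (- (a * x)) *
    (D^-1 * (y * sin (x * y) + - a * cos (x * y))))).
    apply: (is_derive_eq dz); rewrite /D.
    by field; rewrite gt_eqF.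
  by apply/funext => z; rewrite -(mulrC D^-1) ?mulNr.
have tr1 x : `|cos (x * y)| <= 1 by rewrite ler_norml cos_geN1 cos_le1.
have tr2 x : `|cos (x * y)| <= (`|y| + a) / D + 1.
  by rewrite (le_trans (tr1 x))// lerDr divr_ge0 ?(ltW D0)// addr_ge0// ltW.
rewrite (Rintegral_hexp_mul a0 dF (@continuous_cosM y) tr2).
  by rewrite mul0r sin0 cos0 mulr0 mulr1 sub0r mulNr opprK.
by move=> x; have [] := @normr_trig_le a y x 0 a0; rewrite ?normr0.
Qed.

Lemma integral_cauchy : (\int[mu]_x (oneDsqr x)^-1%:E = (@pi R)%:E)%E.
Proof.
rewrite ge0_symfun_integralT//.
- have -> : [set x : R | 0 <= x] = `[0, +oo[%classic.
    by apply/seteqP; split => x /=; rewrite in_itv /= andbT.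
  by rewrite integral0y_oneDsqr -EFinM; congr EFin; field.
- exact: continuous_oneDsqrV.
- by move=> x /=; rewrite /oneDsqr sqrrN.
Qed.

Lemma integrable_cauchy : Lint (fun x : R => (oneDsqr x)^-1).
Proof.
apply/integrableP; split.
  apply/measurable_EFinP; apply: continuous_measurable_fun.
  exact: continuous_oneDsqrV.
under eq_integral do rewrite /= ger0_norm ?invr_ge0//.
by rewrite integral_cauchy ltry.
Qed.

End Kernels.

Section Affine.
Context {R : realType}.
Local Notation mu := (@lebesgue_measure R).

Lemma measurable_affR (a b : R) : mfunT (fun x : R => a * x + b).
Proof. by apply: measurable_funD => //; apply: measurable_funM. Qed.

Lemma integrable_affine (a b : R) (f : R -> R) : a != 0 ->
  Lint f -> Lint (fun x => f (a * x + b)).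
Proof.
move=> a0 fi; have mf := integrable_meas fi.
apply/integrableP; split.
  apply/measurable_EFinP; exact: (measurableT_comp mf (measurable_affR a b)).
have /integrableP[_ fo] := fi.
rewrite (@ge0_integral_affine _ a b (fun x => (`|f x|)%:E))//.
  by rewrite lte_mul_pinfty// lee_fin invr_ge0.
by apply/measurable_EFinP; exact: measurableT_comp.
Qed.

Lemma cintegrable_affine (a b : R) (f : R -> R[i]) : a != 0 ->
  cintegrable f -> cintegrable (fun x => f (a * x + b)).
Proof.
move=> a0 [f1 f2]; split.
  exact: (@integrable_affine a b (fun x => Re (f x))).
exact: (@integrable_affine a b (fun x => Im (f x))).
Qed.

Let N1 : (-1 : R) != 0. Proof. by rewrite oppr_eq0 oner_eq0. Qed.

Lemma integrable_refl (f : R -> R) : Lint f ->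
  Lint (fun x => f (- x)).
Proof.
move=> /(integrable_affine 0 N1); congr (mu.-integrable _ _).
by apply/funext => x /=; rewrite mulN1r addr0.
Qed.

Lemma Rintegral_refl (f : R -> R) : mfunT f ->
  \int[mu]_x f (- x) = \int[mu]_x f x.
Proof.
move=> mf; have := Rintegral_affine 0 N1 mf; rewrite normrN1 invr1 mul1r => <-.
by apply: eq_Rintegral => x _; rewrite mulN1r addr0.
Qed.

Lemma cintegrable_refl (b : R) (f : R -> R[i]) : cintegrable f ->
  cintegrable (fun x => f (b - x)).
Proof.
move=> /(cintegrable_affine b N1); congr cintegrable.
by apply/funext => x; rewrite mulN1r addrC.
Qed.

Lemma cintegral_refl (b : R) (f : R -> R[i]) : cmeas f ->
  cintegral (fun x => f (b - x)) = cintegral f.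
Proof.
move=> mf; have := cintegral_affine b N1 mf; rewrite normrN1 invr1 mul1r => <-.
by apply: eq_cintegral => x; rewrite mulN1r addrC.
Qed.

Lemma cintegral_shift (b : R) (f : R -> R[i]) : cmeas f ->
  cintegral (fun x => f (x + b)) = cintegral f.
Proof.
move=> mf; have := cintegral_affine b (oner_neq0 R) mf; rewrite normr1 invr1 mul1r => <-.
by apply: eq_cintegral => x; rewrite mul1r.
Qed.

Lemma ge0_integral_refl (b : R) (f : R -> \bar R) : mfunT f ->
  (forall x, 0 <= f x)%E -> (\int[mu]_x f (b - x)%R = \int[mu]_x f x)%E.
Proof.
move=> mf f0; have := ge0_integral_affine b N1 mf f0; rewrite normrN1 invr1 mul1e => <-.
by apply: eq_integral => x _; rewrite mulN1r addrC.
Qed.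

Lemma ge0_integral_shift (b : R) (f : R -> \bar R) : mfunT f ->
  (forall x, 0 <= f x)%E -> (\int[mu]_x f (x + b)%R = \int[mu]_x f x)%E.
Proof.
move=> mf f0; have := ge0_integral_affine b (oner_neq0 R) mf f0.
rewrite normr1 invr1 mul1e => <-.
by apply: eq_integral => x _; rewrite mul1r.
Qed.

End Affine.

Section Fourier.
Context {R : realType}.
Local Notation mu := (@lebesgue_measure R).
Local Notation Fi := (@inverse_fourier_int R).
Local Notation Fh := (@fourier_int R).

Definition kap : R := (Num.sqrt (2 * pi))^-1.

Lemma kap_gt0 : 0 < kap.
Proof. by rewrite invr_gt0 sqrtr_gt0 mulr_gt0// pi_gt0. Qed.

Lemma kap2 : kap ^+ 2 = (2 * pi)^-1.
Proof. by rewrite exprVn sqr_sqrtr// mulr_ge0// pi_ge0. Qed.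

Lemma FiE g x : Fi g x = kap%:C * cintegral (fun xi => g xi * expi (x * xi)).
Proof. by []. Qed.

Lemma FhE g x : Fh g x = Fi g (- x).
Proof.
rewrite FiE /fourier_int; congr (_ * _); apply: eq_cintegral => y.
by rewrite mulNr (mulrC x).
Qed.

Lemma cmeas_pair2 (f : R -> R[i]) : cmeas f -> cmeas (fun p : R * R => f p.2).
Proof. by move=> mf; exact: (cmeas_comp mf measurable_snd). Qed.
Lemma cmeas_pair1 (f : R -> R[i]) : cmeas f -> cmeas (fun p : R * R => f p.1).
Proof. by move=> mf; exact: (cmeas_comp mf measurable_fst). Qed.

Lemma measurable_mul12 : mfunT (fun p : R * R => p.1 * p.2).
Proof. by apply: measurable_funM; [exact: measurable_fst|exact: measurable_snd]. Qed.

Lemma cintegrable_expi (g : R -> R[i]) x : cintegrable g ->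
  cintegrable (fun xi => g xi * expi (x * xi)).
Proof.
move=> gi; apply: (@cintegrableMr _ _ _ 1) => //.
  apply: cmeas_expi; exact: measurable_funM.
by move=> y; rewrite normc_expi.
Qed.

Lemma cmeas_Fi g : cmeas g -> cmeas (Fi g).
Proof.
move=> mg; apply: cmeasM; first exact: cmeas_cst.
apply: (@cmeas_cintegral _ _ _ (fun p : R * R => g p.2 * expi (p.1 * p.2))).
by apply: cmeasM; [exact: cmeas_pair2|apply: cmeas_expi; exact: measurable_mul12].
Qed.

Lemma Fi_bound g x : cintegrable g ->
  normc (Fi g x) <= kap * \int[mu]_xi normc (g xi).
Proof.
move=> gi; rewrite FiE Normc.normcM normcC ger0_norm ?(ltW kap_gt0)//.
rewrite ler_pM2l ?kap_gt0//.
apply: le_trans (le_normc_cintegral_R (cintegrable_expi x gi)) _.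
by under eq_Rintegral do rewrite Normc.normcM normc_expi mulr1.
Qed.

Lemma Fi_ae g h : {ae mu, forall x, g x = h x} -> Fi g = Fi h.
Proof.
move=> gh; apply/funext => x; rewrite !FiE; congr (_ * _); apply: ae_cintegral.
by apply: aeS gh => y ->.
Qed.

Lemma FiD g h x : cintegrable g -> cintegrable h ->
  Fi (fun y => g y + h y) x = Fi g x + Fi h x.
Proof.
move=> gi hi; rewrite !FiE -mulrDr -cintegralD; [|exact: cintegrable_expi..].
by congr (_ * _); apply: eq_cintegral => y; rewrite mulrDl.
Qed.

Lemma FiZ c g x : cintegrable g -> Fi (fun y => c * g y) x = c * Fi g x.
Proof.
move=> gi; rewrite !FiE mulrCA -(cintegralZ _ (cintegrable_expi x gi)).
by congr (_ * _); apply: eq_cintegral => y; rewrite mulrA.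
Qed.

Lemma FiN g x : cintegrable g -> Fi (fun y => - g y) x = - Fi g x.
Proof.
move=> gi; rewrite -mulN1r -FiZ//; congr (Fi _ x); apply/funext => y.
by rewrite mulN1r.
Qed.

Lemma FiB g h x : cintegrable g -> cintegrable h ->
  Fi (fun y => g y - h y) x = Fi g x - Fi h x.
Proof. by move=> gi hi; rewrite FiD ?FiN//; exact: cintegrableN. Qed.

Lemma Fi_pairing f g : cintegrable f -> cintegrable g ->
  cintegral (fun x => Fi g x * f x) = cintegral (fun xi => g xi * Fi f xi).
Proof.
move=> fi gi.
have mf := cintegrable_meas fi; have mg := cintegrable_meas gi.
pose F (x xi : R) := g xi * expi (x * xi) * f x.
have mF : cmeas (fun p : R * R => F p.1 p.2).
  apply: cmeasM; last exact: cmeas_pair1.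
  by apply: cmeasM; [exact: cmeas_pair2|apply: cmeas_expi; exact: measurable_mul12].
have iF : (\int[mu]_x L1n (F x) < +oo)%E.
  have E x : L1n (F x) = ((normc (f x))%:E * L1n g)%E.
    rewrite /L1n -ge0_integralZl//; last 3 first.
    - exact/measurable_EFinP/cmeas_norm.
    - by move=> xi _; rewrite lee_fin normc_ge0.
    - by rewrite lee_fin normc_ge0.
    apply: eq_integral => xi _; rewrite -EFinM.
    by rewrite /F !Normc.normcM normc_expi mulr1 mulrC.
  under eq_integral do rewrite E L1n_fin//.
  rewrite ge0_integralZr//; last 3 first.
  - exact/measurable_EFinP/cmeas_norm.
  - by move=> x _; rewrite lee_fin normc_ge0.
  - by rewrite lee_fin; apply: Rintegral_ge0 => x _; exact: normc_ge0.
  have := L1n_fin fi; rewrite /L1n => ->; rewrite -EFinM ltry//.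
have := cFubini mF iF.
have -> : cintegral (fun x => cintegral (F x)) =
    cintegral (fun x => cintegral (fun xi => g xi * expi (x * xi)) * f x).
  by apply: eq_cintegral => x; rewrite -cintegralZr//; exact: cintegrable_expi.
have -> : cintegral (fun y => cintegral (F^~ y)) =
    cintegral (fun y => g y * cintegral (fun x => f x * expi (y * x))).
  apply: eq_cintegral => y; rewrite -cintegralZ; last exact: cintegrable_expi.
  by apply: eq_cintegral => x; rewrite /F (mulrC x y); ring.
move=> FE.
have Fib h : cintegrable h ->
    forall x, normc (cintegral (fun xi => h xi * expi (x * xi))) <= \int[mu]_xi normc (h xi).
  move=> hi x; apply: le_trans (le_normc_cintegral_R (cintegrable_expi x hi)) _.
  by under eq_Rintegral do rewrite Normc.normcM normc_expi mulr1.
have Fim (h : R -> R[i]) : cmeas h -> cmeas (fun x : R => cintegral (fun xi => h xi * expi (x * xi))).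
  move=> mh; apply: (@cmeas_cintegral _ _ _ (fun p : R * R => h p.2 * expi (p.1 * p.2))).
  by apply: cmeasM; [exact: cmeas_pair2|apply: cmeas_expi; exact: measurable_mul12].
transitivity (kap%:C * cintegral (fun x => cintegral (fun xi => g xi * expi (x * xi)) * f x)).
  rewrite -cintegralZ; last exact: (cintegrableMl fi (Fim _ mg) (Fib _ gi)).
  by apply: eq_cintegral => x; rewrite FiE mulrA.
rewrite FE -cintegralZ; last exact: (cintegrableMr gi (Fim _ mf) (Fib _ fi)).
by apply: eq_cintegral => x; rewrite FiE mulrCA.
Qed.

Definition ccontinuous (f : R -> R[i]) :=
  continuous (fun x => Re (f x)) /\ continuous (fun x => Im (f x)).

Definition abexp (e x : R) : R := hexp e x + hexp e (- x).

Lemma integrable_abexp (e : R) : 0 < e -> Lint (abexp e).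
Proof.
move=> e0; have h := integrable_hexp e0.
have := integrableD measurableT h (integrable_refl h).
by congr (mu.-integrable _ _).
Qed.

Lemma Fi_abexp (e y : R) : 0 < e ->
  cintegral (fun x => (abexp e x)%:C * expi (y * x)) = (2 * e / (e ^+ 2 + y ^+ 2))%:C.
Proof.
move=> e0.
have mh : mfunT (hexp e).
  exact: (@measurable_hexp2 _ _ _ (fun=> e) (fun x => x)).
have i1 := integrable_hexp e0.
have bd (tr : R -> R) : (forall x, `|tr x| <= 1) -> continuous tr ->
    Lint (fun x => hexp e x * tr x).
  move=> tr1 ct; apply: (integrable_le _ i1).
    by apply: measurable_funM => //; exact: continuous_measurable_fun.
  by move=> x; rewrite normrM (ger0_norm (hexp_ge0 _ _)) ler_piMr// hexp_ge0.
have ic := bd (fun x => cos (x * y)) (fun x => ltac:(by rewrite ler_norml cos_geN1 cos_le1)) (@continuous_cosM R y).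
have is_ := bd (fun x => sin (x * y)) (fun x => ltac:(by rewrite ler_norml sin_geN1 sin_le1)) (@continuous_sinM R y).
have ic' := integrable_refl ic; have ice := Rintegral_refl (integrable_meas ic).
have is' := integrable_refl is_; have ise := Rintegral_refl (integrable_meas is_).
apply: complex_eqP.
  rewrite Re_cintegral ReC.
  under eq_Rintegral do rewrite ReM ReC ImC mul0r subr0 /= (mulrC y) /abexp mulrDl.
  have -> : \int[mu]_x (hexp e x * cos (x * y) + hexp e (- x) * cos (x * y)) =
     \int[mu]_x (hexp e x * cos (x * y) + hexp e (- x) * cos (- x * y)).
    by apply: eq_Rintegral => x _; rewrite mulNr cosN.
  by rewrite RintegralD// ice Rintegral_hexp_cos//; field; rewrite gt_eqF// sqrD_gt0.
rewrite Im_cintegral ImC.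
under eq_Rintegral do rewrite ImM ReC ImC mul0r addr0 /= (mulrC y) /abexp mulrDl.
have -> : \int[mu]_x (hexp e x * sin (x * y) + hexp e (- x) * sin (x * y)) =
   \int[mu]_x (hexp e x * sin (x * y) - hexp e (- x) * sin (- x * y)).
  by apply: eq_Rintegral => x _; rewrite mulNr sinN mulrN opprK.
by rewrite RintegralB// ise subrr.
Qed.

End Fourier.

Section Inversion.
Context {R : realType}.
Local Notation mu := (@lebesgue_measure R).
Local Notation Fi := (@inverse_fourier_int R).
Local Notation Fh := (@fourier_int R).
Local Notation kap := (@kap R).

Lemma CM (x y : R) : (x * y)%:C = x%:C * y%:C :> R[i].
Proof. exact: rmorphM. Qed.
Lemma CD (x y : R) : (x + y)%:C = x%:C + y%:C :> R[i].
Proof. exact: rmorphD. Qed.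
Lemma CN (x : R) : (- x)%:C = - x%:C :> R[i].
Proof. exact: rmorphN. Qed.

Definition ccvg (u : nat -> R[i]) (l : R[i]) :=
  (Re (u n) @[n --> \oo] --> Re l) /\ (Im (u n) @[n --> \oo] --> Im l).

Lemma ccvg_unique u l l' : ccvg u l -> ccvg u l' -> l = l'.
Proof.
move=> [a b] [c d]; apply: complex_eqP; [exact: (Rcvg_unique a c)|exact: (Rcvg_unique b d)].
Qed.

Lemma ccvg_cst l : ccvg (fun=> l) l.
Proof. by split; exact: cvg_cst. Qed.

Lemma ccvgM u v l m : ccvg u l -> ccvg v m -> ccvg (fun n => u n * v n) (l * m).
Proof.
move=> [a b] [c d]; split.
  by under eq_fun do rewrite ReM; rewrite ReM; apply: cvgB; exact: cvgM.
by under eq_fun do rewrite ImM; rewrite ImM; apply: cvgD; exact: cvgM.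
Qed.

Lemma ccvgD u v l m : ccvg u l -> ccvg v m -> ccvg (fun n => u n + v n) (l + m).
Proof.
move=> [a b] [c d]; split.
  by under eq_fun do rewrite ReD; rewrite ReD; exact: cvgD.
by under eq_fun do rewrite ImD; rewrite ImD; exact: cvgD.
Qed.

Lemma ccvgC (u : nat -> R) (l : R) : u @ \oo --> l -> ccvg (fun n => (u n)%:C) l%:C.
Proof. by move=> ul; split => //=; exact: cvg_cst. Qed.

Lemma ccvg_cintegral (f_ : nat -> R -> R[i]) (f : R -> R[i]) (g : R -> R) :
  (forall n, cmeas (f_ n)) -> cmeas f -> Lint g ->
  {ae mu, forall x, ccvg (f_ ^~ x) (f x)} ->
  (forall n x, normc (f_ n x) <= g x) ->
  ccvg (fun n => cintegral (f_ n)) (cintegral f).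
Proof.
move=> mf_ mf ig ff fg; split.
  apply: (@cvg_Rintegral_dom _ (fun n x => Re (f_ n x)) (fun x => Re (f x)) g) => //.
  - by move=> n; case: (mf_ n).
  - by case: mf.
  - by apply: aeS ff => x [].
  - by move=> n x; apply: le_trans (Re_le_normc _) _.
apply: (@cvg_Rintegral_dom _ (fun n x => Im (f_ n x)) (fun x => Im (f x)) g) => //.
- by move=> n; case: (mf_ n).
- by case: mf.
- by apply: aeS ff => x [].
- by move=> n x; apply: le_trans (Im_le_normc _) _.
Qed.

Lemma ae_neq (a : R) : {ae mu, forall x : R, x != a}.
Proof.
exists [set a]; split => //; first exact: lebesgue_measure_set1.
by move=> x /= /negP; rewrite negbK => /eqP.
Qed.

Lemma abexp_ge0 (e x : R) : 0 <= abexp e x.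
Proof. by rewrite addr_ge0// hexp_ge0. Qed.
Lemma abexp_le2 (e x : R) : 0 <= e -> abexp e x <= 2.
Proof. by move=> e0; rewrite -[2]/(1 + 1) lerD// hexp_le1. Qed.

Lemma abexp_cvg (x : R) : x != 0 -> abexp (n.+1%:R^-1) x @[n --> \oo] --> (1 : R).
Proof.
move=> x0; have E (n : nat) : abexp (n.+1%:R^-1) x = expR (- (n.+1%:R^-1 * `|x|)).
  rewrite /abexp /hexp; have [xn|xp|xe] := ltgtP x 0; last by rewrite xe eqxx in x0.
    by rewrite ifT ?oppr_ge0 ?ltW// add0r ltr0_norm.
  by rewrite ifF ?addr0 ?gtr0_norm// oppr_ge0 leNgt xp.
rewrite (_ : (fun n => _) = (fun n => expR (- (n.+1%:R^-1 * `|x|)))); last exact/funext.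
rewrite -[X in _ --> X]expR0; apply: continuous_cvg; first exact: continuous_expR.
rewrite -[X in _ --> X]oppr0 -[X in _ --> - X](mul0r `|x|); apply: cvgN; apply: cvgM; last exact: cvg_cst.
exact: cvg_harmonic.
Qed.

Lemma ccontinuous_cvg (m : R -> R[i]) (u : nat -> R) x : ccontinuous m ->
  u @ \oo --> x -> ccvg (fun n => m (u n)) (m x).
Proof.
move=> [m1 m2] ux; split.
  exact: (cvg_comp _ _ ux (m1 x)).
exact: (cvg_comp _ _ ux (m2 x)).
Qed.

Lemma Fh_Fi (m : R -> R[i]) (M : R) : cintegrable m -> ccontinuous m ->
  (forall x, normc (m x) <= M) -> cintegrable (Fi m) -> forall xi, Fh (Fi m) xi = m xi.
Proof.
move=> im cm mM ih xi; have mm := cintegrable_meas im; have mh := cintegrable_meas ih.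
pose e (n : nat) : R := n.+1%:R^-1.
have e0 n : 0 < e n by rewrite invr_gt0.
pose w n (x : R) : R[i] := (abexp (e n) x)%:C * expi (- (x * xi)).
have mexp : cmeas (fun x : R => expi (- (x * xi))).
  by apply: cmeas_expi; apply: measurableT_comp => //; exact: measurable_funM.
have iab n : cintegrable (fun x : R => (abexp (e n) x)%:C : R[i]).
  by apply: cintegrableC; exact: integrable_abexp.
have iw n : cintegrable (w n).
  apply: (@cintegrableMr _ _ _ 1) => //.
  by move=> x; rewrite normc_expi.
have cvg1 : ccvg (fun n => cintegral (fun x => Fi m x * w n x))
    (cintegral (fun x => Fi m x * expi (- (x * xi)))).
  apply: (ccvg_cintegral (g := fun x => 2 * normc (Fi m x))).
  - move=> n; apply: cmeasM => //; exact: cintegrable_meas (iw n).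
  - exact: cmeasM.
  - exact: (integrableZl measurableT 2 (cintegrable_norm ih)).
  - apply: aeS (ae_neq 0) => x x0; apply: ccvgM; first exact: ccvg_cst.
    rewrite -[X in ccvg _ X]mul1r; apply: ccvgM; last exact: ccvg_cst.
    exact: (ccvgC (abexp_cvg x0)).
  - move=> n x; rewrite Normc.normcM [normc (_%:C * expi _)]Normc.normcM normc_expi mulr1.
    rewrite normcC ger0_norm ?abexp_ge0// mulrC.
    by rewrite ler_wpM2r ?normc_ge0// abexp_le2// ltW.
have E n : cintegral (fun x => Fi m x * w n x) =
    cintegral (fun s => m (e n * s + xi) * (2 * kap / oneDsqr s)%:C).
  rewrite Fi_pairing//.
  have -> : cintegral (fun eta => m eta * Fi (w n) eta) =
      cintegral (fun eta => m eta * (kap * (2 * e n / (e n ^+ 2 + (eta - xi) ^+ 2)))%:C).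
    apply: eq_cintegral => eta; congr (_ * _); rewrite FiE CM; congr (_ * _).
    rewrite -Fi_abexp//; apply: eq_cintegral => x; rewrite /w -mulrA -expiD.
    by congr (_ * expi _); ring.
  pose g eta := m eta * (kap * (2 * e n / (e n ^+ 2 + (eta - xi) ^+ 2)))%:C.
  have mg : cmeas g.
    apply: cmeasM => //; apply: cmeasC; apply: continuous_measurable_fun => x.
    apply: cvgM; first exact: cvg_cst.
    apply: cvgM; first exact: cvg_cst.
    apply: cvgV; first by rewrite gt_eqF// sqrD_gt0.
    apply: cvgD; first exact: cvg_cst.
    rewrite expr2; under eq_fun do rewrite expr2.
    by apply: cvgM; apply: cvgB => //; exact: cvg_cst.
  have := cintegral_affine xi (lt0r_neq0 (e0 n)) mg.
  rewrite gtr0_norm// => /(congr1 (fun z => (e n)%:C * z)).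
  rewrite mulrA -CM mulfV ?gt_eqF// mul1r => <-.
  have ig : cintegrable g.
    apply: (@cintegrableMr _ _ _ (kap * (2 / e n))) => //.
      apply: cmeasC; apply: continuous_measurable_fun => x.
      apply: cvgM; first exact: cvg_cst.
      apply: cvgM; first exact: cvg_cst.
      apply: cvgV; first by rewrite gt_eqF// sqrD_gt0.
      apply: cvgD; first exact: cvg_cst.
      rewrite expr2; under eq_fun do rewrite expr2.
      by apply: cvgM; apply: cvgB => //; exact: cvg_cst.
    move=> x; rewrite normcC ger0_norm; last first.
      by rewrite mulr_ge0 ?(ltW kap_gt0)// divr_ge0 ?(ltW (sqrD_gt0 _ _))// mulr_ge0// ltW.
    rewrite ler_pM2l ?kap_gt0// ler_pdivrMr ?sqrD_gt0//.
    rewrite mulrDr (_ : 2 / e n * e n ^+ 2 = 2 * e n); last first.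
      by field; rewrite gt_eqF.
    by rewrite lerDl mulr_ge0 ?sqr_ge0// divr_ge0// ltW.
  rewrite -cintegralZ; last exact: (cintegrable_affine xi (lt0r_neq0 (e0 n)) ig).
  apply: eq_cintegral => s; rewrite /g mulrCA -CM; congr (_ * _%:C).
  rewrite /oneDsqr; have := e0 n; move: (e n) => c c0.
  rewrite addrK; have h : 0 < 1 + s ^+ 2 by rewrite ltr_pwDl// sqr_ge0.
  by field; rewrite !gt_eqF//= sqrD_gt0// mulr_gt0.
have cvg2 : ccvg (fun n => cintegral (fun s => m (e n * s + xi) * (2 * kap / oneDsqr s)%:C))
    (cintegral (fun s => m xi * (2 * kap / oneDsqr s)%:C)).
  have ic : Lint (fun s : R => 2 * kap * (oneDsqr s)^-1).
    exact: (integrableZl measurableT (2 * kap) (@integrable_cauchy R)).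
  apply: (ccvg_cintegral (g := fun s => `|M| * (2 * kap / oneDsqr s))).
  - move=> n; apply: cmeasM; first exact: (cmeas_comp mm (measurable_affR _ _)).
    by apply: cmeasC; exact: integrable_meas ic.
  - apply: cmeasM; first exact: cmeas_cst.
    by apply: cmeasC; exact: integrable_meas ic.
  - exact: (integrableZl measurableT `|M| ic).
  - apply: aeW => s; apply: ccvgM; last exact: ccvg_cst.
    apply: ccontinuous_cvg => //; rewrite -[X in _ --> X]add0r -(mul0r s).
    apply: cvgD; last exact: cvg_cst.
    by apply: cvgM; [exact: cvg_harmonic|exact: cvg_cst].
  - have h (s : R) : 0 <= 2 * kap / oneDsqr s.
      by rewrite divr_ge0 ?mulr_ge0 ?(ltW kap_gt0)// (le_trans ler01)// oneDsqr_ge1.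
    move=> n s; rewrite Normc.normcM normcC (ger0_norm (h s)).
    by rewrite ler_wpM2r// (le_trans (mM _))// ler_norm.
have V : cintegral (fun s => m xi * (2 * kap / oneDsqr s)%:C) = m xi * (2 * kap * pi)%:C.
  have ic : Lint (fun s : R => 2 * kap * (oneDsqr s)^-1).
    exact: (integrableZl measurableT (2 * kap) (@integrable_cauchy R)).
  rewrite cintegralZ; last exact: cintegrableC.
  rewrite cintegralC RintegralZl//; last exact: integrable_cauchy.
  by rewrite /Rintegral integral_cauchy.
have := ccvg_unique cvg1; rewrite (_ : (fun n => _) = (fun n =>
  cintegral (fun s => m (e n * s + xi) * (2 * kap / oneDsqr s)%:C))); last exact/funext.
move=> /(_ _ cvg2); rewrite V /fourier_int => ->.
rewrite mulrCA -CM -[(Num.sqrt _)^-1]/kap.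
have -> : kap * (2 * kap * pi) = kap ^+ 2 * (2 * pi) by ring.
by rewrite kap2 mulVf ?mulr1// gt_eqF// mulr_gt0// pi_gt0.
Qed.

End Inversion.

(** * Distributional Fourier transforms *)

Section Schwartz.
Context {R : realType}.
Local Notation mu := (@lebesgue_measure R).
Local Notation Fi := (@inverse_fourier_int R).
Local Notation Fh := (@fourier_int R).
Local Notation kap := (@kap R).
Implicit Types phi f : R -> R.

Lemma integrableM_bounded (f g : R -> R) (C : R) : Lint f ->
  mfunT g -> (forall x, `|g x| <= C) ->
  Lint (fun x => f x * g x).
Proof.
move=> fi mg gC.
have h := integrableZl measurableT C (integrable_norm fi).
apply: (integrable_le _ h); first by apply: measurable_funM => //; exact: integrable_meas.
by move=> x /=; rewrite normrM mulrC ler_wpM2r.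
Qed.

Lemma cos_le (x : R) : `|cos x| <= 1. Proof. by rewrite ler_norml cos_geN1 cos_le1. Qed.
Lemma sin_le (x : R) : `|sin x| <= 1. Proof. by rewrite ler_norml sin_geN1 sin_le1. Qed.

Lemma Fh_derive (f f' : R -> R) (C : R) : (forall x : R, is_derive x 1 f (f' x)) ->
  continuous f' -> Lint f -> Lint f' ->
  (forall x, `|x| * `|f x| <= C) -> forall xi,
  Fh (fun x => (f' x)%:C) xi = Complex 0 xi * Fh (fun x => (f x)%:C) xi.
Proof.
move=> df cf' fi fi' fC xi; rewrite /fourier_int mulrCA; congr (_ * _).
have cf : continuous f.
  by move=> x; apply/differentiable_continuous/derivable1_diffP; case: (df x).
have mc : mfunT (fun x : R => cos (x * xi)).
  exact: continuous_measurable_fun (@continuous_cosM R xi).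
have ms : mfunT (fun x : R => sin (x * xi)).
  exact: continuous_measurable_fun (@continuous_sinM R xi).
have mi (g h : R -> R) : Lint g -> mfunT h ->
    (forall x, `|h x| <= 1) -> Lint (fun x => g x * h x).
  by move=> gi mh h1; exact: integrableM_bounded h1.
have cosb x : `|cos (x * xi)| <= 1 by exact: cos_le.
have sinb x : `|sin (x * xi)| <= 1 by exact: sin_le.
have ic' := mi _ _ fi' mc cosb; have is' := mi _ _ fi' ms sinb.
have ic := mi _ _ fi mc cosb; have is_ := mi _ _ fi ms sinb.
have bound h : (forall x, `|h x| <= 1) -> forall x : R, `|x| * `|f x * h x| <= C.
  by move=> h1 x; apply: le_trans (fC x); rewrite normrM mulrA ler_piMr// mulr_ge0.
have cMul (g h : R -> R) : continuous g -> continuous h -> continuous (fun x => g x * h x).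
  by move=> cg ch x; apply: cvgM; [exact: cg|exact: ch].
have E1 : \int[mu]_x (f' x * cos (x * xi)) = xi * \int[mu]_x (f x * sin (x * xi)).
  have d x := isdM (df x) (is_derive_expcos 0 xi x).2.1.
  have ii : Lint (fun x => f' x * cos (x * xi) +
      f x * (- xi * sin (x * xi))).
    have := integrableD measurableT ic' (integrableZl measurableT (- xi) is_).
    by congr (mu.-integrable _ _); apply/funext => x /=; rewrite -EFinD; congr EFin; ring.
  have := @Rintegral_derive0_bound _ _ _ C d _ ii (bound _ cosb).
  have -> : \int[mu]_x (f' x * cos (x * xi) + f x * (- xi * sin (x * xi))) =
      \int[mu]_x (f' x * cos (x * xi)) - xi * \int[mu]_x (f x * sin (x * xi)).
    rewrite -RintegralZl// -RintegralB//; last exact: (integrableZl measurableT xi is_).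
    by apply: eq_Rintegral => x _; ring.
  move=> h; apply/eqP; rewrite -subr_eq0; apply/eqP; apply: h.
  move=> x; apply: cvgD; first by apply: cMul => //; exact: continuous_cosM.
  apply: (cMul f (fun x => - xi * sin (x * xi))) => //.
  by apply: cMul; [move=> y; exact: cvg_cst|exact: continuous_sinM].
have E2 : \int[mu]_x (f' x * sin (x * xi)) = - (xi * \int[mu]_x (f x * cos (x * xi))).
  have d x := isdM (df x) (is_derive_expcos 0 xi x).2.2.
  have ii : Lint (fun x => f' x * sin (x * xi) +
      f x * (xi * cos (x * xi))).
    have := integrableD measurableT is' (integrableZl measurableT xi ic).
    by congr (mu.-integrable _ _); apply/funext => x /=; rewrite -EFinD; congr EFin; ring.
  have := @Rintegral_derive0_bound _ _ _ C d _ ii (bound _ sinb).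
  have -> : \int[mu]_x (f' x * sin (x * xi) + f x * (xi * cos (x * xi))) =
      \int[mu]_x (f' x * sin (x * xi)) + xi * \int[mu]_x (f x * cos (x * xi)).
    rewrite -RintegralZl// -RintegralD//; last exact: (integrableZl measurableT xi ic).
    by apply: eq_Rintegral => x _; ring.
  move=> h; apply/eqP; rewrite -subr_eq0 opprK; apply/eqP; apply: h.
  move=> x; apply: cvgD; first by apply: cMul => //; exact: continuous_sinM.
  apply: (cMul f (fun x => xi * cos (x * xi))) => //.
  by apply: cMul; [move=> y; exact: cvg_cst|exact: continuous_cosM].
have P g : Re (cintegral (fun x => (g x)%:C * expi (- (x * xi)))) = \int[mu]_x (g x * cos (x * xi)).
  rewrite Re_cintegral; apply: eq_Rintegral => x _.
  by rewrite ReM ReC ImC mul0r subr0 /= cosN.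
have Q g : Lint (fun x => g x * sin (x * xi)) ->
    Im (cintegral (fun x => (g x)%:C * expi (- (x * xi)))) = - \int[mu]_x (g x * sin (x * xi)).
  move=> gi; rewrite Im_cintegral -mulN1r -RintegralZl//; apply: eq_Rintegral => x _.
  by rewrite ImM ReC ImC mul0r addr0 /= sinN mulN1r mulrN.
apply: complex_eqP.
  by rewrite ReM !P Q// mul0r sub0r mulrN opprK E1.
by rewrite ImM Q// !P mul0r add0r E2 opprK.
Qed.

Lemma is_derive_supp (f f' : R -> R) (M : R) : (forall x : R, is_derive x 1 f (f' x)) ->
  (forall x, M < `|x| -> f x = 0) -> forall x, M < `|x| -> f' x = 0.
Proof.
move=> df fM x Mx; have <- : derive1 f x = f' x by rewrite (derive1_is df).
rewrite derive1E (@near_eq_derive _ _ _ f (cst 0)) ?derive_cst//.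
near=> y; apply: fM; near: y.
have /cvgrPdist_lt h : `|y| @[y --> x] --> `|x| by exact: cvg_norm.
have Mx0 : 0 < `|x| - M by rewrite subr_gt0.
near=> y; have : `| `|x| - `|y| | < `|x| - M by near: y; exact: h.
by move=> /(le_lt_trans (ler_norm _)); rewrite ltrD2l ltrN2.
Unshelve. all: by end_near. Qed.

Lemma test_derive1 f : test_fun f -> test_fun (derive1 f).
Proof.
move=> [sf [M fM]]; split; first exact: smooth_derive1.
by exists M; exact: (is_derive_supp (smooth_is_derive sf) fM).
Qed.

Lemma test_derive1n n f : test_fun f -> test_fun (derive1n n f).
Proof. by elim: n => [|n IH] // tf; rewrite derive1nS; exact/test_derive1/IH. Qed.

Lemma supp_bounded f (M : R) : continuous f -> (forall x, M < `|x| -> f x = 0) ->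
  exists C, forall x, `|f x| <= C.
Proof.
move=> cf fM; have [M0|M0] := ltP M 0.
  by exists 0 => x; rewrite fM ?normr0// (lt_le_trans M0).
have ab : - M <= M by rewrite (le_trans _ M0)// oppr_le0.
have cn : continuous (fun x => `|f x|) by move=> x; apply: cvg_norm; exact: cf.
have [c _ hc] := EVT_max ab (continuous_subspaceT cn).
exists `|f c| => x; have [xM|/fM ->] := leP `|x| M; last by rewrite normr0.
by apply: hc; rewrite in_itv /= -ler_norml.
Qed.

Lemma test_schwartz f : test_fun f -> schwartz f.
Proof.
move=> tf; split; first by case: tf.
move=> k n; have [sf [M fM]] := test_derive1n n tf.
apply: (@supp_bounded (fun x => x ^+ k * derive1n n f x) M).
  move=> x; apply: cvgM; last exact: (smooth_continuous sf).
  exact: exprn_continuous.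
by move=> x /fM ->; rewrite mulr0.
Qed.

Lemma schwartz_derive1 f : schwartz f -> schwartz (derive1 f).
Proof.
move=> [sf fC]; split; first exact: smooth_derive1.
by move=> k n; have [C hC] := fC k n.+1; exists C => x; have := hC x; rewrite derive1Sn.
Qed.

Lemma schwartz_bound f : schwartz f -> exists C, forall x, `|f x| <= C / oneDsqr x.
Proof.
move=> [_ fC]; have [C0 h0] := fC 0%N 0%N; have [C2 h2] := fC 2%N 0%N.
exists (C0 + C2) => x; rewrite ler_pdivlMr; last first.
  by rewrite (lt_le_trans ltr01)// oneDsqr_ge1.
rewrite mulrDr mulr1; apply: lerD; first by have := h0 x; rewrite expr0 mul1r.
have := h2 x; rewrite normrM => /(le_trans _); apply.
by rewrite mulrC normrX real_normK ?num_real.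
Qed.

Lemma schwartz_integrable f : schwartz f -> Lint f.
Proof.
move=> sf; have [C hC] := schwartz_bound sf.
apply: (integrable_le _ (integrableZl measurableT C (@integrable_cauchy R))).
  by apply: smooth_measurable; case: sf.
by move=> x; exact: hC.
Qed.

Lemma schwartz_bounded f : schwartz f -> exists C, forall x, `|f x| <= C.
Proof.
move=> [_ fC]; have [C hC] := fC 0%N 0%N; exists C => x.
by have := hC x; rewrite expr0 mul1r.
Qed.

Lemma schwartz_Fh_derive1 f xi : schwartz f ->
  Fh (fun x => (derive1 f x)%:C) xi = Complex 0 xi * Fh (fun x => (f x)%:C) xi.
Proof.
move=> sf; have [s fC] := sf; have [C hC] := fC 1%N 0%N.
apply: (Fh_derive (C := C)).
- exact: smooth_is_derive.
- exact/smooth_continuous/smooth_derive1.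
- exact: schwartz_integrable.
- exact/schwartz_integrable/schwartz_derive1.
- by move=> x; have := hC x; rewrite normrM expr1.
Qed.

Lemma schwartz_Fh_decay f : schwartz f ->
  exists C, forall xi, normc (Fh (fun x => (f x)%:C) xi) <= C / oneDsqr xi.
Proof.
move=> sf; have s2 := schwartz_derive1 (schwartz_derive1 sf).
exists (kap * \int[mu]_x `|f x| + kap * \int[mu]_x `|derive1 (derive1 f) x|) => xi.
rewrite ler_pdivlMr; last by rewrite (lt_le_trans ltr01)// oneDsqr_ge1.
have B g : schwartz g -> normc (Fh (fun x => (g x)%:C) xi) <= kap * \int[mu]_x `|g x|.
  move=> sg; rewrite FhE; have := Fi_bound (- xi) (cintegrableC (schwartz_integrable sg)).
  by move=> /le_trans; apply; under eq_Rintegral do rewrite normcC.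
rewrite mulrDr mulr1; apply: lerD; first exact: B.
have := B _ s2; rewrite schwartz_Fh_derive1; last exact: schwartz_derive1.
rewrite schwartz_Fh_derive1// mulrA Normc.normcM => h; apply: le_trans h.
rewrite mulrC ler_wpM2r ?normc_ge0//.
rewrite Normc.normcM /= expr0n /= add0r sqrtr_sqr -expr2 real_normK ?num_real//.
Qed.

Lemma schwartz_Fh_integrable f : schwartz f -> cintegrable (Fh (fun x => (f x)%:C)).
Proof.
move=> sf; have [C hC] := schwartz_Fh_decay sf.
apply: (cintegrable_le _ (integrableZl measurableT C (@integrable_cauchy R))); last exact: hC.
have mf : cmeas (fun x => (f x)%:C).
  by apply: cmeasC; exact: integrable_meas (schwartz_integrable sf).
have := cmeas_comp (cmeas_Fi mf) (@oppr_measurable R setT).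
by congr cmeas; apply/funext => x; rewrite FhE.
Qed.

Lemma FiE_Fh g x : Fi g x = Fh g (- x).
Proof. by rewrite FhE opprK. Qed.

Lemma schwartz_Fi_integrable f : schwartz f -> cintegrable (Fi (fun x => (f x)%:C)).
Proof.
move=> /schwartz_Fh_integrable /(cintegrable_refl 0); congr cintegrable.
by apply/funext => x; rewrite FiE_Fh sub0r.
Qed.

Lemma schwartz_Fh_Fi f x : schwartz f -> Fh (Fi (fun x => (f x)%:C)) x = (f x)%:C.
Proof.
move=> sf; have [C hC] := schwartz_bounded sf.
apply: (@Fh_Fi _ (fun x => (f x)%:C) C).
- exact/cintegrableC/schwartz_integrable.
- split => //=; last by move=> y; exact: cvg_cst.
  by apply: smooth_continuous; case: sf.
- by move=> y; rewrite normcC.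
- exact: schwartz_Fi_integrable.
Qed.

Lemma Fi_refl g x : cmeas g -> Fi (fun y => g (- y)) x = Fh g x.
Proof.
move=> mg; rewrite FiE /fourier_int; congr (_ * _).
rewrite -(cintegral_refl 0); last first.
  apply: cmeasM; last by apply: cmeas_expi; exact: measurable_funM.
  exact: (cmeas_comp mg (@oppr_measurable R setT)).
by apply: eq_cintegral => y; rewrite sub0r opprK mulrN mulrC (mulrC x y) mulrC.
Qed.

Lemma schwartz_Fi_Fh f x : schwartz f -> Fi (Fh (fun x => (f x)%:C)) x = (f x)%:C.
Proof.
move=> sf; rewrite -schwartz_Fh_Fi// -[RHS]Fi_refl; last first.
  exact: cintegrable_meas (schwartz_Fi_integrable sf).
by congr (Fi _ x); apply/funext => y; rewrite FhE.
Qed.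

Definition herm (g : R -> R[i]) := forall x, g (- x) = conjc (g x).

Lemma Fi_herm g x : cintegrable g -> herm g -> Fi g x = (Re (Fi g x))%:C.
Proof.
move=> gi hg; suff h : conjc (Fi g x) = Fi g x.
  apply: complex_eqP => //=; have := congr1 (fun z => Im z) h; rewrite ImJ => /eqP.
  rewrite eq_sym -subr_eq0 opprK -mulr2n mulrn_eq0 /= => /eqP.
  by [].
rewrite !FiE conjcM conjcC; congr (_ * _).
rewrite -cintegralJ; last exact: cintegrable_expi.
rewrite -(cintegral_refl 0); last first.
  by apply/cmeasJ/cintegrable_meas; exact: cintegrable_expi.
apply: eq_cintegral => y; rewrite sub0r conjcM hg.
have -> : conjc (conjc (g y)) = g y by apply: complex_eqP; rewrite !reimE ?opprK.
by rewrite mulrN expiN; congr (_ * _); apply: complex_eqP; rewrite !reimE ?opprK.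
Qed.

Definition Fr (g : R -> R[i]) (x : R) : R := Re (Fi g x).

Lemma measurable_Fr g : cmeas g -> mfunT (Fr g).
Proof. by move=> mg; case: (cmeas_Fi mg). Qed.

Lemma Fr_bound g x : cintegrable g -> `|Fr g x| <= kap * \int[mu]_xi normc (g xi).
Proof. by move=> gi; apply: le_trans (Re_le_normc _) (Fi_bound x gi). Qed.

Lemma Fr_locint g : cintegrable g -> locally_integrable setT (Fr g).
Proof.
move=> gi; apply: (@bounded_locally_integrable _ _ (kap * \int[mu]_xi normc (g xi))).
  by apply: measurable_Fr; exact: cintegrable_meas.
by move=> x; exact: Fr_bound.
Qed.

Lemma is_fourier_ae f g : locally_integrable setT f -> cintegrable g -> herm g ->
  {ae mu, forall x, f x = Fr g x} -> is_fourier f g.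
Proof.
move=> lf gi hg fg; split=> // phi sphi /=.
have iphi := schwartz_Fh_integrable sphi.
have mf : mfunT f by case: lf.
have E : {ae mu, forall x, (f x)%:C * Fh (fun x => (phi x)%:C) x =
     Fi g x * Fh (fun x => (phi x)%:C) x}.
  by apply: aeS fg => x ->; rewrite [Fi g x]Fi_herm.
have i1 : cintegrable (fun x => Fi g x * Fh (fun x => (phi x)%:C) x).
  apply: (@cintegrableMl _ _ _ (kap * \int[mu]_xi normc (g xi))) => //.
    exact/cmeas_Fi/cintegrable_meas.
  by move=> x; exact: Fi_bound.
have [C hC] := schwartz_bounded sphi.
have mphi : cmeas (fun x => (phi x)%:C).
  by apply: cmeasC; exact: integrable_meas (schwartz_integrable sphi).
split.
- apply/cintegrableP; split.
    by apply: cmeasM; [exact: cmeasC|exact: cintegrable_meas].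
  by rewrite (ae_L1n E) cintegrable_L1n.
- by apply: (@cintegrableMr _ _ _ C) => // x; rewrite normcC.
- rewrite (ae_cintegral E) Fi_pairing//; apply: eq_cintegral => x.
  by rewrite schwartz_Fi_Fh.
Qed.

Lemma is_fourier_Fr g : cintegrable g -> herm g -> is_fourier (Fr g) g.
Proof.
by move=> gi hg; apply: is_fourier_ae => //; [exact: Fr_locint|exact: aeW].
Qed.

End Schwartz.

Lemma aeI d (T : measurableType d) (R : realType) (mu : {measure set T -> \bar R})
  (P Q : T -> Prop) : {ae mu, forall x, P x} -> {ae mu, forall x, Q x} ->
  {ae mu, forall x, P x /\ Q x}.
Proof. by move=> p q; apply: filterS2 p q. Qed.

Section FourierUnique.
Context {R : realType}.
Local Notation mu := (@lebesgue_measure R).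
Local Notation Fi := (@inverse_fourier_int R).
Local Notation Fh := (@fourier_int R).
Local Notation kap := (@kap R).
Implicit Types (f phi : R -> R) (g : R -> R[i]).

Definition cutoff (M x : R) : R := plateau (- (M + 1)) (M + 1) 0 x.

Lemma cutoff1 (M x : R) : `|x| <= M -> cutoff M x = 1.
Proof.
rewrite ler_norml => /andP[x1 x2].
by rewrite /cutoff /plateau !sstep_ge1 ?mulr1// mul1r; lra.
Qed.
Lemma test_cutoff (M : R) : test_fun (cutoff M). Proof. exact: test_plateau. Qed.
Lemma cutoff_ge0 (M x : R) : 0 <= cutoff M x. Proof. exact: plateau_ge0. Qed.
Lemma is_fourier_cint f g phi : is_fourier f g -> schwartz phi ->
  cintegrable (fun xi => g xi * (phi xi)%:C).
Proof. by move=> [_ h] /h[]. Qed.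

Lemma cmeas_cvg d (T : measurableType d) (u : nat -> T -> R[i]) (f : T -> R[i]) :
  (forall n, cmeas (u n)) -> (forall x, ccvg (u ^~ x) (f x)) -> cmeas f.
Proof.
move=> mu_ uf; split.
  apply: (@measurable_fun_cvg _ _ _ setT (fun n x => Re (u n x))) => //.
    by move=> n; case: (mu_ n).
  by move=> x _; case: (uf x).
apply: (@measurable_fun_cvg _ _ _ setT (fun n x => Im (u n x))) => //.
  by move=> n; case: (mu_ n).
by move=> x _; case: (uf x).
Qed.

Lemma is_fourier_cmeas f g : is_fourier f g -> cmeas g.
Proof.
move=> fg; apply: (@cmeas_cvg _ _ (fun n x => g x * (cutoff n%:R x)%:C)).
  move=> n; apply: cintegrable_meas; apply: (is_fourier_cint fg).
  exact/test_schwartz/test_cutoff.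
have h (v : R[i] -> R) x : v (g x * (cutoff n%:R x)%:C) @[n --> \oo] --> v (g x).
  apply: cvg_near_cst; near=> n; rewrite cutoff1 ?mulr1//.
  by near: n; exact: nbhs_infty_ger.
by move=> x; split; exact: h.
Unshelve. all: by end_near. Qed.

Lemma is_fourier_locint f g : is_fourier f g ->
  locally_integrable setT (fun x => Re (g x)) /\ locally_integrable setT (fun x => Im (g x)).
Proof.
move=> fg; have [m1 m2] := is_fourier_cmeas fg.
have H (v : R[i] -> R) : (forall z, `|v z| <= normc z) ->
    mfunT (fun x => v (g x)) -> locally_integrable setT (fun x => v (g x)).
  move=> vz mv; split => //; first exact: openT.
  move=> K _ cK; have [M [_ KM]] := compact_bounded cK.
  have {}KM x : K x -> `|x| <= `|M| + 1.
    by move=> Kx; apply: KM => //; rewrite (le_lt_trans (ler_norm _))// ltrDl.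
  have := cintegrable_L1n (is_fourier_cint fg (test_schwartz (test_cutoff (`|M| + 1)))).
  apply: le_lt_trans; rewrite [leLHS]integral_mkcond.
  apply: ge0_le_integral_nomeas => x _; rewrite patchE; case: ifPn => //.
  - move=> /set_mem/KM Kx; rewrite lee_fin Normc.normcM normcC cutoff1//.
    by rewrite normr1 mulr1.
  - by rewrite lee_fin normc_ge0.
split; apply: H => //; [exact: Re_le_normc|exact: Im_le_normc].
Qed.

Lemma locally_integrableB f1 f2 : locally_integrable setT f1 ->
  locally_integrable setT f2 -> locally_integrable setT (fun x => f1 x - f2 x).
Proof.
move=> [m1 o h1] [m2 _ h2]; split => //; first exact: measurable_funB.
move=> K KT cK.
have := lte_add_pinfty (h1 K KT cK) (h2 K KT cK).
have mK := compact_measurable cK.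
rewrite -ge0_integralD//; last 2 first.
- by apply/measurable_EFinP; apply: measurableT_comp => //; exact: measurable_funTS.
- by apply/measurable_EFinP; apply: measurableT_comp => //; exact: measurable_funTS.
apply: le_lt_trans; apply: ge0_le_integral_nomeas => x _; first by rewrite lee_fin.
by rewrite -EFinD lee_fin ler_normB.
Qed.

Lemma c_ortho_eq0 g : locally_integrable setT (fun x => Re (g x)) ->
  locally_integrable setT (fun x => Im (g x)) ->
  (forall phi, test_fun phi -> cintegral (fun x => g x * (phi x)%:C) = 0) ->
  {ae mu, forall x, g x = 0}.
Proof.
move=> l1 l2 h.
have a1 : {ae mu, forall x, Re (g x) = 0}.
  apply: test_ortho_eq0 => // phi tp; have := congr1 (fun z => Re z) (h _ tp).
  rewrite Re_cintegral Re0 => <-; apply: eq_Rintegral => x _.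
  by rewrite ReM ReC ImC mulr0 subr0.
have a2 : {ae mu, forall x, Im (g x) = 0}.
  apply: test_ortho_eq0 => // phi tp; have := congr1 (fun z => Im z) (h _ tp).
  rewrite Im_cintegral Im0 => <-; apply: eq_Rintegral => x _.
  by rewrite ImM ReC ImC mulr0 add0r.
by apply: aeS (aeI a1 a2) => x [r i]; exact: complex_eqP.
Qed.

Lemma is_fourier_unique f g1 g2 : is_fourier f g1 -> is_fourier f g2 ->
  {ae mu, forall x, g1 x = g2 x}.
Proof.
move=> f1 f2; have [a1 b1] := is_fourier_locint f1; have [a2 b2] := is_fourier_locint f2.
suff : {ae mu, forall x, g1 x - g2 x = 0}.
  by apply: aeS => x /eqP; rewrite subr_eq0 => /eqP.
apply: c_ortho_eq0.
- by under eq_fun do rewrite ReB; exact: locally_integrableB.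
- by under eq_fun do rewrite ImB; exact: locally_integrableB.
- move=> phi /test_schwartz sp.
  have [_ /(_ phi sp)[_ i1 e1]] := f1; have [_ /(_ phi sp)[_ i2 e2]] := f2.
  under eq_fun do rewrite mulrBl.
  by rewrite cintegralB// -e1 -e2 subrr.
Qed.

Lemma cintegrable_locint g : cintegrable g ->
  locally_integrable setT (fun x => Re (g x)) /\ locally_integrable setT (fun x => Im (g x)).
Proof. by move=> [g1 g2]; split; exact: integrable_locally_integrable. Qed.

Lemma Fh_pairing (f g : R -> R[i]) : cintegrable f -> cintegrable g ->
  cintegral (fun x => Fh g x * f x) = cintegral (fun xi => g xi * Fh f xi).
Proof.
move=> fi gi; have mg := cintegrable_meas gi; have mf := cintegrable_meas fi.
have gi' := cintegrable_refl 0 gi; have fi' := cintegrable_refl 0 fi.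
have := Fi_pairing fi gi'.
have -> : cintegral (fun x => Fi (fun y => g (0 - y)) x * f x) =
          cintegral (fun x => Fh g x * f x).
  apply: eq_cintegral => x; rewrite -Fi_refl//; congr (Fi _ x * _).
  by apply/funext => y; rewrite sub0r.
move=> ->; rewrite -(cintegral_refl 0); last first.
  by apply: cmeasM; [exact: cintegrable_meas|exact: cmeas_Fi].
by apply: eq_cintegral => x; rewrite FhE !sub0r opprK.
Qed.

Lemma Fh_inj g : cintegrable g -> {ae mu, forall c, Fh g c = 0} ->
  {ae mu, forall x, g x = 0}.
Proof.
move=> gi g0; have [l1 l2] := cintegrable_locint gi.
apply: c_ortho_eq0 => // phi /test_schwartz sp.
have -> : cintegral (fun x => g x * (phi x)%:C) =
    cintegral (fun x => g x * Fh (Fi (fun x => (phi x)%:C)) x).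
  by apply: eq_cintegral => x; rewrite schwartz_Fh_Fi.
rewrite -Fh_pairing//; last exact: schwartz_Fi_integrable.
rewrite -[RHS](@cintegral0 R); apply: ae_cintegral.
by apply: aeS g0 => x ->; rewrite mul0r.
Qed.

Lemma schwartz_affine (a b : R) phi : a != 0 -> test_fun phi ->
  test_fun (fun x => phi (a * x + b)).
Proof.
move=> a0 [sp [M pM]]; split; first by apply: smooth_comp => //; exact: smooth_aff.
exists ((`|M| + `|b|) / `|a|) => x; rewrite ltr_pdivrMr ?normr_gt0// => h; apply: pM.
rewrite -normrM mulrC in h.
apply: le_lt_trans (ler_norm M) _.
have : `|a * x| <= `|a * x + b| + `|b| by rewrite -{1}(addrK b (a * x)) ler_normB.
by rewrite -(ltrD2r `|b|); exact: lt_le_trans.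
Qed.

Definition bump : R -> R := cutoff 1.

Lemma Rintegral_gt0 (f : R -> R) (a b : R) : a < b -> Lint f ->
  (forall x, 0 <= f x) -> (forall x, a < x < b -> 0 < f x) -> 0 < \int[mu]_x f x.
Proof.
move=> ab fi f0 fp; rewrite lt_neqAle Rintegral_ge0// andbT; apply/eqP => h.
have mf := integrable_meas fi.
have : (\int[mu]_x `|(f x)%:E| = 0)%E.
  under eq_integral do rewrite /= ger0_norm//.
  have := integrable_fin_num measurableT fi.
  by move: h; rewrite /Rintegral; case: (integral _ _ _) => //= r <-.
move=> /(ae_eq_integral_abs mu measurableT (proj2 (measurable_EFinP _ _) mf)).1.
move=> [N [mN N0 sN]].
suff : (mu `]a, b[ <= mu N)%E.
  rewrite [X in (_ <= X)%E]N0 lebesgue_measure_itv /= lte_fin ab -EFinB lee_fin.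
  by rewrite leNgt subr_gt0 ab.
apply: le_measure; rewrite ?inE//.
move=> x /=; rewrite in_itv /= => xab; apply: sN => /= /(_ I) [] h0.
by have := fp _ xab; rewrite h0 ltxx.
Qed.

Lemma Fh_bump_neq0 y : `|y| <= 1 / 2 -> Fh (fun x => (bump x)%:C) y != 0.
Proof.
move=> y1; have ib : Lint bump.
  exact/test_fun_integrable/test_cutoff.
suff : 0 < Re (Fh (fun x => (bump x)%:C) y).
  by apply: contraTneq => ->; rewrite ltxx.
rewrite /fourier_int ReM ReC ImC mul0r subr0 mulr_gt0 ?kap_gt0//.
rewrite Re_cintegral.
have ibc : Lint (fun x => bump x * cos (x * y)).
  apply: (integrableM_bounded (C := 1)) => //; last by move=> x; exact: cos_le.
  exact: continuous_measurable_fun (@continuous_cosM R y).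
have -> : \int[mu]_x Re ((bump x)%:C * expi (- (x * y))) = \int[mu]_x (bump x * cos (x * y)).
  by apply: eq_Rintegral => x _; rewrite ReM ReC ImC mul0r subr0 /= cosN.
have ph := @pihalf_ge1 R.
have cge0 x : `|x| <= 2 -> 0 <= cos (x * y).
  move=> x2; apply: cos_ge0_pihalf.
  rewrite -ler_norml normrM; apply: le_trans ph.
  by rewrite -[1](@divfK _ 2)// mulrC ler_pM// mul1r -div1r.
apply: (@Rintegral_gt0 _ (-1) 1) => //.
  move=> x; have [x2|x2] := leP `|x| 2.
    by rewrite mulr_ge0 ?cge0// cutoff_ge0.
  rewrite /bump /cutoff plateau_out ?mul0r// => /andP[h1 h2].
  by move: x2; rewrite ltNge ler_norml; lra.
move=> x x1; rewrite /bump cutoff1; last by rewrite ler_norml; lra.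
rewrite mul1r; apply: cos_gt0_pihalf.
have xy : `|x * y| < 1.
  rewrite normrM; apply: le_lt_trans (_ : 1 * (1 / 2) < 1); last by lra.
  by apply: ler_pM => //; rewrite ler_norml; lra.
by rewrite -ltr_norml (lt_le_trans xy).
Qed.

Lemma is_fourier_inv f g : is_fourier f g -> cintegrable g ->
  {ae mu, forall x, (f x)%:C = Fi g x}.
Proof.
move=> fg gi; have mf : mfunT f by case: fg => -[].
have mg := cintegrable_meas gi.
pose h x : R[i] := (f x)%:C - Fi g x.
have key n : {ae mu, forall x, h x * Fh (fun x => (bump x)%:C) (x / n.+1%:R) = 0}.
  have n0 : (n.+1%:R : R) != 0 by [].
  have np : 0 < (n.+1%:R : R) by [].
  pose phi c (x : R) := bump (n.+1%:R * x + - c).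
  have tphi c : test_fun (phi c) by apply: schwartz_affine => //; exact: test_cutoff.
  have mb : cmeas (fun x : R => (bump x)%:C).
    by apply: cmeasC; exact: integrable_meas (test_fun_integrable (test_cutoff 1)).
  have Fphi c x : Fh (fun x => (phi c x)%:C) x =
     (n.+1%:R^-1)%:C * expi (- (x / n.+1%:R * c)) * Fh (fun x => (bump x)%:C) (x / n.+1%:R).
    rewrite /fourier_int mulrCA; congr (_ * _).
    pose G (s : R) : R[i] := (bump s)%:C * expi (- ((s + c) / n.+1%:R * x)).
    have mG : cmeas G.
      apply: cmeasM => //; apply: cmeas_expi; apply: measurableT_comp => //.
      apply: measurable_funM => //; apply: measurable_funM => //.
      exact: measurable_funD.
    transitivity (cintegral (fun x => G (n.+1%:R * x + - c))).
      apply: eq_cintegral => s; rewrite /G /phi; congr (_ * expi (- (_ * _))).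
      by rewrite subrK mulrC mulKf.
    rewrite (cintegral_affine _ n0 mG) gtr0_norm// -[RHS]mulrA; congr (_ * _).
    rewrite -cintegralZ; last first.
      apply: (@cintegrableMr _ _ _ 1).
      - exact/cintegrableC/test_fun_integrable/test_cutoff.
      - by apply: cmeas_expi; apply: measurableT_comp => //; exact: measurable_funM.
      - by move=> s; rewrite normc_expi.
    apply: eq_cintegral => s; rewrite /G mulrCA -expiD; congr (_ * expi _).
    by field.
  have hc c : cintegrable (fun x => h x * Fh (fun x => (phi c x)%:C) x) /\
      cintegral (fun x => h x * Fh (fun x => (phi c x)%:C) x) = 0.
    have sp := test_schwartz (tphi c).
    have [_ /(_ _ sp)[i1 i2 e]] := fg.
    have ip := schwartz_Fh_integrable sp.
    have i3 : cintegrable (fun x => Fi g x * Fh (fun x => (phi c x)%:C) x).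
      apply: (cintegrableMl ip (cmeas_Fi mg)) => x; exact: Fi_bound.
    under eq_fun do rewrite mulrBl; split; first exact: cintegrableB.
    rewrite cintegralB// e Fi_pairing//; apply/eqP; rewrite subr_eq0; apply/eqP.
    by apply: eq_cintegral => x; rewrite schwartz_Fi_Fh.
  apply: Fh_inj.
    have [i0 _] := hc 0; have := cintegrableZ (n.+1%:R)%:C i0; congr cintegrable.
    apply/funext => x; rewrite Fphi mulr0 oppr0 expi0 mulr1 mulrCA.
    by congr (_ * _); rewrite mulrA -CM mulfV// mul1r.
  apply: aeW => c; rewrite /fourier_int; apply/eqP; rewrite mulf_eq0; apply/orP; right.
  have [i0 e0] := hc (n.+1%:R * c).
  have : (n.+1%:R)%:C * cintegral (fun x => h x * Fh (fun y => (phi (n.+1%:R * c) y)%:C) x) = 0.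
    by rewrite e0 mulr0.
  rewrite -cintegralZ// => <-; apply/eqP; apply: eq_cintegral => x.
  rewrite Fphi; have -> : x / n.+1%:R * (n.+1%:R * c) = x * c by rewrite mulrA divfK.
  have K (N Ni H E B : R[i]) : N * Ni = 1 -> H * B * E = N * (H * (Ni * E * B)).
    by move=> NNi; rewrite -[LHS]mul1r -NNi; ring.
  by apply: K; rewrite -CM mulfV.
have : {ae mu, forall x (n : nat), h x * Fh (fun x => (bump x)%:C) (x / n.+1%:R) = 0}.
  exact: ae_foralln.
apply: aeS => x hx.
have [n xn] : exists n : nat, `|x / n.+1%:R| <= 1 / 2.
  exists (Num.truncn (2 * `|x|)); rewrite normrM normfV normr_nat ler_pdivrMr//.
  rewrite mul1r ler_pdivlMl//; apply: ltW.
  have x0 : 0 <= 2 * `|x| by rewrite mulr_ge0.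
  by have /andP[] := truncn_itv x0.
have /eqP := hx n; rewrite mulf_eq0 (negbTE (Fh_bump_neq0 xn)) orbF.
by rewrite subr_eq0 => /eqP.
Qed.

Lemma is_fourier_inv_Fr f g : is_fourier f g -> cintegrable g ->
  {ae mu, forall x, f x = Fr g x}.
Proof.
move=> fg gi; apply: aeS (is_fourier_inv fg gi) => x /(congr1 (fun z => Re z)).
by rewrite ReC.
Qed.

Lemma is_fourier_herm f g : is_fourier f g -> {ae mu, forall x, g (- x) = conjc (g x)}.
Proof.
move=> fg; have mg := is_fourier_cmeas fg.
suff h : is_fourier f (fun x => conjc (g (- x))).
  apply: aeS (is_fourier_unique fg h) => x ->.
  by apply: complex_eqP; rewrite !reimE ?opprK.
split; first by case: fg.
move=> phi sp /=.
have sp' : schwartz (fun x => phi (- x)).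
  have [s sC] := sp; split.
    have -> : (fun x => phi (- x)) = (fun x => phi ((-1) * x + 0)).
      by apply/funext => x; rewrite mulN1r addr0.
    by apply: smooth_comp => //; exact: smooth_aff.
  have D n : derive1n n (fun x => phi (- x)) = fun x => (-1) ^+ n * derive1n n phi (- x).
    elim: n => [|n IH]; first by apply/funext => x; rewrite expr0 mul1r.
    rewrite derive1nS IH; apply: derive1_is => x.
    have dN : is_derive x 1 (fun x : R => - x) (-1) by exact: is_deriveNid.
    have := isdZ ((-1) ^+ n) (isd_comp (smooth_is_derive (@smooth_derive1n _ n _ s) (- x)) dN).
    by move=> dz; apply: (is_derive_eq dz); rewrite derive1nS exprS; ring.
  move=> k n; have [C hC] := sC k n; exists C => x.
  have := hC (- x); by rewrite D !normrM !normrX !normrN normr1 expr1n mul1r.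
have [_ /(_ _ sp')[i1 i2 e]] := fg.
have E x : Fh (fun x => (phi (- x))%:C) x = conjc (Fh (fun x => (phi x)%:C) x).
  have mp : cmeas (fun x => (phi x)%:C).
    by apply: cmeasC; exact: integrable_meas (schwartz_integrable sp).
  have ip := cintegrableC (schwartz_integrable sp).
  rewrite FhE (@Fi_refl _ (fun y => (phi y)%:C))// /fourier_int conjcM conjcC; congr (_ * _).
  rewrite -cintegralJ; last first.
    have := cintegrable_expi (- x) ip; congr cintegrable; apply/funext => y.
    by rewrite mulNr (mulrC x).
  by apply: eq_cintegral => y; rewrite conjcM conjcC -expiN mulrN opprK.
have Jx (z : R[i]) (r : R) : z * r%:C = conjc (conjc z * r%:C).
  by apply: complex_eqP; rewrite !reimE; ring.
split.
- have := cintegrableJ i1; congr cintegrable; apply/funext => x.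
  by rewrite E conjcM conjcC; congr (_ * _); apply: complex_eqP; rewrite !reimE ?opprK.
- have := cintegrable_refl 0 (cintegrableJ i2); congr cintegrable; apply/funext => x.
  by rewrite sub0r opprK conjcM conjcC.
- transitivity (conjc (cintegral (fun x => (f x)%:C * Fh (fun x => (phi (- x))%:C) x))).
    rewrite -cintegralJ//; apply: eq_cintegral => x.
    by rewrite E conjcM conjcC; congr (_ * _); apply: complex_eqP; rewrite !reimE ?opprK.
  rewrite e -cintegralJ// -(cintegral_refl 0); last exact: cintegrable_meas (cintegrableJ i2).
  by apply: eq_cintegral => x; rewrite sub0r opprK conjcM conjcC.
Qed.

Lemma fourier_spec f g : is_fourier f g ->
  is_fourier f (fourier f) /\ {ae mu, forall x, fourier f x = g x}.
Proof.
move=> fg; have h : is_fourier f (fourier f) by apply: (@xgetPex _ _ [set g | is_fourier f g]); exists g.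
by split => //; exact: is_fourier_unique h fg.
Qed.

Lemma wiener_normE (al : R) f g : is_fourier f g ->
  wiener_norm al f = (\int[mu]_xi ((1 + `|xi| `^ al) * normc (g xi))%:E)%E.
Proof.
move=> fg; rewrite /wiener_norm; case: asboolP => [_|]; last by case; exists g.
apply: ae_integral_indep; have [_ ae_] := fourier_spec fg.
by apply: aeS ae_ => x ->.
Qed.

Lemma wiener_norm0E f g : is_fourier f g -> wiener_norm0 f = L1n g.
Proof.
move=> fg; rewrite /wiener_norm0; case: asboolP => [_|]; last by case; exists g.
by apply: ae_L1n; have [] := fourier_spec fg.
Qed.

Lemma multiplierE m f g x : is_fourier f g ->
  multiplier m f x = Fr (fun xi => m xi * g xi) x.
Proof.
move=> fg; rewrite /multiplier /Fr; congr (Re (_ x)); apply: Fi_ae.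
by have [_] := fourier_spec fg; apply: aeS => y ->.
Qed.

End FourierUnique.

(** * The nonlinearity on the Fourier side *)

Section Bilinear.
Context {R : realType}.
Local Notation mu := (@lebesgue_measure R).
Local Notation Fi := (@inverse_fourier_int R).
Local Notation kap := (@kap R).
Implicit Types (p q u v g : R -> R[i]).

Lemma measurable_subr12 : mfunT (fun x : R * R => x.1 - x.2).
Proof. by apply: measurable_funB; [exact: measurable_fst|exact: measurable_snd]. Qed.

Implicit Types a b : R -> \bar R.

Definition econv a b (x : R) : \bar R := (\int[mu]_y (a (x - y)%R * b y))%E.

Lemma econv_ge0 a b : (forall x, 0 <= a x)%E -> (forall x, 0 <= b x)%E ->
  forall x, (0 <= econv a b x)%E.
Proof. by move=> a0 b0 x; apply: integral_ge0 => y _; exact: mule_ge0. Qed.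

Lemma measurable_econv12 a b : mfunT a -> mfunT b ->
  mfunT (fun z : R * R => (a (z.1 - z.2)%R * b z.2)%E).
Proof.
move=> ma mb; apply: emeasurable_funM; first exact: (measurableT_comp ma measurable_subr12).
exact: (measurableT_comp mb measurable_snd).
Qed.

Lemma measurable_econv_sec a b x : mfunT a -> mfunT b ->
  mfunT (fun y : R => (a (x - y)%R * b y)%E).
Proof.
move=> ma mb; apply: emeasurable_funM => //.
exact: (measurableT_comp ma (measurable_funB (measurable_cst x) (@measurable_id _ _ setT))).
Qed.

Lemma measurable_econv a b : mfunT a -> mfunT b ->
  (forall x, 0 <= a x)%E -> (forall x, 0 <= b x)%E -> mfunT (econv a b).
Proof.
move=> ma mb a0 b0; apply: (measurable_ge0_integral (measurable_econv12 ma mb)) => z.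
exact: mule_ge0.
Qed.

Lemma integral_econv a b : mfunT a -> mfunT b ->
  (forall x, 0 <= a x)%E -> (forall x, 0 <= b x)%E ->
  (\int[mu]_x econv a b x = (\int[mu]_x a x) * (\int[mu]_x b x))%E.
Proof.
move=> ma mb a0 b0; rewrite Tonelli; [|exact: measurable_econv12|by move=> x y; exact: mule_ge0].
under eq_integral => y _.
  rewrite ge0_integralZr//; last first.
    exact: (measurableT_comp ma (measurable_funB (@measurable_id _ _ setT) (measurable_cst y))).
  rewrite (ge0_integral_shift (- y) ma a0).
  over.
by rewrite ge0_integralZl//; exact: integral_ge0.
Qed.

Lemma le_normc_cintegral_m (f : R -> R[i]) : cmeas f ->
  ((normc (cintegral f))%:E <= L1n f)%E.
Proof.
move=> mf; have [h|h] := ltP (L1n f) +oo%E; last first.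
  by apply: le_trans h; exact: leey.
by apply: le_normc_cintegral; apply/cintegrableP.
Qed.

Definition wn (w : R -> R) (f : R -> R[i]) : \bar R :=
  (\int[mu]_x (w x * normc (f x))%:E)%E.

Definition n1 := wn (fun x => `|x|).
Definition n2 := wn (fun x => `|x| ^+ 2).

Lemma measurable_wn (w : R -> R) f : mfunT w -> cmeas f ->
  mfunT (fun x => (w x * normc (f x))%:E).
Proof. by move=> mw mf; apply/measurable_EFinP; apply: measurable_funM => //; exact: cmeas_norm. Qed.

Lemma wn_ge0 (w : R -> R) f : (forall x, 0 <= w x) -> (0 <= wn w f)%E.
Proof. by move=> w0; apply: integral_ge0 => x _; rewrite lee_fin mulr_ge0// normc_ge0. Qed.

Lemma n1_ge0 f : (0 <= n1 f)%E. Proof. exact: wn_ge0. Qed.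
Lemma n2_ge0 f : (0 <= n2 f)%E. Proof. by apply: wn_ge0 => x; exact: exprn_ge0. Qed.

Lemma wn1 f : wn (fun=> 1) f = L1n f.
Proof. by apply: eq_integral => x _; rewrite mul1r. Qed.

Lemma wnD (w1 w2 : R -> R) f : mfunT w1 -> mfunT w2 ->
  (forall x, 0 <= w1 x) -> (forall x, 0 <= w2 x) -> cmeas f ->
  wn (fun x => w1 x + w2 x) f = (wn w1 f + wn w2 f)%E.
Proof.
move=> m1 m2 w10 w20 mf; rewrite /wn -ge0_integralD//.
- by apply: eq_integral => x _; rewrite -EFinD mulrDl.
- by move=> x _; rewrite lee_fin mulr_ge0// normc_ge0.
- exact: measurable_wn.
- by move=> x _; rewrite lee_fin mulr_ge0// normc_ge0.
- exact: measurable_wn.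
Qed.

Lemma measurable_normr1 : mfunT (fun x : R => `|x|).
Proof. exact: normr_measurable. Qed.
Lemma measurable_normr2 : mfunT (fun x : R => `|x| ^+ 2).
Proof. by apply: measurable_funX; exact: measurable_normr1. Qed.

Section Weights.
Variable u : R -> R[i].
Hypothesis mgu : cmeas u.
Definition w0 (x : R) : \bar R := (normc (u x))%:E.
Definition w1 (x : R) : \bar R := (`|x| * normc (u x))%:E.
Definition w2 (x : R) : \bar R := (`|x| ^+ 2 * normc (u x))%:E.
Lemma measurable_w0 : mfunT w0.
Proof. by apply/measurable_EFinP; exact: cmeas_norm. Qed.
Lemma measurable_w1 : mfunT w1.
Proof. exact: measurable_wn measurable_normr1 mgu. Qed.
Lemma measurable_w2 : mfunT w2.
Proof. exact: measurable_wn measurable_normr2 mgu. Qed.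
Lemma w0_ge0 x : (0 <= w0 x)%E. Proof. by rewrite lee_fin normc_ge0. Qed.
Lemma w1_ge0 x : (0 <= w1 x)%E. Proof. by rewrite lee_fin mulr_ge0 ?normc_ge0. Qed.
Lemma w2_ge0 x : (0 <= w2 x)%E.
Proof. by rewrite lee_fin mulr_ge0 ?normc_ge0// exprn_ge0. Qed.
End Weights.

Lemma n1_sqr_le u : cmeas u -> (n1 u * n1 u <= L1n u * n2 u)%E.
Proof.
move=> mgu; have m0 := measurable_w0 mgu; have m1 := measurable_w1 mgu; have m2 := measurable_w2 mgu.
have p0 := w0_ge0 u; have p1 := w1_ge0 u; have p2 := w2_ge0 u.
have : (n1 u * n1 u + n1 u * n1 u <= L1n u * n2 u + n2 u * L1n u)%E.
  rewrite -(integral_econv m1 m1 p1 p1) -(integral_econv m0 m2 p0 p2) -(integral_econv m2 m0 p2 p0).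
  rewrite -!ge0_integralD//; try (by move=> x _; exact: econv_ge0); try exact: measurable_econv.
  apply: ge0_le_integral_nomeas => x _; first by rewrite adde_ge0// econv_ge0.
  rewrite /econv -!ge0_integralD//; try (by move=> y _; exact: mule_ge0);
    try exact: measurable_econv_sec.
  apply: ge0_le_integral_nomeas => y _; first by rewrite adde_ge0// mule_ge0.
  rewrite -!EFinM -!EFinD lee_fin.
  have := mulr_ge0 (normc_ge0 (u (x - y))) (normc_ge0 (u y)).
  have := sqr_ge0 (`|x - y| - `|y|); set c := `|x - y|; set b := `|y|.
  set A := normc (u (x - y)); set B := normc (u y) => AB ab.
  rewrite -subr_ge0.
  have -> : A * (b ^+ 2 * B) + c ^+ 2 * A * B - (c * A * (b * B) + c * A * (b * B)) =
     A * B * (c - b) ^+ 2 by ring.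
  exact: mulr_ge0.
by rewrite (muleC (n2 u)) -!mule2n -!mule_natl lee_pmul2l.
Qed.

Variable delta : R.

Definition ker (x y : R) : R := Num.sg (x - y) * y + delta * `|y|.

Definition Bil p q (x : R) : R[i] :=
  kap%:C * cintegral (fun y => (ker x y)%:C * (p (x - y) * q y)).

Definition C0 : R := kap * (1 + `|delta|).

Lemma C0E : C0 = (Num.sqrt (2 * pi))^-1 * (1 + `|delta|). Proof. by []. Qed.

Lemma C0_gt0 : 0 < C0.
Proof. by rewrite mulr_gt0 ?kap_gt0// ltr_pwDl. Qed.

Lemma ker_le x y : `|ker x y| <= (1 + `|delta|) * `|y|.
Proof.
rewrite mulrDl mul1r; apply: le_trans (ler_normD _ _) _; rewrite !normrM normr_id.
by rewrite lerD2r ler_piMl// normr_sg; case: eqP.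
Qed.

Lemma measurable_sg : mfunT (@Num.sg R).
Proof.
rewrite /Num.sg; apply: measurable_fun_ifT.
- exact: measurable_fun_eqr.
- exact: measurable_cst.
- apply: measurable_fun_ifT; [exact: measurable_fun_ltr|exact: measurable_cst|exact: measurable_cst].
Qed.

Lemma measurable_ker d (T : measurableType d) (f g : T -> R) :
  mfunT f -> mfunT g ->
  mfunT (fun z => ker (f z) (g z)).
Proof.
move=> mf mg; apply: measurable_funD.
  apply: measurable_funM => //; exact: (measurableT_comp measurable_sg (measurable_funB mf mg)).
by apply: measurable_funM => //; exact: (measurableT_comp measurable_normr1 mg).
Qed.

Lemma cmeas_Bil_int d (T : measurableType d) (p q : T -> R -> R[i]) (f : T -> R) :
  cmeas (fun z : T * R => p z.1 z.2) -> cmeas (fun z : T * R => q z.1 z.2) ->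
  mfunT f ->
  cmeas (fun z : T * R => (ker (f z.1) z.2)%:C * (p z.1 (f z.1 - z.2) * q z.1 z.2)).
Proof.
move=> mp mq mf.
have mf1 : mfunT (fun z : T * R => f z.1).
  exact: (measurableT_comp mf measurable_fst).
apply: cmeasM.
  apply: (@cmeasC _ _ _ (fun z : T * R => ker (f z.1) z.2)).
  exact: (measurable_ker mf1 measurable_snd).
apply: cmeasM => //.
apply: (cmeas_comp mp (measurable_fun_pair measurable_fst (measurable_funB mf1 measurable_snd))).
Qed.

Lemma cmeas_Bil2 (p q : R -> R -> R[i]) :
  cmeas (fun z : R * R => p z.1 z.2) -> cmeas (fun z : R * R => q z.1 z.2) ->
  cmeas (fun z : R * R => Bil (p z.1) (q z.1) z.2).
Proof.
move=> mp mq; apply: cmeasM; first exact: cmeas_cst.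
have lift (r : R -> R -> R[i]) : cmeas (fun z : R * R => r z.1 z.2) ->
    cmeas (fun z : (R * R) * R => r z.1.1 z.2).
  move=> mr; apply: (cmeas_comp mr (measurable_fun_pair _ measurable_snd)).
  exact: (measurableT_comp measurable_fst measurable_fst).
apply: (@cmeas_cintegral _ _ _ (fun z : (R * R) * R => (ker z.1.2 z.2)%:C * (p z.1.1 (z.1.2 - z.2) * q z.1.1 z.2))).
exact: (@cmeas_Bil_int _ _ (fun z : R * R => p z.1) (fun z => q z.1) snd (lift _ mp) (lift _ mq) measurable_snd).
Qed.

Lemma cmeas_Bil p q : cmeas p -> cmeas q -> cmeas (Bil p q).
Proof.
move=> mp mq; apply: cmeasM; first exact: cmeas_cst.
apply: (@cmeas_cintegral _ _ _ (fun z : R * R => (ker z.1 z.2)%:C * (p (z.1 - z.2) * q z.2))).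
by apply: (@cmeas_Bil_int _ _ (fun=> p) (fun=> q) id) => //; exact: cmeas_pair2.
Qed.

Lemma cmeas_Bil_sec p q x : cmeas p -> cmeas q ->
  cmeas (fun y => (ker x y)%:C * (p (x - y) * q y)).
Proof.
move=> mp mq.
apply: (@cmeasM _ _ _ (fun y => (ker x y)%:C)).
  apply: (@cmeasC _ _ _ (fun y => ker x y)).
  exact: (measurable_ker (measurable_cst x) (@measurable_id _ _ setT)).
apply: cmeasM => //; apply: (cmeas_comp mp).
exact: (measurable_funB (measurable_cst x) (@measurable_id _ _ setT)).
Qed.

Definition bilmaj p q : R -> \bar R := econv (w0 p) (w1 q).

Lemma bilmaj_ge0 p q x : (0 <= bilmaj p q x)%E.
Proof. by apply: econv_ge0 => y; rewrite ?w0_ge0 ?w1_ge0. Qed.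

Lemma integral_bilmaj p q : cmeas p -> cmeas q ->
  (\int[mu]_x bilmaj p q x = L1n p * n1 q)%E.
Proof.
move=> mp mq; apply: integral_econv; [exact: measurable_w0|exact: measurable_w1|exact: w0_ge0|exact: w1_ge0].
Qed.

Lemma measurable_bilmaj p q : cmeas p -> cmeas q -> mfunT (bilmaj p q).
Proof.
move=> mp mq; apply: measurable_econv; [exact: measurable_w0|exact: measurable_w1|exact: w0_ge0|exact: w1_ge0].
Qed.

Definition Bil_sec p q (x y : R) : R[i] := (ker x y)%:C * (p (x - y) * q y).

Lemma L1n_Bil_sec p q x : cmeas p -> cmeas q ->
  (L1n (Bil_sec p q x) <= (1 + `|delta|)%:E * bilmaj p q x)%E.
Proof.
move=> mp mq; rewrite -ge0_integralZl//; last 2 first.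
- by apply: measurable_econv_sec; [exact: measurable_w0|exact: measurable_w1].
- by move=> y _; rewrite mule_ge0// ?w0_ge0 ?w1_ge0.
apply: ge0_le_integral_nomeas => y _; first by rewrite lee_fin normc_ge0.
rewrite -!EFinM lee_fin !Normc.normcM normcC.
have -> : (1 + `|delta|) * (normc (p (x - y)) * (`|y| * normc (q y))) =
  ((1 + `|delta|) * `|y|) * (normc (p (x - y)) * normc (q y)) by ring.
by rewrite ler_wpM2r ?ker_le// mulr_ge0 ?normc_ge0.
Qed.

Lemma Bil_le p q x : cmeas p -> cmeas q ->
  ((normc (Bil p q x))%:E <= C0%:E * bilmaj p q x)%E.
Proof.
move=> mp mq; rewrite /Bil Normc.normcM normcC gtr0_norm ?kap_gt0// /C0 !EFinM -muleA.
apply: lee_pmul => //; rewrite ?lee_fin ?normc_ge0 ?(ltW kap_gt0)//.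
apply: le_trans (L1n_Bil_sec x mp mq).
by apply: le_normc_cintegral_m; exact: cmeas_Bil_sec.
Qed.

Lemma L1n_Bil p q : cmeas p -> cmeas q ->
  (L1n (Bil p q) <= C0%:E * (L1n p * n1 q))%E.
Proof.
move=> mp mq; rewrite -integral_bilmaj// -ge0_integralZl//; last 3 first.
- exact: measurable_bilmaj.
- by move=> x _; exact: bilmaj_ge0.
- by rewrite lee_fin (ltW C0_gt0).
apply: ge0_le_integral_nomeas => x _; first by rewrite lee_fin normc_ge0.
exact: Bil_le.
Qed.

Definition A1n := wn (fun x => 1 + `|x|).
Definition D1n := wn (fun x => `|x| * (1 + `|x|)).

Lemma A1nE f : cmeas f -> A1n f = (L1n f + n1 f)%E.
Proof. by move=> mf; rewrite /A1n wnD ?wn1//; exact: measurable_normr1. Qed.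

Lemma D1nE f : cmeas f -> D1n f = (n1 f + n2 f)%E.
Proof.
move=> mf; rewrite /n1 /n2 -wnD//.
- by apply: eq_integral => x _; rewrite mulrDr mulr1 expr2.
- exact: measurable_normr2.
Qed.

Lemma A1n_Bil u : cmeas u -> (A1n (Bil u u) <= (2 * C0)%:E * (L1n u * D1n u))%E.
Proof.
move=> mgu; have m0 := measurable_w0 mgu; have m1 := measurable_w1 mgu; have m2 := measurable_w2 mgu.
have p0 := w0_ge0 u; have p1 := w1_ge0 u; have p2 := w2_ge0 u.
set cv := fun x => (econv (w0 u) (w1 u) x + (econv (w0 u) (w2 u) x + econv (w1 u) (w1 u) x))%E.
have pt x : (((1 + `|x|) * normc (Bil u u x))%:E <= C0%:E * cv x)%E.
  rewrite EFinM; apply: le_trans (lee_wpmul2l _ (Bil_le x mgu mgu)) _.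
    by rewrite lee_fin addr_ge0.
  rewrite muleCA; apply: lee_wpmul2l; first by rewrite lee_fin (ltW C0_gt0).
  rewrite /bilmaj /cv /econv -ge0_integralZl//; last 2 first.
  - exact: measurable_econv_sec.
  - by move=> y _; exact: mule_ge0.
  rewrite -ge0_integralD//; try (by move=> y _; exact: mule_ge0); try exact: measurable_econv_sec.
  rewrite -ge0_integralD//; try (by move=> y _; rewrite ?adde_ge0 ?mule_ge0);
    try exact: measurable_econv_sec;
    last by apply: emeasurable_funD; exact: measurable_econv_sec.
  apply: ge0_le_integral_nomeas => y _; first by rewrite !mule_ge0// lee_fin addr_ge0.
  rewrite -!EFinM -!EFinD lee_fin.
  have xy : `|x| <= `|x - y| + `|y| by rewrite -{1}(subrK y x) ler_normD.
  have AB := mulr_ge0 (normc_ge0 (u (x - y))) (normc_ge0 (u y)).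
  have := mulr_ge0 (normr_ge0 y) AB.
  move: xy AB; set A := normc (u (x - y)); set B := normc (u y).
  set a := `|x|; set b := `|y|; set c := `|x - y| => xy AB yAB.
  have -> : A * (b * B) + (A * (b ^+ 2 * B) + c * A * (b * B)) = (1 + (c + b)) * (b * (A * B)) by ring.
  have -> : (1 + a) * (A * (b * B)) = (1 + a) * (b * (A * B)) by ring.
  by rewrite ler_wpM2r// lerD2l.
have i01 := measurable_econv m0 m1 p0 p1; have i02 := measurable_econv m0 m2 p0 p2.
have i11 := measurable_econv m1 m1 p1 p1.
have c01 := econv_ge0 p0 p1; have c02 := econv_ge0 p0 p2; have c11 := econv_ge0 p1 p1.
apply: (@le_trans _ _ (\int[mu]_x (C0%:E * cv x))%E).
  apply: ge0_le_integral_nomeas => x _; last exact: pt.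
  by rewrite lee_fin mulr_ge0 ?normc_ge0// addr_ge0.
rewrite ge0_integralZl//; last 3 first.
- by apply: emeasurable_funD => //; exact: emeasurable_funD.
- by move=> x _; exact: (adde_ge0 (c01 x) (adde_ge0 (c02 x) (c11 x))).
- by rewrite lee_fin (ltW C0_gt0).
rewrite ge0_integralD//; [|by move=> x _; rewrite adde_ge0|exact: emeasurable_funD].
rewrite ge0_integralD// !integral_econv//.
rewrite -/(L1n u) -[(\int[mu]_x w1 u x)%E]/(n1 u) -[(\int[mu]_x w2 u x)%E]/(n2 u).
rewrite (_ : (2 * C0)%:E = (C0%:E * 2%:E)%E); last by rewrite -EFinM mulrC.
rewrite -muleA; apply: lee_wpmul2l; first by rewrite lee_fin (ltW C0_gt0).
rewrite D1nE//; apply: (@le_trans _ _ (L1n u * n1 u + (L1n u * n2 u + L1n u * n2 u)))%E.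
  by rewrite leeD2l// leeD2l// n1_sqr_le.
have key (l a b : \bar R) : (0 <= l)%E -> (0 <= a)%E -> (0 <= b)%E ->
    (l * a + (l * b + l * b) <= 2%:E * (l * (a + b)))%E.
  move=> l0 a0 b0; rewrite -[2%:E]/(2%:R%:E) mule_natl mule2n ge0_muleDr// addeACA.
  by rewrite leeD2r// leeDl// mule_ge0.
by apply: key; rewrite ?L1n_ge0 ?n1_ge0 ?n2_ge0.
Qed.

Lemma cintegrable_Bil_sec p q x : cmeas p -> cmeas q -> (bilmaj p q x < +oo)%E ->
  cintegrable (Bil_sec p q x).
Proof.
move=> mp mq fx; apply/cintegrableP; split; first exact: cmeas_Bil_sec.
apply: le_lt_trans (L1n_Bil_sec x mp mq) _.
by apply: lte_mul_pinfty => //; rewrite lee_fin addr_ge0.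
Qed.

Lemma bilmaj_fin_ae p q : cmeas p -> cmeas q -> (L1n p < +oo)%E -> (n1 q < +oo)%E ->
  {ae mu, forall x, (bilmaj p q x < +oo)%E}.
Proof.
move=> mp mq fp fq.
have i : mu.-integrable setT (bilmaj p q).
  apply/integrableP; split; first exact: measurable_bilmaj.
  rewrite (@eq_integral _ _ _ mu setT (bilmaj p q)); last by move=> x _; rewrite gee0_abs// bilmaj_ge0.
  by rewrite integral_bilmaj// lte_mul_pinfty ?L1n_ge0// ge0_fin_numE ?L1n_ge0.
apply: aeS (integrable_ae measurableT i) => x /(_ I); rewrite ge0_fin_numE ?bilmaj_ge0//.
Qed.

Lemma Bil_sub_le (s t : R) u v x : 0 <= s -> cmeas u -> cmeas v ->
  (bilmaj u u x < +oo)%E -> (bilmaj v v x < +oo)%E ->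
  ((normc (s%:C * Bil u u x - t%:C * Bil v v x))%:E <=
   C0%:E * (bilmaj (fun y => s%:C * u y - t%:C * v y)%R v x +
            s%:E * bilmaj u (fun y => u y - v y)%R x))%E.
Proof.
move=> s0 mgu mv fu fv; have iu := cintegrable_Bil_sec mgu mgu fu; have iv := cintegrable_Bil_sec mv mv fv.
have -> : s%:C * Bil u u x - t%:C * Bil v v x =
    kap%:C * cintegral (fun y => s%:C * Bil_sec u u x y - t%:C * Bil_sec v v x y).
  rewrite cintegralB ?cintegralZ//; try exact: cintegrableZ.
  by rewrite /Bil -!/(Bil_sec _ _ _) mulrBr !(mulrCA kap%:C).
rewrite Normc.normcM normcC gtr0_norm ?kap_gt0// /C0 !EFinM -muleA.
apply: lee_pmul => //; rewrite ?lee_fin ?normc_ge0 ?(ltW kap_gt0)//.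
have md : cmeas (fun y => s%:C * u y - t%:C * v y).
  by apply: cmeasB; apply: cmeasM => //; exact: cmeas_cst.
have mb : cmeas (fun y => u y - v y) by exact: cmeasB.
apply: le_trans (le_normc_cintegral_m _) _.
  by apply: cmeasB; apply: cmeasM; try exact: cmeas_cst; exact: cmeas_Bil_sec.
have mj1 := measurable_econv_sec x (measurable_w0 md) (measurable_w1 mv).
have mj2 := measurable_econv_sec x (measurable_w0 mgu) (measurable_w1 mb).
rewrite /bilmaj /econv -ge0_integralZl//; last by move=> y _; rewrite mule_ge0// ?w0_ge0 ?w1_ge0.
rewrite -ge0_integralD//; last 3 first.
- by move=> y _; rewrite mule_ge0// ?w0_ge0 ?w1_ge0.
- by move=> y _; rewrite !mule_ge0// ?w0_ge0 ?w1_ge0.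
- by apply: emeasurable_funM.
rewrite -ge0_integralZl//; last 2 first.
- by apply: emeasurable_funD => //; apply: emeasurable_funM.
- by move=> y _; rewrite adde_ge0// !mule_ge0// ?w0_ge0 ?w1_ge0.
apply: ge0_le_integral_nomeas => y _; first by rewrite lee_fin normc_ge0.
have -> : s%:C * Bil_sec u u x y - t%:C * Bil_sec v v x y = (ker x y)%:C *
   ((s%:C * u (x - y) - t%:C * v (x - y)) * v y + s%:C * (u (x - y) * (u y - v y))).
  by rewrite /Bil_sec; ring.
rewrite Normc.normcM normcC.
have -> : ((1 + `|delta|)%:E * (w0 (fun y => s%:C * u y - t%:C * v y)%R (x - y)%R * w1 v y +
    s%:E * (w0 u (x - y)%R * w1 (fun y => u y - v y)%R y)))%E =
  ((1 + `|delta|) * (normc (s%:C * u (x - y) - t%:C * v (x - y)) * (`|y| * normc (v y)) +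
    s * (normc (u (x - y)) * (`|y| * normc (u y - v y)))))%:E by [].
rewrite lee_fin.
set A := normc (s%:C * u _ - _); set B := normc (v y); set D := normc (u (x - y)); set E := normc (u y - _).
have h : normc ((s%:C * u (x - y) - t%:C * v (x - y)) * v y + s%:C * (u (x - y) * (u y - v y))) <=
    A * B + s * (D * E).
  by apply: le_trans (le_normcD _ _) _; rewrite !Normc.normcM normcC (ger0_norm s0).
apply: le_trans (ler_pM _ _ (ker_le x y) h) _ => //; first exact: normc_ge0.
by rewrite le_eqVlt; apply/orP; left; apply/eqP; ring.
Qed.

Lemma L1n_Bil_sub (s t : R) u v : 0 <= s -> cmeas u -> cmeas v ->
  (L1n u < +oo)%E -> (n1 u < +oo)%E -> (L1n v < +oo)%E -> (n1 v < +oo)%E ->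
  (L1n (fun x => s%:C * Bil u u x - t%:C * Bil v v x)%R <=
   C0%:E * (L1n (fun y => s%:C * u y - t%:C * v y)%R * n1 v +
            s%:E * (L1n u * n1 (fun y => u y - v y)%R)))%E.
Proof.
move=> s0 mgu mv u0 u1 v0 v1.
have md : cmeas (fun y => s%:C * u y - t%:C * v y).
  by apply: cmeasB; apply: cmeasM => //; exact: cmeas_cst.
have mb : cmeas (fun y => u y - v y) by exact: cmeasB.
have mj1 := measurable_bilmaj md mv; have mj2 := measurable_bilmaj mgu mb.
rewrite -!integral_bilmaj// -ge0_integralZl//; last by move=> x _; exact: bilmaj_ge0.
rewrite -ge0_integralD//; last 3 first.
- by move=> y _; exact: bilmaj_ge0.
- by move=> y _; rewrite mule_ge0// bilmaj_ge0.
- by apply: emeasurable_funM.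
rewrite -ge0_integralZl//; last 3 first.
- by apply: emeasurable_funD => //; apply: emeasurable_funM.
- by move=> y _; rewrite adde_ge0 ?mule_ge0// ?bilmaj_ge0.
- by rewrite lee_fin (ltW C0_gt0).
apply: ae_ge0_le_integral_nomeas; first by move=> x; rewrite lee_fin normc_ge0.
  by move=> x _; rewrite mule_ge0 ?lee_fin ?(ltW C0_gt0)// adde_ge0 ?mule_ge0 ?bilmaj_ge0.
apply: aeS (aeI (bilmaj_fin_ae mgu mgu u0 u1) (bilmaj_fin_ae mv mv v0 v1)) => x [fu fv] _.
exact: Bil_sub_le.
Qed.

End Bilinear.

Section LemmaW.
Context {R : realType}.
Local Notation mu := (@lebesgue_measure R).
Local Notation Fi := (@inverse_fourier_int R).
Local Notation Fh := (@fourier_int R).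
Local Notation kap := (@kap R).
Implicit Types (p q u v g : R -> R[i]).

Lemma FrE g x : Fr g x = kap * \int[mu]_y (Re (g y) * cos (x * y) - Im (g y) * sin (x * y)).
Proof.
rewrite /Fr FiE ReM ReC ImC mul0r subr0 Re_cintegral; congr (_ * _).
by apply: eq_Rintegral => y _; rewrite ReM.
Qed.

Lemma integrable_Fr_int g x : cintegrable g ->
  Lint (fun y => Re (g y) * cos (x * y) - Im (g y) * sin (x * y)).
Proof.
move=> /(cintegrable_expi x) [h _]; apply: eq_integrable h => // y _.
by rewrite /= ReM.
Qed.

Lemma continuous_Fr g : cintegrable g -> continuous (Fr g).
Proof.
move=> gi x; rewrite (_ : Fr g = fun x => kap * \int[mu]_y (Re (g y) * cos (x * y) - Im (g y) * sin (x * y))); last first.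
  by apply/funext => z; exact: FrE.
apply: cvgM; first exact: cvg_cst.
apply: (@continuity_under_integral R _ _ mu _ setT measurableT (x - 1) (x + 1) _ _
  (fun y => `|Re (g y)| + `|Im (g y)|)).
- by move=> z _; exact: integrable_Fr_int.
- apply: aeW => y _ z _; apply: cvgB; apply: cvgM; try exact: cvg_cst.
    exact: (@continuous_cosM R y).
  exact: (@continuous_sinM R y).
- case: gi => g1 g2; have := integrableD measurableT (integrable_norm g1) (integrable_norm g2).
  by congr (mu.-integrable _ _).
- move=> z _; apply: aeW => y _; apply: le_trans (ler_normB _ _) _; rewrite !normrM.
  by apply: lerD; apply: ler_piMr => //; [exact: cos_le|exact: sin_le].
- by rewrite inE /= in_itv /=; apply/andP; split; lra.
Qed.

Lemma normc_iM (y : R) (z : R[i]) : normc (Complex 0 y * z) = normc (y%:C * z).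
Proof. by rewrite !Normc.normcM normcC /= expr0n add0r sqrtr_sqr. Qed.

Lemma cmeas_id : cmeas (fun y : R => y%:C : R[i]).
Proof. exact: cmeasC (@measurable_id _ _ setT). Qed.

Lemma cmeas_i : cmeas (fun y : R => Complex 0 y : R[i]).
Proof. by apply: cmeas_Complex; [exact: measurable_cst|exact: measurable_id]. Qed.

Lemma cintegrable_iM g : cmeas g -> cintegrable (fun y => y%:C * g y) ->
  cintegrable (fun y => Complex 0 y * g y).
Proof.
move=> mg yi; apply: (cintegrable_lec _ yi); first by apply: cmeasM => //; exact: cmeas_i.
by move=> y; rewrite normc_iM.
Qed.

Lemma is_derive_Fr g (x : R) : cintegrable g -> cintegrable (fun y => y%:C * g y) ->
  is_derive x 1 (Fr g) (Fr (fun y => Complex 0 y * g y) x).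
Proof.
move=> gi yi.
pose f (x y : R) := Re (g y) * cos (x * y) - Im (g y) * sin (x * y).
pose f' (x y : R) := Re (Complex 0 y * g y) * cos (x * y) - Im (Complex 0 y * g y) * sin (x * y).
have df (y z : R) : is_derive z 1 (f ^~ y) (f' z y).
  have [_ [dc ds]] := is_derive_expcos 0 y z.
  have := isdD (isdZ (Re (g y)) dc) (isdZ (- Im (g y)) ds).
  rewrite /f /f' => d; rewrite (_ : (fun x0 => _) = (fun x0 => Re (g y) * cos (x0 * y) + - Im (g y) * sin (x0 * y))).
    by apply: (is_derive_eq d); rewrite ReM ImM /=; ring.
  by apply/funext => t; rewrite mulNr.
have pE z y : partial1of2 f z y = f' z y by rewrite /partial1of2 (derive1_is (df y)).
have bnd z y : `|partial1of2 f z y| <= normc (y%:C * g y) + normc (y%:C * g y).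
  rewrite pE /f'; apply: le_trans (ler_normB _ _) _; rewrite !normrM -normc_iM.
  apply: lerD; rewrite -[leRHS]mulr1; apply: ler_pM => //;
    [exact: Re_le_normc|exact: cos_le|exact: Im_le_normc|exact: sin_le].
have xI : `]x - 1, x + 1[%classic x by rewrite /= in_itv /=; apply/andP; split; lra.
have iG : Lint (fun y => normc (y%:C * g y) + normc (y%:C * g y)).
  have := integrableD measurableT (cintegrable_norm yi) (cintegrable_norm yi).
  by congr (mu.-integrable _ _).
have G0 y : 0 <= normc (y%:C * g y) + normc (y%:C * g y) by rewrite addr_ge0 ?normc_ge0.
have intf z : `]x - 1, x + 1[%classic z -> Lint (f z).
  by move=> _; exact: integrable_Fr_int.
have der z y : `]x - 1, x + 1[%classic z -> setT y -> derivable (f ^~ y) z 1.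
  by move=> _ _; case: (df y z).
have bnd' z y : `]x - 1, x + 1[%classic z -> setT y ->
  `|partial1of2 f z y| <= normc (y%:C * g y) + normc (y%:C * g y) by [].
have d1 := derivable_under_integral measurableT xI intf der G0 iG bnd'.
have d2 := differentiation_under_integral measurableT xI intf der G0 iG bnd'.
have d : is_derive x 1 (fun x => \int[mu]_y f x y) (\int[mu]_y f' x y).
  apply: DeriveDef => //; rewrite -derive1E d2.
  by apply: eq_Rintegral => y _; rewrite pE.
have := isdZ kap d; rewrite FrE (_ : (fun x0 => _) = Fr g)//.
by apply/funext => z; rewrite FrE.
Qed.

Lemma cintegrable_sg p : cintegrable p -> cintegrable (fun y => (Num.sg y)%:C * p y).
Proof.
move=> pi; apply: (cintegrable_lec _ pi).
  apply: cmeasM; [exact: cmeasC measurable_sg|exact: cintegrable_meas].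
move=> y; rewrite Normc.normcM normcC normr_sg.
by case: eqP => _; rewrite ?mul1r// mul0r normc_ge0.
Qed.

Lemma cintegrable_abs q : cmeas q -> cintegrable (fun y => y%:C * q y) ->
  cintegrable (fun y => `|y|%:C * q y).
Proof.
move=> mq qi; apply: (cintegrable_lec _ qi).
  by apply: cmeasM => //; exact: cmeasC measurable_normr1.
by move=> y; rewrite !Normc.normcM !normcC normr_id.
Qed.

Lemma n1_fin q : cmeas q -> cintegrable (fun y => y%:C * q y) -> (n1 q < +oo)%E.
Proof.
move=> mq /cintegrable_L1n; congr (_ < _)%E; apply: eq_integral => y _.
by rewrite Normc.normcM normcC.
Qed.

Lemma Fi_Bil delta p q x : cintegrable p -> cintegrable q -> cintegrable (fun y => y%:C * q y) ->
  Fi (Bil delta p q) x = Fi (fun y => (Num.sg y)%:C * p y) x * Fi (fun y => y%:C * q y) x +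
    delta%:C * (Fi p x * Fi (fun y => `|y|%:C * q y) x).
Proof.
move=> pi qi yi; have mp := cintegrable_meas pi; have mq := cintegrable_meas qi.
have si := cintegrable_sg pi; have ai := cintegrable_abs mq yi.
pose F (xi eta : R) := Bil_sec delta p q xi eta * expi (x * xi).
have mF : cmeas (fun z : R * R => F z.1 z.2).
  apply: cmeasM; last first.
    by apply: cmeas_expi; apply: measurable_funM => //; exact: measurable_fst.
  by apply: (@cmeas_Bil_int _ _ _ _ (fun=> p) (fun=> q) id) => //; exact: cmeas_pair2.
have finF : (\int[mu]_xi L1n (F xi) < +oo)%E.
  apply: (@le_lt_trans _ _ (\int[mu]_xi ((1 + `|delta|)%:E * bilmaj p q xi))%E).
    apply: ge0_le_integral_nomeas => xi _; first exact: L1n_ge0.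
    apply: le_trans (L1n_Bil_sec delta xi mp mq).
    apply: ge0_le_integral_nomeas => eta _; first by rewrite lee_fin normc_ge0.
    by rewrite lee_fin Normc.normcM normc_expi mulr1.
  rewrite ge0_integralZl//; last 2 first.
  - exact: measurable_bilmaj.
  - by move=> y _; exact: bilmaj_ge0.
  rewrite integral_bilmaj//; apply: lte_mul_pinfty => //.
  apply: lte_mul_pinfty; [exact: L1n_ge0| |exact: n1_fin].
  by rewrite ge0_fin_numE ?L1n_ge0//; exact: cintegrable_L1n.
rewrite [LHS]FiE.
have -> : cintegral (fun xi => Bil delta p q xi * expi (x * xi)) =
    kap%:C * cintegral (fun xi => cintegral (F xi)).
  rewrite -cintegralZ; last by have [] := L1n_cintegral_le mF finF.
  apply: ae_cintegral; apply: aeS (bilmaj_fin_ae mp mq (cintegrable_L1n pi) (n1_fin mq yi)) => xi fx.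
  by rewrite /Bil -mulrA; congr (_ * _); rewrite -cintegralZr//; exact: cintegrable_Bil_sec.
rewrite (cFubini mF finF).
set c1 := cintegral (fun z => (Num.sg z)%:C * p z * expi (x * z)).
set c2 := cintegral (fun z => p z * expi (x * z)).
have E eta : cintegral (fun xi => F xi eta) =
   (eta%:C * q eta * expi (x * eta)) * c1 + delta%:C * ((`|eta|%:C * q eta * expi (x * eta)) * c2).
  rewrite -(@cintegral_shift _ eta); last exact: (cmeas_comp mF (@pair2_measurable _ _ _ _ eta)).
  rewrite /c1 /c2 -cintegralZ; last exact: cintegrable_expi.
  rewrite -cintegralZ; last exact: cintegrable_expi.
  rewrite -cintegralZ; last by apply: cintegrableZ; exact: cintegrable_expi.
  rewrite -cintegralD; [|by do ?apply: cintegrableZ; exact: cintegrable_expi..].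
  apply: eq_cintegral => z; rewrite /F /Bil_sec /ker addrK mulrDr expiD CD !CM; ring.
rewrite (eq_cintegral E).
have ei1 : cintegrable (fun eta => eta%:C * q eta * expi (x * eta)) by exact: cintegrable_expi.
have ei2 : cintegrable (fun eta => `|eta|%:C * q eta * expi (x * eta)) by exact: cintegrable_expi.
have zr (f : R -> R[i]) c : cintegrable f -> cintegrable (fun y => f y * c).
  by move=> fi; rewrite (_ : (fun y => _) = (fun y => c * f y));
    [exact: cintegrableZ|apply/funext => y; rewrite mulrC].
rewrite cintegralD; [|exact: zr|by apply: cintegrableZ; exact: zr].
rewrite cintegralZ; last exact: zr.
by rewrite !cintegralZr// !FiE -/c1 -/c2; ring.
Qed.

End LemmaW.

Section LambdaTest.
Context {R : realType}.
Local Notation cmeas2 F := (cmeas (fun z : R * R => F z.1 z.2)).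
Local Notation mu := (@lebesgue_measure R).
Local Notation Fi := (@inverse_fourier_int R).
Local Notation Fh := (@fourier_int R).
Local Notation kap := (@kap R).

Lemma derive_lipschitz (f f' : R -> R) (a b B : R) : (forall x : R, is_derive x 1 f (f' x)) ->
  a <= b -> (forall x, a <= x <= b -> `|f' x| <= B) -> `|f b - f a| <= B * (b - a).
Proof.
move=> df ab fB; have cf : {within `[a, b], continuous f}.
  by apply: continuous_subspaceT => x; apply/differentiable_continuous/derivable1_diffP; case: (df x).
have [c cI ->] := MVT_segment ab (fun x _ => df x) cf.
rewrite normrM (ger0_norm (_ : 0 <= b - a)) ?subr_ge0//.
by rewrite ler_wpM2r ?subr_ge0//; apply: fB; move: cI; rewrite in_itv.
Qed.

Lemma sin_le_id (x : R) : `|sin x| <= `|x|.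
Proof.
have pos (y : R) : 0 <= y -> `|sin y| <= y.
  move=> y0; have := @derive_lipschitz sin cos 0 y 1 _ y0.
  rewrite sin0 !subr0 mul1r; apply => // z _; exact: cos_le.
have [x0|x0] := leP 0 x; first by rewrite (ger0_norm x0) pos.
by rewrite -normrN -sinN (ltr0_norm x0) pos// oppr_ge0 ltW.
Qed.

Definition kk (y : R) : R := 2 * (1 - cos y) / y ^+ 2.

Lemma cos_sin_half (y : R) : 1 - cos y = 2 * sin (y / 2) ^+ 2.
Proof.
have -> : cos y = cos (y / 2 + y / 2) by congr cos; field.
by rewrite cosD -!expr2 cos2sin2; ring.
Qed.

Lemma kk_ge0 y : 0 <= kk y.
Proof. by rewrite divr_ge0 ?sqr_ge0// mulr_ge0// subr_ge0 cos_le1. Qed.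

Lemma kk_le y : kk y <= 8 / oneDsqr y.
Proof.
have od : 0 < oneDsqr y by rewrite (lt_le_trans ltr01)// oneDsqr_ge1.
have [->|y0] := eqVneq y 0; first by rewrite /kk expr0n invr0 mulr0 divr_ge0// ltW.
have y2 : 0 < y ^+ 2 by rewrite exprn_even_gt0.
rewrite /kk ler_pdivlMr// mulrAC ler_pdivrMr// /oneDsqr.
have [h|h] := leP (y ^+ 2) 1; last first.
  have c := cos_geN1 y; nra.
have s2 : 1 - cos y <= y ^+ 2 / 2.
  rewrite cos_sin_half; have h2 : sin (y / 2) ^+ 2 <= (y / 2) ^+ 2.
    by rewrite -real_normK ?num_real// -[leRHS]real_normK ?num_real// lerXn2r ?nnegrE ?sin_le_id.
  by apply: le_trans (ler_wpM2l _ h2) _ => //; rewrite le_eqVlt; apply/orP; left; apply/eqP; field.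
nra.
Qed.

Lemma measurable_sqrV : mfunT (fun y : R => (y ^+ 2)^-1).
Proof.
rewrite (_ : (fun y => _) = (fun y : R => `|y| `^ (- 2%:R))).
  exact: (measurableT_comp (measurable_powR (- 2%:R)) measurable_normr1).
by apply/funext => y; rewrite powRN powR_mulrn// real_normK ?num_real.
Qed.

Lemma measurable_kk : mfunT kk.
Proof.
apply: measurable_funM.
  apply: measurable_funM; first exact: measurable_cst.
  apply: measurable_funB; first exact: measurable_cst.
  exact: continuous_measurable_fun (@continuous_cos R).
exact: measurable_sqrV.
Qed.

Lemma integrable_kk : Lint kk.
Proof.
apply: (integrable_le measurable_kk (integrableZl measurableT 8 (@integrable_cauchy R))) => x.
by rewrite ger0_norm ?kk_ge0// kk_le.
Qed.

Definition ckk : R := \int[mu]_y kk y.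

Lemma ckk_gt0 : 0 < ckk.
Proof.
apply: (@Rintegral_gt0 _ kk 0 1) => //; [exact: integrable_kk|exact: kk_ge0|].
move=> x /andP[x0 x1]; rewrite divr_gt0 ?exprn_gt0// mulr_gt0// cos_sin_half.
rewrite mulr_gt0// exprn_gt0// sin_gt0_pi//.
by have := @pi_ge2 R; move=> p2; apply/andP; split; lra.
Qed.

Lemma cos_kk (y xi : R) : 2 * (1 - cos (y * xi)) / y ^+ 2 = xi ^+ 2 * kk (xi * y + 0).
Proof.
rewrite addr0 /kk (mulrC xi) exprMn; have [->|x0] := eqVneq xi 0.
  by rewrite mulr0 cos0 subrr !mulr0 !mul0r mulr0.
have [->|y0] := eqVneq y 0; first by rewrite mul0r expr0n /= mul0r invr0 !mulr0.
by field; rewrite x0 y0.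
Qed.

Lemma integral_cos_kk (xi : R) : \int[mu]_y (2 * (1 - cos (y * xi)) / y ^+ 2) = ckk * `|xi|.
Proof.
under eq_Rintegral => y _ do rewrite cos_kk.
have [->|x0] := eqVneq xi 0.
  rewrite normr0 mulr0 /Rintegral.
  by rewrite integral0_eq// => y _; rewrite expr0n mul0r.
rewrite RintegralZl//; last exact: (integrable_affine 0 x0 integrable_kk).
rewrite Rintegral_affine//; last exact: measurable_kk.
by rewrite -/ckk -real_normK ?num_real// expr2 mulrA mulfK ?normr_eq0// mulrC.
Qed.

Lemma integrable_cos_kk (xi : R) :
  Lint (fun y => 2 * (1 - cos (y * xi)) / y ^+ 2).
Proof.
rewrite (_ : (fun y => _) = (fun y => xi ^+ 2 * kk (xi * y + 0))); last first.
  by apply/funext => y; exact: cos_kk.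
have [->|x0] := eqVneq xi 0.
  rewrite (_ : (fun y => _) = (fun=> 0)); first exact: integrable0.
  by apply/funext => y; rewrite expr0n mul0r.
exact: (integrableZl measurableT _ (integrable_affine 0 x0 integrable_kk)).
Qed.

Lemma Fi_cos (psi : R -> R) (x y : R) : test_fun psi ->
  cintegral (fun xi => (2 * (1 - cos (y * xi)))%:C * (Fh (fun z => (psi z)%:C) xi * expi (x * xi))) =
  (kap^-1 * (2 * psi x - psi (x + y) - psi (x - y)))%:C.
Proof.
move=> /test_schwartz sp; have gi := schwartz_Fh_integrable sp.
set g := Fh _ in gi *.
have ei z : cintegrable (fun xi => g xi * expi (z * xi)) by exact: cintegrable_expi.
have E z : cintegral (fun xi => g xi * expi (z * xi)) = (kap^-1 * psi z)%:C.
  have := schwartz_Fi_Fh z sp; rewrite FiE -/g CM => <-.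
  by rewrite mulrA -CM mulVf ?mul1r// gt_eqF// kap_gt0.
rewrite -[X in X = _]/(_) (_ : (fun xi => _) = (fun xi => 2%:C * (g xi * expi (x * xi)) -
   g xi * expi ((x + y) * xi) - g xi * expi ((x - y) * xi))); last first.
  apply/funext => xi; rewrite (mulrDl x) (mulrDl x) expiD mulNr !expiD expiN !mulrA.
  have K (z v : R[i]) : (2 * (1 - Re z))%:C * v = 2%:C * v - v * z - v * conjc z.
    by case: z => a b; case: v => c d; apply: complex_eqP; rewrite !reimE /=; ring.
  have := K (expi (y * xi)) (g xi * expi (x * xi)); rewrite !mulrA; exact.
rewrite !cintegralB// ?cintegralZ// ?E; try exact: cintegrableZ;
  try (by apply: cintegrableB => //; exact: cintegrableZ).
by rewrite -CM -!CN -!CD; congr (_%:C); ring.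
Qed.

Lemma schwartz_Fh_abs (psi : R -> R) : schwartz psi ->
  cintegrable (fun xi => `|xi|%:C * Fh (fun z => (psi z)%:C) xi).
Proof.
move=> sp; have gi := schwartz_Fh_integrable sp; have gi' := schwartz_Fh_integrable (schwartz_derive1 sp).
apply: (cintegrable_lec _ gi').
  by apply: cmeasM; [exact: cmeasC measurable_normr1|exact: cintegrable_meas gi].
by move=> x; rewrite schwartz_Fh_derive1// normc_iM !Normc.normcM !normcC normr_id.
Qed.

Definition diff2 (psi : R -> R) (x y : R) : R := 2 * psi x - psi (x + y) - psi (x - y).

Lemma diff2_le (psi : R -> R) (B x y : R) : smooth psi ->
  (forall x, `|derive1 (derive1 psi) x| <= B) -> `|diff2 psi x y| <= 2 * B * y ^+ 2.
Proof.
move=> sp pB.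
have B0 : 0 <= B by apply: le_trans (pB 0).
have d1 := smooth_is_derive sp; have d2 := smooth_is_derive (smooth_derive1 sp).
have pos (z : R) : 0 <= z -> `|diff2 psi x z| <= 2 * B * z ^+ 2.
  move=> z0.
  have dg (s : R) : is_derive s 1 (diff2 psi x) (- derive1 psi (x + s) + derive1 psi (x - s)).
    have dxp : is_derive s 1 (fun s : R => x + s) 1.
      by have := isdD (is_derive_cst x s (1:R)) (is_derive_id s (1 : R)); rewrite add0r.
    have dxm : is_derive s 1 (fun s : R => x - s) (-1).
      have := isdD (is_derive_cst x s (1:R)) (isdZ (-1) (is_derive_id s (1 : R))).
      rewrite add0r mulr1; congr (is_derive _ _ _ _).
      by apply/funext => t; rewrite mulN1r.
    have := isdD (isdD (is_derive_cst (2 * psi x) s (1:R)) (isdZ (-1) (isd_comp (d1 (x + s)) dxp)))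
      (isdZ (-1) (@isd_comp _ psi (fun s => x - s) s _ _ (d1 (x - s)) dxm)).
    rewrite (_ : (fun x0 => _) = diff2 psi x).
      by move=> h; apply: (is_derive_eq h); ring.
    by apply/funext => t; rewrite /diff2 /cst !mulN1r.
  have := @derive_lipschitz _ _ 0 z (2 * B * z) dg z0.
  rewrite /diff2 addr0 !subr0 (_ : 2 * psi x - psi x - psi x = 0) ?subr0; last by ring.
  rewrite (_ : 2 * B * z * z = 2 * B * z ^+ 2); last by ring.
  apply=> s /andP[s0 sz]; rewrite addrC -normrN opprB.
  apply: le_trans (derive_lipschitz d2 _ (fun t _ => pB t)) _; first by lra.
  have -> : B * (x + s - (x - s)) = 2 * B * s by ring.
  by rewrite ler_wpM2l// mulr_ge0.
have [y0|y0] := leP 0 y; first exact: pos.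
have := pos (- y); rewrite sqrrN oppr_ge0 => /(_ (ltW y0)).
by rewrite /diff2 opprK addrAC.
Qed.

Lemma diff2_bound (psi : R -> R) : test_fun psi -> exists B M : R, [/\ 0 <= B, 0 <= M &
  forall x y, `|diff2 psi x y / y ^+ 2| <= 2 / oneDsqr y *
    (2 * B * \1_(`[- (M + 1), M + 1]%classic) x + 2 * `|psi x| + `|psi (x + y)| + `|psi (x - y)|)].
Proof.
move=> tp; have [sp [M0 hM0]] := tp.
have [B hB] := schwartz_bounded (schwartz_derive1 (schwartz_derive1 (test_schwartz tp))).
have B0 : 0 <= B by apply: le_trans (hB 0).
exists B, `|M0|; split => // x y.
set M := `|M0|; have hM z : M < `|z| -> psi z = 0.
  by move=> h; apply: hM0; apply: le_lt_trans h; exact: ler_norm.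
have od : 0 < oneDsqr y by rewrite (lt_le_trans ltr01)// oneDsqr_ge1.
set N := (X in _ <= _ * X).
have ind0 : 0 <= \1_(`[- (M + 1), M + 1]%classic) x :> R by rewrite indicE.
have [->|y0] := eqVneq y 0.
  have N0 : 0 <= N by rewrite !addr_ge0// ?mulr_ge0.
  by rewrite expr0n invr0 mulr0 normr0; apply: mulr_ge0 => //; rewrite divr_ge0// addr_ge0// sqr_ge0.
have y2 : 0 < y ^+ 2 by rewrite exprn_even_gt0.
rewrite normrM normfV (ger0_norm (ltW y2)) ler_pdivrMr//.
have N0 : 0 <= N by rewrite !addr_ge0// ?mulr_ge0.
have [h|h] := leP (y ^+ 2) 1; last first.
  have D : `|diff2 psi x y| <= N.
    rewrite /diff2 /N; apply: le_trans (ler_normB _ _) _; rewrite lerD2r.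
    apply: le_trans (ler_normB _ _) _; rewrite lerD2r normrM ger0_norm//.
    by rewrite lerDr !mulr_ge0.
  apply: le_trans D _; rewrite mulrAC ler_peMl// mulrAC ler_pdivlMr// mul1r /oneDsqr; lra.
have h1 : `|y| <= 1 by rewrite -(ler_pXn2r (ltn0Sn 1)) ?nnegrE// real_normK ?num_real// expr1n.
have D : `|diff2 psi x y| <= y ^+ 2 * N.
  have [xM|xM] := leP `|x| (M + 1).
    have i1 : \1_(`[- (M + 1), M + 1]%classic) x = 1 :> R.
      by rewrite indicE mem_set//= in_itv /= -ler_norml.
    have := normr_ge0 (psi x); have := normr_ge0 (psi (x + y)); have := normr_ge0 (psi (x - y)).
    move=> q1 q2 q3; have N1 : 2 * B <= N by rewrite /N i1; lra.
    apply: le_trans (diff2_le x y sp hB) _; rewrite (mulrC (2 * B)).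
    by apply: ler_wpM2l N1; exact: ltW.
  have xa : `|x| <= `|x + y| + `|y| by rewrite -{1}(addrK y x) ler_normB.
  have xb : `|x| <= `|x - y| + `|y| by rewrite -{1}(subrK y x) ler_normD.
  rewrite /diff2 !hM; try lra.
  by rewrite mulr0 !subr0 normr0 mulr_ge0 // ltW.
apply: le_trans D _; rewrite -(mulrA (2 / _)) (mulrC N) ler_peMl ?(mulr_ge0 (ltW y2) N0)//.
by rewrite ler_pdivlMr// mul1r /oneDsqr; lra.
Qed.

Lemma measurable_diff2 (psi : R -> R) : test_fun psi ->
  mfunT (fun z : R * R => diff2 psi z.1 z.2 / z.2 ^+ 2).
Proof.
move=> [sp _]; have mp := smooth_measurable sp.
apply: measurable_funM; last exact: (measurableT_comp measurable_sqrV measurable_snd).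
apply: measurable_funB; last exact: (measurableT_comp mp measurable_subr12).
apply: measurable_funB.
  by apply: measurable_funM => //; exact: (measurableT_comp mp measurable_fst).
apply: (measurableT_comp mp); apply: measurable_funD; [exact: measurable_fst|exact: measurable_snd].
Qed.

Lemma cintegrable_diff2 (psi : R -> R) (x : R) : test_fun psi ->
  cintegrable (fun y => (diff2 psi x y / y ^+ 2)%:C).
Proof.
move=> tp; have [B [M [B0 M0 h]]] := diff2_bound tp.
have [S hS] := schwartz_bounded (test_schwartz tp).
have ig := integrableZl measurableT (2 * (2 * B + 4 * S)) (@integrable_cauchy R).
apply: (@cintegrable_le _ _ (fun y => 2 * (2 * B + 4 * S) * (oneDsqr y)^-1)) ig _.
  exact: (@cmeasC _ _ _ (fun y => diff2 psi x y / y ^+ 2))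
    (measurableT_comp (measurable_diff2 tp) (@pair1_measurable _ _ _ _ x)).
move=> y; rewrite normcC; apply: le_trans (h x y) _.
rewrite mulrAC ler_wpM2r ?invr_ge0 ?addr_ge0 ?sqr_ge0// ler_wpM2l//.
have i1 : 2 * B * \1_(`[- (M + 1), M + 1]%classic) x <= 2 * B.
  by rewrite ler_piMr ?mulr_ge0// indicE; case: (_ \in _).
have := hS x; have := hS (x + y); have := hS (x - y); lra.
Qed.

Lemma Fi_abs_diff2 (psi : R -> R) (x : R) : test_fun psi ->
  (ckk%:C * Fi (fun xi => `|xi|%:C * Fh (fun z => (psi z)%:C) xi) x =
   cintegral (fun y => (diff2 psi x y / y ^+ 2)%:C)).
Proof.
move=> tp; have sp := test_schwartz tp; have gi := schwartz_Fh_integrable sp.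
have mg := cintegrable_meas gi; have ai := schwartz_Fh_abs sp.
set g := Fh _ in mg gi ai *.
pose G (xi y : R) : R[i] := (2 * (1 - cos (y * xi)) / y ^+ 2)%:C * (g xi * expi (x * xi)).
have mG : cmeas2 G.
  apply: cmeasM.
    apply: (@cmeasC _ _ _ (fun z : R * R => 2 * (1 - cos (z.2 * z.1)) / z.2 ^+ 2)).
    apply: measurable_funM; last exact: (measurableT_comp measurable_sqrV measurable_snd).
    apply: measurable_funM; first exact: measurable_cst.
    apply: measurable_funB; first exact: measurable_cst.
    apply: (measurableT_comp (continuous_measurable_fun (@continuous_cos R))).
    by apply: measurable_funM; [exact: measurable_snd|exact: measurable_fst].
  apply: cmeasM; first exact: cmeas_pair1.
  by apply: cmeas_expi; apply: measurable_funM => //; exact: measurable_fst.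
have L xi : L1n (G xi) = (ckk * (`|xi| * normc (g xi)))%:E.
  rewrite /L1n /G; under eq_integral => y _.
    rewrite Normc.normcM (Normc.normcM (g xi)) normc_expi mulr1 normcC ger0_norm; last first.
      by rewrite divr_ge0 ?sqr_ge0// mulr_ge0// subr_ge0 cos_le1.
    over.
  have HI : (\int[mu]_y (2 * (1 - cos (y * xi)) / y ^+ 2)%:E = (ckk * `|xi|)%:E)%E.
    by rewrite -integral_cos_kk fineK//; exact: integrable_fin_num (integrable_cos_kk xi).
  have := integralZr measurableT (integrable_cos_kk xi) (normc (g xi)).
  by rewrite [X in _ = (X * _)%E]HI -EFinM -mulrA => <-.
have fG : (\int[mu]_xi L1n (G xi) < +oo)%E.
  rewrite (_ : (fun xi => _) = (fun xi => ckk%:E * (normc (`|xi|%:C * g xi))%:E)%E); last first.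
    by apply/funext => xi; rewrite L (Normc.normcM `|xi|%:C) normcC normr_id.
  rewrite ge0_integralZl//; last 3 first.
  - by apply/measurable_EFinP; exact: cmeas_norm (cintegrable_meas ai).
  - by move=> y _; rewrite lee_fin normc_ge0.
  - by rewrite lee_fin (ltW ckk_gt0).
  by apply: lte_mul_pinfty; rewrite ?lee_fin ?(ltW ckk_gt0)//; exact: cintegrable_L1n.
have key := cFubini mG fG.
have E1 xi : cintegral (G xi) = ckk%:C * (`|xi|%:C * g xi * expi (x * xi)).
  rewrite cintegralZr; last exact: (cintegrableC (integrable_cos_kk xi)).
  by rewrite cintegralC integral_cos_kk CM !mulrA.
have E2 y : cintegral (fun xi => G xi y) = (kap^-1)%:C * (diff2 psi x y / y ^+ 2)%:C.
  rewrite (_ : (fun xi => _) = (fun xi => (y ^+ 2)^-1%:C * ((2 * (1 - cos (y * xi)))%:C *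
     (g xi * expi (x * xi))))); last by apply/funext => xi; rewrite /G CM; ring.
  rewrite cintegralZ; last first.
    apply: (@cintegrableMl _ _ _ 4); first exact: cintegrable_expi.
    apply: (@cmeasC _ _ _ (fun xi => 2 * (1 - cos (y * xi)))).
    apply: measurable_funM; first exact: measurable_cst.
    apply: measurable_funB; first exact: measurable_cst.
    apply: (measurableT_comp (continuous_measurable_fun (@continuous_cos R))).
    by apply: measurable_funM; [exact: measurable_cst|exact: measurable_id].
    by move=> z; rewrite normcC ler_norml; have := cos_le1 (y * z); have := cos_geN1 (y * z); lra.
  have FC : cintegral (fun xi => (2 * (1 - cos (y * xi)))%:C * (g xi * expi (x * xi))) =
      (kap^-1 * diff2 psi x y)%:C by exact: (Fi_cos x y tp).
  by rewrite FC !CM mulrCA; congr (_ * _); rewrite mulrC.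
have fi := cintegrable_diff2 x tp.
move: key; rewrite (eq_cintegral E1) (eq_cintegral E2) !cintegralZ//; last exact: cintegrable_expi.
move=> k; rewrite FiE mulrCA k mulrA -CM mulfV ?mul1r//.
by rewrite gt_eqF// kap_gt0.
Qed.

(* [|xi|] is, up to a constant, [int_0^oo (2 - 2 cos (y xi)) / y^2 dy], so this
   function is an integral of second differences of [psi]. *)
Lemma cintegrable_Lambda_test (psi : R -> R) : test_fun psi ->
  cintegrable (Fi (fun xi => `|xi|%:C * Fh (fun z => (psi z)%:C) xi)).
Proof.
move=> tp; have [B [M [B0 M0 h]]] := diff2_bound tp.
pose f (x y : R) : R[i] := (diff2 psi x y / y ^+ 2)%:C.
have mf : cmeas2 f.
  exact: (@cmeasC _ _ _ (fun z : R * R => diff2 psi z.1 z.2 / z.2 ^+ 2)) (measurable_diff2 tp).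
have [ci _] : cintegrable (fun x => cintegral (f x)) /\
    (L1n (fun x => cintegral (f x)) <= \int[mu]_x L1n (f x))%E.
  apply: L1n_cintegral_le => //; rewrite L1n_swap//.
  pose a (x : R) := (2 * B * \1_(`[- (M + 1), M + 1]%classic) x)%:E.
  pose p (x : R) := `|psi x|%:E.
  have ma : mfunT a.
    apply/measurable_EFinP; apply: measurable_funM => //; exact: measurable_indic.
  have mp : mfunT p.
    apply/measurable_EFinP; exact: (measurableT_comp measurable_normr1 (smooth_measurable (proj1 tp))).
  have a0 x : (0 <= a x)%E by rewrite lee_fin mulr_ge0// ?mulr_ge0// indicE.
  have p0 x : (0 <= p x)%E by rewrite lee_fin.
  have mps (y : R) : mfunT (fun x : R => p (x + y)).
    exact: (measurableT_comp mp (measurable_funD (@measurable_id _ _ setT) (measurable_cst y))).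
  pose K := (\int[mu]_x a x + (\int[mu]_x p x + \int[mu]_x p x) + \int[mu]_x p x + \int[mu]_x p x)%E.
  have ia : (0 <= \int[mu]_x a x)%E by exact: integral_ge0.
  have ip : (0 <= \int[mu]_x p x)%E by exact: integral_ge0.
  have K0 : (0 <= K)%E by exact: (adde_ge0 (adde_ge0 (adde_ge0 ia (adde_ge0 ip ip)) ip) ip).
  have Kfin : (K < +oo)%E.
    have fa : (\int[mu]_x a x < +oo)%E.
      rewrite /a; under eq_integral => x _ do rewrite EFinM.
      rewrite ge0_integralZl//; last 2 first.
      - by apply/measurable_EFinP; exact: measurable_indic.
      - by rewrite lee_fin mulr_ge0.
      rewrite integral_indic// setIT; apply: lte_mul_pinfty; rewrite ?lee_fin ?mulr_ge0//.
      by rewrite /= lebesgue_measure_itv /=; case: ifP => _; rewrite ltry.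
    have fp : (\int[mu]_x p x < +oo)%E.
      by have /integrableP[_] := test_fun_integrable tp.
    exact: (lte_add_pinfty (lte_add_pinfty (lte_add_pinfty fa (lte_add_pinfty fp fp)) fp) fp).
  apply: (@le_lt_trans _ _ (\int[mu]_y ((2 / oneDsqr y)%:E * K))%E).
    apply: ge0_le_integral_nomeas => y _; first exact: L1n_ge0.
    have od : 0 <= 2 / oneDsqr y by rewrite divr_ge0// addr_ge0// sqr_ge0.
    apply: (@le_trans _ _ (\int[mu]_x ((2 / oneDsqr y)%:E *
        (a x + (p x + p x) + p (x + y)%R + p (x - y)%R)))%E).
      apply: ge0_le_integral_nomeas => x _; first by rewrite lee_fin normc_ge0.
      have := h x y; rewrite -lee_fin normcC => /le_trans; apply.
      rewrite [2 * `|psi x|](_ : _ = `|psi x| + `|psi x|); last by ring.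
      by rewrite EFinM.
    have mpy := mps y; have mpy' := mps (- y).
    have mpp : mfunT (fun x => p x + p x)%E by apply: emeasurable_funD.
    have m1 : mfunT (fun x => a x + (p x + p x))%E by apply: emeasurable_funD.
    have m2 : mfunT (fun x => a x + (p x + p x) + p (x + y)%R)%E by apply: emeasurable_funD.
    have m3 : mfunT (fun x => a x + (p x + p x) + p (x + y)%R + p (x - y)%R)%E by apply: emeasurable_funD.
    rewrite ge0_integralZl//; last by move=> x _; rewrite !adde_ge0.
    apply: lee_wpmul2l; first by rewrite lee_fin.
    rewrite ge0_integralD//; last by move=> x _; rewrite !adde_ge0.
    rewrite ge0_integralD//; last by move=> x _; rewrite !adde_ge0.
    rewrite ge0_integralD//; last by move=> x _; rewrite !adde_ge0.
    by rewrite ge0_integralD// !ge0_integral_shift.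
  have /integrableP[mc _] := integrableZl measurableT 2 (@integrable_cauchy R).
  rewrite ge0_integralZr//.
  have /integrableP[_ fc] := integrableZl measurableT 2 (@integrable_cauchy R).
  rewrite lte_mul_pinfty//; [by apply: integral_ge0 => y _; rewrite lee_fin divr_ge0// addr_ge0// sqr_ge0|].
  rewrite ge0_fin_numE; last by apply: integral_ge0 => y _; rewrite lee_fin divr_ge0// addr_ge0// sqr_ge0.
  apply: le_lt_trans fc; apply: ge0_le_integral_nomeas => y _.
    by rewrite lee_fin divr_ge0// addr_ge0// sqr_ge0.
  exact: lee_abs.
have := cintegrableZ (ckk^-1)%:C ci; congr cintegrable; apply/funext => x.
by rewrite /f -Fi_abs_diff2// mulrA -CM mulVf ?mul1r// gt_eqF// ckk_gt0.
Qed.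

End LambdaTest.

Section InnerIntegral.
Context {R : realType}.
Local Notation mu := (@lebesgue_measure R).
Local Notation Fi := (@inverse_fourier_int R).
Local Notation Fh := (@fourier_int R).
Local Notation kap := (@kap R).
Implicit Types (p q u v g : R -> R[i]).

Lemma hermM p q : herm p -> herm q -> herm (fun x => p x * q x).
Proof. by move=> hp hq x; rewrite hp hq conjcM. Qed.

Lemma hermD p q : herm p -> herm q -> herm (fun x => p x + q x).
Proof. by move=> hp hq x; rewrite hp hq conjcD. Qed.

Lemma herm_abs : herm (fun x : R => `|x|%:C : R[i]).
Proof. by move=> x; rewrite normrN conjcC. Qed.

Lemma herm_id_i : herm (fun x : R => Complex 0 x : R[i]).
Proof. by move=> x; apply: complex_eqP => //=; rewrite oppr0. Qed.

Lemma herm_sg : herm (fun x : R => Complex 0 (- Num.sg x) : R[i]).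
Proof. by move=> x; rewrite sgrN. Qed.

Lemma herm_Fh (f : R -> R) : Lint f -> herm (Fh (fun x => (f x)%:C)).
Proof.
move=> fi x; rewrite !FhE opprK !FiE conjcM conjcC -cintegralJ; last first.
  exact: (cintegrable_expi _ (cintegrableC fi)).
by congr (_ * _); apply: eq_cintegral => y; rewrite conjcM conjcC -expiN mulNr opprK.
Qed.

Lemma is_fourier_test (psi : R -> R) : test_fun psi -> is_fourier psi (Fh (fun x => (psi x)%:C)).
Proof.
move=> tp; have sp := test_schwartz tp; have ip := test_fun_integrable tp.
apply: is_fourier_ae; first exact: integrable_locally_integrable.
- exact: schwartz_Fh_integrable.
- exact: herm_Fh.
- by apply: aeW => x; rewrite /Fr schwartz_Fi_Fh.
Qed.

Lemma Lambda1E (f : R -> R) g x : is_fourier f g ->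
  Lambda 1 f x = Fr (fun xi => `|xi|%:C * g xi) x.
Proof.
move=> fg; rewrite /Lambda (multiplierE _ _ fg); congr (Fr _ x).
by apply/funext => xi; rewrite powRr1.
Qed.

Lemma ccontinuousM p q : ccontinuous p -> ccontinuous q -> ccontinuous (fun x => p x * q x).
Proof.
move=> [p1 p2] [q1 q2]; split => x.
  rewrite (_ : (fun x => _) = (fun x => Re (p x) * Re (q x) - Im (p x) * Im (q x))).
    by apply: cvgB; apply: cvgM; [exact: p1|exact: q1|exact: p2|exact: q2].
  by apply/funext => y; rewrite ReM.
rewrite (_ : (fun x => _) = (fun x => Re (p x) * Im (q x) + Im (p x) * Re (q x))).
  by apply: cvgD; apply: cvgM; [exact: p1|exact: q2|exact: p2|exact: q1].
by apply/funext => y; rewrite ImM.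
Qed.

Lemma ccontinuous_abs : ccontinuous (fun x : R => `|x|%:C : R[i]).
Proof. by split => x; [exact: norm_continuous|exact: cvg_cst]. Qed.

Lemma ccontinuous_Fh g : cintegrable g -> ccontinuous (Fh g).
Proof.
move=> gi; have c (h : R -> R[i]) : cintegrable h -> continuous (fun x => Fr h (- x)).
  move=> hi x; have cc := @continuous_Fr _ _ hi (- x).
  by apply: (@continuous_comp _ _ _ (fun x : R => - x) (Fr h)) => //; exact: opp_continuous.
split.
  by rewrite (_ : (fun x => _) = (fun x => Fr g (- x))); [exact: c|apply/funext => x; rewrite FhE].
rewrite (_ : (fun x => _) = (fun x => Fr (fun y => Complex 0 (-1) * g y) (- x))); first by apply/c/cintegrableZ.
by apply/funext => x; rewrite FhE /Fr FiZ// ReM /=; ring.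
Qed.

Lemma cintegral_Fr_Lambda v (psi : R -> R) : cintegrable v -> cintegrable (fun y => y%:C * v y) ->
  herm v -> test_fun psi ->
  Lint (fun x => Fr v x * Lambda 1 psi x) /\
  \int[mu]_x (Fr v x * Lambda 1 psi x) = \int[mu]_x (Fr (fun xi => `|xi|%:C * v xi) x * psi x).
Proof.
move=> vi yi hv tp; have mv := cintegrable_meas vi.
have sp := test_schwartz tp; have ip := test_fun_integrable tp.
have ai := cintegrable_abs mv yi; have hi := cintegrable_Lambda_test tp.
set m := (fun xi => `|xi|%:C * Fh (fun z => (psi z)%:C) xi) in hi.
have mi : cintegrable m by exact: schwartz_Fh_abs.
have LE x : Lambda 1 psi x = Fr m x by exact: Lambda1E (is_fourier_test tp).
have hm : herm m by apply: hermM; [exact: herm_abs|exact: herm_Fh].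
have mC x : (Fr m x)%:C = Fi m x by rewrite (Fi_herm x mi hm).
have vC x : (Fr v x)%:C = Fi v x by rewrite (Fi_herm x vi hv).
have ha : herm (fun xi => `|xi|%:C * v xi) by apply: hermM => //; exact: herm_abs.
have aC x : (Fr (fun xi => `|xi|%:C * v xi) x)%:C = Fi (fun xi => `|xi|%:C * v xi) x.
  by rewrite (Fi_herm x ai ha).
have ii : Lint (fun x => Fr v x * Lambda 1 psi x).
  have im : Lint (Fr m) by case: hi.
  have := integrableM_bounded im (measurable_Fr mv) (fun x => Fr_bound x vi).
  by congr (mu.-integrable _ _); apply/funext => x /=; rewrite LE mulrC.
split => //.
have [C hC] : exists C, forall xi, normc (m xi) <= C.
  have isp := schwartz_integrable (schwartz_derive1 sp).
  exists (kap * \int[mu]_y normc ((derive1 psi y)%:C)) => xi.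
  rewrite /m Normc.normcM normcC normr_id -normcC -Normc.normcM -normc_iM -schwartz_Fh_derive1// FhE.
  exact: Fi_bound (cintegrableC isp).
have FFi : forall xi, Fi (Fi m) xi = m (- xi).
  move=> xi; rewrite FiE_Fh; apply: (@Fh_Fi _ _ C) => //.
    by apply: ccontinuousM; [exact: ccontinuous_abs|exact: ccontinuous_Fh (cintegrableC ip)].
have E1 := Fi_pairing hi vi; have E2 := Fi_pairing (cintegrableC ip) ai.
have E3 : cintegral (fun x => Fi v x * Fi m x) = cintegral (fun x => Fi (fun xi => `|xi|%:C * v xi) x * (psi x)%:C).
  rewrite E1 E2; apply: eq_cintegral => xi; rewrite FFi /m normrN FiE_Fh; ring.
move: E3; rewrite (eq_cintegral (g := fun x => (Fr v x * Lambda 1 psi x)%:C)); last first.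
  by move=> x; rewrite CM vC LE mC.
rewrite [in RHS](eq_cintegral (g := fun x => (Fr (fun xi => `|xi|%:C * v xi) x * psi x)%:C)); last first.
  by move=> x; rewrite CM aC.
by rewrite !cintegralC => /(congr1 (fun z => Re z)).
Qed.

Lemma herm_repr (f : R -> R) g : is_fourier f g -> exists h, [/\ herm h, is_fourier f h &
  {ae mu, forall x, g x = h x}].
Proof.
move=> fg; have hg := is_fourier_herm fg; have mg := is_fourier_cmeas fg.
pose h x := (2^-1)%:C * (g x + conjc (g (- x))).
have gh : {ae mu, forall x, g x = h x}.
  apply: aeS hg => x; rewrite /h => ->.
  by rewrite conjcK; apply: complex_eqP; rewrite !reimE; field.
exists h; split => //.
  by move=> x; rewrite /h conjcM conjcC conjcD conjcK opprK addrC.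
have [lf H] := fg; split => // phi sphi phihat.
have [c1 c2 c3] := H phi sphi; have mgr : cmeas h.
  apply: cmeasM; first exact: cmeas_cst.
  apply: cmeasD => //; apply: cmeasJ; apply: (cmeas_comp mg); exact: oppr_measurable.
have e : {ae mu, forall x, g x * (phi x)%:C = h x * (phi x)%:C} by apply: aeS gh => x ->.
split => //; last by rewrite -(ae_cintegral e).
have sp := schwartz_integrable sphi.
apply/cintegrableP; split; first by apply: cmeasM => //; exact: cmeasC (integrable_meas sp).
by rewrite -(ae_L1n e); exact: cintegrable_L1n.
Qed.

Variable delta : R.

Definition Gen v (xi : R) : R[i] := `|xi|%:C * v xi + Bil delta v v xi.

Lemma GenE v xi : Gen v xi = `|xi|%:C * v xi + Bil delta v v xi. Proof. by []. Qed.

Lemma cintegrable_Bil v : cintegrable v -> cintegrable (fun y => y%:C * v y) ->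
  cintegrable (Bil delta v v).
Proof.
move=> vi yi; have mv := cintegrable_meas vi.
apply/cintegrableP; split; first exact: cmeas_Bil.
apply: le_lt_trans (L1n_Bil delta mv mv) _; apply: lte_mul_pinfty => //.
  by rewrite lee_fin (ltW (C0_gt0 delta)).
apply: lte_mul_pinfty; [exact: L1n_ge0| |exact: n1_fin].
by rewrite ge0_fin_numE ?L1n_ge0//; exact: cintegrable_L1n.
Qed.

Lemma Fr_Bil v x : cintegrable v -> cintegrable (fun y => y%:C * v y) -> herm v ->
  Fr (Bil delta v v) x =
    Fr (fun xi => Complex 0 (- Num.sg xi) * v xi) x * Fr (fun xi => Complex 0 xi * v xi) x +
    delta * (Fr (fun xi => `|xi|%:C * v xi) x * Fr v x).
Proof.
move=> vi yi hv; have mv := cintegrable_meas vi; have ai := cintegrable_abs mv yi.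
have si := cintegrable_sg vi.
have E1 : Fi (fun xi => Complex 0 (- Num.sg xi) * v xi) x = Complex 0 (-1) * Fi (fun xi => (Num.sg xi)%:C * v xi) x.
  rewrite -FiZ//; congr (Fi _ x); apply/funext => xi; rewrite mulrA; congr (_ * _).
  by apply: complex_eqP; rewrite !reimE /=; ring.
have E2 : Fi (fun xi => Complex 0 xi * v xi) x = Complex 0 1 * Fi (fun xi => xi%:C * v xi) x.
  rewrite -FiZ//; congr (Fi _ x); apply/funext => xi; rewrite mulrA; congr (_ * _).
  by apply: complex_eqP; rewrite !reimE /=; ring.
have hi : cintegrable (fun xi => Complex 0 (- Num.sg xi) * v xi).
  rewrite (_ : (fun xi => _) = (fun xi => Complex 0 (-1) * ((Num.sg xi)%:C * v xi))); first exact: cintegrableZ.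
  apply/funext => xi; rewrite mulrA; congr (_ * _).
  by apply: complex_eqP; rewrite !reimE /=; ring.
have ii := cintegrable_iM mv yi.
have vC := Fi_herm x vi hv.
have aC := Fi_herm x ai (hermM herm_abs hv).
have sC := Fi_herm x hi (hermM herm_sg hv).
have iC := Fi_herm x ii (hermM herm_id_i hv).
have := Fi_Bil delta x vi vi yi.
rewrite (_ : Fi (fun xi => (Num.sg xi)%:C * v xi) x * Fi (fun xi => xi%:C * v xi) x =
  Fi (fun xi => Complex 0 (- Num.sg xi) * v xi) x * Fi (fun xi => Complex 0 xi * v xi) x); last first.
  rewrite E1 E2 [RHS]mulrACA (_ : Complex 0 (-1) * Complex 0 1 = 1) ?mul1r//.
  by apply: complex_eqP; rewrite !reimE /=; ring.
rewrite vC aC sC iC -!CM -CD => /(congr1 (fun z => Re z)); rewrite ReC => E.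
by rewrite [LHS]E /Fr (mulrC (Re (Fi v x))).
Qed.

Lemma Fr_Gen v x : cintegrable v -> cintegrable (fun y => y%:C * v y) -> herm v ->
  Fr (Gen v) x = Fr (fun xi => `|xi|%:C * v xi) x + Fr (Bil delta v v) x.
Proof.
move=> vi yi hv; rewrite /Fr /Gen FiD ?ReD//; last exact: cintegrable_Bil.
by apply: cintegrable_abs => //; exact: cintegrable_meas.
Qed.

Lemma integrable_Fr_test v (psi : R -> R) : cintegrable v -> Lint psi ->
  Lint (fun x => Fr v x * psi x).
Proof.
move=> vi ip; have := integrableM_bounded ip (measurable_Fr (cintegrable_meas vi)) (fun x => Fr_bound x vi).
by congr (mu.-integrable _ _); apply/funext => x /=; rewrite mulrC.
Qed.

Lemma inner_integralE (f phi psi : R -> R) v : is_fourier f v -> herm v ->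
  cintegrable v -> cintegrable (fun y => y%:C * v y) -> test_fun psi ->
  Lint phi ->
  \int[mu]_x (f x * phi x + hilbert f x * f x * derive1 psi x
    + (1 - delta) * Lambda 1 f x * f x * psi x - f x * Lambda 1 psi x) =
  \int[mu]_x (Fr v x * phi x) - \int[mu]_x (Fr (Gen v) x * psi x).
Proof.
move=> fv hv vi yi tp iphi; have mv := cintegrable_meas vi.
have [sp [M hM]] := tp.
have fE := is_fourier_inv_Fr fv vi.
pose H := Fr (fun xi => Complex 0 (- Num.sg xi) * v xi).
pose L := Fr (fun xi => `|xi|%:C * v xi).
pose F := Fr v; pose F' := Fr (fun xi => Complex 0 xi * v xi).
have ai := cintegrable_abs mv yi; have ii := cintegrable_iM mv yi.
have msg : cmeas (fun xi : R => Complex 0 (- Num.sg xi) : R[i]).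
  by apply: cmeas_Complex => //; apply: measurable_funN; exact: measurable_sg.
have hi : cintegrable (fun xi => Complex 0 (- Num.sg xi) * v xi).
  apply: (cintegrable_lec _ vi); first exact: cmeasM.
  move=> y; rewrite Normc.normcM ler_piMl ?normc_ge0//= expr0n add0r sqrtr_sqr normrN normr_sg.
  by case: eqP.
have yhi : cintegrable (fun xi => xi%:C * (Complex 0 (- Num.sg xi) * v xi)).
  apply: (cintegrable_lec _ yi); first by apply: cmeasM; [exact: cmeas_id|exact: cmeasM].
  move=> y; rewrite mulrCA Normc.normcM ler_piMl ?normc_ge0//= expr0n add0r sqrtr_sqr normrN normr_sg.
  by case: eqP.
have dF (x : R) : is_derive x 1 F (F' x) by exact: is_derive_Fr.
have dH (x : R) : is_derive x 1 H (L x).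
  apply: (is_derive_eq (is_derive_Fr x hi yhi)); congr (Fr _ x); apply/funext => y.
  rewrite mulrA; congr (_ * _); apply: complex_eqP; rewrite !reimE /=; last by ring.
  by rewrite normrEsg; ring.
have cF : continuous F by exact: continuous_Fr.
have cF' : continuous F' by exact: continuous_Fr.
have cH : continuous H by exact: continuous_Fr.
have cL : continuous L by exact: continuous_Fr.
have cp := smooth_continuous sp; have cp' := smooth_continuous (smooth_derive1 sp).
have cMul (g h : R -> R) : continuous g -> continuous h -> continuous (fun x => g x * h x).
  by move=> cg ch x; apply: cvgM; [exact: cg|exact: ch].
have cAdd (g h : R -> R) : continuous g -> continuous h -> continuous (fun x => g x + h x).
  by move=> cg ch x; apply: cvgD; [exact: cg|exact: ch].
pose D x := (L x * F x + H x * F' x) * psi x + (H x * F x) * derive1 psi x.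
have dHFp (x : R) : is_derive x 1 (fun x => H x * F x * psi x) (D x).
  exact: (isdM (isdM (dH x) (dF x)) (smooth_is_derive sp x)).
have cD : continuous D.
  exact: (cAdd _ _ (cMul _ _ (cAdd _ _ (cMul _ _ cL cF) (cMul _ _ cH cF')) cp) (cMul _ _ (cMul _ _ cH cF) cp')).
have sD x : M < `|x| -> H x * F x * psi x = 0 by move=> /hM ->; rewrite mulr0.
have ID : \int[mu]_x D x = 0 by exact: (Rintegral_derive0_supp dHFp cD sD).
have iD : Lint D.
  apply: (compact_supp_integrable (M := M)) => // x xM.
  exact: (is_derive_supp dHFp sD).
have [iFL EFL] := cintegral_Fr_Lambda vi yi hv tp.
have iBil := cintegrable_Bil vi yi.
have ip := test_fun_integrable tp.
have iFp := integrable_Fr_test vi iphi.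
have iBp := integrable_Fr_test iBil ip.
have iLp := integrable_Fr_test ai ip.
have -> : \int[mu]_x (Fr (Gen v) x * psi x) = \int[mu]_x (L x * psi x) + \int[mu]_x (Fr (Bil delta v v) x * psi x).
  rewrite -(RintegralD measurableT iLp iBp); apply: eq_Rintegral => x _.
  by rewrite Fr_Gen// mulrDl.
rewrite -EFL.
have -> : \int[mu]_x (Fr v x * phi x) - (\int[mu]_x (Fr v x * Lambda 1 psi x) + \int[mu]_x (Fr (Bil delta v v) x * psi x)) =
   \int[mu]_x (F x * phi x + D x - F x * Lambda 1 psi x - Fr (Bil delta v v) x * psi x).
  have i1 : Lint (fun x => F x * phi x + D x).
    by have := integrableD measurableT iFp iD; congr (mu.-integrable _ _).
  have i2 : Lint (fun x => F x * phi x + D x - F x * Lambda 1 psi x).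
    by have := integrableB measurableT i1 iFL; congr (mu.-integrable _ _).
  by rewrite RintegralB// RintegralB// RintegralD// ID addr0 opprD addrA.
apply: ae_Rintegral_indep; apply: aeS fE => x -> _.
have hE : hilbert f x = H x by exact: multiplierE fv.
have LE : Lambda 1 f x = L x by exact: Lambda1E fv.
have BE : Fr (Bil delta v v) x = H x * F' x + delta * (L x * F x) by exact: Fr_Bil.
rewrite hE LE BE /D -/(F x); set l := Lambda 1 psi x.
by set a := H x; set b := F x; set c := L x; set d := F' x; ring.
Qed.

End InnerIntegral.

(** * Duhamel formula and fixed point *)

Section Duhamel.
Context {R : realType}.
Local Notation mu := (@lebesgue_measure R).

Lemma normc0 : normc (0 : R[i]) = 0.
Proof. by rewrite -[0]/(0%:C) normcC normr0. Qed.

Definition ind (T t : R) : R := if (0 <= t) && (t <= T) then 1 else 0.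

Lemma ind_ge0 T t : 0 <= ind T t.
Proof. by rewrite /ind; case: ifP. Qed.

Lemma ind_le1 T t : ind T t <= 1.
Proof. by rewrite /ind; case: ifP. Qed.

Lemma measurable_ind T : mfunT (ind T).
Proof.
rewrite /ind; apply: measurable_fun_ifT => //.
by apply: measurable_and; apply: measurable_fun_ler.
Qed.

Lemma integral_indE (T : R) (f : R -> \bar R) :
  (\int[mu]_(t in `[0%R, T]) f t = \int[mu]_t ((ind T t)%:E * f t))%E.
Proof.
rewrite integral_mkcond; apply: eq_integral => t _.
rewrite patchE mem_setE in_itv /= /ind.
by case: ifP => _; rewrite ?mul1e// mul0e.
Qed.

Lemma integral_exp_hexp (K a s : R) : 0 < K -> 0 <= a ->
  (\int[mu]_t (expR (- (K * t)) * (K + a) * hexp a (t - s))%:E = (expR (- (K * s)))%:E)%E.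
Proof.
move=> K0 a0; have Ka : 0 < K + a by rewrite ltr_wpDr.
have mh : mfunT (fun t => (hexp (K + a) t)%:E).
  by apply/measurable_EFinP; exact: (@measurable_hexp2 _ _ _ (fun=> K + a) (fun x => x)).
have mhs : mfunT (fun t : R => (hexp (K + a) (t - s)%R)%:E).
  by apply/measurable_EFinP; apply: measurable_hexp2 => //; exact: measurable_funB.
transitivity (\int[mu]_t ((expR (- (K * s)) * (K + a))%:E * (hexp (K + a) (t - s)%R)%:E))%E.
  apply: eq_integral => t _; rewrite -EFinM; congr EFin; rewrite /hexp; case: ifP => _; last by rewrite !mulr0.
  rewrite -!mulrA (mulrCA (expR (- (K * s)))) (mulrCA (expR _)) -!expRD; congr (_ * expR _).
  by ring.
rewrite ge0_integralZl//; last 2 first.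
- by move=> t _; rewrite lee_fin hexp_ge0.
- by rewrite lee_fin mulr_ge0 ?expR_ge0// ltW.
rewrite (ge0_integral_shift (- s) mh); last by move=> t; rewrite lee_fin hexp_ge0.
by rewrite integral_hexp// -EFinM -mulrA mulfV ?mulr1// gt_eqF.
Qed.

Lemma integral_ind_hexp (T a s : R) : 0 <= a -> 0 <= s ->
  ((hexp a (T - s))%:E + \int[mu]_t (ind T t * a * hexp a (t - s))%:E = (ind T s)%:E)%E.
Proof.
move=> a0 s0; have [sT|Ts] := leP s T; last first.
  rewrite {1}/hexp {2}/ind subr_ge0 s0/= leNgt Ts/= add0e integral0_eq// => t _.
  rewrite /hexp /ind; case: ifP => [/andP[_ tT]|]; last by rewrite !mul0r.
  by rewrite subr_ge0 leNgt (le_lt_trans tT Ts)/= mulr0.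
have d (t : R) : is_derive t 1 (fun t => - expR (- (a * (t - s)))) (a * expR (- (a * (t - s)))).
  have dz (c : R) : is_derive t 1 (fun t : R => t - c) 1.
    by have := isdD (is_derive_id t (1 : R)) (is_derive_cst (- c) t (1 : R)); rewrite addr0.
  have := isdZ (-1) (@isd_comp _ expR (fun t => - a * (t - s)) t _ _ (is_derive_expR (- a * (t - s))) (isdZ (- a) (dz s))).
  rewrite [X in is_derive _ _ X _ -> _](_ : _ = (fun t => - expR (- (a * (t - s))))).
    by move=> h; apply: (is_derive_eq h); rewrite (mulNr a); set e := expR _; ring.
  by apply/funext => x; rewrite mulN1r mulNr.
have c : continuous (fun t : R => a * expR (- (a * (t - s)))).
  move=> t; apply: cvgM; first exact: cvg_cst.
  apply: (@continuous_comp _ _ _ (fun t => - (a * (t - s))) expR); last exact: continuous_expR.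
  by apply: cvgN; apply: cvgM; [exact: cvg_cst|apply: cvgB => //; exact: cvg_cst].
have := Rintegral_FTC sT d c; rewrite subrr mulr0 oppr0 expR0 => E.
have i := continuous_itv_integrable s T c.
have -> : (\int[mu]_t (ind T t * a * hexp a (t - s))%:E = \int[mu]_(t in `[s, T]) (a * expR (- (a * (t - s))))%:E)%E.
  rewrite [RHS]integral_mkcond; apply: eq_integral => t _.
  rewrite patchE mem_setE in_itv /= /ind /hexp subr_ge0.
  case: (leP s t) => st /=; last by rewrite mulr0.
  by rewrite (le_trans s0 st)/=; case: ifP => _; rewrite ?mul1r// !mul0r.
rewrite -(fineK (integrable_fin_num _ i))// -[fine _]/(\int[mu]_(t in `[s, T]) (a * expR (- (a * (t - s))))) E.
by rewrite -EFinD /hexp /ind subr_ge0 s0 sT/=; congr EFin; ring.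
Qed.

Lemma ge0_intD (f g : R -> \bar R) : mfunT f -> mfunT g ->
  (forall x, 0 <= f x)%E -> (forall x, 0 <= g x)%E ->
  (\int[mu]_x f x + \int[mu]_x g x = \int[mu]_x (f x + g x))%E.
Proof. by move=> mf mg f0 g0; rewrite ge0_integralD. Qed.

Definition duh (f : R -> R -> R) (t xi : R) : \bar R :=
  (\int[mu]_s (hexp `|xi| (t - s) * f s xi)%:E)%E.

Section Kernel.
Variable f : R -> R -> R.
Hypothesis mf : mfunT (fun z : R * R => f z.1 z.2).
Hypothesis f0 : forall s xi, 0 <= f s xi.

Lemma duh_ge0 t xi : (0 <= duh f t xi)%E.
Proof. by apply: integral_ge0 => s _; rewrite lee_fin mulr_ge0 ?hexp_ge0. Qed.

Lemma measurable_duh_int : mfunT (fun z : (R * R) * R =>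
  hexp `|z.1.2| (z.1.1 - z.2) * f z.2 z.1.2).
Proof.
have m1 : mfunT (fun z : (R * R) * R => z.1.1).
  exact: (measurableT_comp measurable_fst measurable_fst).
have m2 : mfunT (fun z : (R * R) * R => z.1.2).
  exact: (measurableT_comp measurable_snd measurable_fst).
apply: measurable_funM.
  apply: measurable_hexp2; first exact: (measurableT_comp measurable_normr1 m2).
  by apply: measurable_funB => //; exact: measurable_snd.
exact: (measurableT_comp mf (measurable_fun_pair measurable_snd m2)).
Qed.

Lemma measurable_duh : mfunT (fun z : R * R => duh f z.1 z.2).
Proof.
apply: (@measurable_ge0_integral _ _ _ (fun z : (R * R) * R =>
  (hexp `|z.1.2| (z.1.1 - z.2) * f z.2 z.1.2)%:E)).
  by apply/measurable_EFinP; exact: measurable_duh_int.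
by move=> z; rewrite lee_fin mulr_ge0 ?hexp_ge0.
Qed.

Lemma duh_tonelli (k : R -> R -> R) : mfunT (fun z : R * R => k z.1 z.2) ->
  (forall t xi, 0 <= k t xi) ->
  (\int[mu]_t \int[mu]_xi ((k t xi)%:E * duh f t xi) =
   \int[mu]_s \int[mu]_xi ((f s xi)%:E * \int[mu]_t (k t xi * hexp `|xi| (t - s))%:E))%E.
Proof.
move=> mk k0.
have mg : mfunT (fun z : (R * R) * R => k z.1.1 z.1.2 * (hexp `|z.1.2| (z.1.1 - z.2) * f z.2 z.1.2)).
  by apply: measurable_funM; [exact: (measurableT_comp mk measurable_fst)|exact: measurable_duh_int].
rewrite Tonelli; last 2 first.
- apply: emeasurable_funM; last exact: measurable_duh.
  exact/measurable_EFinP.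
- by move=> t xi; rewrite mule_ge0 ?lee_fin// duh_ge0.
rewrite [RHS]Tonelli; last 2 first.
- apply: emeasurable_funM; first exact/measurable_EFinP.
  apply: (@measurable_ge0_integral _ _ _ (fun z : (R * R) * R => (k z.2 z.1.2 * hexp `|z.1.2| (z.2 - z.1.1))%:E)).
    apply/measurable_EFinP; apply: measurable_funM.
      apply: (measurableT_comp mk (measurable_fun_pair measurable_snd _)).
      exact: (measurableT_comp measurable_snd measurable_fst).
    apply: measurable_hexp2.
      exact: (measurableT_comp measurable_normr1 (measurableT_comp measurable_snd measurable_fst)).
    apply: measurable_funB; first exact: measurable_snd.
    exact: (measurableT_comp measurable_fst measurable_fst).
  by move=> z; rewrite lee_fin mulr_ge0 ?hexp_ge0.
- by move=> t xi; rewrite mule_ge0 ?lee_fin//; apply: integral_ge0 => s _; rewrite lee_fin mulr_ge0 ?hexp_ge0.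
apply: eq_integral => xi _.
have mts : mfunT (fun z : R * R => k z.1 xi * (hexp `|xi| (z.1 - z.2) * f z.2 xi)).
  exact: (measurableT_comp mg (measurable_fun_pair (measurable_fun_pair measurable_fst (measurable_cst xi)) measurable_snd)).
transitivity (\int[mu]_t \int[mu]_s (k t xi * (hexp `|xi| (t - s) * f s xi))%:E)%E.
  apply: eq_integral => t _; rewrite /duh -ge0_integralZl ?lee_fin//; last by move=> s _; rewrite lee_fin mulr_ge0 ?hexp_ge0.
  apply/measurable_EFinP; exact: (measurableT_comp measurable_duh_int (pair1_measurable (t, xi))).
rewrite Tonelli; last 2 first.
- exact/measurable_EFinP.
- by move=> t s; rewrite lee_fin !mulr_ge0 ?hexp_ge0.
apply: eq_integral => s _; rewrite -ge0_integralZl ?lee_fin//.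
- by apply: eq_integral => t _; rewrite -EFinM; congr EFin; ring.
- apply/measurable_EFinP; apply: measurable_funM.
    exact: (measurableT_comp mk (pair2_measurable xi)).
  by apply: measurable_hexp2 => //; exact: measurable_funB.
- by move=> t _; rewrite lee_fin mulr_ge0 ?hexp_ge0.
Qed.

End Kernel.

Implicit Types (F : R -> R -> R[i]) (w : R -> R).

Definition Sd F (t xi : R) : R[i] := cintegral (fun s => (hexp `|xi| (t - s))%:C * F s xi).

Definition nF F (t xi : R) : R := normc (F t xi).

Lemma measurable_nF F : cmeas (fun z : R * R => F z.1 z.2) ->
  mfunT (fun z : R * R => nF F z.1 z.2).
Proof. exact: cmeas_norm. Qed.

Lemma cmeas_Sd_int F : cmeas (fun z : R * R => F z.1 z.2) ->
  cmeas (fun z : (R * R) * R => (hexp `|z.1.2| (z.1.1 - z.2))%:C * F z.2 z.1.2).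
Proof.
move=> mF.
have m1 : mfunT (fun z : (R * R) * R => z.1.1).
  exact: (measurableT_comp measurable_fst measurable_fst).
have m2 : mfunT (fun z : (R * R) * R => z.1.2).
  exact: (measurableT_comp measurable_snd measurable_fst).
apply: cmeasM; last exact: (cmeas_comp mF (measurable_fun_pair measurable_snd m2)).
apply: (@cmeasC _ _ _ (fun z : (R * R) * R => hexp `|z.1.2| (z.1.1 - z.2))).
apply: measurable_hexp2; first exact: (measurableT_comp measurable_normr1 m2).
by apply: measurable_funB => //; exact: measurable_snd.
Qed.

Lemma cmeas_Sd F : cmeas (fun z : R * R => F z.1 z.2) -> cmeas (fun z : R * R => Sd F z.1 z.2).
Proof.
move=> mF; exact: (@cmeas_cintegral _ _ _ (fun z : (R * R) * R =>
  (hexp `|z.1.2| (z.1.1 - z.2))%:C * F z.2 z.1.2) (cmeas_Sd_int mF)).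
Qed.

Lemma Sd_le F t xi : cmeas (fun z : R * R => F z.1 z.2) ->
  ((normc (Sd F t xi))%:E <= duh (nF F) t xi)%E.
Proof.
move=> mF; apply: le_trans (le_normc_cintegral_m _) _.
  exact: (cmeas_comp (cmeas_Sd_int mF) (pair1_measurable (t, xi))).
apply: ge0_le_integral_nomeas => s _; first by rewrite lee_fin normc_ge0.
by rewrite lee_fin Normc.normcM normcC ger0_norm ?hexp_ge0.
Qed.

Lemma cmeas_sec1 F t : cmeas (fun z : R * R => F z.1 z.2) -> cmeas (F t).
Proof. by move=> mF; exact: (cmeas_comp mF (pair1_measurable t)). Qed.

Lemma measurable_wnF w F : mfunT w -> (forall x, 0 <= w x) ->
  cmeas (fun z : R * R => F z.1 z.2) -> mfunT (fun t => wn w (F t)).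
Proof.
move=> mw w0 mF; apply: (@measurable_ge0_integral _ _ _ (fun z : R * R => (w z.2 * normc (F z.1 z.2))%:E)).
  apply/measurable_EFinP; apply: measurable_funM; last exact: cmeas_norm.
  exact: (measurableT_comp mw measurable_snd).
by move=> z; rewrite lee_fin mulr_ge0 ?normc_ge0.
Qed.

Definition NK (K : R) F : \bar R := (\int[mu]_t ((expR (- (K * t)))%:E * L1n (F t)))%E.

Lemma measurable_expK (K : R) : mfunT (fun t : R => expR (- (K * t))).
Proof.
apply: (measurableT_comp (@measurable_expR R)).
by apply: measurableT_comp => //; apply: measurable_funM.
Qed.

Lemma NK_Sd (K : R) F : 0 < K -> cmeas (fun z : R * R => F z.1 z.2) ->
  (\int[mu]_t ((expR (- (K * t)))%:E * (K%:E * L1n (Sd F t) + n1 (Sd F t))) <= NK K F)%E.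
Proof.
move=> K0 mF; have mS := cmeas_Sd mF; have mn := measurable_nF mF.
have n0 s xi : 0 <= nF F s xi by exact: normc_ge0.
pose k (t xi : R) := expR (- (K * t)) * (K + `|xi|).
have mk : mfunT (fun z : R * R => k z.1 z.2).
  apply: measurable_funM; first exact: (measurableT_comp (measurable_expK K) measurable_fst).
  by apply: measurable_funD => //; exact: (measurableT_comp measurable_normr1 measurable_snd).
have k0 t xi : 0 <= k t xi by rewrite mulr_ge0 ?expR_ge0// addr_ge0// ltW.
apply: (@le_trans _ _ (\int[mu]_t \int[mu]_xi ((k t xi)%:E * duh (nF F) t xi))%E).
  apply: ge0_le_integral_nomeas => t _.
    by rewrite mule_ge0 ?lee_fin ?expR_ge0// adde_ge0 ?n1_ge0// mule_ge0 ?L1n_ge0// lee_fin ltW.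
  have mSt := cmeas_sec1 t mS; have m1 := measurable_wn measurable_normr1 mSt.
  have m0 : mfunT (fun xi => (normc (Sd F t xi))%:E) by apply/measurable_EFinP; exact: cmeas_norm.
  rewrite -ge0_integralZl ?lee_fin ?(ltW K0)//; last by move=> xi _; rewrite lee_fin normc_ge0.
  rewrite -ge0_integralD//; last 3 first.
  - by move=> xi _; rewrite -EFinM lee_fin mulr_ge0 ?normc_ge0// ltW.
  - by apply: emeasurable_funM.
  - by move=> xi _; rewrite lee_fin mulr_ge0 ?normc_ge0.
  rewrite -ge0_integralZl ?lee_fin ?expR_ge0//; last 2 first.
  - by apply: emeasurable_funD => //; apply: emeasurable_funM.
  - by move=> xi _; rewrite -EFinM -EFinD lee_fin addr_ge0 ?mulr_ge0 ?normc_ge0// ltW.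
  apply: ge0_le_integral_nomeas => xi _.
    apply: mule_ge0; first by rewrite lee_fin expR_ge0.
    apply: adde_ge0; last by rewrite lee_fin mulr_ge0 ?normc_ge0.
    by apply: mule_ge0; rewrite lee_fin ?normc_ge0 ?(ltW K0).
  rewrite [(k t xi)%:E]EFinM -muleA; apply: lee_wpmul2l; first by rewrite lee_fin expR_ge0.
  apply: le_trans (lee_wpmul2l _ (Sd_le t xi mF)); last by rewrite lee_fin addr_ge0// ltW.
  by rewrite -!EFinM -EFinD mulrDl.
rewrite (duh_tonelli mn n0 mk k0).
apply: ge0_le_integral_nomeas => s _.
  by apply: integral_ge0 => xi _; rewrite mule_ge0 ?lee_fin//; apply: integral_ge0 => t _; rewrite lee_fin mulr_ge0 ?hexp_ge0.
rewrite -ge0_integralZl ?lee_fin ?expR_ge0//; last 2 first.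
- by apply/measurable_EFinP; exact: cmeas_norm (cmeas_sec1 s mF).
- by move=> xi _; rewrite lee_fin normc_ge0.
apply: ge0_le_integral_nomeas => xi _.
  by rewrite mule_ge0 ?lee_fin//; apply: integral_ge0 => t _; rewrite lee_fin mulr_ge0 ?hexp_ge0.
by rewrite integral_exp_hexp// muleC.
Qed.

Definition causal F := forall t xi, t < 0 -> F t xi = 0.

Variable u0 : R -> R[i].
Hypothesis mu0 : cmeas u0.

Definition Sol F (t xi : R) : R[i] := (hexp `|xi| t)%:C * u0 xi - Sd F t xi.

Lemma cmeas_Sol F : cmeas (fun z : R * R => F z.1 z.2) -> cmeas (fun z : R * R => Sol F z.1 z.2).
Proof.
move=> mF; apply: cmeasB; last exact: cmeas_Sd.
apply: cmeasM; last exact: cmeas_pair2.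
apply: (@cmeasC _ _ _ (fun z : R * R => hexp `|z.2| z.1)); apply: measurable_hexp2; last exact: measurable_fst.
exact: (measurableT_comp measurable_normr1 measurable_snd).
Qed.

Lemma Sol_le F t xi : cmeas (fun z : R * R => F z.1 z.2) ->
  ((normc (Sol F t xi))%:E <= (hexp `|xi| t * normc (u0 xi))%:E + duh (nF F) t xi)%E.
Proof.
move=> mF; apply: le_trans (leeD2l _ (Sd_le t xi mF)).
rewrite -EFinD lee_fin; apply: le_trans (normcB _ _) _.
by rewrite Normc.normcM normcC ger0_norm ?hexp_ge0.
Qed.

Lemma Sol_energy w (T : R) F : mfunT w -> (forall x, 0 <= w x) -> 0 <= T ->
  cmeas (fun z : R * R => F z.1 z.2) -> causal F ->
  (wn w (Sol F T) + \int[mu]_(t in `[0%R, T]) wn (fun x => (`|x| * w x)%R) (Sol F t) <=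
   wn w u0 + \int[mu]_(s in `[0%R, T]) wn w (F s))%E.
Proof.
move=> mw w0 T0 mF cF; have mn := measurable_nF mF.
have n0 s xi : 0 <= nF F s xi by exact: normc_ge0.
have mS := cmeas_Sol mF.
pose h (t xi : R) : \bar R := (hexp `|xi| t * normc (u0 xi))%:E.
have h0 t xi : (0 <= h t xi)%E by rewrite lee_fin mulr_ge0 ?hexp_ge0 ?normc_ge0.
have mh : mfunT (fun z : R * R => h z.1 z.2).
  apply/measurable_EFinP; apply: measurable_funM.
    apply: measurable_hexp2; last exact: measurable_fst.
    exact: (measurableT_comp measurable_normr1 measurable_snd).
  exact: (measurableT_comp (cmeas_norm mu0) measurable_snd).
have md := measurable_duh mn n0; have d0 := duh_ge0 n0.
pose k (t xi : R) := ind T t * (`|xi| * w xi).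
have mk : mfunT (fun z : R * R => k z.1 z.2).
  apply: measurable_funM; first exact: (measurableT_comp (measurable_ind T) measurable_fst).
  apply: measurable_funM; first exact: (measurableT_comp measurable_normr1 measurable_snd).
  exact: (measurableT_comp mw measurable_snd).
have k0 t xi : 0 <= k t xi by rewrite !mulr_ge0// ind_ge0.
have mwE : mfunT (fun xi => (w xi)%:E) by exact/measurable_EFinP.
have A1 : (wn w (Sol F T) <= \int[mu]_xi ((w xi)%:E * h T xi) + \int[mu]_xi ((w xi)%:E * duh (nF F) T xi))%E.
  have p1 xi : (0 <= (w xi)%:E * h T xi)%E by rewrite mule_ge0// lee_fin.
  have p2 xi : (0 <= (w xi)%:E * duh (nF F) T xi)%E by rewrite mule_ge0// lee_fin.
  have q1 := emeasurable_funM mwE (measurableT_comp mh (pair1_measurable T)).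
  have q2 := emeasurable_funM mwE (measurableT_comp md (pair1_measurable T)).
  rewrite (ge0_intD q1 q2 p1 p2).
  apply: ge0_le_integral_nomeas => xi _; first by rewrite lee_fin mulr_ge0 ?normc_ge0.
  rewrite EFinM /= -ge0_muleDr ?h0 ?d0//; apply: lee_wpmul2l; first by rewrite lee_fin.
  exact: Sol_le.
have A2 : (\int[mu]_(t in `[0%R, T]) wn (fun x => (`|x| * w x)%R) (Sol F t) <=
    \int[mu]_t \int[mu]_xi ((k t xi)%:E * h t xi) + \int[mu]_t \int[mu]_xi ((k t xi)%:E * duh (nF F) t xi))%E.
  have mkE : mfunT (fun z : R * R => (k z.1 z.2)%:E) by exact/measurable_EFinP.
  have mkh := emeasurable_funM mkE mh; have mkd := emeasurable_funM mkE md.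
  have kh0 t xi : (0 <= (k t xi)%:E * h t xi)%E by rewrite mule_ge0// lee_fin.
  have kd0 t xi : (0 <= (k t xi)%:E * duh (nF F) t xi)%E by rewrite mule_ge0// lee_fin.
  have p1 t : (0 <= \int[mu]_xi ((k t xi)%:E * h t xi))%E by exact: integral_ge0.
  have p2 t : (0 <= \int[mu]_xi ((k t xi)%:E * duh (nF F) t xi))%E by exact: integral_ge0.
  have q1 := measurable_ge0_integral mkh (fun z => kh0 z.1 z.2).
  have q2 := measurable_ge0_integral mkd (fun z => kd0 z.1 z.2).
  rewrite integral_indE (ge0_intD q1 q2 p1 p2).
  apply: ge0_le_integral_nomeas => t _.
    rewrite mule_ge0 ?lee_fin ?ind_ge0//; apply: wn_ge0 => x; exact: mulr_ge0.
  rewrite (ge0_intD (measurableT_comp mkh (pair1_measurable t)) (measurableT_comp mkd (pair1_measurable t))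
    (kh0 t) (kd0 t)).
  rewrite -ge0_integralZl ?lee_fin ?ind_ge0//; last 2 first.
  - apply: measurable_wn; first by apply: measurable_funM => //; exact: measurable_normr1.
    exact: cmeas_sec1.
  - by move=> xi _; rewrite lee_fin !mulr_ge0 ?normc_ge0.
  apply: ge0_le_integral_nomeas => xi _.
    by rewrite -EFinM lee_fin !mulr_ge0 ?normc_ge0 ?ind_ge0.
  have -> : ((ind T t)%:E * (`|xi| * w xi * normc (Sol F t xi))%:E = (k t xi)%:E * (normc (Sol F t xi))%:E)%E.
    by rewrite -!EFinM mulrA.
  rewrite /= -ge0_muleDr ?h0 ?d0//; apply: lee_wpmul2l; first by rewrite lee_fin.
  exact: Sol_le.
apply: le_trans (leeD A1 A2) _; rewrite addeACA; apply: leeD.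
  rewrite Tonelli; last 2 first.
  - by apply: emeasurable_funM => //; exact/measurable_EFinP.
  - by move=> t xi; rewrite mule_ge0// lee_fin.
  have p1 xi : (0 <= (w xi)%:E * h T xi)%E by rewrite mule_ge0// lee_fin.
  have q1 := emeasurable_funM mwE (measurableT_comp mh (pair1_measurable T)).
  have mkhE : mfunT (fun z : R * R => ((k z.2 z.1)%:E * h z.2 z.1)%E).
    apply: (measurableT_comp (emeasurable_funM (_ : mfunT (fun z : R * R => (k z.1 z.2)%:E)) mh)
      (measurable_fun_pair measurable_snd measurable_fst)); exact/measurable_EFinP.
  have q2 : mfunT (fun xi => \int[mu]_t ((k t xi)%:E * h t xi))%E.
    by apply: (measurable_ge0_integral mkhE) => z; rewrite mule_ge0// lee_fin.
  have p2 xi : (0 <= \int[mu]_t ((k t xi)%:E * h t xi))%E.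
    by apply: integral_ge0 => t _; rewrite mule_ge0// lee_fin.
  rewrite (ge0_intD q1 q2 p1 p2).
  apply: ge0_le_integral_nomeas => xi _; first by rewrite adde_ge0 ?p1 ?p2.
  have -> : (\int[mu]_t ((k t xi)%:E * h t xi) =
      (w xi * normc (u0 xi))%:E * \int[mu]_t (ind T t * `|xi| * hexp `|xi| (t - 0))%:E)%E.
    rewrite -ge0_integralZl ?lee_fin ?mulr_ge0 ?normc_ge0//.
    - by apply: eq_integral => t _; rewrite -!EFinM /k subr0; congr EFin; ring.
    - apply/measurable_EFinP; apply: measurable_funM.
        by apply: measurable_funM => //; exact: measurable_ind.
      by apply: measurable_hexp2 => //; exact: measurable_funB.
    - by move=> t _; rewrite lee_fin !mulr_ge0 ?hexp_ge0 ?ind_ge0.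
  have -> : ((w xi)%:E * h T xi = (w xi * normc (u0 xi))%:E * (hexp `|xi| (T - 0))%:E)%E.
    by rewrite /h -!EFinM subr0; congr EFin; ring.
  rewrite -ge0_muleDr ?lee_fin ?hexp_ge0//; last first.
    by apply: integral_ge0 => t _; rewrite lee_fin !mulr_ge0 ?hexp_ge0 ?ind_ge0.
  rewrite integral_ind_hexp// -EFinM lee_fin ler_piMr ?mulr_ge0 ?normc_ge0 ?ind_le1//.
rewrite (duh_tonelli mn n0 mk k0) integral_indE.
pose k1 (s xi : R) := w xi * hexp `|xi| (T - s).
have mk1 : mfunT (fun z : R * R => k1 z.1 z.2).
  apply: measurable_funM; first exact: (measurableT_comp mw measurable_snd).
  apply: measurable_hexp2; first exact: (measurableT_comp measurable_normr1 measurable_snd).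
  by apply: measurable_funB => //; exact: measurable_fst.
have k10 s xi : 0 <= k1 s xi by rewrite mulr_ge0 ?hexp_ge0.
have mfk1 : mfunT (fun z : R * R => ((nF F z.1 z.2)%:E * (k1 z.1 z.2)%:E)%E).
  by apply: emeasurable_funM; exact/measurable_EFinP.
have fk10 s xi : (0 <= (nF F s xi)%:E * (k1 s xi)%:E)%E by rewrite mule_ge0 ?lee_fin.
have -> : (\int[mu]_xi ((w xi)%:E * duh (nF F) T xi) = \int[mu]_s \int[mu]_xi ((nF F s xi)%:E * (k1 s xi)%:E))%E.
  rewrite Tonelli//; apply: eq_integral => xi _; rewrite /duh -ge0_integralZl ?lee_fin//.
  - by apply: eq_integral => s _; rewrite -!EFinM /k1; congr EFin; ring.
  - apply/measurable_EFinP; apply: measurable_funM; last exact: (measurableT_comp mn (pair2_measurable xi)).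
    by apply: measurable_hexp2 => //; exact: measurable_funB.
  - by move=> s _; rewrite lee_fin mulr_ge0 ?hexp_ge0.
pose k2 s xi := (\int[mu]_t (k t xi * hexp `|xi| (t - s))%:E)%E.
have k20 s xi : (0 <= k2 s xi)%E by apply: integral_ge0 => t _; rewrite lee_fin mulr_ge0 ?hexp_ge0.
have mk2 : mfunT (fun z : R * R => k2 z.1 z.2).
  apply: (@measurable_ge0_integral _ _ _ (fun z : (R * R) * R => (k z.2 z.1.2 * hexp `|z.1.2| (z.2 - z.1.1))%:E)).
    apply/measurable_EFinP; apply: measurable_funM.
      apply: (measurableT_comp mk (measurable_fun_pair measurable_snd _)).
      exact: (measurableT_comp measurable_snd measurable_fst).
    apply: measurable_hexp2.
      exact: (measurableT_comp measurable_normr1 (measurableT_comp measurable_snd measurable_fst)).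
    apply: measurable_funB; first exact: measurable_snd.
    exact: (measurableT_comp measurable_fst measurable_fst).
  by move=> z; rewrite lee_fin mulr_ge0 ?hexp_ge0.
have mfk2 : mfunT (fun z : R * R => ((nF F z.1 z.2)%:E * k2 z.1 z.2)%E).
  by apply: emeasurable_funM => //; exact/measurable_EFinP.
have fk20 s xi : (0 <= (nF F s xi)%:E * k2 s xi)%E by rewrite mule_ge0 ?lee_fin.
have p1 s : (0 <= \int[mu]_xi ((nF F s xi)%:E * (k1 s xi)%:E))%E by exact: integral_ge0.
have p2 s : (0 <= \int[mu]_xi ((nF F s xi)%:E * k2 s xi))%E by exact: integral_ge0.
have q1 := measurable_ge0_integral mfk1 (fun z => fk10 z.1 z.2).
have q2 := measurable_ge0_integral mfk2 (fun z => fk20 z.1 z.2).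
rewrite -/(k2 _ _) (ge0_intD q1 q2 p1 p2).
apply: ge0_le_integral_nomeas => s _; first by rewrite adde_ge0 ?p1 ?p2.
rewrite (ge0_intD (measurableT_comp mfk1 (pair1_measurable s)) (measurableT_comp mfk2 (pair1_measurable s))
    (fk10 s) (fk20 s)).
rewrite -ge0_integralZl ?lee_fin ?ind_ge0//; last 2 first.
- by apply: measurable_wn => //; exact: cmeas_sec1.
- by move=> xi _; rewrite lee_fin mulr_ge0 ?normc_ge0.
apply: ge0_le_integral_nomeas => xi _; first exact: (adde_ge0 (fk10 s xi) (fk20 s xi)).
rewrite /=; have [s0|s0] := ltP s 0.
  by rewrite /nF (cF _ _ s0) normc0 !mul0e add0e mulr0 mule0.
rewrite -ge0_muleDr ?lee_fin//.
have -> : ((k1 s xi)%:E + k2 s xi = (w xi)%:E * (ind T s)%:E)%E.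
  rewrite -(@integral_ind_hexp T `|xi| s)// ge0_muleDr ?lee_fin ?hexp_ge0//; last first.
    by apply: integral_ge0 => t _; rewrite lee_fin !mulr_ge0 ?hexp_ge0 ?ind_ge0.
  congr (_ + _)%E; rewrite -ge0_integralZl ?lee_fin//.
  - by apply: eq_integral => t _; rewrite -EFinM /k; congr EFin; ring.
  - apply/measurable_EFinP; apply: measurable_funM.
      by apply: measurable_funM => //; exact: measurable_ind.
    by apply: measurable_hexp2 => //; exact: measurable_funB.
  - by move=> t _; rewrite lee_fin !mulr_ge0 ?hexp_ge0 ?ind_ge0.
by rewrite -!EFinM lee_fin /nF le_eqVlt; apply/orP; left; apply/eqP; ring.
Qed.

End Duhamel.

Section Limit.
Context {R : realType}.
Local Notation mu := (@lebesgue_measure R).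
Implicit Types (F G : R -> R -> R[i]) (W : R -> R -> R).

Lemma ae_fin_integral (f : R -> \bar R) : mfunT f -> (forall x, 0 <= f x)%E ->
  (\int[mu]_x f x < +oo)%E -> {ae mu, forall x, (f x < +oo)%E}.
Proof.
move=> mf f0 fi; have i : mu.-integrable setT f.
  apply/integrableP; split => //.
  by rewrite (@eq_integral _ _ _ mu setT f)// => x _; rewrite gee0_abs.
by apply: aeS (integrable_ae measurableT i) => x /(_ I); rewrite ge0_fin_numE.
Qed.

Lemma ae_eq0_integral (f : R -> \bar R) : mfunT f -> (forall x, 0 <= f x)%E ->
  (\int[mu]_x f x = 0)%E -> {ae mu, forall x, f x = 0}.
Proof.
move=> mf f0 fi; have [h _] := ae_eq_integral_abs mu measurableT mf.
apply: aeS (h _) => [x /(_ I)//|].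
by rewrite -fi; apply: eq_integral => x _; rewrite gee0_abs.
Qed.

Lemma ccvg_norm (u : nat -> R[i]) l : ccvg u l -> (normc (u n))%:E @[n --> \oo] --> (normc l)%:E.
Proof.
move=> [u1 u2]; apply: cvg_EFin; first exact: nearW.
have nE (z : R[i]) : normc z = Num.sqrt (Re z ^+ 2 + Im z ^+ 2) by case: z.
rewrite nE (_ : fine \o _ = (fun n => Num.sqrt (Re (u n) ^+ 2 + Im (u n) ^+ 2))); last first.
  by apply/funext => n /=; rewrite nE.
apply: (cvg_comp (fun n => Re (u n) ^+ 2 + Im (u n) ^+ 2) (@Num.sqrt R)); last exact: sqrt_continuous.
by apply: cvgD; rewrite expr2; apply: cvgM.
Qed.

Lemma limn_einf_ge0 (u : nat -> \bar R) : (forall n, 0 <= u n)%E -> (0 <= limn_einf u)%E.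
Proof.
move=> u0; rewrite limn_einf_lim; apply: lime_ge; first exact: is_cvg_einfs.
by apply: nearW => n; apply: le_ereal_inf_tmp => _ [m /= nm <-].
Qed.

Lemma limn_einf_le (u : nat -> \bar R) (B : \bar R) : (forall n, u n <= B)%E -> (limn_einf u <= B)%E.
Proof.
move=> uB; rewrite limn_einf_lim; apply: lime_le; first exact: is_cvg_einfs.
by apply: nearW => n; apply: ge_ereal_inf; exists (u n) => //; exists n => /=.
Qed.

Lemma fatou_ae (f_ : nat -> R -> \bar R) (f : R -> \bar R) :
  (forall n, mfunT (f_ n)) -> (forall n x, 0 <= f_ n x)%E -> (forall x, 0 <= f x)%E ->
  {ae mu, forall x, (f x <= limn_einf (f_ ^~ x))%E} ->
  (\int[mu]_x f x <= limn_einf (fun n => \int[mu]_x f_ n x))%E.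
Proof.
move=> mf f0 g0 h.
have := @fatou _ _ _ mu setT measurableT f_ mf (fun n x _ => f0 n x); apply: le_trans.
apply: ae_ge0_le_integral_nomeas => // [x _|]; first exact: limn_einf_ge0.
by apply: aeS h.
Qed.

Definition WN W F : \bar R := (\int[mu]_t \int[mu]_xi (W t xi * normc (F t xi))%:E)%E.

Definition WNd W F G := WN W (fun t xi => F t xi - G t xi).

Section WN.
Variable W : R -> R -> R.
Hypothesis mW : mfunT (fun z : R * R => W z.1 z.2).
Hypothesis W0 : forall t xi, 0 <= W t xi.

Lemma WN_int_ge0 F t xi : (0 <= (W t xi * normc (F t xi))%:E)%E.
Proof. by rewrite lee_fin mulr_ge0 ?normc_ge0. Qed.

Lemma WN_sec_ge0 F t : (0 <= \int[mu]_xi (W t xi * normc (F t xi))%:E)%E.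
Proof. by apply: integral_ge0 => xi _; exact: WN_int_ge0. Qed.

Lemma WN_ge0 F : (0 <= WN W F)%E.
Proof. by apply: integral_ge0 => t _; exact: WN_sec_ge0. Qed.

Lemma measurable_WN_int F : cmeas (fun z : R * R => F z.1 z.2) ->
  mfunT (fun z : R * R => (W z.1 z.2 * normc (F z.1 z.2))%:E).
Proof. by move=> mF; apply/measurable_EFinP; apply: measurable_funM => //; exact: cmeas_norm. Qed.

Lemma measurable_WN_int1 F t : cmeas (fun z : R * R => F z.1 z.2) ->
  mfunT (fun xi : R => (W t xi * normc (F t xi))%:E).
Proof. by move=> mF; exact: (measurableT_comp (measurable_WN_int mF) (pair1_measurable t)). Qed.

Lemma measurable_WN_sec F : cmeas (fun z : R * R => F z.1 z.2) ->
  mfunT (fun t : R => \int[mu]_xi (W t xi * normc (F t xi))%:E)%E.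
Proof.
by move=> mF; apply: (measurable_ge0_integral (measurable_WN_int mF)) => z; exact: WN_int_ge0.
Qed.

Lemma WN_fatou (F_ : nat -> R -> R -> R[i]) F B :
  (forall n, cmeas (fun z : R * R => F_ n z.1 z.2)) ->
  {ae mu, forall t, {ae mu, forall xi, ccvg (fun n => F_ n t xi) (F t xi)}} ->
  (forall n, WN W (F_ n) <= B)%E -> (WN W F <= B)%E.
Proof.
move=> mF h FB; apply: le_trans (limn_einf_le FB).
apply: (@fatou_ae (fun n t => \int[mu]_xi (W t xi * normc (F_ n t xi))%:E)%E
  (fun t => \int[mu]_xi (W t xi * normc (F t xi))%:E)%E).
- by move=> n; exact: measurable_WN_sec.
- by move=> n t; exact: WN_sec_ge0.
- by move=> t; exact: WN_sec_ge0.
apply: aeS h => t h.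
apply: (@fatou_ae (fun n xi => (W t xi * normc (F_ n t xi))%:E) (fun xi => (W t xi * normc (F t xi))%:E)).
- by move=> n; exact: measurable_WN_int1.
- by move=> n xi; exact: WN_int_ge0.
- by move=> xi; exact: WN_int_ge0.
apply: aeS h => xi /ccvg_norm c.
have cc : (W t xi * normc (F_ n t xi))%:E @[n --> \oo] --> (W t xi * normc (F t xi))%:E.
  rewrite EFinM (_ : (fun n => _) = (fun n => (W t xi)%:E * (normc (F_ n t xi))%:E)%E); last exact/funext.
  exact: cvgeZl.
by have [-> _] := cvg_limn_einf_sup cc.
Qed.

Lemma WNd_tri F G H : cmeas (fun z : R * R => F z.1 z.2) -> cmeas (fun z : R * R => G z.1 z.2) ->
  cmeas (fun z : R * R => H z.1 z.2) -> (WNd W F H <= WNd W F G + WNd W G H)%E.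
Proof.
move=> mF mG mH.
have mFG : cmeas (fun z : R * R => F z.1 z.2 - G z.1 z.2) by exact: cmeasB.
have mGH : cmeas (fun z : R * R => G z.1 z.2 - H z.1 z.2) by exact: cmeasB.
rewrite /WNd /WN (ge0_intD (@measurable_WN_sec (fun t xi => F t xi - G t xi) mFG)
  (@measurable_WN_sec (fun t xi => G t xi - H t xi) mGH) (WN_sec_ge0 _) (WN_sec_ge0 _)).
apply: ge0_le_integral_nomeas => t _; first exact: (WN_sec_ge0 (fun t xi => F t xi - H t xi)).
rewrite (ge0_intD (@measurable_WN_int1 (fun t xi => F t xi - G t xi) t mFG)
  (@measurable_WN_int1 (fun t xi => G t xi - H t xi) t mGH) (WN_int_ge0 _ t) (WN_int_ge0 _ t)).
apply: ge0_le_integral_nomeas => xi _; first exact: (WN_int_ge0 (fun t xi => F t xi - H t xi)).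
rewrite -EFinD lee_fin -mulrDr ler_wpM2l//.
by apply: le_trans (le_normcD _ _); rewrite addrA subrK.
Qed.

Lemma WNdC F G : WNd W F G = WNd W G F.
Proof.
by apply: eq_integral => t _; apply: eq_integral => xi _; rewrite normcBC.
Qed.

Lemma WN_eq0 F : (forall t xi, 0 < W t xi) -> cmeas (fun z : R * R => F z.1 z.2) -> WN W F = 0 ->
  {ae mu, forall t, {ae mu, forall xi, F t xi = 0}}.
Proof.
move=> Wp mF /(ae_eq0_integral (measurable_WN_sec mF) (WN_sec_ge0 _)).
apply: aeS => t /(ae_eq0_integral (measurable_WN_int1 t mF) (WN_int_ge0 _ t)).
apply: aeS => xi [] /eqP; rewrite mulf_eq0 gt_eqF//= => /eqP; exact: normc_eq0.
Qed.

End WN.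

Section Sequence.
Variable W : R -> R -> R.
Hypothesis mW : mfunT (fun z : R * R => W z.1 z.2).
Hypothesis Wp : forall t xi, 0 < W t xi.
Variable F_ : nat -> R -> R -> R[i].
Hypothesis mF : forall n, cmeas (fun z : R * R => F_ n z.1 z.2).
Variable c : R.
Hypothesis hc : forall n, (WNd W (F_ n.+1) (F_ n) <= (c / 2 ^+ n)%:E)%E.

Let W0 t xi : 0 <= W t xi. Proof. exact: ltW. Qed.

Definition incr n t xi : \bar R := (normc (F_ n.+1 t xi - F_ n t xi))%:E.
Definition incrs t xi : \bar R := (\sum_(n <oo) incr n t xi)%E.

Lemma incr_ge0 n t xi : (0 <= incr n t xi)%E. Proof. by rewrite lee_fin normc_ge0. Qed.

Lemma incrs_ge0 t xi : (0 <= incrs t xi)%E.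
Proof. by apply: nneseries_ge0 => n _ _; exact: incr_ge0. Qed.

Lemma measurable_incr n : mfunT (fun z : R * R => incr n z.1 z.2).
Proof.
apply/measurable_EFinP.
by apply: (@cmeas_norm _ _ _ (fun z : R * R => F_ n.+1 z.1 z.2 - F_ n z.1 z.2)); exact: cmeasB.
Qed.

Lemma measurable_incrs : mfunT (fun z : R * R => incrs z.1 z.2).
Proof.
have := @ge0_emeasurable_sum _ _ R setT (fun n (z : R * R) => incr n z.1 z.2) xpredT
  (fun k x _ _ => incr_ge0 k _ _) (fun k _ => measurable_incr k).
by congr measurable_fun.
Qed.

Lemma incrs_fin_cvg t xi : (incrs t xi < +oo)%E -> exists l, ccvg (fun n => F_ n t xi) l.
Proof.
move=> fin.
have key (h : R[i] -> R) : (forall z w, h (z - w) = h z - h w) -> (forall z, `|h z| <= normc z) ->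
    exists l : R, h (F_ n t xi) @[n --> \oo] --> l.
  move=> hB hn; pose v n := h (F_ n t xi).
  have cv : cvgn (series (telescope v)).
    apply: normed_cvg; apply: (@nondecreasing_is_cvgn _ (fun n => \sum_(0 <= k < n) `|telescope v k|)).
      by apply/nondecreasing_seqP => n; rewrite big_nat_recr//= lerDl.
    exists (fine (incrs t xi)) => _ [n _ <-].
    rewrite -lee_fin fineK; last by rewrite ge0_fin_numE// incrs_ge0.
    apply: le_trans (nneseries_lim_ge (m := 0) n _); last by move=> k _ _; exact: incr_ge0.
    rewrite -sumEFin; apply: lee_sum => k _.
    by rewrite lee_fin /telescope /= /v -hB; exact: hn.
  exists (limn (series (telescope v)) + v 0%N).
  have cc : (series (telescope v) n + v 0%N) @[n --> \oo] --> limn (series (telescope v)) + v 0%N.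
    by apply: cvgD cv _; exact: cvg_cst.
  rewrite (_ : (fun n => _) = (fun n => series (telescope v) n + v 0%N))//.
  by apply/funext => n; rewrite telescopeK /= subrK.
have [a ha] := key _ ReB Re_le_normc; have [b hb] := key _ ImB Im_le_normc.
by exists (Complex a b).
Qed.

Definition Flim t xi : R[i] :=
  if (incrs t xi < +oo)%E then xget 0 [set l | ccvg (fun n => F_ n t xi) l] else 0.

Lemma Flim_cvg t xi : (incrs t xi < +oo)%E -> ccvg (fun n => F_ n t xi) (Flim t xi).
Proof. by rewrite /Flim => h; rewrite h; have [l hl] := incrs_fin_cvg h; exact: (xgetI 0 hl). Qed.

Lemma cmeas_Flim : cmeas (fun z : R * R => Flim z.1 z.2).
Proof.
apply: (@cmeas_cvg _ _ _ (fun n (z : R * R) => if (incrs z.1 z.2 < +oo)%E then F_ n z.1 z.2 else 0)).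
  move=> n; have mb : mfunT (fun z : R * R => (incrs z.1 z.2 < +oo)%E).
    by apply: measurable_fun_lte => //; exact: measurable_incrs.
  split.
    rewrite (_ : (fun z => _) = (fun z : R * R => if (incrs z.1 z.2 < +oo)%E then Re (F_ n z.1 z.2) else 0)).
      by apply: measurable_fun_ifT => //; exact: cmeas_Re.
    by apply/funext => z; case: ifP.
  rewrite (_ : (fun z => _) = (fun z : R * R => if (incrs z.1 z.2 < +oo)%E then Im (F_ n z.1 z.2) else 0)).
    by apply: measurable_fun_ifT => //; exact: cmeas_Im.
  by apply/funext => z; case: ifP.
move=> z; case: (boolP (incrs z.1 z.2 < +oo)%E) => h; first exact: Flim_cvg.
by rewrite /Flim (negbTE h); exact: ccvg_cst.
Qed.

Lemma integral_incrs : (\int[mu]_t \int[mu]_xi ((W t xi)%:E * incrs t xi) < +oo)%E.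
Proof.
have mWi n : mfunT (fun z : R * R => ((W z.1 z.2)%:E * incr n z.1 z.2)%E).
  by apply: emeasurable_funM; [exact/measurable_EFinP|exact: measurable_incr].
have Wi0 n t xi : (0 <= (W t xi)%:E * incr n t xi)%E by rewrite mule_ge0 ?incr_ge0 ?lee_fin.
have -> : (\int[mu]_t \int[mu]_xi ((W t xi)%:E * incrs t xi) =
    \sum_(n <oo) WNd W (F_ n.+1) (F_ n))%E.
  rewrite -integral_nneseries//; last 2 first.
  - move=> n; apply: (@measurable_WN_sec _ mW W0 (fun t xi => F_ n.+1 t xi - F_ n t xi)).
    exact: cmeasB.
  - by move=> n t _; exact: (WN_sec_ge0 W0 (fun t xi => F_ n.+1 t xi - F_ n t xi)).
  apply: eq_integral => t _; rewrite -integral_nneseries//; last 2 first.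
  - move=> n; apply: (@measurable_WN_int1 _ mW (fun t xi => F_ n.+1 t xi - F_ n t xi)).
    exact: cmeasB.
  - by move=> n xi _; exact: (WN_int_ge0 W0 (fun t xi => F_ n.+1 t xi - F_ n t xi)).
  apply: eq_integral => xi _; rewrite -nneseriesZl ?lee_fin//.
  by move=> n _; exact: incr_ge0.
apply: (@le_lt_trans _ _ (\sum_(n <oo) (c / 2 ^+ n)%:E)%E).
  by apply: lee_nneseries => [n _ _|n _]; [exact: WN_ge0|exact: hc].
have c0 : 0 <= c.
  by have := le_trans (WN_ge0 W0 _) (hc 0); rewrite lee_fin expr0 divr1.
apply: (@le_lt_trans _ _ (2 * c)%:E); last exact: ltry.
apply: lime_le.
  by apply: is_cvg_nneseries => n _ _; rewrite lee_fin divr_ge0 ?exprn_ge0.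
apply: nearW => n; rewrite sumEFin lee_fin.
suff -> : \sum_(0 <= i < n) c / 2 ^+ i = 2 * c - 2 * c / 2 ^+ n.
  by rewrite lerBlDr lerDl divr_ge0 ?mulr_ge0 ?exprn_ge0.
elim: n => [|n IH]; first by rewrite big_nil expr0 divr1 subrr.
by rewrite big_nat_recr//= IH exprS; field; rewrite expf_neq0.
Qed.

Lemma Flim_ae : {ae mu, forall t, {ae mu, forall xi, ccvg (fun n => F_ n t xi) (Flim t xi)}}.
Proof.
have mWi : mfunT (fun z : R * R => ((W z.1 z.2)%:E * incrs z.1 z.2)%E).
  by apply: emeasurable_funM; [exact/measurable_EFinP|exact: measurable_incrs].
have Wi0 t xi : (0 <= (W t xi)%:E * incrs t xi)%E by rewrite mule_ge0 ?incrs_ge0 ?lee_fin.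
have P t : (0 <= \int[mu]_xi ((W t xi)%:E * incrs t xi))%E by exact: integral_ge0.
apply: aeS (ae_fin_integral (measurable_ge0_integral mWi (fun z => Wi0 z.1 z.2)) P integral_incrs) => t h.
have := ae_fin_integral (measurableT_comp mWi (pair1_measurable t)) (Wi0 t) h.
apply: aeS => xi /= h'; apply: Flim_cvg.
by rewrite ltNge; apply: contraTN h'; rewrite leye_eq => /eqP ->; rewrite gt0_muley ?lte_fin// ltxx.
Qed.

Lemma WNd_Flim n : (WNd W Flim (F_ n) <= (2 * c / 2 ^+ n)%:E)%E.
Proof.
have c0 : 0 <= c.
  by have := le_trans (WN_ge0 W0 _) (hc 0); rewrite lee_fin expr0 divr1.
have st m : (WNd W (F_ (m + n)) (F_ n) <= (2 * c / 2 ^+ n - 2 * c / 2 ^+ (m + n))%:E)%E.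
  elim: m => [|m IH].
    rewrite subrr /WNd /WN integral0_eq// => t _; rewrite integral0_eq// => xi _.
    by rewrite add0n subrr normc0 mulr0.
  apply: le_trans (WNd_tri mW W0 (mF _) (mF (m + n)) (mF _)) _.
  apply: le_trans (leeD (hc _) IH) _; rewrite -EFinD lee_fin exprS le_eqVlt; apply/orP; left; apply/eqP.
  by field; rewrite ?expf_neq0.
apply: (@WN_fatou W mW W0 (fun m t xi => F_ (m + n) t xi - F_ n t xi)).
- by move=> m; exact: cmeasB.
- apply: aeS Flim_ae => t; apply: aeS => xi h.
  have h' : ccvg (fun m => F_ (m + n) t xi) (Flim t xi).
    case: h => h1 h2; split; first by rewrite (cvg_shiftn n (fun m => Re (F_ m t xi))).
    by rewrite (cvg_shiftn n (fun m => Im (F_ m t xi))).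
  by apply: ccvgD => //; exact: ccvg_cst.
- move=> m; apply: le_trans (st m) _; rewrite lee_fin lerBlDr lerDl.
  by rewrite divr_ge0 ?mulr_ge0 ?exprn_ge0.
Qed.

Lemma Flim_herm t : (forall n, herm (F_ n t)) -> herm (Flim t).
Proof.
move=> h xi; have iE : incrs t (- xi) = incrs t xi.
  by apply: eq_eseriesr => n _; rewrite /incr !h -conjcB normcJ.
case: (boolP (incrs t xi < +oo)%E) => f; last by rewrite /Flim iE (negbTE f) -[0]/(0%:C) conjcC.
have [a1 a2] := Flim_cvg f; have := f; rewrite -iE => /Flim_cvg b.
apply: ccvg_unique b _; split.
  by rewrite ReJ (_ : (fun n => _) = (fun n => Re (F_ n t xi)))//; apply/funext => n; rewrite h ReJ.
rewrite ImJ (_ : (fun n => _) = (fun n => - Im (F_ n t xi))); last by apply/funext => n; rewrite h ImJ.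
exact: cvgN.
Qed.

Lemma Flim_eq0 t xi : (forall n, F_ n t xi = 0) -> Flim t xi = 0.
Proof.
move=> h; case: (boolP (incrs t xi < +oo)%E) => f; last by rewrite /Flim (negbTE f).
apply: ccvg_unique (Flim_cvg f) _; rewrite (_ : (fun n => _) = (fun=> 0)); first exact: ccvg_cst.
exact/funext.
Qed.

End Sequence.

End Limit.

Section RintegralN.
Context {R : realType}.
Local Notation mu := (@lebesgue_measure R).

Lemma RintegralN_gen (f : R -> R) : \int[mu]_x (- f x) = - \int[mu]_x f x.
Proof.
rewrite /Rintegral (integralE mu setT (fun x => (f x)%:E)) (integralE mu setT (fun x => (- f x)%:E)).
have -> : (fun x => (- f x)%:E)^\+%E = (fun x => (f x)%:E)^\-%E by rewrite -funeposN; congr (_^\+%E).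
have -> : (fun x => (- f x)%:E)^\-%E = (fun x => (f x)%:E)^\+%E by rewrite -funenegN; congr (_^\-%E).
have p0 : (0 <= \int[mu]_x (fun x => (f x)%:E)^\+ x)%E by apply: integral_ge0 => x _; exact: funepos_ge0.
have n0 : (0 <= \int[mu]_x (fun x => (f x)%:E)^\- x)%E by apply: integral_ge0 => x _; exact: funeneg_ge0.
move: p0 n0; case: (\int[mu]_x _)%E => [r||]; case: (\int[mu]_x _)%E => [s||] //= _ _; rewrite ?oppr0//.
by rewrite opprB.
Qed.

Lemma cintegralJ_gen (f : R -> R[i]) : cintegral (fun x => conjc (f x)) = conjc (cintegral f).
Proof.
apply: complex_eqP; rewrite ?ReJ ?ImJ ?Re_cintegral ?Im_cintegral.
  by apply: eq_Rintegral => x _; rewrite ReJ.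
by rewrite -RintegralN_gen; apply: eq_Rintegral => x _; rewrite ImJ.
Qed.

Lemma conjc0 : conjc (0 : R[i]) = 0.
Proof. by apply: complex_eqP => //=; rewrite oppr0. Qed.

Lemma Bil_herm (delta : R) (p q : R -> R[i]) : cmeas p -> cmeas q -> herm p -> herm q ->
  herm (Bil delta p q).
Proof.
move=> mp mq hp hq x; rewrite /Bil conjcM conjcC; congr (_ * _).
rewrite -(@cintegral_refl _ 0); last exact: cmeas_Bil_sec.
rewrite -cintegralJ_gen; apply: eq_cintegral => y.
rewrite sub0r !conjcM conjcC -hp -hq opprB opprK; congr (_%:C * (p _ * _)); last by ring.
by rewrite /ker normrN (_ : - x - - y = - (x - y)) ?sgrN; ring.
Qed.

Lemma Sol_herm (u0 : R -> R[i]) (F : R -> R -> R[i]) t : herm u0 -> (forall s, herm (F s)) ->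
  herm (Sol u0 F t).
Proof.
move=> h0 hF xi; rewrite /Sol /Sd normrN h0 conjcB conjcM conjcC; congr (_ - _).
by rewrite -cintegralJ_gen; apply: eq_cintegral => s; rewrite conjcM conjcC -hF.
Qed.

End RintegralN.

Section Picard.
Context {R : realType}.
Local Notation mu := (@lebesgue_measure R).
Local Notation cmeas2 F := (cmeas (fun z : R * R => F z.1 z.2)).
Implicit Types (F G : R -> R -> R[i]) (u v : R -> R[i]).
Variable delta : R.
Local Notation C0 := (C0 delta).
Local Notation Bil := (Bil delta).
Variable u0 : R -> R[i].
Hypotheses (mu0 : cmeas u0) (hu0 : herm u0).
Variables (a1 E b : R).
Hypotheses (a1_gt0 : 0 < a1) (E_ge0 : 0 <= E) (b_ge0 : 0 <= b).
Hypotheses (u0E : (A1n u0 <= E%:E)%E) (small : 2 * C0 * a1 <= 1).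
Hypothesis bE : 2 * C0 * a1 * (E + b) <= b.
Local Notation Sol := (Sol u0).

(* Rescales [u] into the L1 ball of radius [a1]. *)
Definition alpha u : R := a1 / Num.max a1 (fine (L1n u)).

Lemma max_gt0 (x : R) : 0 < Num.max a1 x.
Proof. by rewrite lt_max a1_gt0. Qed.

Lemma alpha_ge0 u : 0 <= alpha u.
Proof. by rewrite divr_ge0 ?ltW ?max_gt0. Qed.

Lemma alpha_le1 u : alpha u <= 1.
Proof. by rewrite ler_pdivrMr ?max_gt0// mul1r le_max lexx. Qed.

Lemma alpha1 u : (L1n u <= a1%:E)%E -> alpha u = 1.
Proof.
move=> h; rewrite /alpha max_l ?divff ?gt_eqF//.
rewrite -lee_fin fineK// ge0_fin_numE ?L1n_ge0//; exact: le_lt_trans h (ltry _).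
Qed.

Lemma alpha_L1n u : (L1n u < +oo)%E -> ((alpha u)%:E * L1n u <= a1%:E)%E.
Proof.
move=> h; rewrite -(fineK (_ : L1n u \is a fin_num)) ?ge0_fin_numE ?L1n_ge0// -EFinM lee_fin /alpha.
by rewrite mulrAC ler_pdivrMr ?max_gt0// ler_wpM2l ?(ltW a1_gt0)// le_max lexx orbT.
Qed.

Lemma measurable_alpha (U : R -> R -> R[i]) : cmeas2 U -> mfunT (fun t => alpha (U t)).
Proof.
move=> mU; apply: measurable_funM => //.
rewrite (_ : (fun t => _) = (fun t => (Num.max a1 (fine (L1n (U t)))) `^ (- 1))).
  apply: (measurableT_comp (measurable_powR _)); apply: measurable_maxr => //.
  apply: (measurableT_comp (fine_measurable measurableT)).
  apply: (@measurable_ge0_integral _ _ _ (fun z : R * R => (normc (U z.1 z.2))%:E)).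
    by apply/measurable_EFinP; exact: cmeas_norm.
  by move=> z; rewrite lee_fin normc_ge0.
by apply/funext => t; rewrite powR_inv1// ltW// max_gt0.
Qed.

Definition Psi F (t xi : R) : R[i] :=
  if 0 <= t then (alpha (Sol F t))%:C * Bil (Sol F t) (Sol F t) xi else 0.

Lemma cmeas_Psi F : cmeas2 F -> cmeas2 (Psi F).
Proof.
move=> mF; have mS := cmeas_Sol mu0 mF; have mB := cmeas_Bil2 delta mS mS.
have mP : cmeas (fun z : R * R => (alpha (Sol F z.1))%:C * Bil (Sol F z.1) (Sol F z.1) z.2).
  apply: cmeasM => //; apply: (@cmeasC _ _ _ (fun z : R * R => alpha (Sol F z.1))).
  exact: (measurableT_comp (measurable_alpha mS) measurable_fst).
have mt : mfunT (fun z : R * R => 0 <= z.1).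
  by apply: measurable_fun_ler => //; exact: measurable_fst.
split.
  rewrite (_ : (fun z => _) = (fun z : R * R => if 0 <= z.1 then
    Re ((alpha (Sol F z.1))%:C * Bil (Sol F z.1) (Sol F z.1) z.2) else 0)).
    by apply: measurable_fun_ifT => //; exact: cmeas_Re mP.
  by apply/funext => z; rewrite /Psi; case: ifP.
rewrite (_ : (fun z => _) = (fun z : R * R => if 0 <= z.1 then
    Im ((alpha (Sol F z.1))%:C * Bil (Sol F z.1) (Sol F z.1) z.2) else 0)).
  by apply: measurable_fun_ifT => //; exact: cmeas_Im mP.
by apply/funext => z; rewrite /Psi; case: ifP.
Qed.

Definition Zp F := [/\ cmeas2 F, causal F, (forall t, herm (F t)) &
  forall T, 0 <= T -> (\int[mu]_(t in `[0%R, T]) A1n (F t) <= b%:E)%E].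

Lemma measurable_1D : mfunT (fun x : R => 1 + `|x|).
Proof. by apply: measurable_funD => //; exact: measurable_normr1. Qed.

Lemma Zp_energy F T : Zp F -> 0 <= T ->
  (A1n (Sol F T) + \int[mu]_(t in `[0%R, T]) D1n (Sol F t) <= (E + b)%:E)%E.
Proof.
move=> [mF cF _ bF] T0.
have w0 (x : R) : 0 <= 1 + `|x| by rewrite addr_ge0.
apply: le_trans (Sol_energy mu0 measurable_1D w0 T0 mF cF) _.
by rewrite EFinD; apply: leeD => //; exact: bF.
Qed.

Lemma A1n_ge0 u : (0 <= A1n u)%E.
Proof. by apply: wn_ge0 => x; rewrite addr_ge0. Qed.

Lemma D1n_ge0 u : (0 <= D1n u)%E.
Proof. by apply: wn_ge0 => x; rewrite mulr_ge0// addr_ge0. Qed.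

Lemma Zp_A1n F T : Zp F -> 0 <= T -> (A1n (Sol F T) <= (E + b)%:E)%E.
Proof.
move=> zF T0; apply: le_trans (Zp_energy zF T0); rewrite leeDl//.
by apply: integral_ge0 => t _; exact: D1n_ge0.
Qed.

Lemma Zp_D1n F T : Zp F -> 0 <= T -> (\int[mu]_(t in `[0%R, T]) D1n (Sol F t) <= (E + b)%:E)%E.
Proof. by move=> zF T0; apply: le_trans (Zp_energy zF T0); rewrite leeDr// A1n_ge0. Qed.

Lemma L1n_le_A1n u : cmeas u -> (L1n u <= A1n u)%E.
Proof. by move=> mgu; rewrite A1nE// leeDl// n1_ge0. Qed.

Lemma n1_le_A1n u : cmeas u -> (n1 u <= A1n u)%E.
Proof. by move=> mgu; rewrite A1nE// leeDr// L1n_ge0. Qed.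

Lemma n1_le_D1n u : cmeas u -> (n1 u <= D1n u)%E.
Proof. by move=> mgu; rewrite D1nE// leeDl// n2_ge0. Qed.

Lemma Zp_L1n F T : Zp F -> 0 <= T -> (L1n (Sol F T) <= (E + b)%:E)%E.
Proof.
move=> zF T0; apply: le_trans (Zp_A1n zF T0); apply: L1n_le_A1n.
by apply: cmeas_sec1; apply: cmeas_Sol => //; case: zF.
Qed.

Lemma Zp_n1 F T : Zp F -> 0 <= T -> (n1 (Sol F T) <= (E + b)%:E)%E.
Proof.
move=> zF T0; apply: le_trans (Zp_A1n zF T0); apply: n1_le_A1n.
by apply: cmeas_sec1; apply: cmeas_Sol => //; case: zF.
Qed.

Lemma wnZ (w : R -> R) (c : R) u : (forall x, 0 <= w x) -> mfunT w -> cmeas u -> 0 <= c ->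
  wn w (fun x => c%:C * u x) = (c%:E * wn w u)%E.
Proof.
move=> w0 mw mgu c0; rewrite /wn -ge0_integralZl ?lee_fin//.
- by apply: eq_integral => x _; rewrite Normc.normcM normcC ger0_norm// -EFinM; congr EFin; ring.
- exact: measurable_wn.
- by move=> x _; rewrite lee_fin mulr_ge0 ?normc_ge0.
Qed.

Lemma C0_ge0 : 0 <= C0. Proof. exact: ltW (C0_gt0 delta). Qed.

Lemma Ca_ge0 : 0 <= 2 * C0 * a1.
Proof. by apply: mulr_ge0; [rewrite mulr_ge0// C0_ge0|exact: ltW]. Qed.

Lemma A1n_Psi F t : Zp F -> 0 <= t -> (A1n (Psi F t) <= (2 * C0 * a1)%:E * D1n (Sol F t))%E.
Proof.
move=> zF t0; have [mF _ _ _] := zF; have mS := cmeas_sec1 t (cmeas_Sol mu0 mF).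
have -> : Psi F t = (fun xi => (alpha (Sol F t))%:C * Bil (Sol F t) (Sol F t) xi).
  by apply/funext => xi; rewrite /Psi t0.
rewrite /A1n wnZ ?alpha_ge0//; last 2 first.
- exact: measurable_1D.
- exact: cmeas_Bil.
apply: le_trans (lee_wpmul2l _ (A1n_Bil delta mS)) _; first by rewrite lee_fin alpha_ge0.
rewrite muleCA (EFinM (2 * C0)) -muleA; apply: lee_wpmul2l; first by rewrite lee_fin mulr_ge0// C0_ge0.
rewrite muleA; apply: lee_wpmul2r; first exact: D1n_ge0.
by apply: alpha_L1n; apply: le_lt_trans (Zp_L1n zF t0) (ltry _).
Qed.

Lemma L1n_Psi F t : Zp F -> 0 <= t -> (L1n (Psi F t) <= (C0 * a1)%:E * n1 (Sol F t))%E.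
Proof.
move=> zF t0; have [mF _ _ _] := zF; have mS := cmeas_sec1 t (cmeas_Sol mu0 mF).
have -> : Psi F t = (fun xi => (alpha (Sol F t))%:C * Bil (Sol F t) (Sol F t) xi).
  by apply/funext => xi; rewrite /Psi t0.
rewrite -wn1 wnZ ?alpha_ge0//; last exact: cmeas_Bil.
rewrite wn1; apply: le_trans (lee_wpmul2l _ (L1n_Bil delta mS mS)) _; first by rewrite lee_fin alpha_ge0.
rewrite muleCA (EFinM C0 a1) -muleA; apply: lee_wpmul2l; first by rewrite lee_fin C0_ge0.
rewrite muleA; apply: lee_wpmul2r; first exact: n1_ge0.
by apply: alpha_L1n; apply: le_lt_trans (Zp_L1n zF t0) (ltry _).
Qed.

Lemma Zp_Psi F : Zp F -> Zp (Psi F).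
Proof.
move=> zF; have [mF cF hF bF] := zF; have mS := cmeas_Sol mu0 mF.
split; first exact: cmeas_Psi.
- by move=> t xi t0; rewrite /Psi leNgt t0.
- move=> t; have [t0|t0] := leP 0 t; last first.
    have P0 xi : Psi F t xi = 0 by rewrite /Psi leNgt t0.
    by move=> xi; rewrite !P0 conjc0.
  have hS := Sol_herm t hu0 hF; have mSt := cmeas_sec1 t mS.
  have -> : Psi F t = (fun xi => (alpha (Sol F t))%:C * Bil (Sol F t) (Sol F t) xi).
    by apply/funext => xi; rewrite /Psi t0.
  by apply: hermM; [move=> xi; rewrite conjcC|exact: Bil_herm].
move=> T T0; apply: (@le_trans _ _ (\int[mu]_(t in `[0%R, T]) ((2 * C0 * a1)%:E * D1n (Sol F t)))%E).
  apply: ge0_le_integral_nomeas => t; first by move=> _; exact: A1n_ge0.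
  by rewrite /= in_itv /= => /andP[t0 _]; exact: A1n_Psi.
rewrite ge0_integralZl//; last 3 first.
- apply: measurable_funTS; apply: (@measurable_wnF R (fun x => `|x| * (1 + `|x|)) (Sol F)) => //.
  by apply: measurable_funM; [exact: measurable_normr1|exact: measurable_1D].
- by move=> t _; exact: D1n_ge0.
- by rewrite lee_fin Ca_ge0.
apply: le_trans (lee_wpmul2l _ (Zp_D1n zF T0)) _; first by rewrite lee_fin Ca_ge0.
by rewrite -EFinM lee_fin.
Qed.

Definition K : R := 4 * C0 * (E + b) + 1.

Lemma Eb_ge0 : 0 <= E + b. Proof. exact: addr_ge0. Qed.

Lemma K_gt0 : 0 < K.
Proof.
apply: lt_le_trans ltr01 _; rewrite lerDr; apply: mulr_ge0; last exact: Eb_ge0.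
by rewrite mulr_ge0// C0_ge0.
Qed.

Definition WK (t xi : R) : R := expR (- (K * t)).

Lemma measurable_WK : mfunT (fun z : R * R => WK z.1 z.2).
Proof. exact: (measurableT_comp (measurable_expK K) measurable_fst). Qed.

Lemma WK_gt0 t xi : 0 < WK t xi. Proof. exact: expR_gt0. Qed.
Lemma WK_ge0 t xi : 0 <= WK t xi. Proof. exact: expR_ge0. Qed.

Lemma WK_NK F : cmeas2 F -> WN WK F = NK K F.
Proof.
move=> mF; apply: eq_integral => t _; rewrite -ge0_integralZl ?lee_fin ?expR_ge0//.
- by apply/measurable_EFinP; exact: cmeas_norm (cmeas_sec1 t mF).
- by move=> x _; rewrite lee_fin normc_ge0.
Qed.

Lemma alpha_sub_le u v : cmeas u -> cmeas v -> (L1n u < +oo)%E -> (L1n v < +oo)%E ->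
  (L1n (fun x => (alpha u)%:C * u x - (alpha v)%:C * v x)%R <= 2%:E * L1n (fun x => u x - v x)%R)%E.
Proof.
move=> mgu mv fu fv.
have md : cmeas (fun x => u x - v x) by exact: cmeasB.
have iu : cintegrable u by exact/cintegrableP.
have iv : cintegrable v by exact/cintegrableP.
have id := cintegrableB iu iv.
set x := fine (L1n u); set y := fine (L1n v); set d := fine (L1n (fun x => u x - v x)).
have xE : L1n u = x%:E by rewrite fineK// ge0_fin_numE// L1n_ge0.
have yE : L1n v = y%:E by rewrite fineK// ge0_fin_numE// L1n_ge0.
have dE : L1n (fun x => u x - v x) = d%:E by rewrite fineK// ge0_fin_numE ?L1n_ge0//; exact: cintegrable_L1n.
have xy : `|y - x| <= d.
  rewrite -lee_fin -dE /x /y (L1n_fin iu) (L1n_fin iv) /= (L1n_fin id) lee_fin.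
  have iB : Lint (fun t => normc (v t) - normc (u t)).
    have := integrableB measurableT (cintegrable_norm iv) (cintegrable_norm iu).
    by congr (mu.-integrable _ _).
  rewrite -RintegralB//; [|exact: cintegrable_norm..].
  apply: le_trans (le_normr_Rintegral measurableT _) _.
    exact: iB.
  apply: le_Rintegral => //.
  - exact: integrable_norm iB.
  - exact: cintegrable_norm.
  - by move=> z _; rewrite distrC normc_sub_le.
apply: (@le_trans _ _ ((alpha u)%:E * L1n (fun x => u x - v x)%R + `|alpha u - alpha v|%:E * L1n v)%E).
  rewrite -!wn1 /wn -!ge0_integralZl ?lee_fin ?alpha_ge0//; last 4 first.
  - by apply: measurable_wn.
  - by move=> z _; rewrite lee_fin mul1r normc_ge0.
  - by apply: measurable_wn.
  - by move=> z _; rewrite lee_fin mul1r normc_ge0.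
  rewrite ge0_intD; last 4 first.
  - by apply: emeasurable_funM => //; exact: measurable_wn.
  - by apply: emeasurable_funM => //; exact: measurable_wn.
  - by move=> z; rewrite mule_ge0 ?lee_fin ?mul1r ?normc_ge0 ?alpha_ge0.
  - by move=> z; rewrite mule_ge0 ?lee_fin ?mul1r ?normc_ge0.
  apply: ge0_le_integral_nomeas => z _; first by rewrite lee_fin mul1r normc_ge0.
  rewrite -!EFinM -EFinD lee_fin !mul1r.
  have -> : (alpha u)%:C * u z - (alpha v)%:C * v z = (alpha u)%:C * (u z - v z) + (alpha u - alpha v)%:C * v z.
    by rewrite CD CN; ring.
  apply: le_trans (le_normcD _ _) _; rewrite !Normc.normcM !normcC.
  by rewrite (ger0_norm (alpha_ge0 u)).
rewrite dE yE -!EFinM -EFinD lee_fin (_ : 2 * d = d + d); last by ring.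
have d0 : 0 <= d by apply: le_trans xy.
apply: lerD; first by rewrite ler_piMl// alpha_le1.
apply: le_trans xy; rewrite /alpha -/x -/y.
set mx := Num.max a1 x; set my := Num.max a1 y.
have mx0 : 0 < mx by exact: max_gt0.
have my0 : 0 < my by exact: max_gt0.
have -> : a1 / mx - a1 / my = (my - mx) * (a1 / mx) / my by field; rewrite ?gt_eqF.
have y0 : 0 <= y by rewrite fine_ge0// L1n_ge0.
rewrite normrM normrM -mulrA (normfV my) (ger0_norm (ltW my0)) -mulrA.
have h1 : `|my - mx| <= `|y - x|.
  rewrite /my /mx; have [] := leP a1 y; have [] := leP a1 x => //; rewrite ?subrr ?normr0//.
  - move=> p q; rewrite (ger0_norm (_ : 0 <= y - a1)) ?subr_ge0// ger0_norm; first by lra.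
    by rewrite subr_ge0; apply/ltW; exact: lt_le_trans p q.
  - move=> p q; rewrite (ler0_norm (_ : a1 - x <= 0)) ?subr_le0// ler0_norm; first by lra.
    by rewrite subr_le0; apply/ltW; exact: lt_le_trans q p.
have h2 : `|a1 / mx| * (my^-1 * y) <= 1.
  rewrite ger0_norm ?divr_ge0 ?(ltW a1_gt0) ?(ltW mx0)//; apply: mulr_ile1.
  - by rewrite divr_ge0 ?(ltW a1_gt0) ?(ltW mx0).
  - by rewrite mulr_ge0 ?invr_ge0 ?(ltW my0).
  - by rewrite ler_pdivrMr// mul1r le_max lexx.
  - by rewrite mulrC ler_pdivrMr// mul1r le_max lexx orbT.
by rewrite -[leRHS]mulr1; apply: ler_pM => //; rewrite !mulr_ge0// invr_ge0 ltW.
Qed.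

Lemma contraction_pt (x y : \bar R) : (0 <= x)%E -> (0 <= y)%E ->
  (C0%:E * (2%:E * x * (E + b)%:E + a1%:E * y) <= (2^-1)%:E * (K%:E * x + y))%E.
Proof.
move=> x0 y0; have c0 := C0_ge0; have e0 := Eb_ge0.
rewrite ge0_muleDr; last 2 first.
- by rewrite !mule_ge0// lee_fin.
- by rewrite mule_ge0// lee_fin ltW.
rewrite [leRHS]ge0_muleDr//; last by rewrite mule_ge0// lee_fin ltW// K_gt0.
apply: leeD.
  rewrite (muleAC 2%:E x) muleA -(EFinM 2 (E + b)) -(EFinM C0) [leRHS]muleA -EFinM.
  by apply: lee_wpmul2r => //; rewrite lee_fin /K; lra.
rewrite muleA -EFinM; apply: lee_wpmul2r => //; rewrite lee_fin.
have := small; lra.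
Qed.

Lemma fin_int_s F t : Zp F -> {ae mu, forall xi, cintegrable (fun s => (hexp `|xi| (t - s))%:C * F s xi)}.
Proof.
move=> [mF cF _ bF].
have [t0|t0] := ltP t 0.
  apply: aeW => xi; rewrite (_ : (fun s => _) = (fun=> 0)).
    by apply/cintegrableP; split; [exact: cmeas_cst|rewrite /L1n integral0_eq// => s _; rewrite normc0].
  apply/funext => s; rewrite /hexp; case: ifP => [|_]; last by rewrite mul0r.
  by rewrite subr_ge0 => st; rewrite cF ?mulr0// (le_lt_trans st t0).
have mn : mfunT (fun z : R * R => (ind t z.2 * normc (F z.2 z.1))%:E).
  apply/measurable_EFinP; apply: measurable_funM.
    exact: (measurableT_comp (measurable_ind t) measurable_snd).
  exact: (measurableT_comp (cmeas_norm mF) (measurable_fun_pair measurable_snd measurable_fst)).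
have n0 z : (0 <= (ind t z.2 * normc (F z.2 z.1))%:E :> \bar R)%E.
  by rewrite lee_fin mulr_ge0 ?ind_ge0 ?normc_ge0.
have fin : (\int[mu]_xi \int[mu]_s (ind t s * normc (F s xi))%:E < +oo)%E.
  rewrite (Tonelli mn) => [|xi s]; last exact: (n0 (xi, s)).
  apply: le_lt_trans (ltry b); apply: le_trans (bF t t0).
  rewrite integral_indE; apply: ge0_le_integral_nomeas => s _.
    by apply: integral_ge0 => xi _; exact: (n0 (xi, s)).
  under eq_integral => xi _ do rewrite EFinM.
  have mFs := cmeas_sec1 s mF.
  rewrite ge0_integralZl ?lee_fin ?ind_ge0//; last 2 first.
  - by apply/measurable_EFinP; exact: cmeas_norm.
  - by move=> xi _; rewrite lee_fin normc_ge0.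
  by apply: lee_wpmul2l; [rewrite lee_fin ind_ge0|exact: L1n_le_A1n].
have P xi : (0 <= \int[mu]_s (ind t s * normc (F s xi))%:E)%E by apply: integral_ge0 => s _; exact: (n0 (xi, s)).
apply: aeS (ae_fin_integral (measurable_ge0_integral mn n0) P fin) => xi h.
apply/cintegrableP; split.
  exact: (cmeas_comp (cmeas_Sd_int mF) (pair1_measurable (t, xi))).
apply: le_lt_trans h; apply: ge0_le_integral_nomeas => s _; first by rewrite lee_fin normc_ge0.
rewrite lee_fin Normc.normcM normcC (ger0_norm (hexp_ge0 _ _)) /ind /= /hexp subr_ge0.
have [s0|s0] := ltP s 0; first by rewrite cF// normc0 !mulr0.
by case: ifP => st //=; rewrite ler_wpM2r ?normc_ge0// -expR0 ler_expR oppr_le0 mulr_ge0// subr_ge0.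
Qed.

Lemma Sol_sub F G t : Zp F -> Zp G ->
  {ae mu, forall xi, Sol F t xi - Sol G t xi = - Sd (fun t xi => F t xi - G t xi) t xi}.
Proof.
move=> zF zG; apply: aeS (aeI (fin_int_s t zF) (fin_int_s t zG)) => xi [iF iG].
rewrite /Sol /Sd (_ : cintegral (fun s => _ * (F s xi - G s xi)) =
  cintegral (fun s => (hexp `|xi| (t - s))%:C * F s xi) - cintegral (fun s => (hexp `|xi| (t - s))%:C * G s xi)).
  by ring.
by rewrite -cintegralB//; apply: eq_cintegral => s; rewrite mulrBr.
Qed.

Lemma ae_wn (w : R -> R) u v : {ae mu, forall x, normc (u x) = normc (v x)} -> wn w u = wn w v.
Proof.
by move=> h; apply: ae_integral_indep; apply: aeS h => x ->.
Qed.

Lemma contraction F G : Zp F -> Zp G ->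
  (WNd WK (Psi F) (Psi G) <= (2^-1)%:E * WNd WK F G)%E.
Proof.
move=> zF zG; have [mF cF _ _] := zF; have [mG cG _ _] := zG.
have mFG : cmeas2 (fun t xi => F t xi - G t xi) by exact: cmeasB.
have mPP : cmeas2 (fun t xi => Psi F t xi - Psi G t xi) by apply: cmeasB; exact: cmeas_Psi.
rewrite /WNd (WK_NK mPP) (WK_NK mFG); set D := fun t xi => F t xi - G t xi.
have mSd : cmeas2 (Sd D) by exact: (@cmeas_Sd _ D mFG).
have mL : mfunT (fun t => (expR (- (K * t)))%:E * (K%:E * L1n (Sd D t) + n1 (Sd D t)))%E.
  apply: emeasurable_funM; first by apply/measurable_EFinP; exact: measurable_expK.
  apply: emeasurable_funD; last first.
    by apply: (@measurable_wnF R (fun x => `|x|)) => //; exact: measurable_normr1.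
  apply: emeasurable_funM => //.
  have := @measurable_wnF R (fun=> 1) (Sd D) (measurable_cst (1 : R)) (fun=> ler01) mSd.
  by congr measurable_fun; apply/funext => t; rewrite wn1.
have L0 t : (0 <= (expR (- (K * t)))%:E * (K%:E * L1n (Sd D t) + n1 (Sd D t)))%E.
  rewrite mule_ge0 ?lee_fin ?expR_ge0//; apply: adde_ge0; last exact: n1_ge0.
  by apply: mule_ge0; [rewrite lee_fin ltW// K_gt0|exact: L1n_ge0].
apply: (@le_trans _ _ (\int[mu]_t ((2^-1)%:E * ((expR (- (K * t)))%:E * (K%:E * L1n (Sd D t) + n1 (Sd D t)))))%E);
  last first.
  by rewrite ge0_integralZl//; apply: lee_wpmul2l => //; exact: (@NK_Sd _ K D K_gt0 mFG).
apply: ge0_le_integral_nomeas => t _.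
  by rewrite mule_ge0 ?lee_fin ?expR_ge0 ?L1n_ge0.
rewrite muleCA; apply: lee_wpmul2l; first by rewrite lee_fin expR_ge0.
have [t0|t0] := ltP t 0.
  rewrite (_ : (fun xi => Psi F t xi - Psi G t xi) = (fun=> 0)).
    rewrite /L1n integral0_eq; last by move=> x _; rewrite normc0.
    rewrite mule_ge0//; apply: adde_ge0; last exact: n1_ge0.
    by apply: mule_ge0; [rewrite lee_fin ltW// K_gt0|exact: L1n_ge0].
  by apply/funext => xi; rewrite /Psi leNgt t0 subrr.
have mSF := cmeas_sec1 t (cmeas_Sol mu0 mF); have mSG := cmeas_sec1 t (cmeas_Sol mu0 mG).
have fl (u : \bar R) : (u <= (E + b)%:E)%E -> (u < +oo)%E by move=> h; apply: le_lt_trans h (ltry _).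
have fF := fl _ (Zp_L1n zF t0); have fG := fl _ (Zp_L1n zG t0).
have -> : (fun xi => Psi F t xi - Psi G t xi) = (fun xi => (alpha (Sol F t))%:C * Bil (Sol F t) (Sol F t) xi -
    (alpha (Sol G t))%:C * Bil (Sol G t) (Sol G t) xi).
  by apply/funext => xi; rewrite /Psi t0.
apply: le_trans (L1n_Bil_sub delta (alpha (Sol G t)) (alpha_ge0 _) mSF mSG fF (fl _ (Zp_n1 zF t0)) fG (fl _ (Zp_n1 zG t0))) _.
have dE : {ae mu, forall xi, normc (Sol F t xi - Sol G t xi) = normc (Sd D t xi)}.
  by apply: aeS (Sol_sub t zF zG) => xi ->; rewrite -sub0r normcBC subr0.
have -> : L1n (Sd D t) = L1n (fun xi => Sol F t xi - Sol G t xi) by rewrite -!wn1; apply: ae_wn; apply: aeS dE => xi ->.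
have -> : n1 (Sd D t) = n1 (fun xi => Sol F t xi - Sol G t xi) by apply: ae_wn; apply: aeS dE => xi ->.
apply: le_trans (contraction_pt (L1n_ge0 _) (n1_ge0 _)).
apply: lee_wpmul2l; first by rewrite lee_fin C0_ge0.
apply: leeD.
  apply: lee_pmul; [exact: L1n_ge0|exact: n1_ge0|exact: alpha_sub_le|exact: Zp_n1].
by rewrite muleA; apply: lee_wpmul2r; [exact: n1_ge0|exact: alpha_L1n].
Qed.

Fixpoint Pic (n : nat) : R -> R -> R[i] := if n is m.+1 then Psi (Pic m) else fun _ _ => 0.

Lemma Zp_Pic n : Zp (Pic n).
Proof.
elim: n => [|n IH] /=; last exact: Zp_Psi.
split => //; first by move=> t x; rewrite conjc0.
move=> T T0; rewrite integral0_eq ?lee_fin// => t _.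
by rewrite /A1n /wn integral0_eq// => x _; rewrite normc0 mulr0.
Qed.

Let c : R := C0 * (E + b) ^+ 2 / K.

Lemma Pic_step n : (WNd WK (Pic n.+1) (Pic n) <= (c / 2 ^+ n)%:E)%E.
Proof.
elim: n => [|n IH]; last first.
  have h := contraction (Zp_Pic n.+1) (Zp_Pic n); apply: le_trans h _.
  apply: le_trans (lee_wpmul2l _ IH) _ => //.
  by rewrite -EFinM lee_fin exprS le_eqVlt; apply/orP; left; apply/eqP; field; rewrite expf_neq0.
rewrite expr0 divr1 /WNd; have z0 := Zp_Pic 0; have [m0 _ _ _] := z0.
have -> : (fun t xi => Pic 1 t xi - Pic 0 t xi) = Psi (Pic 0) by apply/funext => t; apply/funext => xi; rewrite /= subr0.
have mP : cmeas2 (Psi (Pic 0)) by exact: cmeas_Psi.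
rewrite WK_NK//.
have mh : mfunT (fun t : R => (hexp K t)%:E).
  by apply/measurable_EFinP; exact: (@measurable_hexp2 _ _ _ (fun=> K) (fun x => x)).
apply: (@le_trans _ _ (\int[mu]_t ((C0 * (E + b) ^+ 2)%:E * (hexp K t)%:E))%E); last first.
  rewrite ge0_integralZl//; last 2 first.
  - by move=> t _; rewrite lee_fin hexp_ge0.
  - by rewrite lee_fin mulr_ge0 ?C0_ge0// sqr_ge0.
  by rewrite integral_hexp ?K_gt0.
apply: ge0_le_integral_nomeas => t _; first by rewrite mule_ge0 ?L1n_ge0// lee_fin expR_ge0.
have [t0|t0] := leP 0 t; last first.
  rewrite /L1n integral0_eq ?mule0; last by move=> x _; rewrite /Psi leNgt t0 normc0.
  by rewrite mule_ge0 ?lee_fin ?hexp_ge0// mulr_ge0 ?C0_ge0// sqr_ge0.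
rewrite /hexp t0 muleC; apply: lee_wpmul2r; first by rewrite lee_fin expR_ge0.
have mS := cmeas_sec1 t (cmeas_Sol mu0 m0).
have -> : Psi (Pic 0) t = (fun xi => (alpha (Sol (Pic 0) t))%:C * Bil (Sol (Pic 0) t) (Sol (Pic 0) t) xi).
  by apply/funext => xi; rewrite /Psi t0.
rewrite -wn1 wnZ ?alpha_ge0//; last exact: cmeas_Bil.
rewrite wn1; apply: (@le_trans _ _ (L1n (Bil (Sol (Pic 0) t) (Sol (Pic 0) t)))).
  by rewrite -[leRHS]mul1e; apply: lee_wpmul2r; [exact: L1n_ge0|rewrite lee_fin alpha_le1].
apply: le_trans (L1n_Bil delta mS mS) _; rewrite (EFinM C0); apply: lee_wpmul2l; first by rewrite lee_fin C0_ge0.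
by rewrite expr2 EFinM; apply: lee_pmul; [exact: L1n_ge0|exact: n1_ge0|exact: Zp_L1n|exact: Zp_n1].
Qed.

Definition Fix : R -> R -> R[i] := Flim Pic.

Let mPic n : cmeas2 (Pic n). Proof. by case: (Zp_Pic n). Qed.

Lemma Fix_ae : {ae mu, forall t, {ae mu, forall xi, ccvg (fun n => Pic n t xi) (Fix t xi)}}.
Proof. exact: (Flim_ae measurable_WK WK_gt0 mPic Pic_step). Qed.

Lemma Zp_Fix : Zp Fix.
Proof.
split.
- exact: cmeas_Flim.
- by move=> t xi t0; apply: Flim_eq0 => n; case: (Zp_Pic n) => _ cP _ _; exact: cP.
- by move=> t; apply: Flim_herm => n; case: (Zp_Pic n).
move=> T T0; pose W (t xi : R) := ind T t * (1 + `|xi|).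
have mW : mfunT (fun z : R * R => W z.1 z.2).
  apply: measurable_funM; first exact: (measurableT_comp (measurable_ind T) measurable_fst).
  exact: (measurableT_comp measurable_1D measurable_snd).
have W0 t xi : 0 <= W t xi by rewrite mulr_ge0 ?ind_ge0// addr_ge0.
have WE F : cmeas2 F -> WN W F = (\int[mu]_(t in `[0%R, T]) A1n (F t))%E.
  move=> mF; rewrite integral_indE; apply: eq_integral => t _.
  rewrite -ge0_integralZl ?lee_fin ?ind_ge0//.
  - by apply: eq_integral => xi _; rewrite -EFinM mulrA.
  - by apply: measurable_wn; [exact: measurable_1D|exact: cmeas_sec1].
  - by move=> xi _; rewrite lee_fin mulr_ge0 ?normc_ge0// addr_ge0.
rewrite -WE; last exact: cmeas_Flim.
apply: (WN_fatou mW W0 mPic Fix_ae) => n; rewrite WE//.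
by case: (Zp_Pic n) => _ _ _; exact.
Qed.

Lemma Fix_fixed : {ae mu, forall t, {ae mu, forall xi, Fix t xi = Psi Fix t xi}}.
Proof.
have [mF _ _ _] := Zp_Fix; have mP := cmeas_Psi mF.
have mFP : cmeas2 (fun t xi => Fix t xi - Psi Fix t xi) by exact: cmeasB.
have c0 : 0 <= c.
  by apply: divr_ge0; [apply: mulr_ge0; [exact: C0_ge0|exact: sqr_ge0]|exact: ltW K_gt0].
have bn n : (WNd WK Fix (Psi Fix) <= (2 * c / 2 ^+ n)%:E)%E.
  apply: le_trans (WNd_tri measurable_WK WK_ge0 mF (mPic n.+1) mP) _.
  apply: le_trans (leeD (WNd_Flim measurable_WK WK_gt0 mPic Pic_step n.+1) (contraction (Zp_Pic n) Zp_Fix)) _.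
  rewrite (WNdC WK).
  apply: le_trans (leeD2l _ (lee_wpmul2l _ (WNd_Flim measurable_WK WK_gt0 mPic Pic_step n))) _ => //.
  rewrite -EFinM -EFinD lee_fin exprS le_eqVlt; apply/orP; left; apply/eqP.
  by field; rewrite expf_neq0.
have e0 : WNd WK Fix (Psi Fix) = 0.
  apply/eqP; rewrite eq_le WN_ge0 ?andbT//; last exact: WK_ge0.
  have cv : (2 * c / 2 ^+ n)%:E @[n --> \oo] --> (0 : R)%:E.
    apply: cvg_EFin; first exact: nearW.
    rewrite -(mulr0 (2 * c)); apply: cvgM; first exact: cvg_cst.
    have h := @cvg_expr R (2^-1) _; rewrite (_ : (fun n => _) = (fun n => (2^-1) ^+ n)).
      by apply: h; rewrite ger0_norm// invf_lt1// ltr1n.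
    by apply/funext => n; rewrite /= exprVn.
  rewrite -[leRHS](cvg_lim _ cv)//; apply: lime_ge; first exact: cvgP cv.
  exact: nearW.
apply: aeS (WN_eq0 measurable_WK WK_ge0 WK_gt0 mFP e0) => t; apply: aeS => xi /eqP.
by rewrite subr_eq0 => /eqP.
Qed.

Lemma Fix_sol : {ae mu, forall t, 0 <= t -> {ae mu, forall xi, Fix t xi =
  (alpha (Sol Fix t))%:C * Bil (Sol Fix t) (Sol Fix t) xi}}.
Proof.
by apply: aeS Fix_fixed => t h t0; apply: aeS h => xi ->; rewrite /Psi t0.
Qed.

Let U := Sol Fix.
Let mUt t : cmeas (U t).
Proof. by apply: cmeas_sec1; apply: cmeas_Sol => //; case: Zp_Fix. Qed.

Variable a0 : R.
Hypotheses (u0a : L1n u0 = a0%:E) (a01 : a0 <= a1).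

Lemma Fix_L1n T : 0 <= T -> (L1n (U T) <= a0%:E)%E.
Proof.
move=> T0; have [mF cF _ _] := Zp_Fix.
have := @Sol_energy _ _ mu0 (fun=> 1) T Fix (measurable_cst (1 : R)) (fun=> ler01) T0 mF cF.
rewrite !wn1 u0a; under eq_integral => t _ do under eq_fun => x do rewrite mulr1.
move=> h; pose X := (\int[mu]_(t in `[0%R, T]) n1 (U t))%E.
have X0 : (0 <= X)%E by apply: integral_ge0 => t _; exact: n1_ge0.
have Xfin : (X < +oo)%E.
  apply: le_lt_trans (ltry (E + b)); apply: le_trans (Zp_D1n Zp_Fix T0).
  by apply: ge0_le_integral_nomeas => t _; [exact: n1_ge0|exact: n1_le_D1n].
have hF : (\int[mu]_(s in `[0%R, T]) wn (fun=> 1%R) (Fix s) <= (C0 * a1)%:E * X)%E.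
  rewrite /X -ge0_integralZl//; last 3 first.
  - apply: measurable_funTS; apply: (@measurable_wnF R (fun x => `|x|) U) => //; exact: cmeas_Sol.
  - by move=> t _; exact: n1_ge0.
  - by rewrite lee_fin mulr_ge0 ?C0_ge0// ltW.
  apply: ae_ge0_le_integral_nomeas => [t _|t _|].
  - exact: wn_ge0.
  - by rewrite mule_ge0 ?n1_ge0// lee_fin mulr_ge0 ?C0_ge0// ltW.
  apply: aeS Fix_fixed => t ht; rewrite /= in_itv /= => /andP[t0 _].
  apply: le_trans (L1n_Psi Zp_Fix t0); rewrite wn1 (ae_L1n ht)//.
have q1 : C0 * a1 <= 1 by have := small; have := Ca_ge0; lra.
have {}h : (L1n (U T) + X <= a0%:E + X)%E.
  apply: le_trans h _; apply: leeD2l; apply: le_trans hF _.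
  by rewrite -[leRHS]mul1e; apply: lee_wpmul2r => //; rewrite lee_fin.
by rewrite leeD2rE in h => //; rewrite ge0_fin_numE.
Qed.

Lemma Fix_Bil : {ae mu, forall t, 0 <= t -> {ae mu, forall xi, Fix t xi = Bil (U t) (U t) xi}}.
Proof.
apply: aeS Fix_sol => t h t0; apply: aeS (h t0) => xi ->.
by rewrite alpha1 ?mul1r//; apply: le_trans (Fix_L1n t0) _; rewrite lee_fin.
Qed.

Lemma Fix_energy T : 0 <= T ->
  (A1n (U T) + (1 - 2 * C0 * a0)%:E * \int[mu]_(t in `[0%R, T]) D1n (U t) <= A1n u0)%E.
Proof.
move=> T0; have [mF cF _ _] := Zp_Fix.
have w0 (x : R) : 0 <= 1 + `|x| by rewrite addr_ge0.
have := Sol_energy mu0 measurable_1D w0 T0 mF cF.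
move=> h; pose Y := (\int[mu]_(t in `[0%R, T]) D1n (U t))%E.
have a00 : 0 <= a0 by rewrite -lee_fin -u0a L1n_ge0.
have q0 : 0 <= 2 * C0 * a0 by apply: mulr_ge0 => //; rewrite mulr_ge0// C0_ge0.
have Y0 : (0 <= Y)%E by apply: integral_ge0 => t _; exact: D1n_ge0.
have Yfin : (Y < +oo)%E by apply: le_lt_trans (Zp_D1n Zp_Fix T0) (ltry _).
have hF : (\int[mu]_(s in `[0%R, T]) A1n (Fix s) <= (2 * C0 * a0)%:E * Y)%E.
  rewrite /Y -ge0_integralZl//; last 2 first.
  - apply: measurable_funTS; apply: (@measurable_wnF R (fun x => `|x| * (1 + `|x|)) U) => //.
    + by apply: measurable_funM; [exact: measurable_normr1|exact: measurable_1D].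
    + exact: cmeas_Sol.
  - by move=> t _; exact: D1n_ge0.
  apply: ae_ge0_le_integral_nomeas => [t _|t _|].
  - exact: A1n_ge0.
  - by rewrite mule_ge0// D1n_ge0.
  apply: aeS Fix_Bil => t ht; rewrite /= in_itv /= => /andP[t0 _].
  have -> : A1n (Fix t) = A1n (Bil (U t) (U t)) by apply: ae_wn; apply: aeS (ht t0) => xi ->.
  apply: le_trans (A1n_Bil delta (mUt t)) _; rewrite (EFinM (2 * C0) a0) -muleA.
  apply: lee_wpmul2l; first by rewrite lee_fin mulr_ge0// C0_ge0.
  by apply: lee_wpmul2r; [exact: D1n_ge0|exact: Fix_L1n].
have {}h : (A1n (U T) + Y <= A1n u0 + (2 * C0 * a0)%:E * Y)%E.
  by apply: le_trans h _; apply: leeD2l.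
move: h Yfin Y0; rewrite -[(\int[mu]_(t in _) D1n (U t))%E]/Y; clear; case: Y => // y h _ _.
move: h; rewrite -EFinM -leeBlDr// -addeA; apply: le_trans; apply: leeD2l.
by rewrite -EFinN -EFinD -EFinM lee_fin le_eqVlt; apply/orP; left; apply/eqP; ring.
Qed.

End Picard.

Lemma fourier_solution {R : realType} (delta : R) (u0 : R -> R[i]) (a0 : R) :
  cmeas u0 -> herm u0 -> L1n u0 = a0%:E -> (A1n u0 < +oo)%E -> 2 * C0 delta * a0 < 1 ->
  exists F : R -> R -> R[i], [/\ cmeas (fun z : R * R => F z.1 z.2), causal F, (forall t, herm (F t)) &
   [/\ forall T, 0 <= T -> (A1n (Sol u0 F T) + (1 - 2 * C0 delta * a0)%:E *
          \int[lebesgue_measure]_(t in `[0%R, T]) D1n (Sol u0 F t) <= A1n u0)%E,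
      forall T, 0 <= T -> (L1n (Sol u0 F T) <= a0%:E)%E,
      forall T, 0 <= T -> (\int[lebesgue_measure]_(t in `[0%R, T]) A1n (F t) < +oo)%E &
      {ae lebesgue_measure, forall t, 0 <= t -> {ae lebesgue_measure, forall xi,
        F t xi = Bil delta (Sol u0 F t) (Sol u0 F t) xi}}]].
Proof.
move=> mu0 hu0 u0a fE small0.
have c0 := C0_gt0 delta; set C := C0 delta in small0 c0 *.
pose a1 := (a0 + (2 * C)^-1) / 2.
pose E := fine (A1n u0).
have EE : A1n u0 = E%:E by rewrite fineK// ge0_fin_numE ?A1n_ge0.
have a00 : 0 <= a0 by rewrite -lee_fin -u0a L1n_ge0.
have c2 : 0 < 2 * C by rewrite mulr_gt0.
have ci : 0 < (2 * C)^-1 by rewrite invr_gt0.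
have cc : 2 * C * (2 * C)^-1 = 1 by rewrite mulfV// gt_eqF.
have a1_gt0 : 0 < a1 by rewrite /a1; lra.
have th1 : 2 * C * a1 < 1 by rewrite /a1; nra.
have a01 : a0 <= a1.
  have : a0 < (2 * C)^-1 by rewrite -(ltr_pM2l c2) cc.
  by rewrite /a1; lra.
have E0 : 0 <= E by rewrite fine_ge0// A1n_ge0.
have th0 : 0 <= 2 * C * a1 by rewrite mulr_ge0// ltW.
pose b := 2 * C * a1 * E / (1 - 2 * C * a1).
have d0 : 0 < 1 - 2 * C * a1 by rewrite subr_gt0.
have b0 : 0 <= b by apply: divr_ge0; [exact: mulr_ge0|exact: ltW].
have bE : 2 * C * a1 * (E + b) <= b.
  by rewrite le_eqVlt /b; apply/orP; left; apply/eqP; field; rewrite gt_eqF.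
have u0E : (A1n u0 <= E%:E)%E by rewrite EE.
have small : 2 * C * a1 <= 1 by exact: ltW.
have zF := Zp_Fix mu0 hu0 a1_gt0 E0 b0 u0E small bE.
exists (Fix delta u0 a1); have [mF cF hF bF] := zF; split => //; split.
- by move=> T T0; exact: (Fix_energy mu0 hu0 a1_gt0 E0 b0 u0E small bE u0a a01).
- by move=> T T0; exact: (Fix_L1n mu0 hu0 a1_gt0 E0 b0 u0E small bE u0a).
- by move=> T T0; apply: le_lt_trans (bF T T0) (ltry _).
- exact: (Fix_Bil mu0 hu0 a1_gt0 E0 b0 u0E small bE u0a a01).
Qed.

Section Resolvent.
Context {R : realType}.
Local Notation mu := (@lebesgue_measure R).
Implicit Types (f v : R -> R[i]) (a t r s : R).

Lemma measurable_hexp_sub a : mfunT (fun z : R * R => hexp a (z.1 - z.2)).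
Proof. by apply: measurable_hexp2; [exact: measurable_cst|exact: measurable_subr12]. Qed.

Lemma measurable_sec2 (k : R -> R -> R) r :
  mfunT (fun z : R * R => k z.1 z.2) -> mfunT (k^~ r).
Proof. by move=> mk; exact: (measurableT_comp mk (measurable_pair2 r)). Qed.

Lemma ge0_cintegrableC (f : R -> R) : mfunT f -> (forall x, 0 <= f x) ->
  (\int[mu]_x (f x)%:E < +oo)%E -> cintegrable (fun x => (f x)%:C : R[i]).
Proof.
move=> mf f0 ff; apply: cintegrableC; apply/integrableP; split; first exact/measurable_EFinP.
apply: le_lt_trans ff; apply: ge0_le_integral_nomeas => x _; first exact: abse_ge0.
by rewrite /= ger0_norm.
Qed.

Lemma addE_fin (x w : R) (y : \bar R) : (x%:E + y = w%:E)%E -> y = (w - x)%:E.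
Proof. by case: y => // y [<-]; congr EFin; ring. Qed.

Lemma measurable_ind2 d (T : measurableType d) (p q : T -> R) : mfunT p ->
  mfunT q -> mfunT (fun x => ind (p x) (q x)).
Proof.
move=> mp mq; apply: measurable_fun_ifT; [|exact: measurable_cst|exact: measurable_cst].
by apply: measurable_and; apply: measurable_fun_ler => //; exact: measurable_cst.
Qed.

Lemma hexp_ind_le a t r : 0 <= a -> 0 <= r -> hexp a (t - r) <= ind t r.
Proof.
move=> a0 r0; rewrite /ind r0 /=; case: ifPn => [_|]; first exact: hexp_le1.
by rewrite -ltNge => rt; rewrite /hexp (lt_geF (_ : t - r < 0)) ?subr_lt0.
Qed.

Lemma hexp_causal_le a t f r : 0 <= a -> (forall r, r < 0 -> f r = 0) ->
  normc ((hexp a (t - r))%:C * f r) <= normc ((ind t r)%:C * f r).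
Proof.
move=> a0 cf; rewrite !Normc.normcM !normcC !ger0_norm ?hexp_ge0 ?ind_ge0//.
have [r0|r0] := leP 0 r; last by rewrite (cf _ r0) normc0 !mulr0.
by rewrite ler_wpM2r ?normc_ge0 ?hexp_ind_le.
Qed.

Lemma cintegrable_hexp a t f : 0 <= a -> cmeas f -> (forall r, r < 0 -> f r = 0) ->
  cintegrable (fun r => (ind t r)%:C * f r) ->
  cintegrable (fun r => (hexp a (t - r))%:C * f r).
Proof.
move=> a0 mf cf hf; apply: (cintegrable_lec _ hf); last by move=> r; exact: hexp_causal_le.
apply: cmeasM => //; apply: cmeasC.
by apply: measurable_hexp2; [exact: measurable_cst|apply: measurable_funB; [exact: measurable_cst|exact: measurable_id]].
Qed.

Lemma kernel_fubini (k : R -> R -> R) a t f : 0 <= a ->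
  mfunT (fun z : R * R => k z.1 z.2) -> (forall s r, 0 <= k s r) ->
  (forall r, 0 <= r -> (\int[mu]_s (k s r)%:E = (ind t r - hexp a (t - r))%:E)%E) ->
  cmeas f -> (forall r, r < 0 -> f r = 0) -> cintegrable (fun r => (ind t r)%:C * f r) ->
  cintegrable (fun s => cintegral (fun r => (k s r)%:C * f r)) /\
  cintegral (fun s => cintegral (fun r => (k s r)%:C * f r)) =
  cintegral (fun r => (ind t r)%:C * f r) - cintegral (fun r => (hexp a (t - r))%:C * f r).
Proof.
move=> a0 mk k0 kE mf cf hf.
have mkf : cmeas (fun z : R * R => (k z.1 z.2)%:C * f z.2).
  by apply: cmeasM; [exact: cmeasC|exact: cmeas_pair2].
have mkr r : mfunT (fun s => k s r).
  exact: measurable_sec2 mk.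
have kr r : L1n (fun s => (k s r)%:C * f r) = ((ind t r - hexp a (t - r)) * normc (f r))%:E.
  have [r0|r0] := leP 0 r; last first.
    rewrite (cf _ r0) normc0 mulr0 /L1n (eq_integral (fun=> 0%E)) ?integral0// => s _.
    by rewrite mulr0 normc0.
  rewrite EFinM -(kE _ r0) muleC -ge0_integralZl//; last 3 first.
  - by apply/measurable_EFinP; exact: mkr.
  - by move=> s _; rewrite lee_fin.
  - by rewrite lee_fin normc_ge0.
  apply: eq_integral => s _.
  by rewrite Normc.normcM normcC ger0_norm// -EFinM mulrC.
have fin : (\int[mu]_s L1n (fun r => (k s r)%:C * f r)%R < +oo)%E.
  rewrite L1n_swap//; apply: le_lt_trans (cintegrable_L1n hf).
  apply: ge0_le_integral_nomeas => r _; first exact: L1n_ge0.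
  rewrite kr lee_fin Normc.normcM normcC ger0_norm ?ind_ge0//.
  by rewrite ler_wpM2r ?normc_ge0// gerBl hexp_ge0.
have [h1 _] := L1n_cintegral_le mkf fin; split => //.
rewrite (cFubini mkf fin) -cintegralB//; last exact: cintegrable_hexp.
apply: eq_cintegral => r /=; rewrite -mulrBl.
have [r0|r0] := leP 0 r; last first.
  by rewrite (cf _ r0) mulr0 -[RHS]cintegral0; apply: eq_cintegral => s; rewrite mulr0.
have ik : cintegrable (fun s => (k s r)%:C : R[i]).
  by apply: ge0_cintegrableC => //; rewrite kE// ltry.
rewrite cintegralZr// cintegralC; congr (_ * _).
by rewrite /Rintegral kE//= CD CN.
Qed.

Lemma mild_integral a t (F : R -> R[i]) (z : R[i]) : 0 <= a -> 0 <= t -> cmeas F ->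
  (forall r, r < 0 -> F r = 0) -> cintegrable (fun r => (ind t r)%:C * F r) ->
  let u s := (hexp a s)%:C * z - cintegral (fun r => (hexp a (s - r))%:C * F r) in
  cintegrable (fun s => (ind t s)%:C * (a%:C * u s + F s)) /\
  u t = z - cintegral (fun s => (ind t s)%:C * (a%:C * u s + F s)).
Proof.
move=> a0 t0 mF cF iF u.
pose k s r := ind t s * a * hexp a (s - r).
have k0 s r : 0 <= k s r by rewrite /k !mulr_ge0 ?ind_ge0 ?hexp_ge0.
have mk : mfunT (fun z : R * R => k z.1 z.2).
  apply: measurable_funM; last exact: measurable_hexp_sub.
  apply: measurable_funM; last exact: measurable_cst.
  by apply: measurable_ind2; [exact: measurable_cst|exact: measurable_fst].
have kE r : 0 <= r -> (\int[mu]_s (k s r)%:E = (ind t r - hexp a (t - r))%:E)%E.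
  move=> r0; have := @integral_ind_hexp R t a r a0 r0; move=> /addE_fin.
  exact.
have [i1 e1] := kernel_fubini a0 mk k0 kE mF cF iF.
have mks : mfunT (fun s => k s 0).
  exact: measurable_sec2 mk.
have ik : cintegrable (fun s => (k s 0)%:C : R[i]).
  by apply: ge0_cintegrableC => //; rewrite kE// ltry.
have E s : (ind t s)%:C * (a%:C * u s + F s) =
  ((k s 0)%:C * z - cintegral (fun r => (k s r)%:C * F r)) + (ind t s)%:C * F s.
  have -> : cintegral (fun r => (k s r)%:C * F r) =
      (ind t s * a)%:C * cintegral (fun r => (hexp a (s - r))%:C * F r).
    have [s0|s0] := eqVneq (ind t s) 0.
      rewrite s0 mul0r mul0r -[RHS]cintegral0; apply: eq_cintegral => r.
      by rewrite /k s0 !mul0r.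
    have st : s <= t by move: s0; rewrite /ind; case: (leP s t) => // _; rewrite andbF eqxx.
    rewrite -cintegralZ; last first.
      apply: cintegrable_hexp => //; apply: (cintegrable_lec _ iF).
        by apply: cmeasM => //; apply: cmeasC; exact: measurable_ind.
      move=> r; rewrite !Normc.normcM !normcC !ger0_norm ?ind_ge0// ler_wpM2r ?normc_ge0//.
      rewrite /ind; case: (leP 0 r) => //= _; case: (leP r s) => [rs|_].
        by rewrite (le_trans rs st).
      by case: ifP.
    by apply: eq_cintegral => r; rewrite /k CM mulrA.
  by rewrite /u /k subr0 mulrDr mulrBr !CM !mulrA mulrBr !mulrA.
have iz : cintegrable (fun s => (k s 0)%:C * z) by exact: (cintegrableMr ik (cmeas_cst _ z) (fun=> lexx (normc z))).
rewrite (_ : (fun s => (ind t s)%:C * (a%:C * u s + F s)) = (fun s =>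
  ((k s 0)%:C * z - cintegral (fun r => (k s r)%:C * F r)) + (ind t s)%:C * F s)); last first.
  by apply/funext => s; exact: E.
split; first by apply: cintegrableD => //; exact: cintegrableB.
rewrite cintegralD//; last exact: cintegrableB.
rewrite cintegralB// e1 cintegralZr// cintegralC /Rintegral kE//= subr0.
rewrite {1}/ind lexx t0 /= /u CD CN; ring.
Qed.

Lemma integral_mild a t (v F : R -> R[i]) (z : R[i]) : 0 <= a -> 0 <= t -> cmeas F -> cmeas v ->
  (forall r, r < 0 -> F r = 0) -> (forall r, r < 0 -> v r = 0) ->
  cintegrable (fun r => (ind t r)%:C * F r) -> cintegrable (fun r => (ind t r)%:C * v r) ->
  let vE s := v s = z - cintegral (fun r => (ind s r)%:C * (a%:C * v r + F r)) in
  {ae mu, forall s, 0 <= s -> vE s} -> vE t ->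
  v t = (hexp a t)%:C * z - cintegral (fun r => (hexp a (t - r))%:C * F r).
Proof.
move=> a0 t0 mF mv cF cv iF iv vE vae vt.
pose k s r := hexp a (t - s) * a * ind s r.
have k0 s r : 0 <= k s r by rewrite /k !mulr_ge0 ?ind_ge0 ?hexp_ge0.
have mk : mfunT (fun z : R * R => k z.1 z.2).
  apply: measurable_funM; last by apply: measurable_ind2; [exact: measurable_fst|exact: measurable_snd].
  apply: measurable_funM; last exact: measurable_cst.
  apply: measurable_hexp2; first exact: measurable_cst.
  by apply: measurable_funB; [exact: measurable_cst|exact: measurable_fst].
have kE r : 0 <= r -> (\int[mu]_s (k s r)%:E = (ind t r - hexp a (t - r))%:E)%E.
  move=> r0; have /addE_fin <- := @integral_ind_hexp R t a r a0 r0.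
  rewrite -(@ge0_integral_refl R (t + r) (fun s => (k s r)%:E)); last 2 first.
  - apply/measurable_EFinP; exact: measurable_sec2 mk.
  - by move=> s; rewrite lee_fin.
  apply: eq_integral => s _; congr EFin; rewrite /k.
  have -> : t - (t + r - s) = s - r by ring.
  rewrite /hexp subr_ge0; have [rs|rs] := leP r s; last by rewrite !(mul0r, mulr0).
  rewrite /ind r0 (le_trans r0 rs) /= -subr_ge0.
  have -> : t + r - s - r = t - s by ring.
  by rewrite subr_ge0 mulrC; rewrite (mulrC (expR _)) mulrA.
pose f r := a%:C * v r + F r.
have mf : cmeas f by apply: cmeasD => //; apply: cmeasM => //; exact: cmeas_cst.
have cf r : r < 0 -> f r = 0 by move=> r0; rewrite /f cF// cv// mulr0 addr0.
have iav : cintegrable (fun r => (ind t r)%:C * (a%:C * v r)).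
  by rewrite (_ : (fun r => _) = (fun r => a%:C * ((ind t r)%:C * v r)));
    [exact: cintegrableZ|apply/funext => r; rewrite mulrCA].
have if_ : cintegrable (fun r => (ind t r)%:C * f r).
  rewrite (_ : (fun r => _) = (fun r => (ind t r)%:C * (a%:C * v r) + (ind t r)%:C * F r)).
    exact: cintegrableD.
  by apply/funext => r; rewrite /f mulrDr.
have [i1 e1] := kernel_fubini a0 mk k0 kE mf cf if_.
have mks : mfunT (fun s => k s 0).
  exact: measurable_sec2 mk.
have ik : cintegrable (fun s => (k s 0)%:C : R[i]).
  by apply: ge0_cintegrableC => //; rewrite kE// ltry.
have iz : cintegrable (fun s => (k s 0)%:C * z) by exact: (cintegrableMr ik (cmeas_cst _ z) (fun=> lexx (normc z))).
have mav : cmeas (fun r => a%:C * v r) by apply: cmeasM => //; exact: cmeas_cst.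
have cav r : r < 0 -> a%:C * v r = 0 by move=> r0; rewrite cv// mulr0.
have A1 : cintegral (fun s => (hexp a (t - s))%:C * (a%:C * v s)) =
   cintegral (fun s => (k s 0)%:C * z - cintegral (fun r => (k s r)%:C * f r)).
  apply: ae_cintegral; apply: aeS vae => s vs.
  have [s0|s0] := leP 0 s; last first.
    rewrite cv// !mulr0 /k {1}/ind lexx /= leNgt s0 /= mulr0 mul0r sub0r.
    rewrite (eq_cintegral (g := fun=> 0)) ?cintegral0 ?oppr0// => r.
    rewrite /k /ind; case: ifP => [/andP[r0 rs]|_]; last by rewrite mulr0 mul0r.
    by have := le_lt_trans (le_trans r0 rs) s0; rewrite ltxx.
  have [st|st] := leP s t; last first.
    have h0 : hexp a (t - s) = 0 by rewrite /hexp leNgt subr_lt0 st.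
    rewrite h0 mul0r /k h0 !mul0r sub0r (eq_cintegral (g := fun=> 0)) ?cintegral0 ?oppr0// => r.
    by rewrite !mul0r.
  rewrite {1}(vs s0) mulrBr mulrBr -/f.
  have -> : cintegral (fun r => (k s r)%:C * f r) =
      (hexp a (t - s) * a)%:C * cintegral (fun r => (ind s r)%:C * f r).
    rewrite -cintegralZ; first by apply: eq_cintegral => r; rewrite /k CM mulrA.
    apply: (cintegrable_lec _ if_).
      by apply: cmeasM => //; apply: cmeasC; exact: measurable_ind.
    move=> r; rewrite !Normc.normcM !normcC !ger0_norm ?ind_ge0// ler_wpM2r ?normc_ge0//.
    rewrite /ind; case: (leP 0 r) => //= _; case: (leP r s) => [rs|_].
      by rewrite (le_trans rs st).
    by case: ifP.
  have -> : k s 0 = hexp a (t - s) * a by rewrite /k /ind lexx s0 mulr1.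
  by rewrite !CM !mulrA.
have ihv := cintegrable_hexp a0 mav cav iav.
have ihF := cintegrable_hexp a0 mF cF iF.
have A2 : cintegral (fun r => (hexp a (t - r))%:C * f r) =
  cintegral (fun s => (hexp a (t - s))%:C * (a%:C * v s)) +
  cintegral (fun r => (hexp a (t - r))%:C * F r).
  by rewrite -cintegralD//; apply: eq_cintegral => r; rewrite /f mulrDr.
move: A1; rewrite cintegralB// cintegralZr// cintegralC e1 A2 {1}/Rintegral kE//= subr0.
rewrite {1}/ind lexx t0 /= => A1.
rewrite /vE -/f in vt.
have {}vt : cintegral (fun r => (ind t r)%:C * f r) = z - v t by rewrite {1}vt opprB addrC subrK.
move: A1; rewrite {}vt.
move: (cintegral _) (cintegral _) => A B AE.
have {}AE : (1 - hexp a t)%:C * z - (z - v t - (B + A)) - B = 0 by rewrite -AE subrr.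
rewrite CD CN in AE; apply/eqP; rewrite -subr_eq0; apply/eqP; rewrite -{}AE.
ring.
Qed.

End Resolvent.

(** * Regularity of the solution *)

Section Physical.
Context {R : realType}.
Local Notation mu := (@lebesgue_measure R).
Local Notation kap := (@kap R).
Implicit Types (f g h : R -> R) (v : R -> R[i]).

Lemma lebesgue_setT_gt0 : (0 < mu setT)%E.
Proof.
apply: (@lt_le_trans _ _ (mu `[0%R, 1%R]%classic)).
  by rewrite lebesgue_measure_itv/= lte_fin ltr01 oppr0 adde0 lte_fin.
by apply: le_measure => //; rewrite inE//; exact: measurable_itv.
Qed.

Lemma Linf_norm_ge0 f : (0 <= Linf_norm f)%E.
Proof. by rewrite /Linf_norm; case: asboolP => // _; exact: Lnorm_ge0. Qed.

Lemma Linf_norm_meas f : (Linf_norm f < +oo)%E -> mfunT f.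
Proof. by rewrite /Linf_norm; case: asboolP. Qed.

Lemma Linf_normP f (C : R) : (Linf_norm f <= C%:E)%E <->
  mfunT f /\ {ae mu, forall x, `|f x| <= C}.
Proof.
rewrite /Linf_norm unlock; case: asboolP => [mf|mf]; last first.
  by split=> [|[]//]; rewrite leNgt ltry.
rewrite lebesgue_setT_gt0; split=> [/ess_sup_inf.ess_supP h|[_ h]].
  by split => //; apply: aeS h => x; rewrite /= lee_fin.
by apply/ess_sup_inf.ess_supP; apply: aeS h => x; rewrite /= lee_fin.
Qed.

Lemma Linf_norm_Fr v : cintegrable v -> (Linf_norm (Fr v) <= kap%:E * L1n v)%E.
Proof.
move=> iv; rewrite (L1n_fin iv) -EFinM; apply/Linf_normP; split.
  by apply: measurable_Fr; exact: cintegrable_meas.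
by apply: aeW => x; exact: Fr_bound.
Qed.

Lemma is_weak_deriv_Fr v : cintegrable v -> cintegrable (fun y => y%:C * v y) ->
  is_weak_deriv (Fr v) (Fr (fun y => Complex 0 y * v y)).
Proof.
move=> iv iyv; have iw := cintegrable_iM (cintegrable_meas iv) iyv.
split; [exact: Fr_locint|exact: Fr_locint|] => phi tphi.
have [sphi [M Mphi]] := tphi.
have dphi := smooth_is_derive sphi.
have dp : forall x : R, is_derive x 1 (fun x => Fr v x * phi x)
  (Fr (fun y => Complex 0 y * v y) x * phi x + Fr v x * derive1 phi x).
  by move=> x; apply: isdM; exact: is_derive_Fr.
have c1 := continuous_Fr iw; have c2 := continuous_Fr iv.
have c3 := smooth_continuous sphi; have c4 := smooth_continuous (smooth_derive1 sphi).
have : \int[mu]_x (Fr (fun y => Complex 0 y * v y) x * phi x + Fr v x * derive1 phi x) = 0.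
  apply: (Rintegral_derive0_supp dp _ (M := M)) => [x|x /Mphi ->]; last by rewrite mulr0.
  apply: (@continuousD _ R^o R^o (fun x => Fr (fun y => Complex 0 y * v y) x * phi x) (fun x => Fr v x * derive1 phi x)).
    by apply: continuousM; [exact: c1|exact: c3].
  by apply: continuousM; [exact: c2|exact: c4].
rewrite RintegralD//.
- by move/eqP; rewrite addrC addr_eq0 => /eqP.
- by apply: integrable_Fr_test => //; exact: test_fun_integrable.
- by apply: integrable_Fr_test => //; exact: test_fun_integrable (test_derive1 tphi).
Qed.

Lemma is_weak_deriv_unique f g h : is_weak_deriv f g -> is_weak_deriv f h ->
  {ae mu, forall x, g x = h x}.
Proof.
move=> [lf lg eg] [_ lh eh].
have : {ae mu, forall x, g x - h x = 0}.
  apply: test_ortho_eq0; first exact: locally_integrableB.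
  move=> phi tphi; have e := eg _ tphi; rewrite (eh _ tphi) in e.
  have [sphi _] := tphi.
  have ip k : locally_integrable setT k -> Lint (fun x => k x * phi x).
    move=> lk; have [M Mphi] := tphi.2.
    have [C hC] := supp_bounded (smooth_continuous sphi) Mphi.
    have ik := integrable_indic_itv (- M) M lk.
    apply: (integrable_le _ (g := fun x => C * (`|k x| * \1_(`[- M, M]%classic) x))).
    - by apply: measurable_funM; [case: lk|exact: smooth_measurable].
    - by have := integrableZl measurableT C ik; apply: eq_integrable.
    - move=> x; rewrite normrM; have [xM|xM] := leP `|x| M.
        rewrite indicE mem_set ?mulr1; last by rewrite /= in_itv /= -ler_norml.
        by rewrite mulrC ler_wpM2r.
      rewrite Mphi// normr0 mulr0 mulr_ge0// ?mulr_ge0 ?indicE//.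
      exact: le_trans (hC 0).
  under eq_Rintegral => x _ do rewrite mulrBl.
  by rewrite RintegralB ?ip//; apply/eqP; rewrite subr_eq0 -eqr_opp; apply/eqP.
by apply: aeS => x /eqP; rewrite subr_eq0 => /eqP.
Qed.

Lemma sobolev_le n f g : is_weak_deriv f g ->
  (sobolev_norm n.+1 f <= Linf_norm f + sobolev_norm n g)%E.
Proof. by move=> fg; apply: leeD2l; apply: ereal_inf_lbound; exists g. Qed.

Lemma cintegrable_n1 v : cmeas v -> (n1 v < +oo)%E -> cintegrable (fun y => y%:C * v y).
Proof.
move=> mv h; apply/cintegrableP; split; first exact: cmeasM cmeas_id mv.
apply: le_lt_trans h; rewrite le_eqVlt; apply/orP; left; apply/eqP.
by apply: eq_integral => x _; rewrite Normc.normcM normcC.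
Qed.

Lemma L1n_iM v : L1n (fun y => Complex 0 y * v y) = n1 v.
Proof. by apply: eq_integral => x _; rewrite normc_iM Normc.normcM normcC. Qed.

Lemma n1_iM v : n1 (fun y => Complex 0 y * v y) = n2 v.
Proof.
by apply: eq_integral => x _; rewrite normc_iM Normc.normcM normcC mulrA -expr2.
Qed.

Lemma wn_iM v : A1n (fun y => Complex 0 y * v y) = D1n v.
Proof.
apply: eq_integral => x _; rewrite normc_iM Normc.normcM normcC mulrA.
by rewrite [X in X * _]mulrC.
Qed.

Lemma sobolev1_Fr v : cmeas v -> (L1n v < +oo)%E -> (n1 v < +oo)%E ->
  (sobolev_norm 1 (Fr v) <= kap%:E * A1n v)%E.
Proof.
move=> mv l1 ln; have iv : cintegrable v by apply/cintegrableP.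
have iy := cintegrable_n1 mv ln.
apply: le_trans (sobolev_le 0 (is_weak_deriv_Fr iv iy)) _.
apply: le_trans (leeD (Linf_norm_Fr iv) (Linf_norm_Fr (cintegrable_iM mv iy))) _.
by rewrite L1n_iM A1nE// (ge0_muleDr kap%:E (L1n_ge0 v) (n1_ge0 v)).
Qed.

Lemma sobolev2_Fr v : cmeas v -> (L1n v < +oo)%E -> (n1 v < +oo)%E -> (n2 v < +oo)%E ->
  (sobolev_norm 2 (Fr v) <= kap%:E * (L1n v + D1n v))%E.
Proof.
move=> mv l1 ln ln2; have iv : cintegrable v by apply/cintegrableP.
have iy := cintegrable_n1 mv ln; have iw := cintegrable_iM mv iy; have mw := cintegrable_meas iw.
apply: le_trans (sobolev_le 1 (is_weak_deriv_Fr iv iy)) _.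
rewrite ge0_muleDr ?L1n_ge0 ?D1n_ge0//; apply: leeD; first exact: Linf_norm_Fr.
by rewrite -wn_iM; apply: sobolev1_Fr => //; [rewrite L1n_iM|rewrite n1_iM].
Qed.

Lemma Rint_indE (T : R) f : \int[mu]_(t in `[0, T]) f t = \int[mu]_t (ind T t * f t).
Proof.
rewrite Rintegral_mkcond; apply: eq_Rintegral => t _.
rewrite patchE /ind mem_setE in_itv /=; case: ifP => _; by rewrite ?mul1r ?mul0r.
Qed.

Lemma integrable_indP (T : R) f : mfunT f ->
  mu.-integrable `[0, T] (EFin \o f) -> Lint (fun t => ind T t * f t).
Proof.
move=> mf /integrableP[_ h]; apply/integrableP; split.
  by apply/measurable_EFinP; apply: measurable_funM => //; exact: measurable_ind.
rewrite integral_indE in h; apply: le_lt_trans h; rewrite le_eqVlt; apply/orP; left; apply/eqP.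
by apply: eq_integral => t _; rewrite /= normrM ger0_norm ?ind_ge0.
Qed.

Lemma ibp_time (phi f g : R -> R) (f0 T : R) : 0 <= T -> smooth phi -> phi T = 0 ->
  mfunT g -> Lint (fun t => ind T t * g t) ->
  (forall t, 0 <= t <= T -> f t = f0 - \int[mu]_s (ind t s * g s)) ->
  \int[mu]_(t in `[0, T]) (derive1 phi t * f t) =
  - (phi 0 * f0) + \int[mu]_(t in `[0, T]) (g t * phi t).
Proof.
move=> T0 sphi phiT mg ig fE; rewrite !Rint_indE.
set phi' := derive1 phi.
have cphi' : continuous phi' by exact: smooth_continuous (smooth_derive1 sphi).
have mphi' : mfunT phi' by exact: smooth_measurable (smooth_derive1 sphi).
have iphi' : Lint (fun t => ind T t * phi' t).
  by apply: integrable_indP => //; exact: continuous_itv_integrable.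
have dphi := smooth_is_derive sphi.
pose k t s := (ind T t * phi' t) * (ind t s * g s).
have mk : mfunT (fun z : R * R => k z.1 z.2).
  apply: measurable_funM.
    apply: (measurableT_comp (f := fun t => ind T t * phi' t)); last exact: measurable_fst.
    by apply: measurable_funM => //; exact: measurable_ind.
  apply: measurable_funM; last exact: (measurableT_comp mg measurable_snd).
  by apply: measurable_ind2; [exact: measurable_fst|exact: measurable_snd].
have ind_le t s : ind T t * ind t s <= ind T s.
  rewrite /ind; case: (leP 0 t) => /= t0; last by rewrite mul0r; case: ifP.
  case: (leP t T) => tT; last by rewrite mul0r; case: ifP.
  rewrite mul1r; case: (leP 0 s) => //= s0; case: (leP s t) => st; first by rewrite (le_trans st tT).
  by case: ifP.
have kfin : (\int[mu]_t \int[mu]_s (`|k t s|)%:E < +oo)%E.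
  pose I := \int[mu]_s `|ind T s * g s|.
  have Ie : (\int[mu]_s (`|ind T s * g s|)%:E = I%:E)%E.
    by rewrite /I /Rintegral fineK//; apply: integrable_fin_num => //; exact: (integrable_norm ig).
  have I0 : 0 <= I by rewrite /I /Rintegral fine_ge0// integral_ge0// => s _; rewrite lee_fin.
  apply: (@le_lt_trans _ _ (\int[mu]_t ((I%:E) * (`|ind T t * phi' t|)%:E))%E); last first.
    rewrite ge0_integralZl// ?lee_fin//; last first.
      apply/measurable_EFinP; apply: measurableT_comp => //; apply: measurable_funM => //.
      exact: measurable_ind.
    apply: lte_mul_pinfty; rewrite ?lee_fin//.
    by have /integrableP[_] := iphi'.
  apply: ge0_le_integral_nomeas => t _; first by apply: integral_ge0 => s _; rewrite lee_fin.
  rewrite muleC -Ie -ge0_integralZl//; last first.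
    apply/measurable_EFinP; apply: measurableT_comp => //; apply: measurable_funM => //.
    exact: measurable_ind.
  apply: ge0_le_integral_nomeas => s _; rewrite lee_fin//.
  rewrite /k !normrM !(ger0_norm (ind_ge0 _ _)) mulrACA [leRHS]mulrACA.
  apply: ler_wpM2r; first by rewrite mulr_ge0.
  have [t0|t0] := eqVneq (ind T t) 0; first by rewrite t0 !mul0r.
  have -> : ind T t = 1 by move: t0; rewrite /ind; case: ifP => //; rewrite eqxx.
  rewrite !mul1r; apply: le_trans (ind_le t s).
  have -> : ind T t = 1 by move: t0; rewrite /ind; case: ifP => //; rewrite eqxx.
  by rewrite mul1r.
have E1 : \int[mu]_t (ind T t * (phi' t * f t)) =
  f0 * \int[mu]_t (ind T t * phi' t) - \int[mu]_t \int[mu]_s k t s.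
  have isec : Lint (fun t => \int[mu]_s k t s).
    have mkc : cmeas (fun z : R * R => (k z.1 z.2)%:C) by exact: cmeasC.
    have [|h _] := L1n_cintegral_le (f := fun t s => (k t s)%:C) mkc.
      apply: le_lt_trans kfin; rewrite le_eqVlt; apply/orP; left; apply/eqP.
      apply: eq_integral => t _; by apply: eq_integral => s _; rewrite normcC.
    by have [h1 _] := h; apply: eq_integrable h1 => // t _ /=; rewrite cintegralC.
  rewrite -RintegralZl// -RintegralB//; last first.
    by have := integrableZl measurableT f0 iphi'; apply: eq_integrable.
  apply: eq_Rintegral => t _; rewrite /k.
  have [t0|t0] := eqVneq (ind T t) 0.
    rewrite t0 !mul0r mulr0 sub0r (eq_Rintegral _ (g := fun=> 0)).
      by rewrite /Rintegral integral0 oppr0.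
    by move=> s _; rewrite !mul0r.
  have [t1 tT] : 0 <= t /\ t <= T by move: t0; rewrite /ind; case: ifP => [/andP[]//|]; rewrite eqxx.
  rewrite fE ?t1// mulrBr mulrBr; congr (_ - _); first by rewrite [RHS]mulrC mulrA.
  rewrite mulrA -RintegralZl//.
  have mi : mfunT (fun s => ind t s * g s).
    by apply: measurable_funM => //; exact: measurable_ind.
  apply: (integrable_le mi (integrable_norm ig)) => s /=.
  rewrite !normrM !(ger0_norm (ind_ge0 _ _)); apply: ler_wpM2r => //.
  apply: le_trans (ind_le t s).
  have -> : ind T t = 1 by move: t0; rewrite /ind; case: ifP => //; rewrite eqxx.
  by rewrite mul1r.
have FT a : 0 <= a <= T -> \int[mu]_t (ind T t * phi' t * ind t a) = phi T - phi a.
  move=> /andP[a0 aT]; rewrite -(Rintegral_FTC aT dphi cphi') [RHS]Rintegral_mkcond.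
  apply: eq_Rintegral => t _; rewrite patchE mem_setE in_itv /= /ind a0 /=.
  case: (leP a t) => ta /=; last by rewrite mulr0.
  by rewrite (le_trans a0 ta) /= mulr1; case: ifP; rewrite ?mul1r ?mul0r.
rewrite E1 RFubini//.
have -> : \int[mu]_t (ind T t * phi' t) = - phi 0.
  have := FT 0; rewrite lexx T0 phiT sub0r => <- //; apply: eq_Rintegral => t _.
  by rewrite /ind lexx /=; case: (leP 0 t) => /=; rewrite ?mulr1// ?mul0r.
rewrite mulrN mulrC; congr (_ + _); rewrite -RintegralN_gen; apply: eq_Rintegral => s _.
rewrite /k; under eq_Rintegral => t _ do rewrite mulrA.
have ik : Lint (fun t => ind T t * phi' t * ind t s).
  have m1 : mfunT (fun t => ind t s).
    by apply: measurable_ind2; [exact: measurable_id|exact: measurable_cst].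
  apply: (integrable_le _ (integrable_norm iphi')) => [|t /=].
    by apply: measurable_funM => //; apply: measurable_funM => //; exact: measurable_ind.
  by rewrite normrM ler_piMr// ger0_norm ?ind_ge0 ?ind_le1.
rewrite RintegralZr//.
have [s1|s1] := boolP (0 <= s <= T).
  by rewrite FT// phiT sub0r /ind s1; ring.
have -> : ind T s = 0 by rewrite /ind (negbTE s1).
rewrite (eq_Rintegral _ (g := fun=> 0)); first by rewrite /Rintegral integral0 /= !mul0r oppr0.
move=> t _; rewrite mulrAC; have -> : ind T t * ind t s = 0; last by rewrite mul0r.
apply/le_anti; rewrite mulr_ge0 ?ind_ge0// andbT; apply: le_trans (ind_le t s) _.
by rewrite /ind (negbTE s1).
Qed.

End Physical.

Section Steps.
Context {R : realType}.
Local Notation mu := (@lebesgue_measure R).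
Local Notation kap := (@kap R).
Local Notation cmeas2 F := (cmeas (fun z : R * R => F z.1 z.2)).
Variable T : R.
Hypothesis T0 : 0 < T.
Local Notation I := `]0, T[%classic.

Definition kn (n : nat) : R := n.+1%:R ^+ 3.
Definition idx (n : nat) (t : R) : nat := Num.truncn (t * kn n).
Definition cell (n i : nat) : set R := `[i%:R / kn n, i.+1%:R / kn n[%classic.

Lemma kn_gt0 n : 0 < kn n. Proof. by rewrite exprn_gt0// ltr0n. Qed.

Lemma cell_idx n i t : 0 <= t -> (\1_(cell n i) t : R) = (i == idx n t)%:R.
Proof.
move=> t0; rewrite indicE /cell /idx; congr (_ %:R); congr nat_of_bool.
have tk : 0 <= t * kn n by rewrite mulr_ge0// ltW// kn_gt0.
rewrite eq_sym truncn_eq// mem_setE in_itv /= ler_pdivrMr ?kn_gt0//.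
by rewrite ltr_pdivlMr ?kn_gt0.
Qed.

Lemma sum_iota_eq (A : pzRingType) (a : nat -> A) j m : (j < m)%N ->
  \sum_(i <- iota 0 m) (i == j)%:R * a i = a j.
Proof.
move=> jm; rewrite (bigD1_seq j) ?mem_iota ?iota_uniq//= eqxx mul1r big1 ?addr0// => i.
by move=> /negbTE ->; rewrite mul0r.
Qed.

Lemma idx_lt n t : t <= T -> (idx n t < (idx n T).+1)%N.
Proof. by move=> tT; rewrite ltnS; apply: le_truncn; rewrite ler_wpM2r// ltW// kn_gt0. Qed.

Lemma idx_bounds n t : 0 <= t -> (idx n t)%:R / kn n <= t /\ t - (idx n t)%:R / kn n <= (kn n)^-1.
Proof.
move=> t0; have tk : 0 <= t * kn n by rewrite mulr_ge0// ltW// kn_gt0.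
have /andP[h1 h2] := truncn_itv tk; split; first by rewrite ler_pdivrMr ?kn_gt0.
rewrite lerBlDr -[X in _ <= X + _]mul1r -mulrDl ler_pdivlMr ?kn_gt0//.
by rewrite -natr1 addrC in h2; exact: ltW.
Qed.

Definition stp (V : nat -> nat -> R -> R) (n : nat) : seq (set R * (R -> R)) :=
  [seq (cell n i, V n i) | i <- iota 0 (idx n T).+1].

Lemma step_val_stp V n t x : 0 <= t <= T -> step_val (stp V n) t x = V n (idx n t) x.
Proof.
move=> /andP[t0 tT]; rewrite /step_val /stp big_map.
under eq_bigr => i _ do rewrite /= cell_idx//.
by rewrite (sum_iota_eq (fun i => V n i x)) ?idx_lt.
Qed.

Lemma measurable_cell n i : measurable (cell n i).
Proof. exact: measurable_itv. Qed.

Lemma is_step_stp (N : (R -> R) -> \bar R) V n : (forall i, (N (V n i) < +oo)%E) -> is_step N (stp V n).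
Proof. by move=> h p /mapP[i _ ->]; split; [exact: measurable_cell|exact: h]. Qed.

Lemma step_approx_stp (N : (R -> R) -> \bar R) (u : R -> R -> R) V : (forall n i, (N (V n i) < +oo)%E) ->
  {ae mu, forall t, 0 < t < T -> (fun n => N (fun x => u t x - V n (idx n t) x)) @ \oo --> 0%E} ->
  step_approx T N u (stp V).
Proof.
move=> NV h; split=> [n|]; first by apply: is_step_stp.
apply: aeS h => t ht; rewrite /= in_itv /= => tI; have := ht tI.
have /andP[/ltW t0 /ltW tT] := tI.
rewrite (_ : (fun n => N (fun x => u t x - V n (idx n t) x)) =
  (fun n => N (fun x => u t x - step_val (stp V n) t x)))//; apply/funext => n; congr N.
by apply/funext => x; rewrite step_val_stp// t0.
Qed.

Lemma integrable_ind : Lint (ind T).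
Proof.
apply/integrableP; split; first by apply/measurable_EFinP; exact: measurable_ind.
apply: (@le_lt_trans _ _ (\int[mu]_(t in `[0%R, T]) 1)%E); last first.
  by rewrite integral_cst ?mul1e/= ?lebesgue_measure_itv/=; [case: ifP; rewrite ?ltry// -EFinN -EFinD ltry|exact: measurable_itv].
rewrite integral_indE; apply: ge0_le_integral_nomeas => t _; first exact: abse_ge0.
by rewrite /= ger0_norm ?ind_ge0 ?mule1.
Qed.

Lemma ind_I t : t != 0 -> t != T -> ind T t != 0 -> 0 < t < T.
Proof.
move=> t0 tT; rewrite /ind; case: ifP; last by rewrite eqxx.
by move=> /andP[a b] _; rewrite lt_neqAle eq_sym t0 a lt_neqAle tT.
Qed.

Lemma integrable_ind_ae (f : R -> R) (C : R) : mfunT f -> 0 <= C ->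
  {ae mu, forall t, 0 < t < T -> `|f t| <= C} ->
  Lint (fun t => ind T t * f t).
Proof.
move=> mf C0 h; apply/integrableP; split.
  by apply/measurable_EFinP; apply: measurable_funM => //; exact: measurable_ind.
have /integrableP[_ h2] := integrableZl measurableT C integrable_ind.
apply: le_lt_trans h2; apply: ae_ge0_le_integral_nomeas => [t _|t _|]; try exact: abse_ge0.
apply: aeS (aeI h (aeI (ae_neq 0) (ae_neq T))) => t [ht [t0 tT]] _.
rewrite /= lee_fin normrM normrM (ger0_norm C0) (ger0_norm (ind_ge0 T t)) mulrC.
have [i0|i0] := eqVneq (ind T t) 0; first by rewrite i0 !mulr0.
by apply: ler_wpM2r; [exact: ind_ge0|apply: ht; exact: ind_I].
Qed.

Lemma step_intE (s : seq (set R * (R -> R))) x : (forall p, p \in s -> measurable p.1) ->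
  Lint (fun t => ind T t * step_val s t x) /\
  step_int T s x = \int[mu]_t (ind T t * step_val s t x).
Proof.
elim: s => [|[A f] s IH] ms.
  rewrite /step_int /step_val big_nil; split.
    rewrite (_ : _ \o _ = cst 0%E); first exact: integrable0.
    by apply/funext => t /=; rewrite big_nil mulr0.
  rewrite (eq_Rintegral _ (g := fun=> 0)); first by rewrite /Rintegral integral0.
  by move=> t _; rewrite big_nil mulr0.
have mA : measurable A by apply: (ms (A, f)); rewrite inE eqxx.
have [|i1 e1] := IH; first by move=> p ps; apply: ms; rewrite inE ps orbT.
have iA : Lint (fun t => ind T t * (\1_A t * f x)).
  apply: (integrable_ind_ae (C := `|f x|)) => //.
    by apply: measurable_funM => //; exact: measurable_cst.
  by apply: aeW => t _; rewrite normrM ler_piMl// indicE normr_nat; case: (_ \in _); rewrite ?ler01.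
have E t : ind T t * step_val ((A, f) :: s) t x = ind T t * (\1_A t * f x) + ind T t * step_val s t x.
  by rewrite /step_val big_cons mulrDr.
split.
  rewrite (_ : (fun t => _) = fun t => ind T t * (\1_A t * f x) + ind T t * step_val s t x).
    exact: (integrableD measurableT iA i1).
  by apply/funext => t; exact: E.
have -> : \int[mu]_t (ind T t * step_val ((A, f) :: s) t x) =
    \int[mu]_t (ind T t * (\1_A t * f x) + ind T t * step_val s t x) by apply: eq_Rintegral.
rewrite RintegralD// -e1 /step_int big_cons /=; congr (_ + _).
have mAI : measurable (A `&` I) by apply: measurableI => //; exact: measurable_itv.
have -> : \int[mu]_t (ind T t * (\1_A t * f x)) = \int[mu]_t (\1_(A `&` I) t * f x).
  apply: ae_Rintegral_indep; apply: aeS (aeI (ae_neq 0) (ae_neq T)) => t [t0 tT] _.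
  rewrite mulrA; congr (_ * _); rewrite indicI /= mulrC; congr (_ * _).
  rewrite indicE mem_setE in_itv /=.
  rewrite /ind; case: ifPn => [/andP[a b]|h].
    by rewrite !lt_neqAle eq_sym t0 tT a b.
  by case: andP => // -[a b]; rewrite (ltW a) (ltW b) in h.
have fm : (mu (A `&` I) < +oo)%E.
  apply: (@le_lt_trans _ _ (mu I)); first by apply: le_measure; rewrite ?inE//; exact: measurable_itv.
  by rewrite lebesgue_measure_itv /=; case: ifP; rewrite ?ltry// -EFinN -EFinD ltry.
have iI : Lint (\1_(A `&` I) : R -> R).
  apply/integrableP; split; first by apply/measurable_EFinP.
  apply: le_lt_trans fm; rewrite -(setIT (A `&` I)) -integral_indic//.
  by apply: ge0_le_integral_nomeas => t _; [exact: abse_ge0|rewrite /= normr_nat setIT].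
by rewrite RintegralZr// /Rintegral integral_indic// setIT.
Qed.

Lemma measurable_Fr2 (W : R -> R -> R[i]) : cmeas2 W -> mfunT (fun z : R * R => Fr (W z.1) z.2).
Proof.
move=> mW.
have m : cmeas (fun z : (R * R) * R => W z.1.1 z.2 * expi (z.1.2 * z.2)).
  have m1 : mfunT (fun z : (R * R) * R => z.1.1).
    exact: (measurableT_comp measurable_fst measurable_fst).
  have m2 : mfunT (fun z : (R * R) * R => z.1.2).
    exact: (measurableT_comp measurable_snd measurable_fst).
  apply: cmeasM; last by apply: cmeas_expi; apply: measurable_funM.
  apply: (cmeas_comp (f := fun z : R * R => W z.1 z.2) (g := fun z : (R * R) * R => (z.1.1, z.2))) => //.
  exact: measurable_fun_pair.
have := cmeas_cintegral m => h.
have : cmeas (fun z : R * R => kap%:C * cintegral (fun xi => W z.1 xi * expi (z.2 * xi))).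
  by apply: cmeasM => //; exact: cmeas_cst.
by case=> mr _; move: mr; apply: eq_measurable_fun => -[t x] _; rewrite /Fr FiE.
Qed.

Lemma measurable_Fr_t (W : R -> R -> R[i]) x : cmeas2 W -> mfunT (fun t => Fr (W t) x).
Proof. by move=> mW; exact: (@measurable_sec2 R (fun t x => Fr (W t) x) x (measurable_Fr2 mW)). Qed.

Definition Qs (Q : nat -> nat -> R -> R[i]) (n : nat) (t xi : R) : R[i] :=
  \sum_(i <- iota 0 (idx n T).+1) (\1_(cell n i) t)%:C * Q n i xi.

Lemma QsE Q n t xi : 0 <= t <= T -> Qs Q n t xi = Q n (idx n t) xi.
Proof.
move=> /andP[t0 tT]; rewrite /Qs.
have E i : ((\1_(cell n i) t : R)%:C : R[i]) = (i == idx n t)%:R.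
  by rewrite cell_idx//; case: (_ == _).
under eq_bigr => i _ do rewrite E.
by rewrite (sum_iota_eq (fun i => Q n i xi)) ?idx_lt.
Qed.

Lemma cmeas_Qs Q n : (forall n i, cmeas (Q n i)) -> cmeas2 (Qs Q n).
Proof.
move=> mQ; apply: cmeas_sum => i; apply: cmeasM; last exact: cmeas_pair2.
apply: cmeasC; apply: (measurableT_comp (f := (\1_(cell n i) : R -> R))); last exact: measurable_fst.
by apply: measurable_indic; exact: measurable_cell.
Qed.

Lemma cvg_Linf_Fr (w : R -> R[i]) (q : nat -> R -> R[i]) (N : (R -> R) -> \bar R) (K : R) :
  (forall n, (0 <= N (Fr (fun xi => w xi - q n xi)%R))%E) ->
  cintegrable w -> (forall n, cintegrable (q n)) ->
  forall e : nat -> \bar R, (forall n, (N (Fr (fun xi => w xi - q n xi)%R) <= K%:E * e n)%E) ->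
  (e n @[n --> \oo] --> 0%E) ->
  (fun n => N (fun x => Fr w x - Fr (q n) x)) @ \oo --> 0%E.
Proof.
move=> N0 iw iq e he ce.
rewrite (_ : (fun n => _) = (fun n => N (Fr (fun xi => w xi - q n xi)))); last first.
  by apply/funext => n; congr N; apply/funext => x; rewrite /Fr FiB// ReB.
apply: (@squeeze_cvge _ _ _ _ (fun=> 0%E) _ (fun n => K%:E * e n)%E).
- by apply: nearW => n; rewrite N0 he.
- exact: cvg_cst.
- by rewrite -(mule0 K%:E); apply: cvgeZl.
Qed.

Lemma bochner_Fr (W : R -> R -> R[i]) (Q : nat -> nat -> R -> R[i]) (M : R) : cmeas2 W ->
  (forall n i, cmeas (Q n i)) -> (forall n i, (L1n (Q n i) <= M%:E)%E) ->
  {ae mu, forall t, 0 < t < T -> (L1n (W t) <= M%:E)%E} ->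
  {ae mu, forall t, 0 < t < T -> (fun n => L1n (fun xi => W t xi - Q n (idx n t) xi)%R) @ \oo --> 0%E} ->
  is_bochner_integral T Linf_norm (fun t x => Fr (W t) x) (fun x => \int[mu]_t (ind T t * Fr (W t) x)).
Proof.
move=> mW mQ bQ bW cv; set V := fun n i => Fr (Q n i).
have M0 : 0 <= M by rewrite -lee_fin; apply: le_trans (bQ 0 0); exact: L1n_ge0.
have iQ n i : cintegrable (Q n i) by apply/cintegrableP; split => //; apply: le_lt_trans (bQ n i) (ltry _).
have mWt t : cmeas (W t) by exact: cmeas_sec1.
have iW : {ae mu, forall t, 0 < t < T -> cintegrable (W t)}.
  by apply: aeS bW => t h /h b; apply/cintegrableP; split => //; apply: le_lt_trans b (ltry _).
have k0 := @kap_gt0 R.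
have mD n : cmeas2 (fun t xi => W t xi - Qs Q n t xi) by apply: cmeasB => //; exact: cmeas_Qs.
pose e n t := L1n (fun xi => W t xi - Qs Q n t xi).
have me n : mfunT (e n).
  have := @measurable_wnF R (fun=> 1) (fun t xi => W t xi - Qs Q n t xi) (measurable_cst (1 : R)) (fun=> ler01) (mD n).
  by apply: eq_measurable_fun => t _; rewrite wn1.
have eE n t : 0 < t < T -> e n t = L1n (fun xi => W t xi - Q n (idx n t) xi).
  move=> /andP[a b]; congr L1n; apply/funext => xi; rewrite QsE//; apply/andP; split; exact: ltW.
have key : {ae mu, forall t, 0 < t < T -> forall n,
    (Linf_norm (fun x => Fr (W t) x - step_val (stp V n) t x)%R <= kap%:E * e n t)%E}.
  apply: aeS iW => t h tI n; have iw := h tI; rewrite eE//.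
  have -> : (fun x => Fr (W t) x - step_val (stp V n) t x) = Fr (fun xi => W t xi - Q n (idx n t) xi).
    apply/funext => x; rewrite step_val_stp.
      by rewrite /V /Fr FiB// ReB.
    by have /andP[a b] := tI; apply/andP; split; exact: ltW.
  by apply: Linf_norm_Fr; exact: cintegrableB.
have key2 : {ae mu, forall t, 0 < t < T -> forall n x,
    ((`|Fr (W t) x - step_val (stp V n) t x|)%:E <= kap%:E * e n t)%E}.
  apply: aeS iW => t h tI n x; have iw := h tI; rewrite eE//.
  rewrite step_val_stp; last by have /andP[a b] := tI; apply/andP; split; exact: ltW.
  rewrite /V /Fr -ReB -FiB// L1n_fin; last exact: cintegrableB.
  by rewrite -EFinM lee_fin; apply: Fr_bound; exact: cintegrableB.
have eb : {ae mu, forall t, 0 < t < T -> forall n, (e n t <= (2 * M)%:E)%E}.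
  apply: aeS bW => t h tI n; rewrite eE//.
  apply: (@le_trans _ _ (L1n (W t) + L1n (Q n (idx n t)))%E).
    have mN f : cmeas f -> mfunT (fun x : R => (normc (f x))%:E).
      by move=> mf; apply/measurable_EFinP; exact: cmeas_norm.
    rewrite /L1n ge0_intD//.
    - apply: ge0_le_integral_nomeas => x _; first by rewrite lee_fin normc_ge0.
      by rewrite -EFinD lee_fin normcB.
    - exact: mN.
    - exact: mN.
    - by move=> x; rewrite lee_fin normc_ge0.
    - by move=> x; rewrite lee_fin normc_ge0.
  by rewrite mulr_natl mulr2n EFinD; apply: leeD; [exact: h|exact: bQ].
have mI : measurable I by exact: measurable_itv.
have Ifin : (mu I < +oo)%E by rewrite lebesgue_measure_itv /=; case: ifP; rewrite ?ltry// -EFinN -EFinD ltry.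
have De : (fun n => \int[mu]_(t in I) e n t)%E @ \oo --> 0%E.
  have [|||||_ _] := @dominated_convergence _ _ _ mu I mI e (fun=> 0%E) (fun=> (2 * M)%:E).
  - by move=> n; apply: measurable_funTS; exact: me.
  - exact: measurable_cst.
  - apply: aeS cv => t h; rewrite /= in_itv /= => tI; have := h tI.
    by rewrite (_ : (fun n => _) = (fun n => e n t))//; apply/funext => n; rewrite eE.
  - apply/integrableP; split; first exact: measurable_cst.
    rewrite integral_cst//; apply: lte_mul_pinfty => //.
  - by apply: aeS eb => t h n; rewrite /= in_itv /= => tI; rewrite gee0_abs ?L1n_ge0 ?h.
  by rewrite integral0.
have mke n : measurable_fun I (fun t => kap%:E * e n t)%E.
  by apply: measurable_funTS; apply: measurable_funeM.
have Dk : (fun n => \int[mu]_(t in I) (kap%:E * e n t))%E @ \oo --> 0%E.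
  rewrite (_ : (fun n => _) = (fun n => kap%:E * \int[mu]_(t in I) e n t)%E).
    by rewrite -(mule0 kap%:E); apply: cvgeZl.
  apply/funext => n; rewrite ge0_integralZl//; first by apply: measurable_funTS; exact: me.
    by move=> t _; exact: L1n_ge0.
  by rewrite lee_fin ltW.
exists (stp V); split.
- apply: step_approx_stp => [n i|].
    apply: le_lt_trans (Linf_norm_Fr (iQ n i)) _.
    by apply: le_lt_trans (lee_wpmul2l _ (bQ n i)) _; rewrite ?lee_fin ?(ltW k0)// -EFinM ltry.
  apply: aeS (aeI iW cv) => t [iw ht] tI.
  apply: (cvg_Linf_Fr (N := Linf_norm) (K := kap) _ (iw tI) _ _ (ht tI)) => [n|n|n].
  + exact: Linf_norm_ge0.
  + exact: iQ.
  + by apply: Linf_norm_Fr; apply: cintegrableB => //; exact: iw.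
- apply: (squeeze_cvge _ (cvg_cst 0%E) Dk); apply: nearW => n; apply/andP; split.
    by apply: integral_ge0 => t _; exact: Linf_norm_ge0.
  apply: ae_ge0_le_integral_nomeas => [t _|t _|]; first exact: Linf_norm_ge0.
    by rewrite mule_ge0 ?L1n_ge0// lee_fin ltW.
  by apply: aeS key => t h; rewrite /= in_itv /= => tI; exact: h.
- apply: (squeeze_cvge _ (cvg_cst 0%E) Dk); apply: nearW => n; rewrite Linf_norm_ge0 /=.
  have kM0 : 0 <= kap * (2 * M) by apply: mulr_ge0; [exact: ltW|exact: mulr_ge0].
  have kfin : (\int[mu]_(t in I) (kap%:E * e n t) < +oo)%E.
    apply: (@le_lt_trans _ _ (\int[mu]_(t in I) (kap * (2 * M))%:E)%E); last first.
      rewrite integral_cst//; apply: lte_mul_pinfty => //.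
    apply: ae_ge0_le_integral_nomeas => [t _|t _|].
    + by rewrite mule_ge0 ?L1n_ge0// lee_fin ltW.
    + by rewrite lee_fin.
    + apply: aeS eb => t h; rewrite /= in_itv /= => tI; rewrite EFinM; apply: lee_wpmul2l.
        by rewrite lee_fin ltW.
      exact: h.
  have kge0 : (0 <= \int[mu]_(t in I) (kap%:E * e n t))%E.
    by apply: integral_ge0 => t _; rewrite mule_ge0 ?L1n_ge0// lee_fin ltW.
  rewrite -(fineK (x := \int[mu]_(t in I) (kap%:E * e n t))%E); last by rewrite ge0_fin_numE.
  have mFr : mfunT (fun z : R * R => Fr (W z.1) z.2) by exact: measurable_Fr2.
  have sI x := @step_intE (stp V n) x (fun p => ltac:(by move=> /mapP[i _ ->]; exact: measurable_cell)).
  apply/Linf_normP; split.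
    apply: measurable_funB; last first.
      rewrite /step_int /stp; under eq_fun do rewrite big_map.
      apply: measurable_sum => i; apply: measurable_funM; first exact: measurable_cst.
      exact: measurable_Fr.
    have mm : mfunT (fun z : R * R => ind T z.2 * Fr (W z.2) z.1).
      apply: measurable_funM; first by apply: (measurableT_comp (measurable_ind T)); exact: measurable_snd.
      exact: (measurableT_comp mFr (measurable_fun_pair measurable_snd measurable_fst)).
    exact: (measurable_Rintegral mm).
  apply: aeW => x; have [is1 ->] := sI x.
  have iF : Lint (fun t => ind T t * Fr (W t) x).
    apply: (integrable_ind_ae (C := kap * M)); first exact: measurable_Fr_t.
      by rewrite mulr_ge0// ltW.
    apply: aeS (aeI iW bW) => t [iw bw] tI; apply: le_trans (Fr_bound x (iw tI)) _.
    by apply: ler_wpM2l; [exact: ltW|rewrite -lee_fin -L1n_fin; [exact: bw|exact: iw]].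
  rewrite -RintegralB// -lee_fin fineK; last by rewrite ge0_fin_numE.
  have iFB := integrableB measurableT iF is1.
  apply: (@le_trans _ _ (\int[mu]_t (`|ind T t * (Fr (W t) x - step_val (stp V n) t x)|)%:E)%E).
    apply: le_trans (_ : _ <= (\int[mu]_t `|ind T t * Fr (W t) x - ind T t * step_val (stp V n) t x|)%:E)%E _.
      by rewrite lee_fin le_normr_Rintegral.
    rewrite /Rintegral fineK; last by apply: integrable_fin_num => //; exact: (integrable_norm iFB).
    by rewrite le_eqVlt; apply/orP; left; apply/eqP; apply: eq_integral => t _; rewrite (mulrBr (ind T t) (Fr (W t) x)).
  rewrite integral_mkcond [leRHS]integral_mkcond; apply: ae_ge0_le_integral_nomeas => [t _|t _|].
  + by rewrite patchE; case: ifP => // _; rewrite lee_fin.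
  + by rewrite patchE; case: ifP => // _; rewrite mule_ge0 ?L1n_ge0// lee_fin ltW.
  + apply: aeS (aeI key2 (aeI (ae_neq 0) (ae_neq T))) => t [h [t0 tT]] _; rewrite !patchE in_setT.
    have [i0|i0] := eqVneq (ind T t) 0.
      rewrite i0 mul0r normr0; case: ifP => // _; rewrite mule_ge0 ?L1n_ge0// lee_fin ltW//.
    have tI := ind_I t0 tT i0; rewrite mem_setE in_itv /= tI normrM ger0_norm ?ind_ge0//.
    have i1 : ind T t = 1 by move: i0; rewrite /ind; case: ifP => //; rewrite eqxx.
    by rewrite i1 mul1r; exact: h.
Qed.

End Steps.

Section TwoVariables.
Context {R : realType}.
Local Notation mu := (@lebesgue_measure R).
Implicit Types (psi : R -> R -> R).

Lemma cvg_tau (t : R) : 0 <= t -> (idx n t)%:R / (kn n : R) @[n --> \oo] --> t.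
Proof.
move=> t0; have h : (t - harmonic n : R) @[n --> \oo] --> t.
  by rewrite -[X in _ --> X]subr0; apply: cvgB; [exact: cvg_cst|exact: cvg_harmonic].
apply: (squeeze_cvgr _ h (cvg_cst t)); apply: nearW => n.
have [h1 h2] := idx_bounds n t0; rewrite h1 andbT lerBlDr -lerBlDl (le_trans h2)//.
rewrite /kn /harmonic lef_pV2 ?posrE ?exprn_gt0 ?ltr0n// -[leLHS]expr1.
by rewrite ler_weXn2l// ler1n.
Qed.

Lemma cont2_sec1 psi t : continuous (fun p : R * R => psi p.1 p.2) -> continuous (psi t).
Proof.
by move=> c x; exact: (cvg_comp2 (cvg_cst t) cvg_id (c (t, x))).
Qed.

Lemma cont2_sec2 psi x : continuous (fun p : R * R => psi p.1 p.2) -> continuous (psi ^~ x).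
Proof.
by move=> c t; exact: (cvg_comp2 cvg_id (cvg_cst x) (c (t, x))).
Qed.

Lemma cont2_bounded psi (T M : R) : continuous (fun p : R * R => psi p.1 p.2) ->
  exists2 C, 0 <= C & forall t x, 0 <= t <= T -> `|x| <= M -> `|psi t x| <= C.
Proof.
move=> c; have cK := compact_setX (@segment_compact R 0 T) (@segment_compact R (- M) M).
have [N [_ hN]] := compact_bounded (continuous_compact (continuous_subspaceT c) cK).
exists (Num.max N 0 + 1); first by rewrite addr_ge0// le_max lexx orbT.
move=> t x tT xM; apply: (hN (Num.max N 0 + 1)).
  by rewrite (@le_lt_trans _ _ (Num.max N 0)) ?le_max ?lexx// ltrDl.
by exists (t, x) => //=; split; rewrite /= in_itv //= -ler_norml.
Qed.

Lemma cvg_psi_tau psi (t x : R) : 0 <= t -> continuous (fun p : R * R => psi p.1 p.2) ->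
  psi ((idx n t)%:R / kn n) x @[n --> \oo] --> psi t x.
Proof. by move=> t0 c; exact: (cvg_comp _ _ (cvg_tau t0) (@cont2_sec2 _ x c t)). Qed.

Lemma measurable_ind_cont2 psi (T : R) : continuous (fun p : R * R => psi p.1 p.2) ->
  mfunT (fun z : R * R => ind T z.1 * psi z.1 z.2).
Proof.
move=> c.
have mi : mfunT (fun z : R * R => ind T z.1).
  exact: (measurableT_comp (measurable_ind T) measurable_fst).
apply: (@measurable_fun_cvg _ _ _ setT (fun n (z : R * R) => ind T z.1 *
   \sum_(i <- iota 0 (idx n T).+1) \1_(cell n i) z.1 * psi (i%:R / (kn n : R)) z.2)) => [n|[t x] _ /=].
  apply: measurable_funM => //; apply: measurable_sum => i; apply: measurable_funM.
    apply: (measurableT_comp (f := (\1_(cell n i) : R -> R))); last exact: measurable_fst.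
    by apply: measurable_indic; exact: measurable_cell.
  apply: (measurableT_comp (f := psi (i%:R / (kn n : R)))); last exact: measurable_snd.
  by apply: continuous_measurable_fun; exact: cont2_sec1.
have [i0|i0] := eqVneq (ind T t) 0.
  by rewrite i0 mul0r (_ : (fun _ => _) = cst 0); [exact: cvg_cst|apply/funext => n; rewrite mul0r].
have /andP[t0 tT] : 0 <= t <= T by move: i0; rewrite /ind; case: ifP => //; rewrite eqxx.
apply: cvgM; first exact: cvg_cst.
rewrite (_ : (fun n => _) = (fun n => psi ((idx n t)%:R / (kn n : R)) x)); last first.
  apply/funext => n; under eq_bigr => i _ do rewrite cell_idx//.
  rewrite -[0%N :: _]/(iota 0 (idx n T).+1).
  by rewrite (sum_iota_eq (fun i => psi (i%:R / (kn n : R)) x)) ?idx_lt.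
exact: cvg_psi_tau.
Qed.

Lemma Cn2_smooth1 psi : (forall n, Cn2 n psi) -> forall t, smooth (psi t).
Proof.
move=> h t; apply: (@smooth_coind R (fun f => exists psi t, (forall n, Cn2 n psi) /\ f = psi t)); last by exists psi, t.
move=> _ [p [s [hp ->]]]; exists (dx p s); split; last by exists (dx p), s; split => // n; have [_ []] := hp n.+1.
by move=> x; have [_ [/(_ s x)[_ d] _ _]] := hp 1; rewrite /dx derive1E; exact: derivableP.
Qed.

Lemma Cn2_smooth2 psi : (forall n, Cn2 n psi) -> forall x, smooth (psi ^~ x).
Proof.
move=> h x; apply: (@smooth_coind R (fun f => exists psi x, (forall n, Cn2 n psi) /\ f = psi ^~ x)); last by exists psi, x.
move=> _ [p [s [hp ->]]]; exists ((dt p)^~ s); split; last by exists (dt p), s; split => // n; have [_ []] := hp n.+1.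
by move=> t; have [_ [/(_ t s)[d _] _ _]] := hp 1; rewrite /dt derive1E; exact: derivableP.
Qed.

Lemma dt_supp psi (M t x : R) : 0 < t -> (forall s, 0 <= s -> psi s x = 0) -> dt psi t x = 0.
Proof.
move=> t0 h; rewrite /dt derive1E (near_eq_derive (g := cst 0)) ?derive_cst ?oner_eq0//.
by near=> s; apply: h; apply: ltW; near: s; exact: lt_nbhsr.
Unshelve. all: by end_near. Qed.

End TwoVariables.

Section Evolution.
Context {R : realType}.
Local Notation mu := (@lebesgue_measure R).
Local Notation kap := (@kap R).
Local Notation Fi := (@inverse_fourier_int R).
Local Notation cmeas2 F := (cmeas (fun z : R * R => F z.1 z.2)).
Implicit Types (u v w : R -> R[i]).

Lemma Fi_param (f : R -> R -> R[i]) x : cmeas2 f -> (\int[mu]_s L1n (f s) < +oo)%E ->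
  Fi (fun xi => cintegral (fun s => f s xi)) x = cintegral (fun s => Fi (f s) x).
Proof.
move=> mf ff.
have mfe : cmeas2 (fun s xi => f s xi * expi (x * xi)).
  apply: cmeasM => //; apply: cmeas_expi; apply: measurable_funM; [exact: measurable_cst|exact: measurable_snd].
have ffe : (\int[mu]_s L1n (fun xi => f s xi * expi (x * xi))%R < +oo)%E.
  apply: le_lt_trans ff; apply: ge0_le_integral_nomeas => s _; first exact: L1n_ge0.
  apply: ge0_le_integral_nomeas => xi _; first by rewrite lee_fin normc_ge0.
  by rewrite (Normc.normcM (f s xi)) normc_expi mulr1.
have fin : {ae mu, forall xi, (L1n (fun s => f s xi) < +oo)%E}.
  apply: ae_fin_integral.
  - apply: (@measurable_ge0_integral R _ _ (fun z : R * R => (normc (f z.2 z.1))%:E)).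
      apply/measurable_EFinP; apply: cmeas_norm.
      exact: (cmeas_comp (f := fun z : R * R => f z.1 z.2) (g := fun z => (z.2, z.1)) mf (measurable_fun_pair measurable_snd measurable_fst)).
    by move=> z; rewrite lee_fin normc_ge0.
  - by move=> xi; exact: L1n_ge0.
  - by rewrite -L1n_swap.
rewrite FiE (ae_cintegral (g := fun xi => cintegral (fun s => f s xi * expi (x * xi)))); last first.
  apply: aeS fin => xi h; rewrite cintegralZr//; apply/cintegrableP; split => //.
  exact: (cmeas_comp (f := fun z : R * R => f z.1 z.2) (g := fun s => (s, xi)) mf (measurable_pair2 xi)).
have [i1 _] := L1n_cintegral_le mfe ffe.
by rewrite -(cFubini mfe ffe) -cintegralZ//; apply: eq_cintegral => s; rewrite FiE.
Qed.

Lemma integral_ind (t : R) : 0 <= t -> (\int[mu]_r (ind t r)%:E = t%:E)%E.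
Proof.
move=> t0; have h : (\int[mu]_(r in `[0%R, t]) 1 = t%:E)%E.
  rewrite integral_cst ?mul1e/= ?lebesgue_measure_itv/=; last exact: measurable_itv.
  rewrite lte_fin; case: ltP => [_|t1]; first by rewrite -EFinD subr0.
  by congr EFin; apply/le_anti; rewrite t0 t1.
rewrite -[RHS]h integral_indE; apply: eq_integral => r _.
by rewrite mule1.
Qed.

Lemma ind_mono (s t r : R) : s <= t -> ind s r <= ind t r.
Proof.
move=> st; rewrite /ind; case: (leP 0 r) => //= _; case: (leP r s) => [rs|_].
  by rewrite (le_trans rs st).
by case: ifP.
Qed.

Lemma integral_indB (s t : R) : 0 <= s <= t -> (\int[mu]_r (ind t r - ind s r)%:E = (t - s)%:E)%E.
Proof.
move=> /andP[s0 st]; apply: addE_fin; rewrite -(integral_ind s0) -(integral_ind (le_trans s0 st)) ge0_intD.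
- by apply: eq_integral => r _; rewrite -EFinD addrC subrK.
- by apply/measurable_EFinP; exact: measurable_ind.
- by apply/measurable_EFinP; apply: measurable_funB; exact: measurable_ind.
- by move=> r; rewrite lee_fin ind_ge0.
- by move=> r; rewrite lee_fin subr_ge0 ind_mono.
Qed.

Lemma L1nD_le u v : cmeas u -> cmeas v -> (L1n (fun x => u x + v x)%R <= L1n u + L1n v)%E.
Proof.
move=> mf mg; have mN f : cmeas f -> mfunT (fun x : R => (normc (f x))%:E).
  by move=> mf'; apply/measurable_EFinP; exact: cmeas_norm.
have p f (x : R) : (0 <= (normc (f x : R[i]))%:E)%E by rewrite lee_fin normc_ge0.
rewrite /L1n ge0_intD//; try exact: mN.
by apply: ge0_le_integral_nomeas => x _; [rewrite lee_fin normc_ge0|rewrite -EFinD lee_fin le_normcD].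
Qed.

Variable delta : R.
Local Notation C0 := (C0 delta).
Local Notation Gen := (Gen delta).
Local Notation Bil := (Bil delta).

Lemma cmeas_abs : cmeas (fun x : R => `|x|%:C : R[i]).
Proof. by apply: cmeasC; exact: measurable_normr1. Qed.

Lemma cmeas_Gen v : cmeas v -> cmeas (Gen v).
Proof. by move=> mv; apply: cmeasD; [apply: cmeasM => //; exact: cmeas_abs|exact: cmeas_Bil]. Qed.

Lemma L1n_abs v : L1n (fun x => `|x|%:C * v x) = n1 v.
Proof. by apply: eq_integral => x _; rewrite Normc.normcM normcC normr_id. Qed.

Section Bounds.
Variable E : R.
Hypothesis E0 : 0 <= E.
Definition CG : R := E + C0 * (E * E).

Lemma CG_ge0 : 0 <= CG.
Proof. by apply: addr_ge0 => //; apply: mulr_ge0; [exact: C0_ge0|exact: mulr_ge0]. Qed.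

Lemma L1n_Gen v : cmeas v -> (A1n v <= E%:E)%E -> (L1n (Gen v) <= CG%:E)%E.
Proof.
move=> mv hv.
have hL : (L1n v <= E%:E)%E by apply: le_trans hv; exact: L1n_le_A1n.
have hn : (n1 v <= E%:E)%E by apply: le_trans hv; exact: n1_le_A1n.
apply: le_trans (L1nD_le _ (cmeas_Bil delta mv mv)) _; first by apply: cmeasM => //; exact: cmeas_abs.
rewrite L1n_abs /CG EFinD; apply: leeD => //; apply: le_trans (L1n_Bil delta mv mv) _.
rewrite (EFinM C0 (E * E)); apply: lee_wpmul2l; first by rewrite lee_fin C0_ge0.
by rewrite EFinM; apply: lee_pmul => //; [exact: L1n_ge0|exact: n1_ge0].
Qed.

Lemma L1n_Gen_sub u v : cmeas u -> cmeas v -> (A1n u <= E%:E)%E -> (A1n v <= E%:E)%E ->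
  (L1n (fun x => Gen u x - Gen v x)%R <= (1 + 2 * C0 * E)%:E * A1n (fun x => u x - v x)%R)%E.
Proof.
move=> mu_ mv hu hv.
have fin w : cmeas w -> (A1n w <= E%:E)%E -> (L1n w <= E%:E)%E /\ (n1 w <= E%:E)%E.
  by move=> mw h; split; apply: le_trans h; [exact: L1n_le_A1n|exact: n1_le_A1n].
have [lu nu] := fin _ mu_ hu; have [lv nv] := fin _ mv hv.
have o (w : \bar R) : (w <= E%:E)%E -> (w < +oo)%E by move=> h; exact: le_lt_trans h (ltry _).
have md : cmeas (fun x => u x - v x) by exact: cmeasB.
rewrite (_ : (fun x => Gen u x - Gen v x) =
   (fun x => `|x|%:C * (u x - v x) + (1%:C * Bil u u x - 1%:C * Bil v v x))); last first.
  by apply/funext => x; rewrite !GenE !mul1r; ring.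
apply: le_trans (L1nD_le _ _) _.
- by apply: cmeasM => //; exact: cmeas_abs.
- by apply: cmeasB; apply: cmeasM; try exact: cmeas_cst; exact: cmeas_Bil.
rewrite L1n_abs.
have := L1n_Bil_sub delta 1 (ler01) mu_ mv (o _ lu) (o _ nu) (o _ lv) (o _ nv).
under [X in (_ <= _ * (L1n X * _ + _))%E -> _]eq_fun => y do rewrite !mul1r.
move=> h; set d := fun x => u x - v x in md h *.
have dA : (n1 d <= A1n d)%E by exact: n1_le_A1n.
have dL : (L1n d <= A1n d)%E by exact: L1n_le_A1n.
apply: (@le_trans _ _ (A1n d + C0%:E * (A1n d * E%:E + E%:E * A1n d))%E).
  apply: leeD => //; apply: le_trans h _; apply: lee_wpmul2l; first by rewrite lee_fin C0_ge0.
  apply: leeD; first by apply: lee_pmul => //; [exact: L1n_ge0|exact: n1_ge0].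
  by rewrite mul1e; apply: lee_pmul => //; [exact: L1n_ge0|exact: n1_ge0].
have a0 := A1n_ge0 d; move: (A1n d) a0 => [a||] a0 //.
  rewrite -!EFinM -!EFinD lee_fin le_eqVlt; apply/orP; left; apply/eqP; ring.
have c1 : 0 < 1 + 2 * C0 * E by rewrite ltr_pwDl//; apply: mulr_ge0 => //; apply: mulr_ge0 => //; exact: C0_ge0.
by rewrite [leRHS]gt0_muley ?lte_fin// leey.
Qed.

End Bounds.

Variables (E : R) (u0 : R -> R[i]) (U F : R -> R -> R[i]).
Hypotheses (E0 : 0 <= E) (mu0 : cmeas u0) (bu0 : (A1n u0 <= E%:E)%E) (mU : cmeas2 U) (mF : cmeas2 F).
Hypothesis hU : forall t, herm (U t).
Hypothesis bU : forall t, 0 <= t -> (A1n (U t) <= E%:E)%E.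
Hypothesis eF : {ae mu, forall t, 0 <= t -> {ae mu, forall xi, F t xi = Bil (U t) (U t) xi}}.
Let G t xi : R[i] := `|xi|%:C * U t xi + F t xi.
Hypothesis iU : forall t, 0 <= t -> {ae mu, forall xi, U t xi = u0 xi - cintegral (fun s => (ind t s)%:C * G s xi)}.
Local Notation CGE := (CG E).

Let mUt t : cmeas (U t). Proof. exact: cmeas_sec1. Qed.

Lemma mG : cmeas2 G.
Proof.
apply: cmeasD => //; apply: cmeasM => //.
exact: (cmeas_comp (f := fun x : R => `|x|%:C : R[i]) cmeas_abs measurable_snd).
Qed.

Lemma mGt t : cmeas (G t). Proof. exact: (cmeas_sec1 t mG). Qed.

Lemma A1n_fin v : cmeas v -> (A1n v <= E%:E)%E -> cintegrable v /\ cintegrable (fun y => y%:C * v y).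
Proof.
move=> mv h; split; first by apply/cintegrableP; split => //; apply: le_lt_trans (le_trans (L1n_le_A1n mv) h) (ltry _).
by apply: cintegrable_n1 => //; apply: le_lt_trans (le_trans (n1_le_A1n mv) h) (ltry _).
Qed.

Lemma cU t : 0 <= t -> cintegrable (U t).
Proof. by move=> t0; have [] := A1n_fin (mUt t) (bU t0). Qed.

Lemma cyU t : 0 <= t -> cintegrable (fun y => y%:C * U t y).
Proof. by move=> t0; have [] := A1n_fin (mUt t) (bU t0). Qed.

Lemma G_Gen : {ae mu, forall t, 0 <= t -> {ae mu, forall xi, G t xi = Gen (U t) xi}}.
Proof. by apply: aeS eF => t h t0; apply: aeS (h t0) => xi e; rewrite GenE /G e. Qed.

Lemma L1n_G : {ae mu, forall t, 0 <= t -> (L1n (G t) <= CGE%:E)%E}.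
Proof. by apply: aeS G_Gen => t h t0; rewrite (ae_L1n (h t0)); apply: L1n_Gen => //; exact: bU. Qed.

Lemma cmeas_indG (k : R -> R) : mfunT k -> cmeas2 (fun s xi => (k s)%:C * G s xi).
Proof.
move=> mk; apply: cmeasM mG; apply: cmeasC; exact: (measurableT_comp mk measurable_fst).
Qed.

Lemma L1n_kG (k : R -> R) t (c : R) : mfunT k -> (forall s, 0 <= k s <= ind t s) -> 0 <= t ->
  (\int[mu]_s (k s)%:E = c%:E)%E ->
  (\int[mu]_s L1n (fun xi => (k s)%:C * G s xi)%R <= (CGE * c)%:E)%E.
Proof.
move=> mk kp t0 kc.
have k0 s : 0 <= k s by have /andP[] := kp s.
rewrite EFinM -kc -ge0_integralZl//; last 3 first.
- exact/measurable_EFinP.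
- by move=> s _; rewrite lee_fin.
- by rewrite lee_fin CG_ge0.
apply: ae_ge0_le_integral_nomeas => [s _|s _|]; first exact: L1n_ge0.
  by rewrite mule_ge0 ?lee_fin ?CG_ge0.
apply: aeS L1n_G => s h _; have [s0|s0] := leP 0 s.
  have -> : L1n (fun xi => (k s)%:C * G s xi) = ((k s)%:E * L1n (G s))%E.
    rewrite -wn1 (wnZ (c := k s)) ?wn1//; try exact: ler01; exact: mGt.
  by rewrite muleC; apply: lee_wpmul2r; rewrite ?lee_fin//; exact: h.
have -> : k s = 0.
  have i0 : ind t s = 0 by rewrite /ind leNgt s0.
  by apply/le_anti; have := kp s; rewrite i0 => /andP[-> ->].
rewrite mule0 /L1n (eq_integral (fun=> 0%E)) ?integral0// => xi _.
by rewrite mul0r normc0.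
Qed.

Lemma ind_self (t s : R) : 0 <= ind t s <= ind t s. Proof. by rewrite ind_ge0 lexx. Qed.

Lemma L1n_indG t : 0 <= t -> (\int[mu]_s L1n (fun xi => (ind t s)%:C * G s xi)%R < +oo)%E.
Proof.
move=> t0; apply: le_lt_trans (L1n_kG (measurable_ind t) (ind_self t) t0 (integral_ind t0)) (ltry _).
Qed.

Lemma indG_ae t : 0 <= t -> {ae mu, forall xi, cintegrable (fun s => (ind t s)%:C * G s xi)}.
Proof.
move=> t0; have m := cmeas_indG (measurable_ind t).
have fin : {ae mu, forall xi, (L1n (fun s => ((ind t s)%:C * G s xi)%R) < +oo)%E}.
  apply: ae_fin_integral.
  - apply: (@measurable_ge0_integral R _ _ (fun z : R * R => (normc ((ind t z.2)%:C * G z.2 z.1))%:E)).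
      apply/measurable_EFinP; apply: cmeas_norm.
      exact: (cmeas_comp (f := fun z : R * R => (ind t z.1)%:C * G z.1 z.2) (g := fun z => (z.2, z.1)) m (measurable_fun_pair measurable_snd measurable_fst)).
    by move=> z; rewrite lee_fin normc_ge0.
  - by move=> xi; exact: L1n_ge0.
  - by rewrite -(L1n_swap m); exact: L1n_indG.
apply: aeS fin => xi h; apply/cintegrableP; split => //.
exact: (cmeas_comp (f := fun z : R * R => (ind t z.1)%:C * G z.1 z.2) (g := fun s => (s, xi)) m (measurable_pair2 xi)).
Qed.

Lemma U_lip s t : 0 <= s <= t -> (L1n (fun xi => U t xi - U s xi)%R <= (CGE * (t - s))%:E)%E.
Proof.
move=> st; have /andP[s0 st1] := st; have t0 := le_trans s0 st1.
pose k r := ind t r - ind s r.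
have mk : mfunT k by apply: measurable_funB; exact: measurable_ind.
have kp r : 0 <= k r <= ind t r by rewrite subr_ge0 ind_mono//= gerBl ind_ge0.
have m := cmeas_indG mk.
rewrite (ae_L1n (g := fun xi => - cintegral (fun r => (k r)%:C * G r xi))); last first.
  apply: aeS (aeI (aeI (iU t0) (iU s0)) (aeI (indG_ae t0) (indG_ae s0))) => xi [[-> ->] [i1 i2]].
  have -> : cintegral (fun r => (k r)%:C * G r xi) = cintegral (fun r => (ind t r)%:C * G r xi) -
      cintegral (fun r => (ind s r)%:C * G r xi).
    by rewrite -cintegralB//; apply: eq_cintegral => r; rewrite /k CD CN mulrDl mulNr.
  ring.
have -> : L1n (fun xi => - cintegral (fun r => (k r)%:C * G r xi)) = L1n (fun xi => cintegral (fun r => (k r)%:C * G r xi)).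
  by apply: eq_integral => xi _; rewrite normcN.
have bnd := L1n_kG mk kp t0 (integral_indB st).
have ms : cmeas2 (fun xi r => (k r)%:C * G r xi).
  exact: (cmeas_comp (f := fun z : R * R => (k z.1)%:C * G z.1 z.2) (g := fun z => (z.2, z.1)) m (measurable_fun_pair measurable_snd measurable_fst)).
rewrite (L1n_swap m) in bnd.
have [_ h] := L1n_cintegral_le ms (le_lt_trans bnd (ltry _)).
exact: le_trans h bnd.
Qed.

Lemma Fr_ind (c : R) v x : c = 0 \/ c = 1 -> Re (Fi (fun xi => c%:C * v xi) x) = c * Fr v x.
Proof.
case=> ->; last first.
  have -> : (fun xi => 1%:C * v xi) = v by apply/funext => xi; rewrite mul1r.
  by rewrite mul1r.
rewrite mul0r FiE (eq_cintegral (g := fun=> 0)) ?cintegral0 ?mulr0// => xi.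
by rewrite !mul0r.
Qed.

Lemma ind01 (t s : R) : ind t s = 0 \/ ind t s = 1.
Proof. by rewrite /ind; case: ifP; [right|left]. Qed.

Lemma FrU_int t x : 0 <= t -> Fr (U t) x = Fr u0 x - \int[mu]_s (ind t s * Fr (G s) x).
Proof.
move=> t0; have m := cmeas_indG (measurable_ind t).
have ms : cmeas2 (fun xi r => (ind t r)%:C * G r xi).
  exact: (cmeas_comp (f := fun z : R * R => (ind t z.1)%:C * G z.1 z.2) (g := fun z => (z.2, z.1)) m (measurable_fun_pair measurable_snd measurable_fst)).
have fin := L1n_indG t0; have fin' := fin; rewrite (L1n_swap m) in fin'.
have [iW _] := L1n_cintegral_le ms fin'.
have [iu0 _] := A1n_fin mu0 bu0.
rewrite /Fr (Fi_ae (iU t0)) FiB// ReB (Fi_param _ m fin) Re_cintegral; congr (_ - _).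
by apply: eq_Rintegral => s _; apply: Fr_ind; exact: ind01.
Qed.

Lemma FrG_bound : {ae mu, forall t, 0 <= t -> forall x, `|Fr (G t) x| <= kap * CGE}.
Proof.
apply: aeS L1n_G => t h t0 x.
have iG : cintegrable (G t) by apply/cintegrableP; split; [exact: mGt|apply: le_lt_trans (h t0) (ltry _)].
apply: le_trans (Fr_bound x iG) _; apply: ler_wpM2l; first exact: ltW kap_gt0.
by rewrite -lee_fin -L1n_fin//; exact: h.
Qed.

Lemma FrU_bound t x : 0 <= t -> `|Fr (U t) x| <= kap * E.
Proof.
move=> t0; apply: le_trans (Fr_bound x (cU t0)) _; apply: ler_wpM2l; first exact: ltW kap_gt0.
rewrite -lee_fin -L1n_fin; last exact: cU.
by apply: le_trans (bU t0); exact: L1n_le_A1n.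
Qed.

Variable theta0 : R -> R.
Hypothesis hth0 : is_fourier theta0 u0.
Let theta t x := Fr (U t) x.

Lemma is_fourier_theta t : 0 <= t -> is_fourier (theta t) (U t).
Proof. by move=> t0; apply: is_fourier_Fr => //; exact: cU. Qed.

Lemma theta_weak : weak_solution 1 delta theta0 theta.
Proof.
move=> T T0 psi [Cpsi [T' [M [T'T supp]]]].
have c0 : continuous (fun p : R * R => psi p.1 p.2) by have [] := Cpsi 0.
have cdt : continuous (fun p : R * R => dt psi p.1 p.2).
  by have [_ [_ h _]] := Cpsi 1; case: h.
have tpsi t : 0 <= t -> test_fun (psi t).
  by move=> t0; split; [exact: Cn2_smooth1|exists M => x xM; apply: supp => //; right].
have dts t x : 0 < t -> M < `|x| -> dt psi t x = 0.
  by move=> t0 xM; apply: dt_supp => // s s0; apply: supp => //; right.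
have idt t : 0 < t -> Lint (dt psi t).
  by move=> t0; apply: (@compact_supp_integrable _ _ M); [exact: cont2_sec1|move=> x; exact: dts].
have ips t : 0 <= t -> Lint (psi t).
  by move=> t0; exact: test_fun_integrable (tpsi t t0).
pose k t x := Fr (U t) x * (ind T t * dt psi t x) - Fr (G t) x * (ind T t * psi t x).
have E1 : \int[mu]_(t in `[0, T]) (\int[mu]_x
       (theta t x * dt psi t x
        + hilbert (theta t) x * theta t x * dx psi t x
        + (1 - delta) * Lambda 1 (theta t) x * theta t x * psi t x
        - theta t x * Lambda 1 (psi t) x)) = \int[mu]_t \int[mu]_x k t x.
  rewrite Rint_indE; apply: ae_Rintegral_indep; apply: aeS (aeI G_Gen (aeI L1n_G (ae_neq 0))) => t [gG [lG tn0]] _.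
  rewrite /k; have [i0|i0] := eqVneq (ind T t) 0.
    rewrite i0 mul0r (eq_Rintegral _ (g := fun=> 0)); first by rewrite /Rintegral integral0.
    by move=> x _; rewrite !mul0r !mulr0 subrr.
  have /andP[t0 tT] : 0 <= t <= T by move: i0; rewrite /ind; case: ifP => //; rewrite eqxx.
  have tp : 0 < t by rewrite lt_neqAle eq_sym tn0.
  have i1 : ind T t = 1 by rewrite /ind t0 tT.
  have iG : cintegrable (G t) by apply/cintegrableP; split; [exact: mGt|apply: le_lt_trans (lG t0) (ltry _)].
  have := inner_integralE delta (is_fourier_theta t0) (hU t) (cU t0) (cyU t0) (tpsi t t0) (idt t tp).
  rewrite i1 mul1r => ->; under [RHS]eq_Rintegral => x _ do rewrite !mul1r.
  have -> : Fr (Gen (U t)) = Fr (G t) by apply/funext => x; rewrite /Fr (Fi_ae (gG t0)).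
  rewrite RintegralB//.
  - by apply: integrable_Fr_test; [exact: cU|exact: idt].
  - by apply: integrable_Fr_test; [|exact: ips].
have mk : mfunT (fun z : R * R => k z.1 z.2).
  apply: measurable_funB; apply: measurable_funM.
  - exact: measurable_Fr2.
  - exact: measurable_ind_cont2.
  - by apply: measurable_Fr2; exact: mG.
  - exact: measurable_ind_cont2.
have [B1 B10 hB1] := cont2_bounded T M cdt; have [B2 B20 hB2] := cont2_bounded T M c0.
have kp0 := ltW (@kap_gt0 R).
pose C := kap * E * B1 + kap * CGE * B2.
have kE0 : 0 <= kap * E := mulr_ge0 kp0 E0.
have kC0 : 0 <= kap * CGE := mulr_ge0 kp0 (CG_ge0 E0).
have C_ge0 : 0 <= C := addr_ge0 (mulr_ge0 kE0 B10) (mulr_ge0 kC0 B20).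
have kb : {ae mu, forall t, forall x, `|k t x| <= C * ind T t * \1_(`[- M, M]%classic) x}.
  apply: aeS (aeI FrG_bound (ae_neq 0)) => t [hG tn0] x; rewrite /k.
  have [i0|i0] := eqVneq (ind T t) 0; first by rewrite i0 !mul0r !mulr0 mul0r subrr normr0.
  have /andP[t0 tT] : 0 <= t <= T by move: i0; rewrite /ind; case: ifP => //; rewrite eqxx.
  have tp : 0 < t by rewrite lt_neqAle eq_sym tn0.
  have i1 : ind T t = 1 by rewrite /ind t0 tT.
  rewrite i1 !mul1r mulr1 indicE mem_setE in_itv /= -ler_norml.
  have [xM|xM] := leP `|x| M; last first.
    have -> : psi t x = 0 by apply: supp => //; right.
    by rewrite dts// !mulr0 subrr normr0.
  rewrite mulr1; apply: le_trans (ler_normB _ _) _; rewrite !normrM; apply: lerD.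
    by apply: ler_pM => //; [exact: FrU_bound|apply: hB1; rewrite ?t0].
  by apply: ler_pM => //; [exact: hG|apply: hB2; rewrite ?t0].
have kfin : (\int[mu]_t \int[mu]_x (`|k t x|)%:E < +oo)%E.
  have m1 : mfunT (fun x : R => (\1_(`[- M, M]%classic) x)%:E : \bar R).
    by apply/measurable_EFinP; apply: measurable_indic; exact: measurable_itv.
  have fM : (\int[mu]_x (\1_(`[- M, M]%classic) x)%:E < +oo)%E.
    by rewrite integral_indic// setIT /= lebesgue_measure_itv /=; case: ifP; rewrite ?ltry.
  set I := (\int[mu]_x _)%E in fM.
  have I0 : (0 <= I)%E by apply: integral_ge0 => x _; rewrite lee_fin.
  apply: (@le_lt_trans _ _ (\int[mu]_t ((C * ind T t)%:E * I))%E).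
    apply: ae_ge0_le_integral_nomeas => [t _|t _|].
    - by apply: integral_ge0 => x _; rewrite lee_fin.
    - by rewrite mule_ge0// lee_fin mulr_ge0 ?ind_ge0.
    apply: aeS kb => t h _; rewrite /I -ge0_integralZl//; last by rewrite lee_fin mulr_ge0 ?ind_ge0.
    by apply: ge0_le_integral_nomeas => x _; rewrite ?lee_fin// -EFinM lee_fin.
  rewrite -(fineK (x := I)) ?ge0_fin_numE//.
  have /integrableP[_ h] := integrableZl measurableT (C * fine I) (integrable_ind T).
  apply: le_lt_trans h; apply: ge0_le_integral_nomeas => t _; first by rewrite mule_ge0 ?lee_fin ?mulr_ge0 ?ind_ge0 ?fine_ge0.
  rewrite /= lee_fin mulrAC; exact: ler_norm.
rewrite E1 RFubini//.
have iu0 := (A1n_fin mu0 bu0).1.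
transitivity (\int[mu]_x (- (psi 0 x * Fr u0 x))).
  apply: eq_Rintegral => x _.
  have sx : smooth (psi ^~ x) by exact: Cn2_smooth2.
  have mp : mfunT (psi ^~ x) by exact: smooth_measurable.
  have mdp : mfunT (dt psi ^~ x) by exact: smooth_measurable (smooth_derive1 sx).
  have mUx := @measurable_Fr_t R U x mU; have mGx := @measurable_Fr_t R G x mG.
  have [D1 D10 hD1] := cont2_bounded T `|x| cdt; have [D2 D20 hD2] := cont2_bounded T `|x| c0.
  have iG : Lint (fun t => ind T t * Fr (G t) x).
    apply: (integrable_ind_ae (C := kap * CGE)) => //.
    by apply: aeS FrG_bound => t h /andP[/ltW t0 _]; exact: h.
  have psiT : psi T x = 0 by apply: supp; [exact: ltW|left].
  have := @ibp_time R (psi ^~ x) (fun t => Fr (U t) x) (fun t => Fr (G t) x) (Fr u0 x) T (ltW T0) sx psiT mGx iG.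
  have -> : derive1 (psi ^~ x) = dt psi ^~ x by [].
  rewrite !Rint_indE => h.
  have i1 : Lint (fun t => ind T t * (dt psi t x * Fr (U t) x)).
    apply: (integrable_ind_ae (C := D1 * (kap * E))); first exact: measurable_funM.
      exact: mulr_ge0.
    apply: aeW => t /andP[/ltW t0 /ltW tT]; rewrite normrM; apply: ler_pM => //; last exact: FrU_bound.
    by apply: hD1 => //; rewrite t0.
  have i2 : Lint (fun t => ind T t * (Fr (G t) x * psi t x)).
    apply: (integrable_ind_ae (C := kap * CGE * D2)); first exact: measurable_funM.
      exact: mulr_ge0.
    apply: aeS FrG_bound => t hg /andP[/ltW t0 /ltW tT]; rewrite normrM; apply: ler_pM => //; first exact: hg.
    by apply: hD2 => //; rewrite t0.
  transitivity (\int[mu]_t (ind T t * (dt psi t x * Fr (U t) x)) - \int[mu]_t (ind T t * (Fr (G t) x * psi t x))).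
    by rewrite -RintegralB//; apply: eq_Rintegral => t _; rewrite /k; ring.
  rewrite h ?addrK// => t /andP[t0 _]; exact: FrU_int.
rewrite RintegralN_gen; congr (- _); apply: ae_Rintegral_indep.
by apply: aeS (is_fourier_inv_Fr hth0 iu0) => x -> _; rewrite mulrC.
Qed.

Lemma sobolev_norm_ge0 n (f : R -> R) : (0 <= sobolev_norm n f)%E.
Proof.
elim: n f => [|n IH] f; first exact: Linf_norm_ge0.
apply: adde_ge0; first exact: Linf_norm_ge0.
by apply: le_ereal_inf_tmp => _ [g _ <-]; exact: IH.
Qed.

Lemma wn_le (w1 w2 : R -> R) u v : (forall x, 0 <= w1 x) ->
  (forall x, w1 x * normc (u x) <= w2 x * normc (v x)) -> (wn w1 u <= wn w2 v)%E.
Proof.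
move=> w0 h; apply: ge0_le_integral_nomeas => x _; rewrite lee_fin//.
by rewrite mulr_ge0// normc_ge0.
Qed.

Definition cut (n : nat) (x : R) : R := if `|x| <= n%:R then 1 else 0.

Lemma measurable_cut n : mfunT (cut n).
Proof.
apply: measurable_fun_ifT; [|exact: measurable_cst|exact: measurable_cst].
by apply: measurable_fun_ler; [exact: measurable_normr1|exact: measurable_cst].
Qed.

Lemma cut01 n x : 0 <= cut n x <= 1.
Proof. by rewrite /cut; case: ifP; rewrite lexx ler01. Qed.

Let q n i xi : R[i] := (cut n xi)%:C * U (i%:R / kn n) xi.

Let tau0 n i : 0 <= i%:R / kn n :> R.
Proof. by rewrite divr_ge0// ltW// kn_gt0. Qed.

Let mq n i : cmeas (q n i).
Proof. by apply: cmeasM => //; apply: cmeasC; exact: measurable_cut. Qed.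

Let q_le n i x : normc (q n i x) <= normc (U (i%:R / kn n) x).
Proof.
have /andP[h0 h1] := cut01 n x.
by rewrite Normc.normcM normcC ger0_norm// ler_piMl// normc_ge0.
Qed.

Let A1n_q n i : (A1n (q n i) <= E%:E)%E.
Proof.
apply: le_trans (bU (tau0 n i)); have p x : 0 <= 1 + `|x| :> R by exact: addr_ge0.
apply: (@wn_le (fun x => 1 + `|x|) (fun x => 1 + `|x|)) => // x.
by apply: ler_wpM2l.
Qed.

Let D1n_q n i : (D1n (q n i) < +oo)%E.
Proof.
apply: (@le_lt_trans _ _ (n%:R%:E * A1n (U (i%:R / kn n)))%E); last first.
  apply: (@le_lt_trans _ _ (n%:R%:E * E%:E)%E); last by rewrite -EFinM ltry.
  by apply: lee_wpmul2l; [rewrite lee_fin|exact: bU].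
rewrite -wnZ//; last exact: measurable_1D.
have p1 (x : R) : 0 <= 1 + `|x| by exact: addr_ge0.
apply: (@wn_le (fun x => `|x| * (1 + `|x|)) (fun x => 1 + `|x|)) => x; first exact: (mulr_ge0 (normr_ge0 x) (p1 x)).
rewrite !Normc.normcM !normcC (ger0_norm (ler0n _ _)) [leRHS]mulrCA mulrA.
rewrite /cut; case: ifP => xn; last first.
  by rewrite normr0 mul0r mulr0; apply: mulr_ge0; [apply: mulr_ge0 => //; exact: addr_ge0|exact: normc_ge0].
rewrite normr1 mul1r; apply: ler_wpM2r; first exact: normc_ge0.
by apply: ler_wpM2r => //; exact: p1.
Qed.

Let Q_cvg (w : R -> R) t : mfunT w -> (forall x, 0 <= w x <= 3 * (1 + `|x|) ^+ 2) -> 0 <= t ->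
  (wn w (U t) < +oo)%E -> wn w (fun xi => U t xi - q n (idx n t) xi) @[n --> \oo] --> 0%E.
Proof.
move=> mw wp t0 fw.
have w0 x : 0 <= w x by have /andP[] := wp x.
pose a n := wn w (fun xi => (1 - cut n xi)%:C * U t xi).
have ca : a n @[n --> \oo] --> 0%E.
  have mcu n : cmeas (fun xi => (1 - cut n xi)%:C * U t xi).
    by apply: cmeasM => //; apply: cmeasC; apply: measurable_funB; [exact: measurable_cst|exact: measurable_cut].
  have [|||||_ _] := @dominated_convergence _ _ _ mu setT measurableT
    (fun n x => (w x * normc ((1 - cut n x)%:C * U t x))%:E) (fun=> 0%E) (fun x => (w x * normc (U t x))%:E).
  - by move=> n; apply: measurable_wn.
  - exact: measurable_cst.
  - apply: aeW => x _; apply: cvg_near_cst; near=> n.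
    have xn : `|x| <= n%:R by near: n; exact: nbhs_infty_ger.
    by rewrite /cut xn subrr mul0r normc0 mulr0.
  - apply/integrableP; split; first exact: measurable_wn.
    apply: le_lt_trans fw; apply: ge0_le_integral_nomeas => x _; first exact: abse_ge0.
    by rewrite gee0_abs// lee_fin mulr_ge0// normc_ge0.
  - apply: aeW => x n _; rewrite gee0_abs ?lee_fin; last by rewrite mulr_ge0// normc_ge0.
    apply: ler_wpM2l => //; have /andP[h0 h1] := cut01 n x.
    rewrite Normc.normcM normcC ger0_norm ?subr_ge0//.
    by rewrite ler_piMl ?normc_ge0// gerBl.
  by rewrite integral0.
have cb : (3 * CGE * harmonic n)%:E @[n --> \oo] --> (0 : R)%:E.
  apply: cvg_EFin; first exact: nearW.
  rewrite -[X in _ --> X](mulr0 (3 * CGE)); apply: cvgM; [exact: cvg_cst|exact: cvg_harmonic].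
have cab : (a n + (3 * CGE * harmonic n)%:E)%E @[n --> \oo] --> 0%E.
  by rewrite -[X in _ --> X](adde0 0%E); apply: cvgeD.
apply: (squeeze_cvge _ (cvg_cst 0%E) cab); apply: nearW => n; rewrite wn_ge0//=.
pose tau : R := (idx n t)%:R / kn n.
have [h1 h2] := idx_bounds n t0; rewrite -/tau in h1 h2.
have tau00 : 0 <= tau by exact: tau0.
have tt : 0 <= tau <= t by rewrite tau00.
have md : cmeas (fun xi => U t xi - U tau xi) by exact: cmeasB.
have c3 : 0 <= 3 * (1 + n%:R) ^+ 2 :> R by rewrite mulr_ge0// exprn_ge0// addr_ge0.
apply: (@le_trans _ _ (a n + wn (fun=> 3 * (1 + n%:R) ^+ 2)%R (fun xi => U t xi - U tau xi)%R)%E).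
  rewrite /a /wn ge0_intD.
  - apply: ge0_le_integral_nomeas => x _; first by rewrite lee_fin mulr_ge0// normc_ge0.
    rewrite -EFinD lee_fin.
    have -> : U t x - q n (idx n t) x = (1 - cut n x)%:C * U t x + (cut n x)%:C * (U t x - U tau x).
      by rewrite /q CD CN -/tau; ring.
    apply: le_trans (ler_wpM2l (w0 x) (le_normcD _ _)) _; rewrite mulrDr lerD2l.
    rewrite Normc.normcM normcC mulrA; apply: ler_wpM2r; first exact: normc_ge0.
    rewrite /cut; case: ifP => xn; last by rewrite normr0 mulr0.
    rewrite normr1 mulr1; have /andP[_ hw] := wp x; apply: le_trans hw _.
    by apply: ler_wpM2l => //; rewrite ler_pXn2r ?nnegrE ?addr_ge0// lerD2l.
  - apply: measurable_wn => //; apply: cmeasM => //; apply: cmeasC.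
    by apply: measurable_funB; [exact: measurable_cst|exact: measurable_cut].
  - by apply: measurable_wn => //; exact: measurable_cst.
  - by move=> x; rewrite lee_fin mulr_ge0// normc_ge0.
  - by move=> x; rewrite lee_fin mulr_ge0// normc_ge0.
apply: leeD2l.
have -> : wn (fun=> 3 * (1 + n%:R) ^+ 2) (fun xi => U t xi - U tau xi) =
   ((3 * (1 + n%:R) ^+ 2)%:E * L1n (fun xi => U t xi - U tau xi)%R)%E.
  rewrite -wn1 -(wnZ (c := 3 * (1 + n%:R) ^+ 2))//; try exact: ler01.
  by apply: eq_integral => x _; rewrite mul1r Normc.normcM normcC ger0_norm.
apply: le_trans (lee_wpmul2l _ (U_lip tt)) _; first by rewrite lee_fin.
rewrite -EFinM lee_fin.
apply: (@le_trans _ _ (3 * (1 + n%:R) ^+ 2 * (CGE * (kn n)^-1))).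
  by apply: ler_wpM2l => //; apply: ler_wpM2l => //; exact: CG_ge0.
rewrite le_eqVlt; apply/orP; left; apply/eqP; rewrite /kn /harmonic.
have -> : 1 + n%:R = n.+1%:R :> R by rewrite -natr1 addrC.
have : n.+1%:R != 0 :> R by rewrite pnatr_eq0.
by move: (n.+1%:R) => y y0; field.
Unshelve. all: by end_near. Qed.

Let A1_cvg t : 0 <= t -> A1n (fun xi => U t xi - q n (idx n t) xi) @[n --> \oo] --> 0%E.
Proof.
move=> t0; apply: Q_cvg => //; [exact: measurable_1D| |exact: le_lt_trans (bU t0) (ltry _)].
move=> x; have := normr_ge0 x; move: `|x| => y y0; apply/andP; split; nra.
Qed.

Let iq n i : cintegrable (q n i).
Proof. exact: (A1n_fin (mq n i) (A1n_q n i)).1. Qed.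

Let md t n : cmeas (fun xi => U t xi - q n (idx n t) xi).
Proof. exact: cmeasB. Qed.

Lemma wn_fin_sub t n (w : R -> R) : mfunT w -> (forall x, 0 <= w x) ->
  (wn w (U t) < +oo)%E -> (wn w (q n (idx n t)) < +oo)%E ->
  (wn w (fun xi => U t xi - q n (idx n t) xi)%R < +oo)%E.
Proof.
move=> mw w0 h1 h2; apply: (@le_lt_trans _ _ (wn w (U t) + wn w (q n (idx n t)))%E); last exact: lte_add_pinfty.
rewrite /wn ge0_intD.
- apply: ge0_le_integral_nomeas => x _; first by rewrite lee_fin mulr_ge0// normc_ge0.
  by rewrite -EFinD lee_fin -mulrDr; apply: ler_wpM2l => //; exact: normcB.
- exact: measurable_wn.
- exact: measurable_wn.
- by move=> x; rewrite lee_fin mulr_ge0// normc_ge0.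
- by move=> x; rewrite lee_fin mulr_ge0// normc_ge0.
Qed.

Let fin_d t n : 0 <= t -> (L1n (fun xi => U t xi - q n (idx n t) xi)%R < +oo)%E /\
  (n1 (fun xi => U t xi - q n (idx n t) xi)%R < +oo)%E.
Proof.
move=> t0; have h : (A1n (fun xi => U t xi - q n (idx n t) xi)%R < +oo)%E.
  apply: wn_fin_sub; [exact: measurable_1D|by move=> x; exact: addr_ge0| |].
    exact: le_lt_trans (bU t0) (ltry _).
  exact: le_lt_trans (A1n_q _ _) (ltry _).
by split; apply: le_lt_trans h; [exact: L1n_le_A1n|exact: n1_le_A1n].
Qed.

Variable T : R.
Hypothesis T0 : 0 < T.

Lemma theta_Linf1 : Linf_time T (sobolev_norm 1) theta.
Proof.
have kp0 := ltW (@kap_gt0 R).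
have bd v : cmeas v -> (A1n v <= E%:E)%E -> (sobolev_norm 1 (Fr v) <= (kap * E)%:E)%E.
  move=> mv h; apply: le_trans (sobolev1_Fr mv _ _) _.
  - by apply: le_lt_trans (le_trans (L1n_le_A1n mv) h) (ltry _).
  - by apply: le_lt_trans (le_trans (n1_le_A1n mv) h) (ltry _).
  - by rewrite EFinM; apply: lee_wpmul2l; rewrite ?lee_fin.
split; last by exists (kap * E); apply: aeW => t; rewrite /= in_itv /= => /andP[/ltW t0 _]; apply: bd => //; exact: bU.
exists (stp T (fun n i => Fr (q n i))); apply: step_approx_stp => [n i|].
  by apply: le_lt_trans (bd _ (mq n i) (A1n_q n i)) (ltry _).
apply: aeW => t /andP[/ltW t0 _].
apply: (cvg_Linf_Fr (N := sobolev_norm 1) (K := kap) _ (cU t0) _ _ (A1_cvg t0)) => [n|n|n].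
- exact: sobolev_norm_ge0.
- exact: iq.
- by have [a b] := fin_d n t0; exact: sobolev1_Fr.
Qed.

Hypothesis bD : (\int[mu]_(t in `[0%R, T]) D1n (U t) < +oo)%E.

Let wD1 : mfunT (fun x : R => `|x| * (1 + `|x|)).
Proof. by apply: measurable_funM; [exact: measurable_normr1|exact: measurable_1D]. Qed.

Let mD1 : mfunT (fun t => D1n (U t)).
Proof. by apply: measurable_wnF => // x; rewrite mulr_ge0// addr_ge0. Qed.

Let D1_ae : {ae mu, forall t, 0 < t < T -> (D1n (U t) < +oo)%E}.
Proof.
have h : {ae mu, forall t, ((ind T t)%:E * D1n (U t) < +oo)%E}.
  apply: ae_fin_integral.
  - by apply: emeasurable_funM => //; apply/measurable_EFinP; exact: measurable_ind.
  - by move=> t; rewrite mule_ge0 ?D1n_ge0// lee_fin ind_ge0.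
  - by rewrite -integral_indE.
by apply: aeS h => t ht /andP[/ltW a /ltW b]; move: ht; rewrite /ind a b mul1e.
Qed.

Let L1D1E v : cmeas v -> (L1n v + D1n v)%E = wn (fun x => 1 + `|x| * (1 + `|x|)) v.
Proof.
by move=> mv; rewrite (wnD _ wD1) ?wn1//.
Qed.

Lemma theta_L12 : L1_time T (sobolev_norm 2) theta.
Proof.
have kp0 := ltW (@kap_gt0 R).
have w0 (x : R) : 0 <= 1 + `|x| * (1 + `|x|) by rewrite addr_ge0// mulr_ge0// addr_ge0.
have mw : mfunT (fun x : R => 1 + `|x| * (1 + `|x|)).
  by apply: measurable_funD => //; exact: measurable_cst.
have n2D v : cmeas v -> (D1n v < +oo)%E -> (n2 v < +oo)%E.
  by move=> mv; rewrite D1nE//; apply: le_lt_trans; rewrite leeDr// n1_ge0.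
split.
  exists (stp T (fun n i => Fr (q n i))); apply: step_approx_stp => [n i|].
    have hL : (L1n (q n i) < +oo)%E by exact: cintegrable_L1n (iq n i).
    apply: le_lt_trans (sobolev2_Fr (mq n i) hL _ (n2D _ (mq n i) (D1n_q n i))) _.
      by apply: le_lt_trans (le_trans (n1_le_A1n (mq n i)) (A1n_q n i)) (ltry _).
    apply: lte_mul_pinfty; rewrite ?lee_fin//; apply: lte_add_pinfty => //; exact: D1n_q.
  apply: aeS D1_ae => t hD tI; have /andP[/ltW t0 _] := tI.
  have fw : (wn (fun x => (1 + `|x| * (1 + `|x|))%R) (U t) < +oo)%E.
    by rewrite -L1D1E//; apply: lte_add_pinfty; [exact: cintegrable_L1n (cU t0)|exact: hD].
  apply: (cvg_Linf_Fr (N := sobolev_norm 2) (K := kap) _ (cU t0) _ _ (Q_cvg mw _ t0 fw)) => [n|n|n|x].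
  - exact: sobolev_norm_ge0.
  - exact: iq.
  - have [a b] := fin_d n t0; rewrite -L1D1E//; apply: sobolev2_Fr => //.
    apply: n2D => //; apply: wn_fin_sub => //; [exact: hD|exact: D1n_q].
  - rewrite w0 /=; have := normr_ge0 x; move: `|x| => y y0; nra.
apply: (@le_lt_trans _ _ (\int[mu]_(t in `[0%R, T]) (kap%:E * (E%:E + D1n (U t))))%E).
  have kD0 t : (0 <= kap%:E * (E%:E + D1n (U t)))%E.
    by apply: mule_ge0; [rewrite lee_fin|apply: adde_ge0; [rewrite lee_fin|exact: D1n_ge0]].
  rewrite integral_mkcond [leRHS]integral_mkcond; apply: ae_ge0_le_integral_nomeas => [t _|t _|].
  - by rewrite patchE; case: ifP => // _; exact: sobolev_norm_ge0.
  - by rewrite patchE; case: ifP.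
  apply: aeS D1_ae => t hD _; rewrite !patchE !mem_setE !in_itv /=.
  case: ifP => [tI|_]; last by case: ifP.
  have /andP[/ltW t0 /ltW tT] := tI; rewrite t0 tT /=.
  have hL : (L1n (U t) <= E%:E)%E by apply: le_trans (bU t0); exact: L1n_le_A1n.
  have hn : (n1 (U t) <= E%:E)%E by apply: le_trans (bU t0); exact: n1_le_A1n.
  apply: le_trans (sobolev2_Fr (mUt t) (le_lt_trans hL (ltry _)) (le_lt_trans hn (ltry _)) (n2D _ (mUt t) (hD tI))) _.
  by apply: lee_wpmul2l; rewrite ?lee_fin//; exact: leeD2r.
rewrite integral_indE.
apply: (@le_lt_trans _ _ (\int[mu]_t ((kap * E * ind T t)%:E + kap%:E * ((ind T t)%:E * D1n (U t))))%E).
  rewrite le_eqVlt; apply/orP; left; apply/eqP; apply: eq_integral => t _.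
  by case: (ind01 T t) => ->; rewrite ?mul0e ?mule0 ?mulr0 ?adde0// !mul1e mulr1 ge0_muleDr ?D1n_ge0 ?lee_fin// EFinM.
have mi : mfunT (fun t => (ind T t)%:E * D1n (U t))%E.
  by apply: emeasurable_funM => //; apply/measurable_EFinP; exact: measurable_ind.
have i0 t : (0 <= (ind T t)%:E * D1n (U t))%E by rewrite mule_ge0 ?D1n_ge0// lee_fin ind_ge0.
rewrite -ge0_intD; last 4 first.
- by apply/measurable_EFinP; apply: measurable_funM; [exact: measurable_cst|exact: measurable_ind].
- exact: measurable_funeM.
- by move=> t; rewrite lee_fin mulr_ge0 ?ind_ge0// mulr_ge0.
- by move=> t; rewrite mule_ge0.
apply: lte_add_pinfty.
  have /integrableP[_ h] := integrableZl measurableT (kap * E) (integrable_ind T).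
  by apply: le_lt_trans h; apply: ge0_le_integral_nomeas => t _; [rewrite lee_fin mulr_ge0 ?ind_ge0// mulr_ge0|rewrite /= lee_fin ler_norm].
rewrite ge0_integralZl// ?lee_fin//; apply: lte_mul_pinfty; rewrite ?lee_fin//.
by rewrite -integral_indE.
Qed.

Lemma Fr_Zr (c : R) v x : cintegrable v -> Fr (fun xi => c%:C * v xi) x = c * Fr v x.
Proof. by move=> iv; rewrite /Fr FiZ// ReM ReC ImC mul0r subr0. Qed.

Lemma L1nZr (c : R) v : cmeas v -> L1n (fun xi => c%:C * v xi) = (`|c|%:E * L1n v)%E.
Proof.
move=> mv; rewrite -!wn1 -(wnZ (c := `|c|))//; try exact: ler01.
by apply: eq_integral => x _; rewrite !Normc.normcM !normcC normr_id.
Qed.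

Lemma bochner_scaled (c : R -> R) (V : R -> R -> R[i]) (Q : nat -> nat -> R -> R[i]) (B M : R) :
  continuous c -> (forall t, `|c t| <= B) -> cmeas2 V -> (forall n i, cmeas (Q n i)) ->
  (forall n i, (L1n (Q n i) <= M%:E)%E) -> {ae mu, forall t, 0 < t < T -> (L1n (V t) <= M%:E)%E} ->
  {ae mu, forall t, 0 < t < T -> (fun n => L1n (fun xi => V t xi - Q n (idx n t) xi)%R) @ \oo --> 0%E} ->
  is_bochner_integral T Linf_norm (fun t x => c t * Fr (V t) x) (fun x => \int[mu]_t (ind T t * (c t * Fr (V t) x))).
Proof.
move=> cc cB mV mQ bQ bV cv.
have B0 : 0 <= B := le_trans (normr_ge0 _) (cB 0).
have M0 : 0 <= M by rewrite -lee_fin; apply: le_trans (bQ 0 0); exact: L1n_ge0.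
have mVt t : cmeas (V t) by exact: cmeas_sec1.
have iV : {ae mu, forall t, 0 < t < T -> cintegrable (V t)}.
  by apply: aeS bV => t h /h b; apply/cintegrableP; split => //; exact: le_lt_trans b (ltry _).
have sc s v : cmeas v -> (L1n v <= M%:E)%E -> (L1n (fun xi => (c s)%:C * v xi)%R <= (B * M)%:E)%E.
  by move=> mv h; rewrite L1nZr// EFinM; apply: lee_pmul; [by rewrite lee_fin|exact: L1n_ge0|by rewrite lee_fin|exact: h].
have mW : cmeas2 (fun t xi => (c t)%:C * V t xi).
  apply: cmeasM => //; apply: cmeasC; apply: (measurableT_comp _ measurable_fst).
  exact: continuous_measurable_fun.
have := @bochner_Fr R T (fun t xi => (c t)%:C * V t xi) (fun n i xi => (c (i%:R / kn n))%:C * Q n i xi) (B * M) mW.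
case.
- by move=> n i; apply: cmeasM => //; exact: cmeas_cst.
- by move=> n i; exact: sc.
- by apply: aeS bV => t h tI; apply: sc => //; exact: h.
- apply: aeS (aeI bV cv) => t [bt ct] tI; have /andP[/ltW t0 _] := tI.
  have ctau : `|c t - c ((idx n t)%:R / kn n)| @[n --> \oo] --> (0 : R).
    have h0 : `|c t - c t| = 0 by rewrite subrr normr0.
    rewrite -[X in _ --> X]h0; apply: cvg_norm; apply: cvgB; first exact: cvg_cst.
    exact: (cvg_comp _ _ (cvg_tau t0) (cc t)).
  have c1 : (`|c t - c ((idx n t)%:R / kn n)|%:E * M%:E)%E @[n --> \oo] --> 0%E.
    rewrite -(mul0e M%:E); apply: cvgeZr => //; exact: cvg_EFin (nearW _ _) ctau.
  have c2 : (B%:E * L1n (fun xi => V t xi - Q n (idx n t) xi)%R)%E @[n --> \oo] --> 0%E.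
    by rewrite -(mule0 B%:E); apply: cvgeZl => //; exact: ct.
  have c3 : (`|c t - c ((idx n t)%:R / kn n)|%:E * M%:E + B%:E * L1n (fun xi => V t xi - Q n (idx n t) xi)%R)%E @[n --> \oo] --> 0%E.
    by rewrite -[X in _ --> X](adde0 0%E); apply: cvgeD.
  apply: (squeeze_cvge _ (cvg_cst 0%E) c3); apply: nearW => n; rewrite L1n_ge0 /=.
  set s := (idx n t)%:R / kn n.
  have -> : (fun xi => (c t)%:C * V t xi - (c s)%:C * Q n (idx n t) xi) =
      (fun xi => (c t - c s)%:C * V t xi + (c s)%:C * (V t xi - Q n (idx n t) xi)).
    by apply/funext => xi; rewrite CD CN; ring.
  have mD : cmeas (fun xi => V t xi - Q n (idx n t) xi) by exact: cmeasB.
  apply: le_trans (L1nD_le _ _) _; [by apply: cmeasM => //; exact: cmeas_cst|by apply: cmeasM => //; exact: cmeas_cst|].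
  rewrite !L1nZr//; apply: leeD; first by apply: lee_wpmul2l; [rewrite lee_fin|exact: bt].
  by apply: lee_wpmul2r; [exact: L1n_ge0|rewrite lee_fin].
move=> s [sa sb sd]; have -> : (fun x => \int[mu]_t (ind T t * (c t * Fr (V t) x))) =
  (fun x => \int[mu]_t (ind T t * Fr (fun xi => (c t)%:C * V t xi) x)).
  apply/funext => x; apply: ae_Rintegral_indep; apply: aeS (aeI iV (aeI (ae_neq 0) (ae_neq T))) => t [ht [t0 tT]] _.
  have [->|i0] := eqVneq (ind T t) 0; first by rewrite !mul0r.
  by rewrite Fr_Zr//; apply: ht; exact: ind_I.
exists s; split => //.
  split; first by case: sa.
  have [_ sa2] := sa; apply: aeS (aeI iV sa2) => t [ht h] tI; have := h tI.
  have tI' : 0 < t < T by move: tI; rewrite /= in_itv.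
  rewrite (_ : (fun n => Linf_norm (fun x => Fr (fun xi => (c t)%:C * V t xi) x - step_val (s n) t x)) =
    (fun n => Linf_norm (fun x => c t * Fr (V t) x - step_val (s n) t x)))//.
  by apply/funext => n; congr Linf_norm; apply/funext => x; rewrite Fr_Zr//; exact: ht.
have -> : (fun n => \int[mu]_(t in `]0%R, T[) Linf_norm (fun x => c t * Fr (V t) x - step_val (s n) t x)%R)%E =
  (fun n => \int[mu]_(t in `]0%R, T[) Linf_norm (fun x => Fr (fun xi => (c t)%:C * V t xi) x - step_val (s n) t x)%R)%E; last exact: sb.
apply/funext => n; apply: ae_integral_indep; apply: aeS iV => t ht tI.
have tI' : 0 < t < T by move: tI; rewrite /= in_itv.
by congr Linf_norm; apply/funext => x; rewrite Fr_Zr//; exact: ht.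
Qed.

Let ng t xi : R[i] := - G t xi.
Let nq n i xi : R[i] := - Gen (q n i) xi.

Let L1nN v : L1n (fun xi => - v xi) = L1n v.
Proof. by apply: eq_integral => xi _; rewrite normcN. Qed.

Let mng : cmeas2 ng. Proof. by apply: cmeasN; exact: mG. Qed.
Let mngt t : cmeas (ng t). Proof. by apply: cmeasN; exact: mGt. Qed.
Let mnq n i : cmeas (nq n i). Proof. by apply: cmeasN; exact: cmeas_Gen. Qed.
Let bnq n i : (L1n (nq n i) <= CGE%:E)%E. Proof. by rewrite L1nN; exact: L1n_Gen. Qed.
Let bng : {ae mu, forall t, 0 < t < T -> (L1n (ng t) <= CGE%:E)%E}.
Proof. by apply: aeS L1n_G => t h /andP[/ltW t0 _]; rewrite L1nN; exact: h. Qed.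

Let cng : {ae mu, forall t, 0 < t < T -> L1n (fun xi => ng t xi - nq n (idx n t) xi) @[n --> \oo] --> 0%E}.
Proof.
apply: aeS G_Gen => t h /andP[/ltW t0 _].
have c1 : ((1 + 2 * C0 * E)%:E * A1n (fun xi => U t xi - q n (idx n t) xi)%R)%E @[n --> \oo] --> 0%E.
  by rewrite -(mule0 (1 + 2 * C0 * E)%:E); apply: cvgeZl => //; exact: A1_cvg.
apply: (squeeze_cvge _ (cvg_cst 0%E) c1); apply: nearW => n; rewrite L1n_ge0 /=.
apply: le_trans (L1n_Gen_sub E0 (mUt t) (mq n (idx n t)) (bU t0) (A1n_q _ _)).
rewrite -L1nN le_eqVlt; apply/orP; left; apply/eqP; apply: ae_L1n; apply: aeS (h t0) => xi e.
by rewrite /ng /nq e; ring.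
Qed.

Lemma theta_W1inf : W1inf_time T Linf_norm theta.
Proof.
have kp0 := ltW (@kap_gt0 R).
have A0 u : cmeas u -> (L1n u <= A1n u)%E by exact: L1n_le_A1n.
have cU1 t : 0 <= t -> L1n (fun xi => U t xi - q n (idx n t) xi) @[n --> \oo] --> 0%E.
  move=> t0; apply: (squeeze_cvge _ (cvg_cst 0%E) (A1_cvg t0)); apply: nearW => n.
  by rewrite L1n_ge0 /=; exact: L1n_le_A1n.
have bq n i : (L1n (q n i) <= E%:E)%E by apply: le_trans (A1n_q n i); exact: L1n_le_A1n.
have bUt t : 0 <= t -> (L1n (U t) <= E%:E)%E by move=> t0; apply: le_trans (bU t0); exact: L1n_le_A1n.
have inq n i : cintegrable (nq n i) by apply/cintegrableP; split => //; exact: le_lt_trans (bnq n i) (ltry _).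
have bd v (M : R) : cintegrable v -> (L1n v <= M%:E)%E -> (Linf_norm (Fr v) <= (kap * M)%:E)%E.
  by move=> iv h; apply: le_trans (Linf_norm_Fr iv) _; rewrite EFinM; apply: lee_wpmul2l; rewrite ?lee_fin.
split.
  split.
    exists (stp T (fun n i => Fr (q n i))); apply: step_approx_stp => [n i|].
      exact: le_lt_trans (bd _ _ (iq n i) (bq n i)) (ltry _).
    apply: aeW => t /andP[/ltW t0 _].
    apply: (cvg_Linf_Fr (N := Linf_norm) (K := kap) _ (cU t0) _ _ (cU1 t t0)) => [n|n|n].
    - exact: Linf_norm_ge0.
    - exact: iq.
    - by apply: Linf_norm_Fr; apply: cintegrableB; [exact: cU|exact: iq].
  exists (kap * E); apply: aeW => t; rewrite /= in_itv /= => /andP[/ltW t0 _].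
  by apply: bd; [exact: cU|exact: bUt].
exists (fun t => Fr (ng t)); split.
  have ing : {ae mu, forall t, 0 < t < T -> cintegrable (ng t)}.
    by apply: aeS bng => t h tI; apply/cintegrableP; split => //; exact: le_lt_trans (h tI) (ltry _).
  split.
    exists (stp T (fun n i => Fr (nq n i))); apply: step_approx_stp => [n i|].
      exact: le_lt_trans (bd _ _ (inq n i) (bnq n i)) (ltry _).
    apply: aeS (aeI ing cng) => t [it ct] tI.
    apply: (cvg_Linf_Fr (N := Linf_norm) (K := kap) _ (it tI) _ _ (ct tI)) => [n|n|n].
    - exact: Linf_norm_ge0.
    - exact: inq.
    - by apply: Linf_norm_Fr; apply: cintegrableB; [exact: it|exact: inq].
  exists (kap * CGE); apply: aeS (aeI ing bng) => t [it bt]; rewrite /= in_itv /= => tI.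
  by apply: bd; [exact: it|exact: bt].
move=> phi sphi [a [b [a0 bT phi0]]].
have supp x : b < `|x| -> phi x = 0.
  move=> bx; apply: phi0 => /andP[ax xb]; have x0 : 0 <= x := le_trans (ltW a0) ax.
  by rewrite ger0_norm// ltNge xb in bx.
have cphi := smooth_continuous sphi; have cphi' := smooth_continuous (smooth_derive1 sphi).
have supp' := is_derive_supp (smooth_is_derive sphi) supp.
have [B hB] := supp_bounded cphi supp; have [B' hB'] := supp_bounded cphi' supp'.
exists (fun x => \int[mu]_t (ind T t * (derive1 phi t * Fr (U t) x))); split.
  apply: (@bochner_scaled (derive1 phi) U q B' E) => //.
    by apply: aeW => t /andP[/ltW t0 _]; exact: bUt.
  by apply: aeW => t /andP[/ltW t0 _]; exact: cU1.
have -> : (fun x => - \int[mu]_t (ind T t * (derive1 phi t * Fr (U t) x))) =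
  (fun x => \int[mu]_t (ind T t * (phi t * Fr (ng t) x))).
  apply/funext => x; have mGx := @measurable_Fr_t R G x mG.
  have iG : Lint (fun t => ind T t * Fr (G t) x).
    apply: (integrable_ind_ae (C := kap * CGE)) => //; first by apply: mulr_ge0 => //; exact: CG_ge0.
    by apply: aeS FrG_bound => t h /andP[/ltW t0 _]; exact: h.
  have phiT : phi T = 0 by apply: phi0 => /andP[_]; rewrite leNgt bT.
  have phi00 : phi 0 = 0 by apply: phi0 => /andP[]; rewrite leNgt a0.
  have := @ibp_time R phi (fun t => Fr (U t) x) (fun t => Fr (G t) x) (Fr u0 x) T (ltW T0) sphi phiT mGx iG.
  rewrite !Rint_indE => -> => [|t /andP[t0 _]]; last exact: FrU_int.
  rewrite phi00 mul0r oppr0 add0r -RintegralN_gen; apply: ae_Rintegral_indep.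
  apply: aeS (aeI L1n_G (aeI (ae_neq 0) (ae_neq T))) => t [ht [t0 tT]] _.
  have [->|i0] := eqVneq (ind T t) 0; first by rewrite !mul0r oppr0.
  have /andP[/ltW t00 _] := ind_I t0 tT i0.
  have iGt : cintegrable (G t) by apply/cintegrableP; split; [exact: mGt|exact: le_lt_trans (ht t00) (ltry _)].
  by rewrite /Fr /ng FiN// ReN; ring.
by apply: (@bochner_scaled phi ng nq B CGE).
Qed.

Lemma theta_W : W_space T theta.
Proof. by split; [exact: theta_Linf1|exact: theta_W1inf|exact: theta_L12]. Qed.

Lemma wiener_theta t : 0 <= t -> wiener_norm 1 (theta t) = A1n (U t).
Proof.
move=> t0; rewrite (wiener_normE 1 (is_fourier_theta t0)).
by apply: eq_integral => x _; rewrite powRr1.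
Qed.

Lemma wiener_theta_x t : 0 <= t -> wiener_norm 1 (weak_deriv (theta t)) = D1n (U t).
Proof.
move=> t0; have iw := cintegrable_iM (mUt t) (cyU t0).
have wd := is_weak_deriv_Fr (cU t0) (cyU t0).
have wd2 : is_weak_deriv (theta t) (weak_deriv (theta t)).
  by rewrite /weak_deriv; case: xgetP => [? -> //|/(_ _ wd)].
have hf : is_fourier (weak_deriv (theta t)) (fun y => Complex 0 y * U t y).
  apply: is_fourier_ae => //; first by case: wd2.
    by apply: hermM => //; exact: herm_id_i.
  exact: is_weak_deriv_unique wd2 wd.
rewrite (wiener_normE 1 hf) -wn_iM.
by apply: eq_integral => x _; rewrite powRr1.
Qed.

Lemma energy_constE (a0 : R) :
  1 - Num.sqrt 2 * (1 + `|delta|) * a0 / Num.sqrt pi = 1 - 2 * C0 * a0.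
Proof.
congr (1 - _); rewrite C0E sqrtrM//.
have s2 : Num.sqrt 2 * Num.sqrt 2 = 2 :> R by rewrite -expr2 sqr_sqrtr.
have p2 : Num.sqrt 2 != 0 :> R by rewrite sqrtr_eq0 -ltNge.
have pp : Num.sqrt pi != 0 :> R by rewrite sqrtr_eq0 -ltNge pi_gt0.
move: (Num.sqrt 2) (Num.sqrt pi) s2 p2 pp => y z <- y0 z0.
by field; rewrite y0 z0.
Qed.

Lemma theta_energy (a0 : R) : L1n u0 = a0%:E ->
  (forall t, 0 <= t -> (A1n (U t) + (1 - 2 * C0 * a0)%:E * \int[mu]_(s in `[0%R, t]) D1n (U s) <= A1n u0)%E) ->
  energy_inequality delta theta0 theta T.
Proof.
move=> u0a en; rewrite /energy_inequality (wiener_norm0E hth0) u0a /=.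
have -> : wiener_norm 1 theta0 = A1n u0.
  by rewrite (wiener_normE 1 hth0); apply: eq_integral => x _; rewrite powRr1.
rewrite energy_constE.
apply: ub_ereal_sup => _ [t tT <-]; move: tT; rewrite /= in_itv /= => /andP[t0 _].
rewrite wiener_theta//; apply: le_trans (en t t0).
apply: leeD2l; rewrite le_eqVlt; apply/orP; left; apply/eqP; congr (_ * _)%E.
apply: eq_integral => s; rewrite inE /= in_itv /= => /andP[s0 _].
exact: wiener_theta_x.
Qed.

End Evolution.

(** * Uniqueness *)

Section Representatives.
Context {R : realType}.
Local Notation mu := (@lebesgue_measure R).
Local Notation Fh := (@fourier_int R).
Local Notation cmeas2 F := (cmeas (fun z : R * R => F z.1 z.2)).

Definition rlim (u : nat -> R) : R := fine (limn_esup (fun n => (u n)%:E)).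

Lemma rlimE u l : u @ \oo --> l -> rlim u = l.
Proof.
move=> h; have c : (u n)%:E @[n --> \oo] --> l%:E by apply: cvg_EFin h; exact: nearW.
by rewrite /rlim (cvg_limn_einf_sup c).2.
Qed.

Lemma measurable_rlim d (T : measurableType d) (f : nat -> T -> R) :
  (forall n, mfunT (f n)) -> mfunT (fun x => rlim (f ^~ x)).
Proof.
move=> mf; apply: (measurableT_comp (f := fine)) => //.
apply: (@measurable_realfun.measurable_fun_limn_esup _ T R setT (fun n x => (f n x)%:E)) => n.
exact/measurable_EFinP.
Qed.

Definition clim (u : nat -> R[i]) : R[i] := Complex (rlim (fun n => Re (u n))) (rlim (fun n => Im (u n))).

Lemma climE u l : ccvg u l -> clim u = l.
Proof. by case: l => a b [ha hb]; rewrite /clim (rlimE ha) (rlimE hb). Qed.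

Lemma cmeas_clim d (T : measurableType d) (f : nat -> T -> R[i]) : (forall n, cmeas (f n)) ->
  cmeas (fun x => clim (f ^~ x)).
Proof.
by move=> mf; split; apply: (measurable_rlim (f := fun n x => _ (f n x))) => n; case: (mf n).
Qed.

Lemma Linf_norm_ae (f : R -> R) : {ae mu, forall x, ((`|f x|)%:E <= Linf_norm f)%E}.
Proof.
rewrite /Linf_norm; case: asboolP => mf; last by apply: aeW => x; rewrite leey.
by rewrite unlock lebesgue_setT_gt0; exact: ess_sup_inf.ess_sup_ge.
Qed.

Lemma Linf_le_sobolev n (f : R -> R) : (Linf_norm f <= sobolev_norm n f)%E.
Proof.
case: n => // n; rewrite /= leeDl//; apply: le_ereal_inf_tmp => _ [g _ <-].
exact: sobolev_norm_ge0.
Qed.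

Lemma measurable_step_val n s : is_step (@sobolev_norm R n) s ->
  mfunT (fun z : R * R => step_val s z.1 z.2).
Proof.
elim: s => [|[A f] s IH] hs.
  by rewrite /step_val; under eq_fun do rewrite big_nil; exact: measurable_cst.
rewrite /step_val; under eq_fun do rewrite big_cons.
have [mA Nf] : measurable A /\ (sobolev_norm n f < +oo)%E by apply: (hs (A, f)); rewrite inE eqxx.
apply: measurable_funD; last by apply: IH => p ps; apply: hs; rewrite inE ps orbT.
apply: measurable_funM; first exact: (measurableT_comp (measurable_indic mA) measurable_fst).
apply: (measurableT_comp _ measurable_snd); apply: Linf_norm_meas.
exact: le_lt_trans (Linf_le_sobolev n f) Nf.
Qed.

Lemma joint_repr n T w : strongly_measurable T (@sobolev_norm R n) w ->
  exists2 W : R -> R -> R, mfunT (fun z : R * R => W z.1 z.2) &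
    {ae mu, forall t, 0 < t < T -> {ae mu, forall x, w t x = W t x}}.
Proof.
move=> [s [hs cs]]; exists (fun t x => rlim (fun n => step_val (s n) t x)).
  by apply: (measurable_rlim (f := fun n z => step_val (s n) z.1 z.2)) => m; exact: measurable_step_val (hs m).
apply: aeS cs => t h tI; have {}h : (fun k => sobolev_norm n (fun x => w t x - step_val (s k) t x)) @ \oo --> 0%E.
  by apply: h; rewrite /= in_itv.
have := ae_foralln (fun k => Linf_norm_ae (fun x => w t x - step_val (s k) t x)).
apply: aeS => x hx; apply/esym/rlimE.
have c0 : (`|w t x - step_val (s k) t x|)%:E @[k --> \oo] --> (0 : R)%:E.
  apply: (squeeze_cvge _ (cvg_cst 0%E) h); apply: nearW => k; rewrite lee_fin normr_ge0 /=.
  exact: le_trans (hx k) (Linf_le_sobolev _ _).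
have c1 : `|w t x - step_val (s k) t x| @[k --> \oo] --> (0 : R) by exact: (fine_cvg c0).
apply/cvgrPdist_lt => e e0; move/cvgrPdist_lt: c1 => /(_ e e0).
by apply: filterS => k; rewrite /= sub0r normrN normr_id.
Qed.

Lemma paste (W : nat -> R -> R -> R) : (forall k, mfunT (fun z : R * R => W k z.1 z.2)) ->
  exists2 V : R -> R -> R, mfunT (fun z : R * R => V z.1 z.2) &
    forall t x, 0 <= t -> V t x = W (idx 0 t) t x.
Proof.
move=> mW; exists (fun t x => rlim (fun n => \sum_(k <- iota 0 n) \1_(cell 0 k) t * W k t x)).
  apply: (measurable_rlim (f := fun n (z : R * R) => \sum_(k <- iota 0 n) \1_(cell 0 k) z.1 * W k z.1 z.2)) => n.
  apply: measurable_sum => k; apply: measurable_funM => //.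
  exact: (measurableT_comp (measurable_indic (measurable_cell 0 k)) measurable_fst).
move=> t x t0; apply: rlimE; apply: cvg_near_cst; near=> n.
have nt : (idx 0 t < n)%N by near: n; exact: nbhs_infty_gt.
under eq_bigr => k _ do rewrite cell_idx//.
exact: (sum_iota_eq (fun k => W k t x) nt).
Unshelve. all: by end_near. Qed.

Lemma integrable_indM (g : R -> R) (D : set R) : measurable D -> Lint g ->
  Lint (fun y => g y * \1_D y).
Proof.
move=> mD ig; apply: (integrableM_bounded (C := 1) ig); first exact: measurable_indic.
by move=> x; rewrite indicE normr_nat; case: (_ \in _); rewrite ?ler01.
Qed.

Lemma avg_ae (g : R -> R) : Lint g ->
  {ae mu, forall xi, (n.+1%:R * \int[mu]_y (g y * \1_(`]xi, xi + harmonic n[%classic) y)) @[n --> \oo] --> g xi}.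
Proof.
move=> ig; have ig' (D : set R) : measurable D -> mu.-integrable D (EFin \o g).
  by move=> mD; exact: integrableS ig.
have := @FTC1Ny R g (fun y => ig' _ (measurable_itv _)) (integrable_locally_integrable ig).
apply: aeS => xi [dF eF]; rewrite -eF.
set F := fun x => _ in dF eF *.
have FE a b : a <= b -> F b - F a = \int[mu]_y (g y * \1_(`]a, b[%classic) y).
  have FI c : F c = \int[mu]_y (g y * \1_(`]-oo, c]%classic) y).
    rewrite /F [LHS]Rintegral_mkcond; apply: eq_Rintegral => y _.
    by rewrite patchE indicE; case: (_ \in _); rewrite ?mulr1 ?mulr0.
  have iI c : Lint (fun y => g y * \1_(`]-oo, c]%classic) y).
    by apply: integrable_indM => //; exact: measurable_itv.
  move=> ab; rewrite !FI -(RintegralB measurableT (iI b) (iI a)).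
  apply: ae_Rintegral_indep; apply: aeS (ae_neq b) => y yb _.
  rewrite !indicE !mem_setE !in_itv /= (lt_neqAle y b) yb /= -mulrBr; congr (_ * _).
  case: (leP y b) => h1; case: (leP y a) => h2 /=; rewrite ?subrr ?subr0//.
  by have := lt_le_trans h1 (le_trans h2 ab); rewrite ltxx.
have hd : (harmonic n)^-1 *: (F (harmonic n *: 1 + xi) - F xi) @[n --> \oo] --> F^`()%classic xi.
  rewrite derive1E.
  have c : (fun h : R => h^-1 *: (F (h *: 1 + xi) - F xi)) @ 0^' --> 'D_1 F xi by exact: dF.
  apply: (cvg_comp _ _ _ c); move=> A /= [e e0 eA]; near=> n; apply: eA => /=.
    by rewrite sub0r normrN; near: n; have /cvgrPdist_lt /(_ e e0) := @cvg_harmonic R; apply: filterS => n; rewrite sub0r normrN.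
  by rewrite /harmonic invr_neq0// pnatr_eq0.
rewrite (_ : (fun n => _) = (fun n => (harmonic n)^-1 *: (F (harmonic n *: 1 + xi) - F xi)))//.
apply/funext => n; rewrite /GRing.scale /= mulr1 [_ + xi]addrC FE ?lerDl; first by rewrite /harmonic invrK.
by rewrite /harmonic invr_ge0.
Unshelve. all: by end_near. Qed.

Lemma cavg_ae (v : R -> R[i]) : cintegrable v -> {ae mu, forall xi,
  ccvg (fun n => (n.+1%:R)%:C * cintegral (fun y => v y * (\1_(`]xi, xi + harmonic n[%classic) y)%:C)) (v xi)}.
Proof.
move=> [i1 i2]; apply: aeS (aeI (avg_ae i1) (avg_ae i2)) => xi [h1 h2]; split.
  rewrite (_ : (fun n => _) = (fun n => n.+1%:R * \int[mu]_y (Re (v y) * \1_(`]xi, xi + harmonic n[%classic) y)))//.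
  apply/funext => n; rewrite ReM ReC ImC mul0r subr0 Re_cintegral; congr (_ * _).
  by apply: eq_Rintegral => y _; rewrite ReM ReC ImC mulr0 subr0.
rewrite (_ : (fun n => _) = (fun n => n.+1%:R * \int[mu]_y (Im (v y) * \1_(`]xi, xi + harmonic n[%classic) y)))//.
apply/funext => n; rewrite ImM ReC ImC mul0r addr0 Im_cintegral; congr (_ * _).
by apply: eq_Rintegral => y _; rewrite ImM ReC ImC mulr0 add0r.
Qed.

Lemma plateau_lim (v : R -> R[i]) (a b : R) : cintegrable v ->
  ccvg (fun m => cintegral (fun y => v y * (plateau a b m y)%:C))
    (cintegral (fun y => v y * (\1_(`]a, b[%classic) y)%:C)).
Proof.
move=> iv; have mv := cintegrable_meas iv.
apply: (ccvg_cintegral (g := fun y => normc (v y))).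
- by move=> m; apply: cmeasM => //; apply: cmeasC; apply: smooth_measurable; exact: smooth_plateau.
- by apply: cmeasM => //; apply: cmeasC; exact: measurable_indic.
- exact: cintegrable_norm.
- apply: aeW => x; apply: ccvgM; first exact: ccvg_cst.
  by apply: ccvgC; exact: plateau_cvg.
- move=> m x; rewrite Normc.normcM normcC ger0_norm ?plateau_ge0//.
  by rewrite ler_piMr ?normc_ge0 ?plateau_le1.
Qed.

Section Transform.
Variable W : R -> R -> R.
Hypothesis mW : mfunT (fun z : R * R => W z.1 z.2).

Definition pair_plateau (n m : nat) (t xi : R) : R[i] :=
  cintegral (fun x => (W t x)%:C * Fh (fun y => (plateau xi (xi + harmonic n) m y)%:C) x).

Lemma cmeas_pair_plateau n m : cmeas2 (pair_plateau n m).
Proof.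
have m11 : mfunT (fun z : (R * R) * R => z.1.1) by exact: (measurableT_comp measurable_fst measurable_fst).
have m12 : mfunT (fun z : (R * R) * R => z.1.2) by exact: (measurableT_comp measurable_snd measurable_fst).
have mp : mfunT (fun z : (R * R) * R => plateau z.1.1 (z.1.1 + harmonic n) m z.2).
  have ms := smooth_measurable (@smooth_sstep R).
  apply: measurable_funM; apply: (measurableT_comp ms); apply: measurable_funM; try exact: measurable_cst.
    by apply: measurable_funB.
  by apply: measurable_funB => //; apply: measurable_funD => //; exact: measurable_cst.
have mF : cmeas (fun z : R * R => Fh (fun y => (plateau z.1 (z.1 + harmonic n) m y)%:C) z.2).
  have h : cmeas (fun z : (R * R) * R => (plateau z.1.1 (z.1.1 + harmonic n) m z.2)%:C * expi (- z.1.2 * z.2)).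
    apply: cmeasM; first exact: cmeasC.
    by apply: cmeas_expi; apply: measurable_funM => //; exact: measurable_funN.
  have := cmeasM (cmeas_cst _ (@kap R)%:C) (cmeas_cintegral h).
  case=> a b; split; [move: a|move: b]; apply: eq_measurable_fun => z _; by rewrite FhE FiE.
have h : cmeas (fun z : (R * R) * R => (W z.1.1 z.2)%:C * Fh (fun y => (plateau z.1.2 (z.1.2 + harmonic n) m y)%:C) z.2).
  apply: cmeasM.
    by apply: cmeasC; exact: (measurableT_comp mW (measurable_fun_pair m11 measurable_snd)).
  exact: (cmeas_comp (g := fun z : (R * R) * R => (z.1.2, z.2)) mF (measurable_fun_pair m12 measurable_snd)).
by have [a b] := cmeas_cintegral h; split; [move: a|move: b]; apply: eq_measurable_fun => -[t xi] _.
Qed.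

(* By Parseval [pair_plateau n m t xi] is the integral of the transform of [W t]
   against a plateau, which tends to the integral over [[xi, xi + harmonic n]] as
   [m] grows; Lebesgue differentiation then recovers the transform. *)
Definition recov (t xi : R) : R[i] :=
  clim (fun n => (n.+1%:R)%:C * clim (fun m => pair_plateau n m t xi)).

Lemma cmeas_recov : cmeas2 recov.
Proof.
apply: (cmeas_clim (f := fun n (z : R * R) => (n.+1%:R)%:C * clim (fun m => pair_plateau n m z.1 z.2))) => n.
apply: cmeasM; first exact: cmeas_cst.
by apply: (cmeas_clim (f := fun m (z : R * R) => pair_plateau n m z.1 z.2)) => m; exact: cmeas_pair_plateau.
Qed.

Lemma recovE t f v : is_fourier f v -> cintegrable v -> {ae mu, forall x, f x = W t x} ->
  {ae mu, forall xi, recov t xi = v xi}.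
Proof.
move=> fv iv fW; apply: aeS (cavg_ae iv) => xi h; apply: climE.
rewrite (_ : (fun n => _) = (fun n => (n.+1%:R)%:C * cintegral (fun y => v y * (\1_(`]xi, xi + harmonic n[%classic) y)%:C)))//.
apply/funext => n; congr (_ * _); apply: climE.
rewrite (_ : (fun m => _) = (fun m => cintegral (fun y => v y * (plateau xi (xi + harmonic n) m y)%:C))).
  exact: plateau_lim.
apply/funext => m; have [_ /(_ _ (test_schwartz (test_plateau xi (xi + harmonic n) m)))[_ _ <-]] := fv.
by apply: ae_cintegral; apply: aeS fW => x ->.
Qed.

End Transform.

Lemma ae_swap (F : R -> R -> R[i]) : cmeas2 F -> {ae mu, forall t, {ae mu, forall xi, F t xi = 0}} ->
  {ae mu, forall xi, {ae mu, forall t, F t xi = 0}}.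
Proof.
move=> mF h.
have mF' : cmeas2 (fun xi t => F t xi).
  exact: (cmeas_comp (f := fun z : R * R => F z.1 z.2) (g := fun z => (z.2, z.1)) mF (measurable_fun_pair measurable_snd measurable_fst)).
have z0 (G : R -> R -> R[i]) : cmeas2 G -> (\int[mu]_t L1n (G t) = 0)%E -> {ae mu, forall t, {ae mu, forall xi, G t xi = 0}}.
  move=> mG e0; have h0 : {ae mu, forall t, L1n (G t) = 0%E}.
    apply: ae_eq0_integral => //; last by move=> t; exact: L1n_ge0.
    have := measurable_wnF (measurable_cst (1 : R)) (fun=> ler01) mG.
    by apply: eq_measurable_fun => t _; rewrite wn1.
  apply: aeS h0 => t ht; have h1 : {ae mu, forall xi, (normc (G t xi))%:E = 0%E}.
    apply: ae_eq0_integral => //; first by apply/measurable_EFinP; apply: cmeas_norm; exact: cmeas_sec1.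
    by move=> xi; rewrite lee_fin normc_ge0.
  by apply: aeS h1 => xi /= [] /normc_eq0.
apply: (z0 (fun xi t => F t xi)) => //; rewrite -(L1n_swap mF).
rewrite (ae_integral_indep (g := fun=> 0%E)) ?integral0//; apply: aeS h => t ht _.
rewrite (ae_L1n ht) /L1n (eq_integral (fun=> 0%E)) ?integral0// => xi _.
by rewrite normc0.
Qed.

End Representatives.

Section Competitor.
Context {R : realType}.
Local Notation mu := (@lebesgue_measure R).
Local Notation kap := (@kap R).
Local Notation Fi := (@inverse_fourier_int R).
Local Notation cmeas2 F := (cmeas (fun z : R * R => F z.1 z.2)).
Variables (delta : R) (theta0 : R -> R) (u0 : R -> R[i]) (E a0 : R).
Hypotheses (hth0 : is_fourier theta0 u0) (hu0 : herm u0) (mu0 : cmeas u0) (u0E : A1n u0 = E%:E).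
Hypotheses (E0 : 0 <= E) (u0a : L1n u0 = a0%:E) (small : 2 * C0 delta * a0 < 1).
Variable w : R -> R -> R.
Hypothesis hw : global_solution 1 delta theta0 w.

Lemma wiener_norm_ge0 (al : R) (f : R -> R) : (0 <= wiener_norm al f)%E.
Proof.
rewrite /wiener_norm; case: asboolP => // _; apply: integral_ge0 => x _.
by rewrite lee_fin mulr_ge0 ?normc_ge0// addr_ge0 ?powR_ge0.
Qed.

Lemma competitor_wiener t : 0 <= t -> (wiener_norm 1 (w t) <= E%:E)%E.
Proof.
move=> t0; have [_ h] := hw; have [_ en] := h (t + 1) (ltr_wpDl t0 ltr01).
move: en; rewrite /energy_inequality (wiener_norm0E hth0) u0a /= energy_constE.
have -> : wiener_norm 1 theta0 = E%:E.
  by rewrite (wiener_normE 1 hth0) -u0E; apply: eq_integral => x _; rewrite powRr1.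
apply: le_trans.
have I0 : (0 <= \int[mu]_(s in `[0%R, t]) wiener_norm 1 (weak_deriv (w s)))%E.
  by apply: integral_ge0 => s _; exact: wiener_norm_ge0.
apply: (@le_trans _ _ (wiener_norm 1 (w t) + (1 - 2 * C0 delta * a0)%:E *
    \int[mu]_(s in `[0%R, t]) wiener_norm 1 (weak_deriv (w s)))%E).
  by rewrite leeDl// mule_ge0// lee_fin subr_ge0 ltW.
apply: ereal_sup_ubound; exists t => //=.
by rewrite in_itv /= t0 lerDl ler01.
Qed.

Lemma competitor_fourier t : 0 <= t ->
  exists v, [/\ herm v, is_fourier (w t) v, cmeas v & (A1n v <= E%:E)%E].
Proof.
move=> t0; have := competitor_wiener t0; rewrite /wiener_norm.
case: asboolP => [[g hg] _|_]; last by rewrite leNgt ltry.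
have [v [hv fv _]] := herm_repr hg; exists v; split => //; first exact: is_fourier_cmeas fv.
rewrite (_ : A1n v = wiener_norm 1 (w t)); first exact: competitor_wiener.
by rewrite (wiener_normE 1 fv); apply: eq_integral => x _; rewrite powRr1.
Qed.

Lemma competitor_joint : exists2 V : R -> R -> R, mfunT (fun z : R * R => V z.1 z.2) &
  {ae mu, forall t, 0 < t -> {ae mu, forall x, w t x = V t x}}.
Proof.
have H (k : nat) : exists W : R -> R -> R, mfunT (fun z : R * R => W z.1 z.2) /\
    {ae mu, forall t, 0 < t < k.+2%:R -> {ae mu, forall x, w t x = W t x}}.
  have [_ h] := hw; have [[[sm _] _ _] _] := h k.+2%:R (ltr0Sn _ _).
  by have [W mW eW] := joint_repr sm; exists W.
have [W hW] := choice H.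
have [V mV VE] := paste (fun k => (hW k).1); exists V => //.
apply: aeS (ae_foralln (fun k => (hW k).2)) => t ht t0.
have [_ tk] := idx_bounds 0 (ltW t0).
have tk2 : t < (idx 0 t).+2%:R.
  have k1 : kn 0 = 1 :> R by rewrite /kn expr1n.
  move: tk; rewrite k1 invr1 mulr1 lerBlDl => h; apply: le_lt_trans h _.
  by rewrite natr1 ltr_nat.
apply: aeS (ht (idx 0 t) _) => [x ->|]; last by rewrite t0.
by rewrite VE// ltW.
Qed.

Lemma competitor_repr : exists vb : R -> R -> R[i],
  [/\ cmeas2 vb, forall t, herm (vb t), forall t, (A1n (vb t) <= E%:E)%E, causal vb &
   {ae mu, forall t, 0 < t -> is_fourier (w t) (vb t)}].
Proof.
have [V mV VE] := competitor_joint; have mr := cmeas_recov mV.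
pose r1 t xi : R[i] := (2^-1)%:C * (recov V t xi + conjc (recov V t (- xi))).
have mr1 : cmeas2 r1.
  apply: cmeasM; first exact: cmeas_cst.
  apply: cmeasD => //; apply: cmeasJ.
  apply: (cmeas_comp (f := fun z : R * R => recov V z.1 z.2) (g := fun z : R * R => (z.1, - z.2))) => //.
  by apply: measurable_fun_pair; [exact: measurable_fst|apply: measurable_funN; exact: measurable_snd].
have hr1 t : herm (r1 t).
  by move=> xi; rewrite /r1 conjcM conjcC conjcD conjcK opprK addrC.
pose m t : R := if (0 <= t) && (A1n (r1 t) <= E%:E)%E then 1 else 0.
have mm : mfunT m.
  apply: measurable_fun_ifT; [|exact: measurable_cst|exact: measurable_cst].
  apply: measurable_and; first by apply: measurable_fun_ler; [exact: measurable_cst|exact: measurable_id].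
  apply: measurable_fun_lee; last exact: measurable_cst.
  by apply: measurable_wnF => //; exact: measurable_1D.
have A0 : A1n (fun xi : R => 0 : R[i]) = 0%E.
  by rewrite /A1n /wn (eq_integral (fun=> 0%E)) ?integral0// => x _; rewrite normc0 mulr0.
exists (fun t xi => (m t)%:C * r1 t xi); split.
- exact: (cmeasM (cmeasC (measurableT_comp mm measurable_fst)) mr1).
- by move=> t xi; rewrite hr1 [RHS]conjcM conjcC.
- move=> t; rewrite /m; case: ifP => [/andP[_ h]|_].
    by rewrite (_ : (fun xi => _) = r1 t)//; apply/funext => xi; rewrite mul1r.
  by rewrite (_ : (fun xi => _) = fun=> 0) ?A0 ?lee_fin//; apply/funext => xi; rewrite mul0r.
- by move=> t xi t0; rewrite /m leNgt t0 mul0r.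
apply: aeS VE => t h t0; have [v [hv fv mv bv]] := competitor_fourier (ltW t0).
have [iv _] := A1n_fin mv bv.
have ev : {ae mu, forall xi, r1 t xi = v xi}.
  have e1 := recovE fv iv (h t0).
  have e2 : {ae mu, forall xi, recov V t (- xi) = v (- xi)}.
    move: e1 => -[N [mN N0 hN]]; exists (aff (-1) 0 @^-1` N); split.
    - by rewrite -[X in measurable X]setTI; exact: measurable_aff.
    - by rewrite lebesgue_affine ?oppr_eq0 ?oner_eq0//; rewrite N0 mule0.
    - move=> xi /= hx; have a1 : aff (-1) 0 xi = - xi by rewrite /aff; ring.
      by apply: hN => /= e; apply: hx; rewrite -a1; exact: e.
  apply: aeS (aeI e1 e2) => xi [h1 h2]; rewrite /r1 h1 h2 hv conjcK.
  by apply: complex_eqP; rewrite !reimE; field.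
have i1 : A1n (r1 t) = A1n v by apply: ae_wn; apply: aeS ev => xi ->.
have e : {ae mu, forall xi, (m t)%:C * r1 t xi = v xi}.
  by apply: aeS ev => xi <-; rewrite /m (ltW t0) i1 bv mul1r.
have iw : cintegrable (fun xi => (m t)%:C * r1 t xi).
  by apply/cintegrableP; split; [apply: cmeasM; [exact: cmeas_cst|exact: cmeas_sec1]|rewrite (ae_L1n e); exact: cintegrable_L1n].
apply: is_fourier_ae => //; first by case: fv.
  by move=> xi; rewrite hr1 [RHS]conjcM conjcC.
by apply: aeS (is_fourier_inv_Fr fv iv) => x ->; rewrite /Fr (Fi_ae e).
Qed.

End Competitor.

Section TestProducts.
Context {R : realType}.
Local Notation mu := (@lebesgue_measure R).

Lemma continuous_prod (chi phi : R -> R) : smooth chi -> smooth phi ->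
  continuous (fun p : R * R => chi p.1 * phi p.2).
Proof.
move=> sc sp; have c1 := smooth_continuous sc; have c2 := smooth_continuous sp.
move=> z; apply: cvgM; first exact: (cvg_comp _ _ (cvg_fst (F := nbhs z.1) (G := nbhs z.2)) (c1 z.1)).
exact: (cvg_comp _ _ (cvg_snd (F := nbhs z.1) (G := nbhs z.2)) (c2 z.2)).
Qed.

Lemma Cn2_prod n (chi phi : R -> R) : smooth chi -> smooth phi -> Cn2 n (fun t x => chi t * phi x).
Proof.
elim: n chi phi => [|n IH] chi phi sc sp; split => //; try exact: continuous_prod.
have dc := smooth_is_derive sc; have dp := smooth_is_derive sp.
have d1 t x : is_derive t (1 : R) (fun t => chi t * phi x) (derive1 chi t * phi x).
  have := isdM (dc t) (is_derive_cst (phi x) t (1 : R)).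
  by rewrite mulr0 addr0.
have d2 t x : is_derive x (1 : R) (fun x => chi t * phi x) (chi t * derive1 phi x) by apply: isdZ.
split.
- by move=> t x; split; [exact: (ex_derive (is_derive := d1 t x))|exact: (ex_derive (is_derive := d2 t x))].
- rewrite (_ : dt _ = fun t x => derive1 chi t * phi x); first by apply: IH => //; exact: smooth_derive1.
  by apply/funext => t; apply/funext => x; rewrite /dt (derive1_is (d1^~ x)).
- rewrite (_ : dx _ = fun t x => chi t * derive1 phi x); first by apply: IH => //; exact: smooth_derive1.
  by apply/funext => t; apply/funext => x; rewrite /dx (derive1_is (d2 t)).
Qed.

Lemma dt_prod (chi phi : R -> R) t x : smooth chi -> dt (fun t x => chi t * phi x) t x = derive1 chi t * phi x.
Proof.
move=> sc; rewrite /dt; suff /derive1_is -> : forall t : R, is_derive t 1 (fun t => chi t * phi x) (derive1 chi t * phi x) by [].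
move=> s; have := isdM (smooth_is_derive sc s) (is_derive_cst (phi x) s (1 : R)).
by rewrite mulr0 addr0.
Qed.

Lemma test_primitive (zeta : R -> R) : test_fun zeta -> exists chi : R -> R,
  [/\ smooth chi, derive1 chi = (fun t => - zeta t) & exists2 M, 0 <= M & forall t, M < t -> chi t = 0 /\ zeta t = 0].
Proof.
move=> tz; have [sz [M hM]] := tz; have iz := test_fun_integrable tz.
pose X t := \int[mu]_(s in `]-oo, t]) zeta s.
have dX t : is_derive t (1 : R) X (zeta t).
  have cz : continuous zeta by exact: smooth_continuous.
  have [|||dX eX] := @continuous_FTC1 R zeta -oo%O t (t + 1) _ _ _ (cz t).
  - by rewrite ltrDl.
  - by apply: integrableS iz => //; exact: measurable_itv.
  - by rewrite /Order.lt /=.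
  - by apply: DeriveDef; [exact: dX|rewrite -derive1E; exact: eX].
pose c := \int[mu]_s zeta s.
have dchi t : is_derive t (1 : R) (fun t => c - X t) (- zeta t).
  have := isdD (is_derive_cst c t (1 : R)) (isdZ (-1) (dX t)); rewrite add0r mulN1r.
  by rewrite (_ : (fun x => _ + _) = (fun t => c - X t))//; apply/funext => x; rewrite mulN1r.
exists (fun t => c - X t); split.
- apply: smoothS dchi _; rewrite (_ : (fun t => - zeta t) = (fun t => -1 * zeta t)); first exact: smoothZ.
  by apply/funext => t; rewrite mulN1r.
- exact: derive1_is.
exists `|M| => // t Mt; have z0 s : t < s -> zeta s = 0.
  move=> ts; apply: hM; apply: le_lt_trans (ler_norm M) _.
  by apply: lt_le_trans Mt _; apply: le_trans (ltW ts) (ler_norm s).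
split; last by apply: hM; apply: le_lt_trans (ler_norm M) _; apply: lt_le_trans Mt (ler_norm t).
apply/eqP; rewrite subr_eq0; apply/eqP; rewrite /X Rintegral_mkcond; apply: eq_Rintegral => s _.
by rewrite patchE mem_setE in_itv /=; case: ifPn => //; rewrite -ltNge => /z0.
Qed.

End TestProducts.

Section WeakToMild.
Context {R : realType}.
Local Notation mu := (@lebesgue_measure R).
Local Notation kap := (@kap R).
Local Notation Fi := (@inverse_fourier_int R).
Local Notation cmeas2 F := (cmeas (fun z : R * R => F z.1 z.2)).

Lemma cmeas2_swap (f : R -> R -> R[i]) : cmeas2 f -> cmeas2 (fun xi s => f s xi).
Proof.
move=> m; exact: (cmeas_comp (f := fun z : R * R => f z.1 z.2) (g := fun z => (z.2, z.1)) m (measurable_fun_pair measurable_snd measurable_fst)).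
Qed.

Lemma cintegrable_sec_ae (f : R -> R -> R[i]) : cmeas2 f -> (\int[mu]_s L1n (f s) < +oo)%E ->
  {ae mu, forall xi, cintegrable (fun s => f s xi)}.
Proof.
move=> m fin; have m' := cmeas2_swap m.
have h : {ae mu, forall xi, (L1n (fun s => f s xi) < +oo)%E}.
  apply: ae_fin_integral; last by rewrite -(L1n_swap m).
    have := @measurable_wnF R (fun=> 1) (fun xi s => f s xi) (measurable_cst (1 : R)) (fun=> ler01) m'.
    by apply: eq_measurable_fun => t _; rewrite wn1.
  by move=> xi; exact: L1n_ge0.
by apply: aeS h => xi h; apply/cintegrableP; split => //; exact: (@cmeas_sec1 R (fun xi s => f s xi) xi m').
Qed.

Lemma ae_forall_count (I : countType) (P : I -> R -> Prop) :
  (forall i, {ae mu, forall t, P i t}) -> {ae mu, forall t, forall i, P i t}.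
Proof.
move=> h; have h' n : {ae mu, forall t, if unpickle n is Some i then P i t else True}.
  by case: (unpickle n) => [i|]; [exact: h|exact: aeW].
by apply: aeS (ae_foralln h') => t ht i; have := ht (pickle i); rewrite pickleK.
Qed.

Lemma pairing_le (v : R -> R[i]) (phi : R -> R) (M : R) : cintegrable v -> (L1n v <= M%:E)%E ->
  Lint phi ->
  `|\int[mu]_x (Fr v x * phi x)| <= kap * M * \int[mu]_x `|phi x|.
Proof.
move=> iv hM ip; have kp0 := ltW (@kap_gt0 R); have ii := integrable_Fr_test iv ip.
apply: le_trans (le_normr_Rintegral measurableT ii) _.
have ia := integrable_norm ip.
have iZ : Lint (fun x => kap * M * `|phi x|).
  by have := integrableZl measurableT (kap * M) ia; apply: eq_integrable.
have -> : kap * M * \int[mu]_x `|phi x| = \int[mu]_x (kap * M * `|phi x|) by rewrite RintegralZl.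
apply: le_Rintegral => //.
  exact: (integrable_norm ii).
move=> x _; rewrite normrM; apply: ler_wpM2r => //; apply: le_trans (Fr_bound x iv) _.
by apply: ler_wpM2l => //; rewrite -lee_fin -L1n_fin.
Qed.

Lemma wnB_le (h : R -> R) (u v : R -> R[i]) : (forall x, 0 <= h x) -> mfunT h -> cmeas u -> cmeas v ->
  (wn h (fun x => u x - v x)%R <= wn h u + wn h v)%E.
Proof.
move=> h0 mh mf mg; have mN f : cmeas f -> mfunT (fun x : R => (h x * normc (f x))%:E).
  by move=> mf'; apply/measurable_EFinP; apply: measurable_funM => //; exact: cmeas_norm.
have p f (x : R) : (0 <= (h x * normc (f x : R[i]))%:E)%E by rewrite lee_fin mulr_ge0 ?normc_ge0.
rewrite /wn ge0_intD//; try exact: mN.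
by apply: ge0_le_integral_nomeas => x _; first exact: (p (fun y => u y - v y)); rewrite -EFinD lee_fin -mulrDr; apply: ler_wpM2l => //; exact: normcB.
Qed.

Lemma ind_sec_ae t (F : R -> R -> R[i]) : cmeas2 F -> (\int[mu]_(s in `[0%R, t]) A1n (F s) < +oo)%E ->
  {ae mu, forall xi, cintegrable (fun s => (ind t s)%:C * F s xi)}.
Proof.
move=> mF fin; apply: (@cintegrable_sec_ae (fun s xi => (ind t s)%:C * F s xi)).
  by apply: cmeasM => //; apply: cmeasC; exact: (measurableT_comp (measurable_ind t) measurable_fst).
apply: le_lt_trans fin; rewrite integral_indE; apply: ge0_le_integral_nomeas => s _; first exact: L1n_ge0.
rewrite L1nZr ?(ger0_norm (ind_ge0 _ _)); last exact: (cmeas_sec1 s mF).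
by apply: lee_wpmul2l; [rewrite lee_fin ind_ge0|apply: L1n_le_A1n; exact: (cmeas_sec1 s mF)].
Qed.

Lemma hexp_sec_ae t (F : R -> R -> R[i]) : cmeas2 F -> causal F ->
  {ae mu, forall xi, cintegrable (fun s => (ind t s)%:C * F s xi)} ->
  {ae mu, forall xi, cintegrable (fun s => (hexp `|xi| (t - s))%:C * F s xi)}.
Proof.
move=> mF cF; apply: aeS => xi; apply: cintegrable_hexp => //.
  exact: (@cmeas_sec1 R (fun xi s => F s xi) xi (cmeas2_swap mF)).
by move=> r r0; exact: cF.
Qed.

Variables (delta : R) (theta0 : R -> R) (u0 : R -> R[i]) (E : R).
Hypotheses (hth0 : is_fourier theta0 u0) (hu0 : herm u0) (mu0 : cmeas u0) (bu0 : (A1n u0 <= E%:E)%E) (E0 : 0 <= E).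
Variables (w : R -> R -> R) (vb : R -> R -> R[i]).
Hypotheses (mvb : cmeas2 vb) (hvb : forall t, herm (vb t)) (bvb : forall t, (A1n (vb t) <= E%:E)%E) (cvb : causal vb).
Hypothesis wvb : {ae mu, forall t, 0 < t -> is_fourier (w t) (vb t)}.
Hypothesis hweak : weak_solution 1 delta theta0 w.
Local Notation Bil := (Bil delta).
Local Notation Gen := (Gen delta).
Local Notation CGE := (CG delta E).
Let G t xi : R[i] := Gen (vb t) xi.

Let mBil : cmeas2 (fun t xi => Bil (vb t) (vb t) xi). Proof. exact: cmeas_Bil2. Qed.
Let mG : cmeas2 G.
Proof.
apply: cmeasD => //; apply: cmeasM => //.
exact: (cmeas_comp (f := fun x : R => `|x|%:C : R[i]) cmeas_abs measurable_snd).
Qed.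
Let mvt t : cmeas (vb t). Proof. exact: (cmeas_sec1 t mvb). Qed.
Let mGt t : cmeas (G t). Proof. exact: (cmeas_sec1 t mG). Qed.
Let iv t : cintegrable (vb t). Proof. exact: (A1n_fin (mvt t) (bvb t)).1. Qed.
Let iyv t : cintegrable (fun y => y%:C * vb t y). Proof. exact: (A1n_fin (mvt t) (bvb t)).2. Qed.
Let bv t : (L1n (vb t) <= E%:E)%E. Proof. by apply: le_trans (bvb t); exact: L1n_le_A1n. Qed.
Let bG t : (L1n (G t) <= CGE%:E)%E. Proof. exact: L1n_Gen. Qed.
Let iG t : cintegrable (G t). Proof. by apply/cintegrableP; split => //; exact: le_lt_trans (bG t) (ltry _). Qed.
Let iu0 : cintegrable u0. Proof. exact: (A1n_fin mu0 bu0).1. Qed.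
Let CG0 : 0 <= CGE. Proof. exact: CG_ge0. Qed.

Let ind_fin t (H : R -> R -> R[i]) (M : R) : 0 <= t -> cmeas2 H -> (forall s, (L1n (H s) <= M%:E)%E) ->
  cmeas2 (fun s xi => (ind t s)%:C * H s xi) /\ (\int[mu]_s L1n (fun xi => (ind t s)%:C * H s xi)%R < +oo)%E.
Proof.
move=> t0 mH bH; split.
  by apply: cmeasM => //; apply: cmeasC; exact: (measurableT_comp (measurable_ind t) measurable_fst).
have M0 : 0 <= M by rewrite -lee_fin; apply: le_trans (bH 0); exact: L1n_ge0.
have /integrableP[_ h] := integrableZl measurableT M (integrable_ind t).
apply: le_lt_trans h; apply: ge0_le_integral_nomeas => s _; first exact: L1n_ge0.
rewrite L1nZr; last exact: (cmeas_sec1 s mH).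
rewrite /= normrM (ger0_norm M0) mulrC EFinM; apply: lee_wpmul2l => //; exact: bH.
Qed.

Section Pairing.
Variable phi : R -> R.
Hypothesis tphi : test_fun phi.
Let f t := \int[mu]_x (Fr (vb t) x * phi x).
Let g t := \int[mu]_x (Fr (G t) x * phi x).
Let f0 := \int[mu]_x (Fr u0 x * phi x).
Let Phi := \int[mu]_x `|phi x|.
Let ip : Lint phi. Proof. exact: test_fun_integrable. Qed.
Let mphi : mfunT phi. Proof. by apply: smooth_measurable; case: tphi. Qed.

Let measurable_pairing (H : R -> R -> R[i]) : cmeas2 H ->
  mfunT (fun t => \int[mu]_x (Fr (H t) x * phi x)).
Proof.
move=> mH; apply: (measurable_Rintegral (f := fun z : R * R => Fr (H z.1) z.2 * phi z.2)).
by apply: measurable_funM; [exact: measurable_Fr2|exact: (measurableT_comp mphi measurable_snd)].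
Qed.

Let mf : mfunT f. Proof. exact: measurable_pairing. Qed.
Let mg : mfunT g. Proof. exact: measurable_pairing. Qed.
Let Bf := kap * E * Phi.
Let Bg := kap * CGE * Phi.
Let fb t : `|f t| <= Bf. Proof. exact: pairing_le. Qed.
Let gb t : `|g t| <= Bg. Proof. exact: pairing_le. Qed.
Let Bf0 : 0 <= Bf. Proof. exact: le_trans (normr_ge0 _) (fb 0). Qed.
Let Bg0 : 0 <= Bg. Proof. exact: le_trans (normr_ge0 _) (gb 0). Qed.
Let I t := \int[mu]_s (ind t s * g s).

Let iig (T : R) : 0 < T -> Lint (fun t => ind T t * g t).
Proof. by move=> T0; apply: (integrable_ind_ae mg Bg0); apply: aeW => t _; exact: gb. Qed.

Let mI : mfunT I.
Proof.
apply: (measurable_Rintegral (f := fun z : R * R => ind z.1 z.2 * g z.2)).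
apply: measurable_funM; last exact: (measurableT_comp mg measurable_snd).
by apply: measurable_ind2; [exact: measurable_fst|exact: measurable_snd].
Qed.

Let Ib t : 0 <= t -> `|I t| <= Bg * t.
Proof.
rewrite le_eqVlt => /orP[/eqP <-|t0].
  rewrite mulr0 /I (ae_Rintegral_indep (g := fun=> 0)) ?/Rintegral ?integral0 ?normr0//.
  apply: aeS (ae_neq 0) => s s0 _; rewrite /ind; case: ifP; rewrite ?mul0r// => /andP[a b].
  by move/eqP: s0; case; apply/le_anti; rewrite a b.
have ia := integrable_norm (iig t0); have ii := integrable_ind t.
apply: le_trans (le_normr_Rintegral measurableT (iig t0)) _.
have -> : Bg * t = \int[mu]_s (Bg * ind t s).
  by rewrite RintegralZl//; congr (_ * _); rewrite /Rintegral integral_ind ?ltW.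
apply: le_Rintegral => //.
  by have := integrableZl measurableT Bg ii; apply: eq_integrable.
move=> s _; rewrite normrM (ger0_norm (ind_ge0 _ _)) mulrC.
by apply: ler_wpM2r; [exact: ind_ge0|exact: gb].
Qed.

Lemma weak_pairing : {ae mu, forall t, 0 <= t -> f t = f0 - I t}.
Proof.
pose D t : R := if 0 <= t then f t - f0 + I t else 0.
pose D2 t : R := D t / oneDsqr t.
have o1 (t : R) : 1 <= oneDsqr t by rewrite /oneDsqr lerDl sqr_ge0.
have op (t : R) : 0 < oneDsqr t := lt_le_trans ltr01 (o1 t).
have so : smooth (@oneDsqr R).
  rewrite (_ : @oneDsqr R = fun x => 1 + x * x); last by apply/funext => x; rewrite /oneDsqr expr2.
  by apply: smoothD; [exact: smooth_cst|apply: smoothM; exact: smooth_id].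
have mD : mfunT D.
  apply: measurable_fun_ifT; last exact: measurable_cst.
    by apply: measurable_fun_ler; [exact: measurable_cst|exact: measurable_id].
  exact: (measurable_funD (measurable_funB mf (measurable_cst f0)) mI).
have lD : locally_integrable setT D2.
  apply: (bounded_locally_integrable (C := Bf + `|f0| + Bg)).
  exact: (measurable_funM mD (smooth_measurable (smoothV so (fun x => lt0r_neq0 (op x))))).
  move=> t; rewrite /D2 normrM normfV (ger0_norm (ltW (op t))) ler_pdivrMr//.
  rewrite /D; case: ifP => t0; last by rewrite normr0; exact: (mulr_ge0 (addr_ge0 (addr_ge0 Bf0 (normr_ge0 _)) Bg0) (ltW (op t))).
  apply: le_trans (ler_normD _ _) _; rewrite mulrDl; apply: lerD.
    apply: le_trans (ler_normB _ _) _; apply: (@le_trans _ _ ((Bf + `|f0|) * 1)).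
      by rewrite mulr1; apply: lerD.
    by apply: ler_wpM2l => //; exact: addr_ge0.
  apply: le_trans (Ib t0) _; apply: ler_wpM2l => //; rewrite /oneDsqr; nra.
have : {ae mu, forall t, D2 t = 0}.
  apply: test_ortho_eq0 lD _ => eta teta.
  pose zeta t := eta t / oneDsqr t.
  have tz : test_fun zeta.
    have [se [M hM]] := teta; split; last by exists M => x /hM h; rewrite /zeta h mul0r.
    exact: (smoothM se (smoothV so (fun x => lt0r_neq0 (op x)))).
  have [chi [sc dc [M M0 hM]]] := test_primitive tz.
  pose T := M + 1.
  have T0 : 0 < T by rewrite ltr_wpDl.
  have chiT : chi T = 0 by apply: (hM T _).1; rewrite ltrDl.
  have [sp [N hN]] := tphi.
  have t2 : test_fun2 T (fun t x => chi t * phi x).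
    split; first by move=> n; exact: Cn2_prod.
    exists M, N; split; first by rewrite ltrDl.
    by move=> t x t0 [/hM[-> _]|/hN ->]; rewrite ?mul0r ?mulr0.
  have Z := hweak T0 t2; rewrite Rint_indE in Z.
  have mchi := smooth_measurable sc; have mz : mfunT zeta by apply: smooth_measurable; case: tz.
  have cz : continuous zeta by apply: smooth_continuous; case: tz.
  have cchi : continuous chi by exact: smooth_continuous.
  have iz : Lint (fun t => ind T t * zeta t).
    by apply: integrable_indP => //; exact: continuous_itv_integrable.
  have ic : Lint (fun t => ind T t * chi t).
    by apply: integrable_indP => //; exact: continuous_itv_integrable.
  have i1 : Lint (fun t => ind T t * (zeta t * f t)).
    have := integrableM_bounded iz mf fb; apply: eq_integrable => // t _; by rewrite /= mulrA.
  have i2 : Lint (fun t => ind T t * (g t * chi t)).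
    by have := integrableM_bounded ic mg gb; apply: eq_integrable => // t _; rewrite /= -mulrA (mulrC (chi t)).
  have i3 : Lint (fun t => ind T t * (zeta t * (f0 - I t))).
    have mh : mfunT (fun t => ind T t * (f0 - I t)).
      exact: (measurable_funM (measurable_ind T) (measurable_funB (measurable_cst f0) mI)).
    have hb t : `|ind T t * (f0 - I t)| <= `|f0| + Bg * T.
      have B0 : 0 <= `|f0| + Bg * T by rewrite addr_ge0// mulr_ge0// ltW.
      rewrite /ind; case: ifP => [/andP[t0 tT]|_]; last by rewrite mul0r normr0.
      rewrite mul1r; apply: le_trans (ler_normB _ _) _; apply: lerD => //.
      by apply: le_trans (Ib t0) _; exact: ler_wpM2l.
    have := integrableM_bounded iz mh hb; apply: eq_integrable => // t _ /=; congr EFin.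
    by case: (ind01 T t) => ->; ring.
  have E1 : \int[mu]_t (ind T t * (zeta t * f t)) + \int[mu]_t (ind T t * (g t * chi t)) = chi 0 * f0.
    rewrite -RintegralD//; apply/eqP; rewrite -eqr_opp -RintegralN_gen; apply/eqP.
    have -> : - (chi 0 * f0) = - \int[mu]_x (theta0 x * (chi 0 * phi x)).
      congr (- _); rewrite /f0 -RintegralZl//; last exact: integrable_Fr_test.
      by apply: ae_Rintegral_indep; apply: aeS (is_fourier_inv_Fr hth0 iu0) => x -> _; rewrite mulrCA.
    rewrite -Z; apply: ae_Rintegral_indep; apply: aeS (aeI wvb (ae_neq 0)) => t [wt tn0] _.
    have [i0|i0] := eqVneq (ind T t) 0; first by rewrite i0 !mul0r addr0 oppr0.
    have /andP[t0 tT] : 0 <= t <= T by move: i0; rewrite /ind; case: ifP => //; rewrite eqxx.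
    have tp : 0 < t by rewrite lt_neqAle eq_sym tn0.
    have tpsi : test_fun (fun x => chi t * phi x).
      by split; [exact: smoothZ|exists N => x /hN ->; rewrite mulr0].
    have idt : Lint (fun x => dt (fun t x => chi t * phi x) t x).
      have := integrableZl measurableT (- zeta t) ip; apply: eq_integrable => // x _.
      by rewrite /= dt_prod// dc.
    have := inner_integralE delta (wt tp) (hvb t) (iv t) (iyv t) tpsi idt.
    rewrite -mulrDr -mulrN => ->; congr (_ * _); rewrite opprD; congr (_ + _).
      have -> : (fun x => Fr (vb t) x * dt (fun t x => chi t * phi x) t x) = (fun x => - zeta t * (Fr (vb t) x * phi x)).
        by apply/funext => x; rewrite dt_prod// dc; ring.
      by rewrite RintegralZl ?mulNr//; exact: integrable_Fr_test.
    congr (- _); have -> : (fun x => Fr (Gen (vb t)) x * (chi t * phi x)) = (fun x => chi t * (Fr (G t) x * phi x)).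
      by apply/funext => x; rewrite mulrCA.
    rewrite (@RintegralZl _ _ _ mu setT (fun x => Fr (G t) x * phi x) (chi t) measurableT (integrable_Fr_test (iG t) ip)); exact: mulrC.
  have E2 : \int[mu]_t (ind T t * (zeta t * (f0 - I t))) + \int[mu]_t (ind T t * (g t * chi t)) = chi 0 * f0.
    have := @ibp_time R chi (fun t => f0 - I t) g f0 T (ltW T0) sc chiT mg (iig T0) (fun _ _ => erefl).
    rewrite !Rint_indE dc => h; have -> : \int[mu]_t (ind T t * (zeta t * (f0 - I t))) =
      - \int[mu]_t (ind T t * (- zeta t * (f0 - I t))).
      by rewrite -RintegralN_gen; apply: eq_Rintegral => t _; ring.
    by rewrite h; ring.
  have E3 : \int[mu]_t (ind T t * (zeta t * f t)) - \int[mu]_t (ind T t * (zeta t * (f0 - I t))) = 0.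
    by apply/eqP; rewrite subr_eq0; apply/eqP/(addIr (\int[mu]_t (ind T t * (g t * chi t)))); rewrite E1 E2.
  rewrite -[RHS]E3 -RintegralB//; apply: eq_Rintegral => t _.
  have -> : D2 t * eta t = D t * zeta t by rewrite /D2 /zeta mulrAC mulrA.
  rewrite /D /ind; case: (leP 0 t) => t0 /=; last by rewrite !mul0r subrr.
  case: (leP t T) => tT /=; first by rewrite !mul1r; ring.
  by rewrite (hM t _).2 ?mulr0 ?mul0r ?subrr//; apply: lt_trans tT; rewrite ltrDl.
apply: aeS => t + t0; rewrite /D2 /D t0 => /eqP; rewrite mulf_eq0 invr_eq0 (gt_eqF (op t)) orbF => /eqP h.
by apply/eqP; rewrite -subr_eq0 opprB addrA addrAC -addrA addrC; apply/eqP; rewrite -[RHS]h; ring.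
Qed.

Lemma time_pairing t : 0 <= t ->
  I t = \int[mu]_x ((\int[mu]_s (ind t s * Fr (G s) x)) * phi x).
Proof.
move=> t0; have mH : mfunT (fun p : R * R => ind t p.1 * (Fr (G p.1) p.2 * phi p.2)).
  apply: measurable_funM; first exact: (measurableT_comp (measurable_ind t) measurable_fst).
  exact: (measurable_funM (measurable_Fr2 mG) (measurableT_comp mphi measurable_snd)).
have kp0 := ltW (@kap_gt0 R); have ia := integrable_norm ip.
have fin : (\int[mu]_s \int[mu]_x (`|ind t s * (Fr (G s) x * phi x)|)%:E < +oo)%E.
  have /integrableP[_ h] := integrableZl measurableT Bg (integrable_ind t).
  apply: le_lt_trans h; apply: ge0_le_integral_nomeas => s _; first by apply: integral_ge0 => x _; rewrite lee_fin.
  rewrite /= normrM (ger0_norm Bg0) (ger0_norm (ind_ge0 _ _)).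
  have e : (\int[mu]_x (kap * CGE * ind t s * `|phi x|)%:E = (Bg * ind t s)%:E)%E.
    under eq_integral do rewrite EFinM.
    rewrite integralZl//; have -> : (\int[mu]_x (`|phi x|)%:E = Phi%:E)%E.
      by rewrite /Phi /Rintegral fineK//; exact: integrable_fin_num.
    by rewrite -EFinM /Bg mulrAC.
  rewrite -e; apply: ge0_le_integral_nomeas => x _; first by rewrite lee_fin.
  rewrite lee_fin !normrM mulrA; apply: ler_wpM2r; first exact: normr_ge0.
  rewrite (ger0_norm (ind_ge0 _ _)) mulrC; apply: ler_wpM2r; first exact: ind_ge0.
  apply: le_trans (Fr_bound x (iG s)) _; apply: ler_wpM2l; first exact: kp0.
  by rewrite -lee_fin -(L1n_fin (iG s)); exact: bG.
have -> : I t = \int[mu]_s \int[mu]_x (ind t s * (Fr (G s) x * phi x)).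
  by apply: eq_Rintegral => s _; rewrite RintegralZl//; exact: (integrable_Fr_test (iG s) ip).
rewrite (RFubini mH fin); apply: eq_Rintegral => x _.
rewrite mulrC -RintegralZl//; first by apply: eq_Rintegral => s _; ring.
apply: (integrable_ind_ae (C := kap * CGE)).
- exact: measurable_Fr_t.
- exact: mulr_ge0.
- apply: aeW => s _; apply: le_trans (Fr_bound x (iG s)) _; apply: ler_wpM2l; first exact: kp0.
  by rewrite -lee_fin -(L1n_fin (iG s)); exact: bG.
Qed.

End Pairing.

Let zt t xi : R[i] := u0 xi - cintegral (fun s => (ind t s)%:C * G s xi).

Let intG t : 0 <= t -> cintegrable (fun xi => cintegral (fun s => (ind t s)%:C * G s xi)).
Proof.
move=> t0; have [m fin] := ind_fin t0 mG bG; rewrite (L1n_swap m) in fin.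
exact: (L1n_cintegral_le (cmeas2_swap m) fin).1.
Qed.

Let GJ s xi : G s (- xi) = conjc (G s xi).
Proof. exact: (hermD (hermM herm_abs (hvb s)) (Bil_herm delta (mvt s) (mvt s) (hvb s) (hvb s)) xi). Qed.

Lemma vb_integral : {ae mu, forall t, 0 <= t -> {ae mu, forall xi,
  vb t xi = u0 xi - cintegral (fun s => (ind t s)%:C * G s xi)}}.
Proof.
have h : {ae mu, forall t, forall i : rat * rat * nat, 0 <= t ->
    \int[mu]_x (Fr (vb t) x * plateau (ratr i.1.1) (ratr i.1.2) i.2 x) =
    \int[mu]_x (Fr u0 x * plateau (ratr i.1.1) (ratr i.1.2) i.2 x) -
    \int[mu]_s (ind t s * \int[mu]_x (Fr (G s) x * plateau (ratr i.1.1) (ratr i.1.2) i.2 x))}.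
  by apply: ae_forall_count => i; exact: (weak_pairing (test_plateau _ _ _)).
apply: aeS h => t ht t0.
have iz : cintegrable (zt t) by apply: cintegrableB => //; exact: intG.
have hz : herm (zt t).
  move=> xi; rewrite /zt hu0 conjcB -cintegralJ_gen; congr (_ - _).
  by apply: eq_cintegral => s; rewrite conjcM conjcC GJ.
have Fz x : Fr (zt t) x = Fr u0 x - \int[mu]_s (ind t s * Fr (G s) x).
  have [m fin] := ind_fin t0 mG bG.
  rewrite /Fr (FiB _ iu0 (intG t0)) ReB (Fi_param _ m fin) Re_cintegral; congr (_ - _).
  by apply: eq_Rintegral => s _; apply: Fr_ind; exact: ind01.
have e : {ae mu, forall x, Fr (vb t) x - Fr (zt t) x = 0}.
  apply: locally_integrable_eq0; first by apply: locally_integrableB; exact: Fr_locint.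
  move=> a b n; have tp := test_plateau (ratr a : R) (ratr b) n; have ip := test_fun_integrable tp.
  have := ht (a, b, n) t0; rewrite /= (time_pairing tp t0) => E1.
  transitivity (\int[mu]_x (Fr (vb t) x * plateau (ratr a) (ratr b) n x - Fr (zt t) x * plateau (ratr a) (ratr b) n x)).
    by apply: eq_Rintegral => x _; rewrite mulrBl.
  rewrite (RintegralB measurableT (integrable_Fr_test (iv t) ip) (integrable_Fr_test iz ip)) E1.
  apply/eqP; rewrite subr_eq0 eq_sym; apply/eqP.
  have iw : Lint (fun x => (\int[mu]_s (ind t s * Fr (G s) x)) * plateau (ratr a) (ratr b) n x).
    have := integrableB measurableT (integrable_Fr_test iu0 ip) (integrable_Fr_test iz ip).
    by apply: eq_integrable => // x _ /=; rewrite -EFinB -mulrBl Fz opprB addrC subrK.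
  rewrite -(RintegralB measurableT (integrable_Fr_test iu0 ip) iw).
  by apply: eq_Rintegral => x _; rewrite Fz mulrBl.
apply: (is_fourier_unique (f := Fr (vb t))); first exact: is_fourier_Fr.
apply: is_fourier_ae => //; first exact: Fr_locint.
by apply: aeS e => x /eqP; rewrite subr_eq0 => /eqP.
Qed.

Let B t xi : R[i] := Bil (vb t) (vb t) xi.

Let bB t : (L1n (B t) <= (C0 delta * (E * E))%:E)%E.
Proof.
apply: le_trans (L1n_Bil delta (mvt t) (mvt t)) _; rewrite (EFinM (C0 delta)) (EFinM E E).
apply: lee_wpmul2l; first by rewrite lee_fin C0_ge0.
apply: lee_pmul; [exact: L1n_ge0|exact: n1_ge0|exact: bv|].
by apply: le_trans (bvb t); exact: n1_le_A1n.
Qed.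

Let cB : causal B.
Proof.
move=> t xi t0; rewrite /B (_ : vb t = fun=> 0); last by apply/funext => y; exact: cvb.
by rewrite /Bil (eq_cintegral (g := fun=> 0)) ?cintegral0 ?mulr0// => y; rewrite !mulr0.
Qed.

Lemma vb_mild : {ae mu, forall t, 0 <= t -> {ae mu, forall xi, vb t xi = Sol u0 B t xi}}.
Proof.
pose D t xi : R[i] := (hexp 0 t)%:C * (vb t xi - zt t xi).
have mz : cmeas2 zt.
  apply: cmeasB; first exact: (cmeas_comp (f := u0) mu0 measurable_snd).
  apply: (cmeas_cintegral (f := fun z : (R * R) * R => (ind z.1.1 z.2)%:C * G z.2 z.1.2)).
  have m11 : mfunT (fun z : (R * R) * R => z.1.1) := measurableT_comp measurable_fst measurable_fst.
  have m12 : mfunT (fun z : (R * R) * R => z.1.2) := measurableT_comp measurable_snd measurable_fst.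
  apply: cmeasM; first exact: (cmeasC (measurable_ind2 m11 measurable_snd)).
  exact: (cmeas_comp (f := fun z : R * R => G z.1 z.2) (g := fun z : (R * R) * R => (z.2, z.1.2)) mG (measurable_fun_pair measurable_snd m12)).
have mD : cmeas2 D.
  apply: cmeasM; last exact: cmeasB.
  apply: cmeasC; exact: (measurable_hexp2 (f := fun=> 0) (measurable_cst _) measurable_fst).
have h0 (t : R) : 0 <= t -> hexp 0 t = 1 by move=> t0; rewrite /hexp t0 mul0r oppr0 expR0.
have D0 : {ae mu, forall t, {ae mu, forall xi, D t xi = 0}}.
  apply: aeS vb_integral => t h; have [t0|t0] := leP 0 t.
    by apply: aeS (h t0) => xi e; rewrite /D e subrr mulr0.
  by apply: aeW => xi; rewrite /D /hexp leNgt t0 mul0r.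
have D1 := ae_swap mD D0.
apply: aeS D0 => t ht t0; have [m1 f1] := ind_fin t0 mBil bB; have [m2 f2] := ind_fin t0 mvb bv.
apply: aeS (aeI (aeI ht D1) (aeI (cintegrable_sec_ae m1 f1) (cintegrable_sec_ae m2 f2))) => xi [[e1 e2] [i1 i2]].
have msec (K : R -> R -> R[i]) : cmeas2 K -> cmeas (fun s => K s xi).
  by move=> mK; exact: (@cmeas_sec1 R (fun xi s => K s xi) xi (cmeas2_swap mK)).
have Dz s : 0 <= s -> D s xi = 0 -> vb s xi = zt s xi.
  by move=> s0; rewrite /D h0// mul1r => /eqP; rewrite subr_eq0 => /eqP.
apply: (integral_mild (a := `|xi|) (v := fun s => vb s xi) (F := fun s => B s xi)) => //.
- exact: (msec _ mBil).
- exact: msec.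
- by move=> r r0; exact: cB.
- by move=> r r0; exact: cvb.
- by apply: aeS e2 => s e s0; exact: (Dz s s0 e).
- exact: (Dz t t0 e1).
Qed.

Lemma mild_unique (F : R -> R -> R[i]) (a0 : R) : 2 * C0 delta * a0 < 1 -> cmeas2 F -> causal F ->
  (forall T, 0 <= T -> (A1n (Sol u0 F T) <= E%:E)%E) ->
  (forall T, 0 <= T -> (L1n (Sol u0 F T) <= a0%:E)%E) ->
  (forall T, 0 <= T -> (\int[mu]_(t in `[0%R, T]) A1n (F t) < +oo)%E) ->
  {ae mu, forall t, 0 <= t -> {ae mu, forall xi, F t xi = Bil (Sol u0 F t) (Sol u0 F t) xi}} ->
  {ae mu, forall t, 0 <= t -> {ae mu, forall xi, vb t xi = Sol u0 F t xi}}.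
Proof.
move=> small mF cF bA ba iF eF; set U := Sol u0 F.
pose H t xi : R[i] := F t xi - B t xi; pose K := 2 * C0 delta * E + 1.
have C00 := C0_ge0 delta; have K0 : 0 < K by rewrite /K ltr_wpDl ?ltr01//; do 2 apply: mulr_ge0 => //.
have mH : cmeas2 H by exact: (cmeasB mF mBil).
have cH : causal H by move=> t xi t0; rewrite /H cF// cB// subrr.
have mS : cmeas2 (Sd H) by exact: cmeas_Sd.
have mU t : cmeas (U t) := cmeas_sec1 t (cmeas_Sol mu0 mF).
pose d t xi : R[i] := U t xi - vb t xi.
have dS : {ae mu, forall t, 0 <= t -> {ae mu, forall xi, normc (Sd H t xi) = normc (d t xi)}}.
  apply: aeS vb_mild => t ht t0; have [m1 f1] := ind_fin t0 mBil bB.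
  have i1 := hexp_sec_ae mF cF (ind_sec_ae mF (iF t t0)).
  have i2 := hexp_sec_ae mBil cB (cintegrable_sec_ae m1 f1).
  apply: aeS (aeI (ht t0) (aeI i1 i2)) => xi [e [j1 j2]]; rewrite /d e /U /Sol /Sd.
  have -> : cintegral (fun s => (hexp `|xi| (t - s))%:C * H s xi) = Sd F t xi - Sd B t xi.
    by rewrite /Sd -(cintegralB j1 j2); apply: eq_cintegral => s; rewrite /H mulrBr.
  by rewrite -normcN; congr normc; rewrite /Sd; ring.
have Sneg t : t < 0 -> Sd H t = fun=> 0.
  move=> t0; apply/funext => xi; rewrite /Sd (eq_cintegral (g := fun=> 0)) ?cintegral0// => s.
  by rewrite /hexp subr_ge0; case: leP => st; rewrite ?mul0r// cH ?mulr0//; exact: le_lt_trans st t0.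
have L00 : L1n (fun=> 0 : R[i]) = 0 by rewrite /L1n integral0_eq// => x _; rewrite normc0.
have n00 : n1 (fun=> 0 : R[i]) = 0 by rewrite /n1 /wn integral0_eq// => x _; rewrite normc0 mulr0.
pose om t : \bar R := (K%:E * L1n (Sd H t) + n1 (Sd H t))%E.
pose W t : \bar R := ((expR (- (K * t)))%:E * om t)%E.
have w0 t : (0 <= om t)%E by apply: adde_ge0; [apply: mule_ge0; [rewrite lee_fin ltW|exact: L1n_ge0]|exact: n1_ge0].
have W0 t : (0 <= W t)%E by apply: mule_ge0 => //; rewrite lee_fin expR_ge0.
have mW : mfunT W.
  apply: emeasurable_funM; first by apply/measurable_EFinP; exact: measurable_expK.
  apply: emeasurable_funD; last exact: (@measurable_wnF R (fun x => `|x|) _ (measurable_normr1) (fun x => normr_ge0 x) mS).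
  apply: emeasurable_funM; first exact: measurable_cst.
  have := @measurable_wnF R (fun=> 1) (Sd H) (measurable_cst (1 : R)) (fun=> ler01) mS.
  by congr measurable_fun; apply/funext => t; rewrite wn1.
have wd : {ae mu, forall t, 0 <= t -> om t = (K%:E * L1n (d t) + n1 (d t))%E}.
  by apply: aeS dS => t h t0; rewrite /om -!wn1 (ae_wn _ (h t0)) /n1 (ae_wn _ (h t0)).
have fl (u : \bar R) (M : R) : (u <= M%:E)%E -> (u < +oo)%E by move=> h; apply: le_lt_trans h (ltry _).
have Lv t := L1n_le_A1n (mvt t); have nv t := n1_le_A1n (mvt t).
have LU t := L1n_le_A1n (mU t); have nU t := n1_le_A1n (mU t).
have bd (t : R) : 0 <= t -> (L1n (d t) <= (E + E)%:E)%E /\ (n1 (d t) <= (E + E)%:E)%E.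
  move=> t0; have fA := bA t t0; rewrite EFinD; split.
    have := @wnB_le (fun=> 1) (U t) (vb t) (fun=> ler01) (measurable_cst (1 : R)) (mU t) (mvt t).
    by rewrite !wn1 => q; apply: le_trans q _; apply: leeD; [exact: le_trans (LU t) fA|exact: le_trans (Lv t) (bvb t)].
  apply: le_trans (@wnB_le (fun x => `|x|) (U t) (vb t) (fun x => normr_ge0 x) measurable_normr1 (mU t) (mvt t)) _.
  by apply: leeD; [exact: le_trans (nU t) fA|exact: le_trans (nv t) (bvb t)].
have X1 : (\int[mu]_t W t <= NK K H)%E by exact: NK_Sd.
have X2 : (NK K H <= (2^-1)%:E * \int[mu]_t W t)%E.
  rewrite -ge0_integralZl//.
  apply: ae_ge0_le_integral_nomeas => [t _|t _|].
  - by apply: mule_ge0; [rewrite lee_fin expR_ge0|exact: L1n_ge0].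
  - by apply: mule_ge0 => //; rewrite lee_fin invr_ge0.
  apply: aeS (aeI eF wd) => t [e wE] _; rewrite /W muleCA; apply: lee_wpmul2l; first by rewrite lee_fin expR_ge0.
  have [t0|t0] := ltP t 0.
    by rewrite (_ : H t = fun=> 0) ?L00; [apply: mule_ge0 => //; rewrite lee_fin invr_ge0|apply/funext => xi; exact: cH].
  have -> : L1n (H t) = L1n (fun xi => 1%:C * Bil (U t) (U t) xi - 1%:C * Bil (vb t) (vb t) xi).
    by rewrite -!wn1; apply: ae_wn; apply: aeS (e t0) => xi E1; rewrite !mul1r /H E1.
  have fA := bA t t0.
  apply: le_trans (L1n_Bil_sub delta 1 ler01 (mU t) (mvt t) (fl _ _ (le_trans (LU t) fA)) (fl _ _ (le_trans (nU t) fA))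
    (fl _ _ (le_trans (Lv t) (bvb t))) (fl _ _ (le_trans (nv t) (bvb t)))) _.
  rewrite (wE t0) mul1e (_ : (fun y => 1%:C * U t y - 1%:C * vb t y) = d t); last by apply/funext => y; rewrite !mul1r.
  have [Ld nd] := bd t t0.
  have nvE := le_trans (nv t) (bvb t); have aU := ba t t0.
  apply: (@le_trans _ _ ((C0 delta)%:E * (L1n (d t) * E%:E + a0%:E * n1 (d t)))%E).
    apply: lee_wpmul2l; first by rewrite lee_fin.
    by apply: leeD; [apply: lee_wpmul2l => //; exact: L1n_ge0|apply: lee_wpmul2r => //; exact: n1_ge0].
  have [x0 y0] := (L1n_ge0 (d t), n1_ge0 (d t)).
  rewrite -(fineK (x := L1n (d t))) ?ge0_fin_numE ?(fl _ _ Ld)// -(fineK (x := n1 (d t))) ?ge0_fin_numE ?(fl _ _ nd)//.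
  move/fine_ge0: x0; move/fine_ge0: y0; move: (fine (L1n (d t))) (fine (n1 (d t))) => x y y0 x0.
  have q : C0 delta * a0 * y <= 2^-1 * y by apply: ler_wpM2r => //; lra.
  rewrite -(EFinM x E) -(EFinM a0 y) -(EFinD (x * E)) -(EFinM (C0 delta)) -(EFinM K x) -(EFinD (K * x)) -(EFinM 2^-1) lee_fin /K; nra.
have Xf : (\int[mu]_t W t < +oo)%E.
  pose M := K * (E + E) + (E + E).
  have EE := addr_ge0 E0 E0; have M0 : 0 <= M := addr_ge0 (mulr_ge0 (ltW K0) EE) EE.
  have e : (\int[mu]_t (M%:E * (hexp K t)%:E) < +oo)%E.
    rewrite ge0_integralZl//; [by rewrite integral_hexp// -EFinM ltry| |].
      by apply/measurable_EFinP; exact: (@measurable_hexp2 R _ _ (fun=> K) (fun x => x)).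
    by move=> x _; rewrite lee_fin hexp_ge0.
  apply: le_lt_trans e; apply: ae_ge0_le_integral_nomeas => [//|t _|].
    by rewrite mule_ge0// lee_fin// hexp_ge0.
  apply: aeS wd => t h _; have [t0|t0] := ltP t 0.
    by rewrite /W /om (Sneg t t0) L00 n00 !mule0 add0e mule0 mule_ge0// lee_fin// hexp_ge0.
  rewrite /W /hexp t0 muleC; apply: lee_wpmul2r; first by rewrite lee_fin expR_ge0.
  have [Ld nd] := bd t t0; rewrite (h t0) /M (EFinD (K * (E + E))) (EFinM K); apply: leeD => //.
  by apply: lee_wpmul2l => //; rewrite lee_fin ltW.
have X0 : (\int[mu]_t W t = 0)%E.
  have Xp : (0 <= \int[mu]_t W t)%E by apply: integral_ge0 => t _.
  have := le_trans X1 X2; move: Xp Xf; case: (\int[mu]_t W t)%E => // r.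
  by rewrite -EFinM !lee_fin => r0 _ h; congr EFin; lra.
apply: aeS (aeI (aeI vb_mild dS) (ae_eq0_integral mW W0 X0)) => t [[_ h] z] t0.
have wz : om t = 0.
  by apply/eqP; move/eqP: z; rewrite /W mule_eq0 eqe gt_eqF ?expR_gt0.
have Lz : L1n (Sd H t) = 0.
  apply/eqP; have := L1n_ge0 (Sd H t); rewrite eq_le => ->; rewrite andbT.
  have : (K%:E * L1n (Sd H t) <= 0)%E by rewrite -wz /om leeDl// n1_ge0.
  by rewrite pmule_rle0// lte_fin.
have mN : mfunT (fun xi => (normc (Sd H t xi))%:E).
  by apply/measurable_EFinP; apply: cmeas_norm; exact: (cmeas_sec1 t mS).
have q : {ae mu, forall xi, (normc (Sd H t xi))%:E = 0%E}.
  by apply: (ae_eq0_integral mN) => // x; rewrite lee_fin normc_ge0.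
apply: aeS (aeI q (h t0)) => xi [] + e.
by rewrite e => -[] /normc_eq0 /eqP; rewrite /d subr_eq0 => /eqP.
Qed.

Lemma competitor_eq (F : R -> R -> R[i]) :
  {ae mu, forall t, 0 <= t -> {ae mu, forall xi, vb t xi = Sol u0 F t xi}} ->
  {ae mu, forall t, 0 < t -> {ae mu, forall x, w t x = Fr (Sol u0 F t) x}}.
Proof.
move=> h; apply: aeS (aeI h wvb) => t [e wt] t0.
apply: aeS (is_fourier_inv_Fr (wt t0) (iv t)) => x ->.
by rewrite /Fr (Fi_ae (e (ltW t0))).
Qed.

End WeakToMild.

Theorem theorem1p5 (R : realType) (gamma delta : R) (hgamma : gamma = 1)
    (theta0 : R -> R)
    (htheta0 : (wiener_norm 1 theta0 < +oo)%E)
    (hsmall : (wiener_norm0 theta0 <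
       (Num.sqrt pi / (Num.sqrt 2 * (1 + `|delta|)))%:E)%E) :
  exists theta : R -> R -> R,
    global_solution gamma delta theta0 theta /\
    forall theta' : R -> R -> R,
      global_solution gamma delta theta0 theta' ->
      {ae lebesgue_measure, forall t : R, 0 < t ->
        {ae lebesgue_measure, forall x : R, theta' t x = theta t x}}.
Proof.
subst gamma; set mu := lebesgue_measure.
have [g hg] : has_fourier theta0.
  by move: htheta0; rewrite /wiener_norm; case: asboolP.
have [u0 [hu0 hth0 _]] := herm_repr hg; have mu0 := is_fourier_cmeas hth0.
have A1 : wiener_norm 1 theta0 = A1n u0.
  by rewrite (wiener_normE 1 hth0); apply: eq_integral => x _; rewrite powRr1.
have fA : (A1n u0 < +oo)%E by rewrite -A1.
pose E := fine (A1n u0); have u0E : A1n u0 = E%:E by rewrite fineK// ge0_fin_numE// A1n_ge0.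
have E0 : 0 <= E by rewrite fine_ge0// A1n_ge0.
pose a0 := fine (L1n u0).
have u0a : L1n u0 = a0%:E.
  by rewrite fineK// ge0_fin_numE ?L1n_ge0//; apply: le_lt_trans fA; exact: L1n_le_A1n.
have small : 2 * C0 delta * a0 < 1.
  have s2 : 0 < Num.sqrt 2 * (1 + `|delta|) :> R by rewrite mulr_gt0 ?sqrtr_gt0// ltr_pwDl.
  have sp : 0 < Num.sqrt pi :> R by rewrite sqrtr_gt0 pi_gt0.
  move: hsmall; rewrite (wiener_norm0E hth0) u0a lte_fin ltr_pdivlMr// mulrC => h.
  by rewrite -subr_gt0 -energy_constE subr_gt0 ltr_pdivrMr// mul1r.
have [F [mF cF hF [en ba iF eF]]] := fourier_solution mu0 hu0 u0a fA small.
have mU := cmeas_Sol mu0 mF.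
have hU t : herm (Sol u0 F t) := Sol_herm t hu0 (hF).
have c0 : 0 < 1 - 2 * C0 delta * a0 by rewrite subr_gt0.
have I0 T : (0 <= \int[mu]_(t in `[0%R, T]) D1n (Sol u0 F t))%E.
  by apply: integral_ge0 => t _; exact: D1n_ge0.
have bU T : 0 <= T -> (A1n (Sol u0 F T) <= E%:E)%E.
  by move=> T0; rewrite -u0E; apply: le_trans (en T T0); rewrite leeDl// mule_ge0// lee_fin ltW.
have bD T : 0 <= T -> (\int[mu]_(t in `[0%R, T]) D1n (Sol u0 F t) < +oo)%E.
  move=> T0; have : ((1 - 2 * C0 delta * a0)%:E * \int[mu]_(t in `[0%R, T]) D1n (Sol u0 F t) <= E%:E)%E.
    by rewrite -u0E; apply: le_trans (en T T0); rewrite leeDr// A1n_ge0.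
  move: (I0 T); case: (\int[mu]_(t in `[0%R, T]) D1n (Sol u0 F t))%E => [r _ _|_|//]; first exact: ltry.
  by rewrite gt0_muley ?lte_fin.
have iU t : 0 <= t -> {ae mu, forall xi, Sol u0 F t xi =
    u0 xi - cintegral (fun s => (ind t s)%:C * (`|xi|%:C * Sol u0 F s xi + F s xi))}.
  move=> t0; apply: aeS (ind_sec_ae mF (iF t t0)) => xi ic.
  apply: (mild_integral (F := fun s => F s xi) (u0 xi) (normr_ge0 xi) t0 _ _ ic).2.
    exact: (@cmeas_sec1 R (fun xi s => F s xi) xi (cmeas2_swap mF)).
  by move=> r; exact: cF.
have bu0 : (A1n u0 <= E%:E)%E by rewrite u0E.
exists (fun t x => Fr (Sol u0 F t) x); split.
  split; first exact: (theta_weak E0 mu0 bu0 mU mF hU bU eF iU hth0).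
  move=> T T0; split; first exact: (theta_W E0 mu0 bu0 mU mF bU eF iU T0 (bD T (ltW T0))).
  exact: (theta_energy mU hU bU hth0 T u0a en).
move=> w hw; have [vb [mvb hvb bvb cvb wvb]] := competitor_repr hth0 u0E E0 u0a small hw.
apply: (competitor_eq mvb bvb wvb).
exact: (mild_unique hth0 hu0 mu0 bu0 E0 mvb hvb bvb cvb wvb hw.1 small mF cF bU ba iF eF).
Qed.
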